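(* The convex hull operator $\mathit{CH}:\mathcal A\to\mathcal A$, $S\mapsto$ the convex hull of $S$, is $(\psi_\circledcirc,\psi_\circledcirc)$-$\mathbf{NP}_2$-$\le^2_{\mathrm m}$-complete; that is, the multi-function $\psi_\circledcirc^{-1}\circ\mathit{CH}\circ\psi_\circledcirc$ from $\mathbf{Reg}$ to $\mathbf{Pred}$ belongs to $\mathbf{NP}_2$ and every $A\in\mathbf{NP}_2$ satisfies $A\le^2_{\mathrm m}\psi_\circledcirc^{-1}\circ\mathit{CH}\circ\psi_\circledcirc$.
   Context: $\Sigma^*$ is the set of finite strings over a finite alphabet $\Sigma$ (containing $0,1,+,-,/$); tuples of strings are encoded as strings by a fixed polynomial-time tupling function. A multi-function $F$ from $X$ to $Y$ is a subset of $X\times Y$; $F[x]=\{y:(x,y)\in F\}$ and $\operatorname{dom}F=\{x:F[x]\neq\emptyset\}$. A total function $\varphi:\Sigma^*\to\Sigma^*$ is regular if $|u|\le|v|$ implies $|\varphi(u)|\le|\varphi(v)|$. $\mathbf{Reg}$ is the set of regular functions and $\mathbf{Pred}\subseteq\mathbf{Reg}$ the set of regular functions with values in $\{0,1\}$. The size of $\varphi\in\mathbf{Reg}$ is the non-decreasing function $|\varphi|:\mathbb N\to\mathbb N$ with $|\varphi|(|u|)=|\varphi(u)|$. Second-order polynomials (in a type-1 variable $\mathtt L$ and type-0 variable $\mathtt n$) are defined inductively: every positive integer and the variable $\mathtt n$ are second-order polynomials, and if $P,Q$ are, so are $P+Q$, $P\cdot Q$ and $\mathtt L(P)$. Each such $P$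 defines a map sending a function $L:\mathbb N\to\mathbb N$ to the function $P(L):\mathbb N\to\mathbb N$ obtained by substitution. Machines are oracle Turing machines (with input, work, output and query tapes); on oracle $\varphi\in\mathbf{Reg}$, a query $w$ is answered by $\varphi(w)$. A deterministic machine $M$ computes a multi-function $A$ from $\mathbf{Reg}$ to $\mathbf{Reg}$ if for every $\varphi\in\operatorname{dom}A$ there is $\psi\in A[\varphi]$ such that $M$ with oracle $\varphi$ on input $u$ outputs $\psi(u)$ for every $u\in\Sigma^*$. A nondeterministic machine $M$ computes a multi-function $A$ from $\mathbf{Reg}$ to $\mathbf{Pred}$ if for every $\varphi\in\operatorname{dom}A$ there is $\psi\in A[\varphi]$ such that for all $u$, $\psi(u)=1$ iff $M^\varphi(u)$ has an accepting computation path. $M$ runs in (second-order) polynomial time if there is a second-order polynomial $P$ such that for all $\varphi\in\mathbf{Reg}$ and $u\in\Sigma^*$, $M^\varphi(u)$ halts within $P(|\varphi|)(|u|)$ steps on every computation path. $\mathbf{FP}_2$ is the class of multi-functions from $\mathbf{Reg}$ to $\mathbf{Reg}$ computed by a deterministic machine running in polynomial time. $\mathbf{NP}_2$ is the class of multi-functions from $\mathbf{Reg}$ to $\mathbf{Pred}$ computed by a nondeterministic machine running in polynomial time. For multi-functions $A,B$ from $\mathbf{Reg}$ to $\mathbf{Pred}$, $A\le^2_{\mathrm m}B$ if there are total $s,t:\mathbf{Reg}\to\mathbf{Reg}$ in $\mathbf{FP}_2$ such that for every $\varphi\in\operatorname{dom}A$, $s(\varphi)\in\operatorname{dom}B$ and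 for every $\theta\in B[s(\varphi)]$, $\theta\circ t(\varphi)\in A[\varphi]$. For representations (surjective partial functions from $\mathbf{Reg}$ onto a set) $\gamma$ of $X$, $\delta$ of $Y$ and a multi-function $A$ from $X$ to $Y$, $\delta^{-1}\circ A\circ\gamma$ is the multi-function with $(\delta^{-1}\circ A\circ\gamma)[\varphi]=\{\psi\in\operatorname{dom}\delta:\delta(\psi)\in A[\gamma(\varphi)]\}$ for $\varphi\in\operatorname{dom}\gamma$ and $\emptyset$ otherwise. Dyadic encoding: $\mathbf D$ is the set of strings $s\,x/1 0^n$ with $s\in\{+,-\}$, $x\in\{0,1\}^*$, $n\in\mathbb N$; such a string encodes the number $\llbracket s x/10^n\rrbracket=\pm(\text{$x$ read as a binary integer, leading zeros allowed})/2^n$. $\mathcal A$ is the set of closed subsets of $[0,1]^2$. For $p\in\mathbb R^2$ and $S\subseteq\mathbb R^2$, $\mathit{dist}(p,S)=\inf_{q\in S}\|p-q\|$ (Euclidean norm). The representation $\psi_\circledcirc$ of $\mathcal A$: $\varphi\in\mathbf{Pred}$ is a $\psi_\circledcirc$-name of $S\in\mathcal A$ iff for all $n\in\mathbb N$ and $u,v\in\mathbf D$: $\varphi(u,v,0^n)=1$ if $\mathit{dist}((\llbracket u\rrbracket,\llbracket v\rrbracket),S)<2^{-n}$, and $\varphi(u,v,0^n)=0$ if $\mathit{dist}((\llbracket u\rrbracket,\llbracket v\rrbracket),S)>2\cdot2^{-n}$. *)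

(* Defs.v *)
From Stdlib Require Import Reals List.
Import ListNotations.
Open Scope R_scope.

Inductive sym : Type := s0 | s1 | splus | sminus | sslash.
Definition str : Type := list sym.

(* Fixed polynomial-time injective pairing function:
   <u,v> = u_1 u_1 u_2 u_2 ... u_k u_k 0 1 v
   (doubling each symbol of u, then the separator "01"); triples are
   <u,v,w> = <u,<v,w>>. *)
Definition pair_str (u v : str) : str :=
  flat_map (fun a => [a; a]) u ++ [s0; s1] ++ v.
Definition triple_str (u v w : str) : str := pair_str u (pair_str v w).

Definition regular (phi : str -> str) : Prop :=
  forall u v : str, (length u <= length v)%nat ->
                    (length (phi u) <= length (phi v))%nat.

Definition is_pred (phi : str -> str) : Prop :=
  regular phi /\ forall u, phi u = [s0] \/ phi u = [s1].

(* |phi|(n) = |phi(u)| for any u with |u| = n (well defined for regular phi). *)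
Definition sizef (phi : str -> str) (n : nat) : nat :=
  length (phi (repeat s0 n)).

Inductive sopoly : Type :=
| SConst : nat -> sopoly          (* SConst c denotes the positive integer c+1 *)
| SVar   : sopoly
| SAdd   : sopoly -> sopoly -> sopoly
| SMul   : sopoly -> sopoly -> sopoly
| SApp   : sopoly -> sopoly.

Fixpoint sop_eval (P : sopoly) (L : nat -> nat) (n : nat) : nat :=
  match P with
  | SConst c => S c
  | SVar => n
  | SAdd P Q => (sop_eval P L n + sop_eval Q L n)%nat
  | SMul P Q => (sop_eval P L n * sop_eval Q L n)%nat
  | SApp P => L (sop_eval P L n)
  end.

(* Tapes: read-only input tape (with head), read/write work tape (with
   head, blank = None), write-only output tape (each step may append a
   symbol), write-only query tape (each step may append a symbol).  A
   step may also issue a query: the current query-tape content w is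
   erased and the answer phi(w) is placed on a read-only answer region of
   the query tape, whose head is reset to 0; the machine reads the answer
   with that head.  The machine halts when no transition applies. *)

Inductive mv : Type := ML | MS | MR.
Definition mvpos (m : mv) (n : nat) : nat :=
  match m with ML => pred n | MS => n | MR => S n end.

Record act (Q : Type) : Type := mkAct {
  a_state : Q;
  a_write : option sym;     (* symbol written on the work tape (None = blank) *)
  a_wmove : mv;
  a_imove : mv;
  a_amove : mv;
  a_out   : option sym;
  a_qry   : option sym;
  a_ask   : bool
}.
Arguments a_state {Q}. Arguments a_write {Q}. Arguments a_wmove {Q}.
Arguments a_imove {Q}. Arguments a_amove {Q}. Arguments a_out {Q}.
Arguments a_qry {Q}. Arguments a_ask {Q}.

Record machine : Type := mkMachine {
  mQ     : Type;
  mQenum : list mQ;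
  mQfin  : forall q : mQ, In q mQenum;
  mstart : mQ;
  macc   : mQ -> bool;
  (* transitions: state, input symbol, work symbol, answer symbol *)
  mdelta : mQ -> option sym -> option sym -> option sym -> list (act mQ)
}.

Record config (M : machine) : Type := mkConfig {
  c_state : mQ M;
  c_ipos  : nat;
  c_work  : list (option sym);
  c_wpos  : nat;
  c_qry   : str;
  c_ans   : str;
  c_apos  : nat;
  c_out   : str
}.
Arguments c_state {M}. Arguments c_ipos {M}. Arguments c_work {M}.
Arguments c_wpos {M}. Arguments c_qry {M}. Arguments c_ans {M}.
Arguments c_apos {M}. Arguments c_out {M}.

Fixpoint upd (l : list (option sym)) (i : nat) (x : option sym)
  : list (option sym) :=
  match l, i with
  | [], O => [x]
  | [], S i => None :: upd [] i x
  | _ :: l, O => x :: l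
  | y :: l, S i => y :: upd l i x
  end.

Definition opt_list (o : option sym) : str :=
  match o with Some a => [a] | None => [] end.

Definition init_config (M : machine) : config M :=
  mkConfig M (mstart M) 0 [] 0 [] [] 0 [].

Definition options (M : machine) (u : str) (c : config M) : list (act (mQ M)) :=
  mdelta M (c_state c)
    (nth_error u (c_ipos c))
    (match nth_error (c_work c) (c_wpos c) with Some x => x | None => None end)
    (nth_error (c_ans c) (c_apos c)).

Definition apply_act (M : machine) (phi : str -> str) (a : act (mQ M))
  (c : config M) : config M :=
  let q := c_qry c ++ opt_list (a_qry a) in
  mkConfig M (a_state a)
    (mvpos (a_imove a) (c_ipos c))
    (upd (c_work c) (c_wpos c) (a_write a))
    (mvpos (a_wmove a) (c_wpos c))
    (if a_ask a then [] else q)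
    (if a_ask a then phi q else c_ans c)
    (if a_ask a then 0%nat else mvpos (a_amove a) (c_apos c))
    (c_out c ++ opt_list (a_out a)).

Inductive reach (M : machine) (phi : str -> str) (u : str)
  : nat -> config M -> Prop :=
| reach0 : reach M phi u 0 (init_config M)
| reachS : forall n c a, reach M phi u n c -> In a (options M u c) ->
    reach M phi u (S n) (apply_act M phi a c).

Definition halted (M : machine) (u : str) (c : config M) : Prop :=
  options M u c = [].

Definition deterministic (M : machine) : Prop :=
  forall q i w a, (length (mdelta M q i w a) <= 1)%nat.

(* M runs in second-order polynomial time bounded by P: on every
   computation path it halts within P(|phi|)(|u|) steps. *)
Definition runs_in (M : machine) (P : sopoly) : Prop :=
  forall phi, regular phi -> forall u n c,
    reach M phi u n c -> (n <= sop_eval P (sizef phi) (length u))%nat.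

Definition outputs (M : machine) (phi : str -> str) (u w : str) : Prop :=
  exists n c, reach M phi u n c /\ halted M u c /\ c_out c = w.

Definition accepts (M : machine) (phi : str -> str) (u : str) : Prop :=
  exists n c, reach M phi u n c /\ halted M u c /\ macc M (c_state c) = true.

(* A multi-function F from Reg to Reg/Pred, given by its graph. *)
Definition mfun : Type := (str -> str) -> (str -> str) -> Prop.
Definition mdom (A : mfun) (phi : str -> str) : Prop := exists psi, A phi psi.

Definition mf_Reg_Pred (A : mfun) : Prop :=
  forall phi psi, A phi psi -> regular phi /\ is_pred psi.

Definition NP2 (A : mfun) : Prop :=
  mf_Reg_Pred A /\
  exists (M : machine) (P : sopoly), runs_in M P /\
    forall phi, mdom A phi ->
      exists psi, A phi psi /\
        forall u, (psi u = [s1] <-> accepts M phi u).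

Definition FP2_total (s : (str -> str) -> (str -> str)) : Prop :=
  (forall phi, regular phi -> regular (s phi)) /\
  exists (M : machine) (P : sopoly), deterministic M /\ runs_in M P /\
    forall phi, regular phi -> forall u, outputs M phi u (s phi u).

Definition mreduces (A B : mfun) : Prop :=
  exists s t : (str -> str) -> (str -> str),
    FP2_total s /\ FP2_total t /\
    forall phi, mdom A phi ->
      mdom B (s phi) /\
      forall theta, B (s phi) theta -> A phi (fun u => theta (t phi u)).

Fixpoint bin_val (x : str) (acc : nat) : nat :=
  match x with
  | [] => acc
  | s1 :: x => bin_val x (2 * acc + 1)
  | _ :: x => bin_val x (2 * acc)
  end.

Definition is_bits (x : str) : Prop := forall a, In a x -> a = s0 \/ a = s1.

Definition dyadic (w : str) (r : R) : Prop :=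
  exists (neg : bool) (x : str) (n : nat),
    is_bits x /\
    w = (if neg then sminus else splus) :: x ++ [sslash; s1] ++ repeat s0 n /\
    r = (if neg then -1 else 1) * INR (bin_val x 0) / 2 ^ n.

Definition point : Type := (R * R)%type.
Definition eucl (p q : point) : R :=
  sqrt ((fst p - fst q)^2 + (snd p - snd q)^2).

Definition in_A (S : point -> Prop) : Prop :=
  (forall p, S p -> 0 <= fst p <= 1 /\ 0 <= snd p <= 1) /\
  (forall p, ~ S p -> exists eps, 0 < eps /\ forall q, eucl p q < eps -> ~ S q).

(* dist(p,S) < r  and  dist(p,S) > r, with dist(p,S) = inf_{q in S} |p-q|
   (inf of the empty set = +infinity). *)
Definition dist_lt (p : point) (S : point -> Prop) (r : R) : Prop :=
  exists q, S q /\ eucl p q < r.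
Definition dist_gt (p : point) (S : point -> Prop) (r : R) : Prop :=
  exists r', r < r' /\ forall q, S q -> r' <= eucl p q.

Definition circ_name (phi : str -> str) (S : point -> Prop) : Prop :=
  is_pred phi /\
  forall (n : nat) (u v : str) (x y : R), dyadic u x -> dyadic v y ->
    (dist_lt (x, y) S (/ 2 ^ n) -> phi (triple_str u v (repeat s0 n)) = [s1]) /\
    (dist_gt (x, y) S (2 * / 2 ^ n) -> phi (triple_str u v (repeat s0 n)) = [s0]).

Definition convex (C : point -> Prop) : Prop :=
  forall p q t, 0 <= t <= 1 -> C p -> C q ->
    C (t * fst p + (1 - t) * fst q, t * snd p + (1 - t) * snd q).

Definition conv_hull (S : point -> Prop) : point -> Prop :=
  fun p => forall C, convex C -> (forall q, S q -> C q) -> C p.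

Definition CH_mf : mfun :=
  fun phi psi => exists S, in_A S /\ circ_name phi S /\ circ_name psi (conv_hull S).

(* Main.v *)
Require Import Defs.
From Stdlib Require Import Reals List Lra Lia ZArith Bool FunctionalExtensionality ClassicalEpsilon Classical.
Import ListNotations.

(** Membership: by Caratheodory's theorem a point of the convex hull of [S] lies in a triangle with corners in [S].
    The machine guesses three grid points, checks them against the given name, guesses two interpolation weights,
    forms the corresponding convex combination in fixed-point arithmetic and compares it with the query point; the
    rounding errors disappear in the gap between [2^-n] and [2 * 2^-n].

    Hardness: for a nondeterministic machine [M] and an oracle [phi], one closed set records all computations of [M]
    on all inputs. The binary digits of its points are read in blocks, and each block carries one bit [b] of a stream
    that first spells an input [u] and then a sequence of choices for [M]: it moves [x] by [b] and [y] by [b] times a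
    slope that depends on the part of [u] spelt so far, and its last [y]-digit is [0] instead of [1] exactly when the
    simulated computation has stopped accepting. The slopes are arranged so that for every [u] the points belonging to
    [u] lie on a line that supports the whole set from below as long as [u] is rejected, whereas an accepting
    computation puts a point strictly below that line. Hence whether a suitable test point just below the line is in
    the convex hull tells whether [u] is accepted. Membership of a dyadic cell in the set is decided by replaying the
    computation that the cell spells out. *)

Open Scope nat_scope.

(** The transformer [s] sees the oracle but not the input, and nothing may be computed from the
    answer; hence one set has to serve all inputs and only the test point may depend on [u]. For the
    set to be decidable cell by cell, every bit string must be a legitimate stream: option numbers
    beyond the last option are clamped and a halted simulation idles. Thus no marked cell is empty
    of points, and a cell of [N] digits is checked by replaying at most [N] bits.

    Both directions require explicit transition tables whose second-order time bounds hold for all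
    strings, also those that encode nothing. This forces the layers below: programs on stacks of
    bits with step-counting Hoare triples, a compiler to one work tape, and a clock that holds the
    time polynomial in unary, evaluated with the help of the oracle.

    The numerical constants stem from one choice: precision [2^-n] is treated with [N = n + 6]
    binary places, so that [2^-n] is 64 grid units. A radius of 70 units absorbs the rounding, and
    the total error stays within 80 units, [1.25 * 2^-n] in each coordinate and so less than
    [2 * 2^-n] in the plane. *)

Class Fin (A : Type) := { enum : list A; enum_all : forall a, In a enum }.

#[export] Instance Fin_unit : Fin unit.
Proof. exists [tt]. intros []; simpl; auto. Defined.
#[export] Instance Fin_bool : Fin bool.
Proof. exists [true; false]. intros []; simpl; auto. Defined.
#[export] Instance Fin_sym : Fin sym.
Proof. exists [s0; s1; splus; sminus; sslash]. intros []; simpl; tauto. Defined.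
#[export] Instance Fin_option {A} {_ : Fin A} : Fin (option A).
Proof.
  exists (None :: map Some enum). intros [a|]; simpl; auto.
  right. apply in_map, enum_all.
Defined.
#[export] Instance Fin_sum {A B} {_ : Fin A} {_ : Fin B} : Fin (A + B).
Proof.
  exists (map inl enum ++ map inr enum).
  intros [a|b]; apply in_or_app; [left|right]; apply in_map, enum_all.
Defined.
#[export] Instance Fin_prod {A B} {_ : Fin A} {_ : Fin B} : Fin (A * B).
Proof.
  exists (list_prod enum enum). intros [a b]. apply in_prod; apply enum_all.
Defined.
#[export] Instance Fin_sigT {A} {B : A -> Type} {_ : Fin A} {_ : forall a, Fin (B a)}
  : Fin {a : A & B a}.
Proof.
  exists (flat_map (fun a => map (existT B a) enum) enum).
  intros [a b]. apply in_flat_map. exists a. split; [|apply in_map]; apply enum_all.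
Defined.

(** Interface shared by the actions of Turing machines and by stack instructions, so that the
    program combinators and their step counts are set up once. An instruction in [LI A] carries its
    possible successors in [A]; [lex_map] says that renaming successors does not change the effect,
    which is what lets fragments be glued by relabelling states. *)
Record lang := mkLang {
  LI : Type -> Type;
  LS : Type;
  LE : Type;
  lmap : forall A B, (A -> B) -> LI A -> LI B;
  lex : forall A, LE -> LI A -> LS -> A * LS;
  lex_map : forall A B (f : A -> B) e i s,
    lex B e (lmap A B f i) s = (f (fst (lex A e i s)), snd (lex A e i s))
}.
Arguments lmap {l A B}. Arguments lex {l A}.

(** * Finite-state program fragments *)

Section Fragments.
Variable G : lang.

(** [X] is the type of exits: an instruction either continues in a state of the fragment or leaves
    it with a result in [X]. *)
Record frag (X : Type) := mkFrag {
  fQ : Type;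
  fFin : Fin fQ;
  fstart : fQ;
  fcode : fQ -> LI G (fQ + X)
}.
Arguments fQ {X}. Arguments fFin {X}. Arguments fstart {X}. Arguments fcode {X}.
#[local] Existing Instance fFin.

Definition fstep {X} (F : frag X) (e : LE G) (c : (fQ F + X) * LS G) :=
  match fst c with
  | inl q => lex e (fcode F q) (snd c)
  | inr _ => c
  end.

Fixpoint run {X} (F : frag X) e n c :=
  match n with 0 => c | S n => run F e n (fstep F e c) end.

Lemma run_add {X} (F : frag X) e n m c : run F e (n + m) c = run F e m (run F e n c).
Proof. revert c. induction n; simpl; auto. Qed.

Lemma run_exit {X} (F : frag X) e n x s : run F e n (inr x, s) = (inr x, s).
Proof. induction n; simpl; auto. Qed.

(** A total-correctness triple with a step bound. Exits are absorbing for [run], so [n] is an upper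
    bound rather than the exact number of steps. *)
Definition tripq {X} (F : frag X) e n q s (Post : X -> LS G -> Prop) : Prop :=
  exists x s', run F e n (inl q, s) = (inr x, s') /\ Post x s'.

Definition trip {X} (F : frag X) e n s (Post : X -> LS G -> Prop) : Prop :=
  tripq F e n (fstart F) s Post.

Lemma trip_le {X} (F : frag X) e n m s P : trip F e n s P -> n <= m -> trip F e m s P.
Proof.
  intros (x & s' & H & HP) L. exists x, s'. split; auto.
  replace m with (n + (m - n)) by lia. now rewrite run_add, H, run_exit.
Qed.

Lemma trip_post {X} (F : frag X) e n s (P P' : X -> LS G -> Prop) :
  trip F e n s P -> (forall x s', P x s' -> P' x s') -> trip F e n s P'.
Proof. intros (x & s' & H & HP) L. exists x, s'. auto. Qed.

Definition prim {X} (i : LI G X) : frag X :=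
  mkFrag X unit _ tt (fun _ => lmap inr i).

Lemma trip_prim {X} (i : LI G X) e s (P : X -> LS G -> Prop) :
  P (fst (lex e i s)) (snd (lex e i s)) -> trip (prim i) e 1 s P.
Proof.
  intros H. unfold trip, tripq. simpl. unfold fstep; simpl. rewrite lex_map. eauto.
Qed.

(** An exit of [F] is redirected straight to the start state of its continuation, so sequencing
    costs no step of its own and the bounds simply add up. *)
Definition bind {X Y} {_ : Fin X} (F : frag X) (K : X -> frag Y) : frag Y :=
  mkFrag Y (fQ F + {x : X & fQ (K x)}) _ (inl (fstart F))
    (fun q => match q with
     | inl q => lmap (fun r => match r with
                 | inl q' => inl (inl q')
                 | inr x => inl (inr (existT (fun x => fQ (K x)) x (fstart (K x))))
                 end) (fcode F q)
     | inr (existT _ x q) => lmap (fun r => match r with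
                 | inl q' => inl (inr (existT (fun x => fQ (K x)) x q'))
                 | inr y => inr y
                 end) (fcode (K x) q)
     end).

Lemma run_bind_r {X Y} {_ : Fin X} (F : frag X) (K : X -> frag Y) e x n : forall q s r s',
  run (K x) e n (inl q, s) = (r, s') ->
  run (bind F K) e n (inl (inr (existT _ x q)), s) =
  (match r with inl q' => inl (inr (existT _ x q')) | inr y => inr y end, s').
Proof.
  induction n; intros q s r s' H; simpl in *.
  - now inversion H.
  - unfold fstep in *; simpl in *. rewrite lex_map.
    destruct (lex e (fcode (K x) q) s) as [[q1|y] s1]; simpl in *; auto.
    rewrite run_exit in *. now inversion H.
Qed.

Lemma tripq_bind {X Y} {_ : Fin X} (F : frag X) (K : X -> frag Y) e n m P : forall q s,
  tripq F e n q s (fun x s' => trip (K x) e m s' P) ->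
  tripq (bind F K) e (n + m) (inl q) s P.
Proof.
  induction n; intros q s (x & s' & H & HP); simpl in H; [discriminate|].
  unfold tripq; simpl. unfold fstep in *; simpl in *. rewrite lex_map.
  destruct (lex e (fcode F q) s) as [[q1|y] s1]; simpl in *.
  - apply IHn. exists x, s'. auto.
  - rewrite run_exit in H. inversion H; subst.
    destruct HP as (y & s2 & H2 & HP). exists y, s2. split; auto.
    rewrite Nat.add_comm, run_add.
    now rewrite (run_bind_r F K e x m _ _ _ _ H2), run_exit.
Qed.

Lemma trip_bind {X Y} {_ : Fin X} (F : frag X) (K : X -> frag Y) e n m s P :
  trip F e n s (fun x s' => trip (K x) e m s' P) -> trip (bind F K) e (n + m) s P.
Proof. apply tripq_bind. Qed.

(** The loop variable lives in the finite control: there is one copy of the body for each [a]. *)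
Definition iter {A X} {_ : Fin A} (K : A -> frag (A + X)) (a : A) : frag X :=
  mkFrag X {a : A & fQ (K a)} _ (existT _ a (fstart (K a)))
    (fun q => match q with
     | existT _ a q => lmap (fun r => match r with
          | inl q' => inl (existT (fun a => fQ (K a)) a q')
          | inr (inl a') => inl (existT (fun a => fQ (K a)) a' (fstart (K a')))
          | inr (inr x) => inr x
          end) (fcode (K a) q)
     end).

Lemma tripq_iter {A X} {_ : Fin A} (K : A -> frag (A + X)) a0 a e n m (P : X -> LS G -> Prop) : forall q s,
  tripq (K a) e n q s (fun r s' => match r with
      | inl a' => tripq (iter K a0) e m (existT _ a' (fstart (K a'))) s' P
      | inr x => P x s'
      end) ->
  tripq (iter K a0) e (n + m) (existT _ a q) s P.
Proof.
  induction n; intros q s (x & s' & H & HP); simpl in H; [discriminate|].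
  unfold tripq; simpl. unfold fstep in *; simpl in *. rewrite lex_map.
  destruct (lex e (fcode (K a) q) s) as [[q1|y] s1]; simpl in *.
  - apply IHn. exists x, s'. auto.
  - rewrite run_exit in H. inversion H; subst.
    destruct x as [a'|x].
    + destruct HP as (y & s2 & H2 & HP). exists y, s2. split; auto.
      rewrite Nat.add_comm, run_add.
      transitivity (run (iter K a0) e n (inr y, s2)); [f_equal; exact H2 | exact (run_exit (iter K a0) e n y s2)].
    + exists x, s'. now rewrite run_exit.
Qed.

(** The last argument of [iter] only selects the start state; the code is the same for all of
    them. *)
Lemma run_iter_start {A X} {_ : Fin A} (K : A -> frag (A + X)) a b e n c :
  run (iter K a) e n c = run (iter K b) e n c.
Proof. revert c. induction n; simpl; auto. Qed.

(** Unrolls one round. Termination is left to an induction on the measure of the particular loop,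
    with [m] bounding the remaining rounds. *)
Lemma trip_iter {A X} {_ : Fin A} (K : A -> frag (A + X)) a e n m s (P : X -> LS G -> Prop) :
  trip (K a) e n s (fun r s' => match r with
      | inl a' => trip (iter K a') e m s' P
      | inr x => P x s'
      end) ->
  trip (iter K a) e (n + m) s P.
Proof.
  intros H. apply tripq_iter. destruct H as (r & s' & H1 & H2). exists r, s'. split; auto.
  destruct r as [a'|x]; [|exact H2]. destruct H2 as (x & s2 & H2 & H3).
  exists x, s2. split; auto. exact (eq_trans (run_iter_start K a a' e m _) H2).
Qed.

Definition fall (C : forall A, LI G A -> Prop) {X} (F : frag X) : Prop :=
  forall q, C _ (fcode F q).

Section Closure.
Variable C : forall A, LI G A -> Prop.
Hypothesis C_map : forall A B (f : A -> B) i, C A i -> C B (lmap f i).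

Lemma fall_prim {X} (i : LI G X) : C X i -> fall C (prim i).
Proof. intros H []. now apply C_map. Qed.

Lemma fall_bind {X Y} {_ : Fin X} (F : frag X) (K : X -> frag Y) :
  fall C F -> (forall x, fall C (K x)) -> fall C (bind F K).
Proof. intros H1 H2 [q|[x q]]; apply C_map; auto. apply H2. Qed.

Lemma fall_iter {A X} {_ : Fin A} (K : A -> frag (A + X)) a :
  (forall a, fall C (K a)) -> fall C (iter K a).
Proof. intros H2 [x q]; apply C_map; apply H2. Qed.
End Closure.

End Fragments.
Arguments fQ {G X}. Arguments fFin {G X}. Arguments fstart {G X}. Arguments fcode {G X}.
Arguments fstep {G X}. Arguments run {G X}. Arguments tripq {G X}. Arguments trip {G X}.
Arguments prim {G X}. Arguments bind {G X Y _}. Arguments iter {G A X _}. Arguments fall {G} C {X}.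
#[export] Existing Instance fFin.

Notation "x <- F ;; K" := (bind F (fun x => K)) (at level 61, F at next level, right associativity).
Notation "F ;;; K" := (bind F (fun _ => K)) (at level 61, right associativity).

(** * Oracle Turing machines as fragments *)

(* [o_ch] lists the outcomes of the nondeterministic choices still to come, so that a run is a function of it and
   nondeterminism is quantification over that list; an exhausted list yields [false] forever. *)
Record outer := mkO {
  o_ip : nat; o_qry : str; o_ans : str; o_apos : nat; o_out : str; o_ch : list bool
}.

Record tst := mkT { t_o : outer; t_work : list (option sym); t_wpos : nat }.

Definition cell (w : list (option sym)) (i : nat) : option sym :=
  match nth_error w i with Some x => x | None => None end.

Lemma cell_upd w i x j : cell (upd w i x) j = if Nat.eqb j i then x else cell w j.
Proof.
  unfold cell. revert w j. induction i; intros [|y w] [|j]; simpl; auto.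
  - destruct j; auto.
  - rewrite IHi. destruct (Nat.eqb j i); auto. destruct j; auto.
Qed.

(** Binary branching suffices, as programs make their choices bit by bit. A state always offers an
    action, so a computation can end only at an exit. *)
Inductive tact (A : Type) := One (a : act A) | Two (a b : act A).
Arguments One {A}. Arguments Two {A}.

Definition amap {A B} (f : A -> B) (a : act A) : act B :=
  mkAct B (f (a_state a)) (a_write a) (a_wmove a) (a_imove a) (a_amove a)
    (a_out a) (a_qry a) (a_ask a).

Definition tmap {A B} (f : A -> B) (t : tact A) : tact B :=
  match t with One a => One (amap f a) | Two a b => Two (amap f a) (amap f b) end.

Definition tapply {A} (phi : str -> str) (a : act A) (t : tst) (ch : list bool) : tst :=
  let o := t_o t in
  let q := o_qry o ++ opt_list (a_qry a) in
  mkT (mkO (mvpos (a_imove a) (o_ip o))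
       (if a_ask a then [] else q)
       (if a_ask a then phi q else o_ans o)
       (if a_ask a then 0 else mvpos (a_amove a) (o_apos o))
       (o_out o ++ opt_list (a_out a)) ch)
    (upd (t_work t) (t_wpos t) (a_write a))
    (mvpos (a_wmove a) (t_wpos t)).

Definition env : Type := ((str -> str) * str)%type.

Definition tpick {A} (t : tact A) (ch : list bool) : act A * list bool :=
  match t with
  | One a => (a, ch)
  | Two a b => match ch with [] => (b, []) | c :: ch => (if c then a else b, ch) end
  end.

Definition TI (A : Type) : Type := option sym -> option sym -> option sym -> tact A.

Definition tsee {A} (e : env) (f : TI A) (t : tst) : tact A :=
  f (nth_error (snd e) (o_ip (t_o t))) (cell (t_work t) (t_wpos t))
    (nth_error (o_ans (t_o t)) (o_apos (t_o t))).

Definition texec {A} (e : env) (f : TI A) (t : tst) : A * tst :=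
  let p := tpick (tsee e f t) (o_ch (t_o t)) in
  (a_state (fst p), tapply (fst e) (fst p) t (snd p)).

Definition TM : lang.
Proof.
  refine (mkLang TI tst env (fun A B f i => fun x y z => tmap f (i x y z)) (@texec) _).
  intros A B f e i s. unfold texec, tsee.
  destruct (i _ _ _) as [a|a b]; simpl; auto.
  destruct (o_ch (t_o s)) as [|[] ?]; reflexivity.
Defined.

Definition tinit ch := mkT (mkO 0 [] [] 0 [] ch) [] 0.

Definition tlist {A} (t : tact A) : list (act A) :=
  match t with One a => [a] | Two a b => [a; b] end.

Definition machine_of (F : frag TM bool) : machine :=
  {| mQ := fQ F + bool; mQenum := enum; mQfin := enum_all;
     mstart := inl (fstart F);
     macc := fun q => match q with inl _ => false | inr b => b end;
     mdelta := fun q i w a =>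
       match q with inl q => tlist (fcode F q i w a) | inr _ => [] end |}.

Section Link.
Variables (F : frag TM bool) (phi : str -> str) (u : str).
Let M := machine_of F.

Definition conf (c : (fQ F + bool) * tst) : config M :=
  let t := snd c in let o := t_o t in
  mkConfig M (fst c) (o_ip o) (t_work t) (t_wpos t) (o_qry o) (o_ans o) (o_apos o) (o_out o).

Definition unconf (c : config M) (ch : list bool) : (fQ F + bool) * tst :=
  (c_state c, mkT (mkO (c_ipos c) (c_qry c) (c_ans c) (c_apos c) (c_out c) ch) (c_work c) (c_wpos c)).

Lemma run_S_r {X} {G : lang} (F0 : frag G X) e n c : run F0 e (S n) c = fstep F0 e (run F0 e n c).
Proof. replace (S n) with (n + 1) by lia. now rewrite run_add. Qed.

(** A path is extended at its end whereas choices are consumed from the front, so the list is built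
    backwards: the induction needs the claim for an arbitrary list [ch0] of choices left over. *)
Lemma reach_run n c : reach M phi u n c ->
  forall ch0, exists ch, run F (phi, u) n (inl (fstart F), tinit ch) = unconf c ch0.
Proof.
  induction 1 as [|n c a H IH Ha]; intros ch0; [now exists ch0|].
  unfold options in Ha. simpl in Ha.
  destruct (c_state c) as [q|b] eqn:Eq; [|contradiction].
  set (t := fcode F q _ _ _) in Ha.
  (* Equality of actions is not decidable in general, so the branch that was taken is identified
     classically. *)
  destruct (IH (match t with One _ => ch0 | Two x _ =>
     if excluded_middle_informative (a = x) then true :: ch0 else false :: ch0 end)) as [ch Hc].
  exists ch. rewrite run_S_r, Hc. unfold fstep, unconf; simpl. rewrite Eq; simpl.
  unfold texec, tsee, cell; simpl. fold t.
  destruct t as [x|x y]; simpl in *.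
  - destruct Ha as [->|[]]. reflexivity.
  - destruct (excluded_middle_informative (a = x)) as [->|n0]; simpl; auto.
    destruct Ha as [->|[->|[]]]; [contradiction|reflexivity].
Qed.

(** The number [m] of machine steps may be smaller than [n], since [run] idles after an exit whereas
    the machine has halted. *)
Lemma run_reach ch n : exists m,
  reach M phi u m (conf (run F (phi, u) n (inl (fstart F), tinit ch))).
Proof.
  induction n; [exists 0; constructor|].
  destruct IHn as [m Hm]. rewrite run_S_r. unfold fstep at 1.
  destruct (run F (phi, u) n _) as [[q|x] t]; simpl in *; [|now exists m].
  exists (S m). set (p := tpick (tsee (phi, u) (fcode F q) t) (o_ch (t_o t))).
  replace (conf _) with (apply_act M phi (fst p) (conf (inl q, t))) by reflexivity.
  constructor; auto. unfold options; simpl. subst p. unfold tsee, cell; simpl.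
  destruct (fcode F q _ _ _) as [a|a b]; simpl; auto.
  destruct (o_ch (t_o t)) as [|[] ?]; simpl; auto.
Qed.

Variables (N : nat) (res : list bool -> bool * str).
Hypothesis Hres : forall ch, trip F (phi, u) N (tinit ch)
  (fun x t => x = fst (res ch) /\ o_out (t_o t) = snd (res ch)).

(** The last configuration but one still has an option, so it is not an exit; after [N] steps,
    however, every run sits at an exit. *)
Lemma machine_of_time n c : reach M phi u n c -> n <= N.
Proof.
  intros H. inversion H as [|n' c' a H' Ha]; [lia|subst].
  destruct (le_lt_dec (S n') N) as [|L]; auto. exfalso.
  destruct (reach_run _ _ H' []) as [ch Hc].
  destruct (Hres ch) as (x & t & Hr & _). change (LS TM) with tst in *.
  replace n' with (N + (n' - N)) in Hc by lia.
  rewrite run_add, Hr, run_exit in Hc. unfold unconf in Hc. inversion Hc as [[E1 E2]].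
  unfold options in Ha. simpl in Ha. rewrite <- E1 in Ha. contradiction.
Qed.

Lemma machine_of_halts ch : exists n c, reach M phi u n c /\ halted M u c /\
  macc M (c_state c) = fst (res ch) /\ c_out c = snd (res ch).
Proof.
  destruct (run_reach ch N) as [m Hm]. destruct (Hres ch) as (x & t & Hr & H1 & H2). change (LS TM) with tst in *.
  rewrite Hr in Hm. exists m, (conf (inr x, t)). repeat split; auto.
Qed.

Lemma machine_of_result n c : reach M phi u n c -> halted M u c ->
  exists ch, macc M (c_state c) = fst (res ch) /\ c_out c = snd (res ch).
Proof.
  intros H Hh. destruct (reach_run _ _ H []) as [ch Hc]. exists ch.
  destruct (Hres ch) as (x & t & Hr & H1 & H2). change (LS TM) with tst in *.
  assert (E : run F (phi, u) n (inl (fstart F), tinit ch) = (inr x, t)).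
  { unfold halted, options in Hh; simpl in Hh.
    destruct (c_state c) as [q|b] eqn:Eq.
    - destruct (fcode F q _ _ _); discriminate.
    - replace (run F (phi,u) n _) with (run F (phi,u) (n + N) (inl (fstart F), tinit ch)).
      + now rewrite Nat.add_comm, run_add, Hr, run_exit.
      + rewrite run_add, Hc. unfold unconf; rewrite Eq. apply run_exit. }
  rewrite E in Hc. unfold unconf in Hc. inversion Hc. subst. simpl in *.
  split; [|congruence]. destruct (c_state c); congruence.
Qed.
End Link.

(** * Stack programs *)

Record store := mkS { s_o : outer; s_stk : nat -> list bool }.

(** Stacks of bits replace the work tape, while input, answer, query and output tape remain those of
    the machine. Tests are continuations: an instruction that reads passes what it has read to its
    successor. *)
Inductive instr (A : Type) :=
| Skip (a : A)
| Push (j : nat) (b : bool) (a : A)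
| Pop (j : nat) (k : option bool -> A)
| Clear (j : nat) (a : A)
| Inp (m : mv) (k : option sym -> A)
| Ans (m : mv) (k : option sym -> A)
| Out (c : sym) (a : A)
| Qry (c : sym) (a : A)
| Ask (a : A)
| Choose (k : bool -> A).
Arguments Skip {A}. Arguments Push {A}. Arguments Pop {A}. Arguments Clear {A}.
Arguments Inp {A}. Arguments Ans {A}. Arguments Out {A}. Arguments Qry {A}.
Arguments Ask {A}. Arguments Choose {A}.

Definition imap {A B} (f : A -> B) (i : instr A) : instr B :=
  match i with
  | Skip a => Skip (f a)
  | Push j b a => Push j b (f a)
  | Pop j k => Pop j (fun o => f (k o))
  | Clear j a => Clear j (f a)
  | Inp m k => Inp m (fun o => f (k o))
  | Ans m k => Ans m (fun o => f (k o))
  | Out c a => Out c (f a)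
  | Qry c a => Qry c (f a)
  | Ask a => Ask (f a)
  | Choose k => Choose (fun b => f (k b))
  end.

Definition setk (s : store) (j : nat) (l : list bool) : store :=
  mkS (s_o s) (fun i => if Nat.eqb i j then l else s_stk s i).

Definition o_move (m : mv) (o : outer) :=
  mkO (mvpos m (o_ip o)) (o_qry o) (o_ans o) (o_apos o) (o_out o) (o_ch o).
Definition o_amove (m : mv) (o : outer) :=
  mkO (o_ip o) (o_qry o) (o_ans o) (mvpos m (o_apos o)) (o_out o) (o_ch o).
Definition o_output (c : sym) (o : outer) :=
  mkO (o_ip o) (o_qry o) (o_ans o) (o_apos o) (o_out o ++ [c]) (o_ch o).
Definition o_query (c : sym) (o : outer) :=
  mkO (o_ip o) (o_qry o ++ [c]) (o_ans o) (o_apos o) (o_out o) (o_ch o).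
Definition o_ask (phi : str -> str) (o : outer) :=
  mkO (o_ip o) [] (phi (o_qry o)) 0 (o_out o) (o_ch o).
Definition o_choose (o : outer) :=
  mkO (o_ip o) (o_qry o) (o_ans o) (o_apos o) (o_out o) (tl (o_ch o)).

Definition onO (s : store) (f : outer -> outer) := mkS (f (s_o s)) (s_stk s).

Definition iexec {A} (e : env) (i : instr A) (s : store) : A * store :=
  match i with
  | Skip a => (a, s)
  | Push j b a => (a, setk s j (b :: s_stk s j))
  | Pop j k => (k (hd_error (s_stk s j)), setk s j (tl (s_stk s j)))
  | Clear j a => (a, setk s j [])
  | Inp m k => (k (nth_error (snd e) (o_ip (s_o s))), onO s (o_move m))
  | Ans m k => (k (nth_error (o_ans (s_o s)) (o_apos (s_o s))), onO s (o_amove m))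
  | Out c a => (a, onO s (o_output c))
  | Qry c a => (a, onO s (o_query c))
  | Ask a => (a, onO s (o_ask (fst e)))
  | Choose k => (k (hd false (o_ch (s_o s))), onO s o_choose)
  end.

Definition STK : lang.
Proof.
  refine (mkLang instr store env (@imap) (@iexec) _). intros A B f e [] s; reflexivity.
Defined.

(** * Compilation of stack programs to oracle Turing machines *)

Definition wstep {A} (f : option sym -> option sym * mv * A) : frag TM A :=
  @prim TM A (fun _ w _ => let '(x, m, a) := f w in
    One (mkAct A a x m MS MS None None false)).

(** The work tape enters only as a function from positions to contents, which hides the trailing
    blanks that [upd] creates. *)
Definition TL (t : tst) (o : outer) (f : nat -> option sym) (p : nat) : Prop :=
  t_o t = o /\ (forall i, cell (t_work t) i = f i) /\ t_wpos t = p.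

Definition fupd (f : nat -> option sym) p x : nat -> option sym :=
  fun i => if Nat.eqb i p then x else f i.

Lemma TL_ext t o f g p : TL t o f p -> (forall i, f i = g i) -> TL t o g p.
Proof. intros (H1 & H2 & H3) E. repeat split; auto. intros i. now rewrite H2. Qed.

Lemma wstep_ok {A} (g : option sym -> option sym * mv * A) e t o f p (P : A -> tst -> Prop) :
  TL t o f p ->
  (forall t', TL t' o (fupd f p (fst (fst (g (f p))))) (mvpos (snd (fst (g (f p)))) p) ->
     P (snd (g (f p))) t') ->
  @trip TM _ (wstep g) e 1 t P.
Proof.
  intros (H1 & H2 & H3) HP. apply trip_prim. simpl.
  unfold texec, tsee. simpl. rewrite H3, H2. destruct (g (f p)) as [[x m] a]; simpl in *.
  apply HP. repeat split; simpl; [| |congruence].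
  - rewrite H1. destruct o; simpl. now rewrite !app_nil_r.
  - intros i. rewrite cell_upd, H3. unfold fupd. destruct (Nat.eqb i p); auto.
Qed.

Lemma fupd_same f p i : fupd f p (f p) i = f i.
Proof. unfold fupd. destruct (Nat.eqb_spec i p); subst; auto. Qed.

Fixpoint rights (n : nat) : frag TM unit :=
  match n with
  | 0 => wstep (fun w => (w, MS, tt))
  | S n => wstep (fun w => (w, MR, tt)) ;;; rights n
  end.

Lemma rights_ok n : forall e t o f p (P : unit -> tst -> Prop), TL t o f p ->
  (forall t', TL t' o f (p + n) -> P tt t') ->
  @trip TM _ (rights n) e (n + 1) t P.
Proof.
  induction n; intros e t o f p P H HP; simpl.
  - eapply wstep_ok; eauto. simpl. intros t' H'. apply HP.
    eapply TL_ext; [rewrite Nat.add_0_r; eauto|apply fupd_same].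
  - apply (trip_bind TM _ _ e 1). eapply wstep_ok; eauto. simpl. intros t' H'.
    eapply IHn with (f := f); [eapply TL_ext; [apply H'|]; apply fupd_same|].
    intros t2 H2. apply HP. replace (p + S n) with (S p + n) by lia. exact H2.
Qed.

Definition is_mark (w : option sym) : bool := match w with Some splus => true | _ => false end.

(** At the marker in cell 0 the head stays put. A backward stride from the first row of the layout
    would overshoot and thus ends on the marker, which matches the truncated subtraction in
    [lefts_ok]. *)
Fixpoint lefts (n : nat) : frag TM unit :=
  match n with
  | 0 => wstep (fun w => (w, MS, tt))
  | S n => wstep (fun w => (w, if is_mark w then MS else ML, tt)) ;;; lefts n
  end.

Definition marked_at_0 (f : nat -> option sym) : Prop :=
  is_mark (f 0) = true /\ forall i, is_mark (f (S i)) = false.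

Lemma lefts_ok n : forall e t o f p (P : unit -> tst -> Prop), marked_at_0 f -> TL t o f p ->
  (forall t', TL t' o f (p - n) -> P tt t') ->
  @trip TM _ (lefts n) e (n + 1) t P.
Proof.
  induction n; intros e t o f p P M H HP; simpl.
  - eapply wstep_ok; eauto. simpl. intros t' H'. apply HP.
    eapply TL_ext; [rewrite Nat.sub_0_r; eauto|apply fupd_same].
  - apply (trip_bind TM _ _ e 1). eapply wstep_ok; eauto. simpl. intros t' H'.
    eapply IHn with (f := f); [eauto|eapply TL_ext; [apply H'|]; apply fupd_same|].
    intros t2 H2. apply HP. destruct M as [M0 M1].
    destruct p; [rewrite M0 in H2|rewrite M1 in H2]; simpl in H2; auto.
Qed.

Definition retl : frag TM unit :=
  iter (fun _ : unit => wstep (fun w => if is_mark w then (w, MS, inr tt) else (w, ML, inl tt))) tt.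

Lemma retl_ok p : forall e t o f (P : unit -> tst -> Prop), marked_at_0 f -> TL t o f p ->
  (forall t', TL t' o f 0 -> P tt t') ->
  @trip TM _ retl e (S p) t P.
Proof.
  induction p; intros e t o f P M H HP.
  - apply (trip_iter TM _ _ e 1 0). eapply wstep_ok; eauto.
    destruct M as [M0 M1]. rewrite M0. simpl. intros t' H'. apply HP.
    eapply TL_ext; eauto. apply fupd_same.
  - apply (trip_iter TM _ _ e 1 (S p)). eapply wstep_ok; eauto.
    pose proof M as [M0 M1]. rewrite M1. simpl. intros t' H'.
    eapply IHp with (f := f); eauto. eapply TL_ext; [apply H'|]. apply fupd_same.
Qed.

Definition encb (b : bool) : sym := if b then s1 else s0.
Definition enco (o : option bool) : option sym := option_map encb o.
Definition deco (w : option sym) : option bool :=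
  match w with Some s1 => Some true | Some s0 => Some false | _ => None end.

Lemma deco_enco o : deco (enco o) = o.
Proof. destruct o as [[]|]; reflexivity. Qed.
Lemma is_mark_enco o : is_mark (enco o) = false.
Proof. destruct o as [[]|]; reflexivity. Qed.

Section Layout.
Variable k : nat.
Hypothesis kpos : 0 < k.

(* Element [i] of stack [j], counted from the top, sits in work cell [1 + j + k * i]; cell 0 holds a marker. *)
Definition layout (st : nat -> list bool) (p : nat) : option sym :=
  match p with
  | 0 => Some splus
  | S p => enco (nth_error (st (p mod k)) (p / k))
  end.

Lemma layout_at st j i : j < k -> layout st (1 + j + k * i) = enco (nth_error (st j) i).
Proof.
  intros H. simpl. rewrite (Nat.mul_comm k i), Nat.Div0.mod_add, Nat.mod_small, Nat.div_add, Nat.div_small; auto. lia.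
Qed.

Lemma layout_marked st : marked_at_0 (layout st).
Proof. split; auto. intros i. apply is_mark_enco. Qed.

Definition strided p q := exists i, q = p + k * i.

(** A loop along one stack touches only cells of its own residue class, so the new contents on that
    class and agreement off it determine the tape. *)
Lemma layout_upd st j l f : j < k -> is_mark (f 0) = true ->
  (forall i, f (1 + j + k * i) = enco (nth_error l i)) ->
  (forall q, ~ strided (1 + j) q -> f q = layout st q) ->
  forall q, f q = layout (fun i => if Nat.eqb i j then l else st i) q.
Proof.
  intros Hj H0 H1 H2 [|q].
  - rewrite H2; auto. intros [i Hi]. lia.
  - unfold layout. destruct (Nat.eqb_spec (q mod k) j) as [E|E].
    + rewrite <- H1. f_equal. rewrite (Nat.div_mod_eq q k) at 1. lia.
    + rewrite H2; auto. intros [i Hi]. apply E.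
      replace q with (j + i * k) by lia. rewrite Nat.Div0.mod_add. now apply Nat.mod_small.
Qed.

Lemma stride_hd r f p : (forall i, f (p + k * i) = enco (nth_error r i)) ->
  deco (f p) = hd_error r.
Proof.
  intros Hf. specialize (Hf 0). rewrite Nat.mul_0_r, Nat.add_0_r in Hf.
  rewrite Hf, deco_enco. now destruct r.
Qed.

(** Pushing shifts the whole stack by one stride: the carried bit is written, and the bit it
    replaces is carried on until a blank is met. *)
Definition pushloop : bool -> frag TM unit :=
  iter (fun c => x <- wstep (fun w => (Some (encb c), MS, deco w));;
          match x with
          | None => wstep (fun w => (w, MS, inr tt))
          | Some b => rights k ;;; wstep (fun w => (w, MS, inl b))
          end).

Lemma strided_shift p q : ~ strided p q -> ~ strided (p + k) q.
Proof. intros H [i Hi]. apply H. exists (S i). lia. Qed.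

Lemma pushloop_ok r : forall c e t o f p (P : unit -> tst -> Prop), TL t o f p ->
  (forall i, f (p + k * i) = enco (nth_error r i)) ->
  (forall t' f', TL t' o f' (p + k * length r) ->
     (forall i, f' (p + k * i) = enco (nth_error (c :: r) i)) ->
     (forall q, ~ strided p q -> f' q = f q) -> P tt t') ->
  @trip TM _ (pushloop c) e ((k + 4) * (length r + 1)) t P.
Proof.
  induction r as [|b r IH]; intros c e t o f p P H Hf HP.
  - eapply trip_le; [apply (trip_iter TM _ _ e 2 0)|simpl; lia].
    apply (trip_bind TM _ _ e 1 1). eapply wstep_ok; eauto. cbn [fst snd].
    rewrite (stride_hd [] f p Hf). simpl. intros t1 H1.
    eapply wstep_ok; eauto. cbn [fst snd]. intros t2 H2.
    apply (HP t2 (fupd f p (Some (encb c)))).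
    + simpl. rewrite Nat.mul_0_r, Nat.add_0_r. eapply TL_ext; [apply H2|]. intros i. apply fupd_same.
    + unfold fupd. intros i. destruct i.
      * rewrite Nat.mul_0_r, Nat.add_0_r, Nat.eqb_refl. auto.
      * destruct (Nat.eqb_spec (p + k * S i) p); [lia|]. rewrite Hf. simpl. destruct i; auto.
    + intros q Hq. unfold fupd. destruct (Nat.eqb_spec q p); auto. subst.
      destruct Hq. exists 0. lia.
  - eapply trip_le; [apply (trip_iter TM _ _ e (1 + ((k + 1) + 1)) ((k + 4) * (length r + 1)))|simpl; lia].
    apply (trip_bind TM _ _ e 1). eapply wstep_ok; eauto. cbn [fst snd].
    rewrite (stride_hd (b :: r) f p Hf). cbn [hd_error]. intros t1 H1.
    apply trip_bind. eapply rights_ok; eauto. intros t2 H2. cbn [mvpos] in *.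
    eapply wstep_ok; eauto. cbn [fst snd]. intros t3 H3.
    assert (H4 : TL t3 o (fupd f p (Some (encb c))) (p + k)).
    { eapply TL_ext; [apply H3|]. intros i. apply fupd_same. }
    eapply IH; eauto.
    + intros i. unfold fupd. destruct (Nat.eqb_spec (p + k + k * i) p); [lia|].
      replace (p + k + k * i) with (p + k * S i) by lia. rewrite Hf. auto.
    + intros t' f' T1 T2 T3. apply (HP t' f').
      * simpl. replace (p + k * S (length r)) with (p + k + k * length r) by lia. auto.
      * intros [|i].
        -- rewrite T3; [|intros [i Hi]; lia]. rewrite Nat.mul_0_r, Nat.add_0_r.
           unfold fupd. now rewrite Nat.eqb_refl.
        -- replace (p + k * S i) with (p + k + k * i) by lia. rewrite T2. auto.
      * intros q Hq. rewrite T3; [|now apply strided_shift].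
        unfold fupd. destruct (Nat.eqb_spec q p); auto. subst. destruct Hq. exists 0; lia.
Qed.

Definition clearloop : frag TM unit :=
  iter (fun _ : unit => x <- wstep (fun w => (None, MS, deco w));;
          match x with
          | None => wstep (fun w => (w, MS, inr tt))
          | Some b => rights k ;;; wstep (fun w => (w, MS, inl tt))
          end) tt.

Lemma clearloop_ok r : forall e t o f p (P : unit -> tst -> Prop), TL t o f p ->
  (forall i, f (p + k * i) = enco (nth_error r i)) ->
  (forall t' f', TL t' o f' (p + k * length r) ->
     (forall i, f' (p + k * i) = None) ->
     (forall q, ~ strided p q -> f' q = f q) -> P tt t') ->
  @trip TM _ clearloop e ((k + 4) * (length r + 1)) t P.
Proof.
  induction r as [|b r IH]; intros e t o f p P H Hf HP.
  - eapply trip_le; [apply (trip_iter TM _ _ e 2 0)|simpl; lia].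
    apply (trip_bind TM _ _ e 1 1). eapply wstep_ok; eauto. cbn [fst snd].
    rewrite (stride_hd [] f p Hf). simpl. intros t1 H1.
    eapply wstep_ok; eauto. cbn [fst snd]. intros t2 H2.
    apply (HP t2 (fupd f p None)).
    + simpl. rewrite Nat.mul_0_r, Nat.add_0_r. eapply TL_ext; [apply H2|]. intros i. apply fupd_same.
    + unfold fupd. intros i. destruct (Nat.eqb_spec (p + k * i) p); [auto|]. rewrite Hf.
      destruct i; auto.
    + intros q Hq. unfold fupd. destruct (Nat.eqb_spec q p); auto. subst.
      destruct Hq. exists 0. lia.
  - eapply trip_le; [apply (trip_iter TM _ _ e (1 + ((k + 1) + 1)) ((k + 4) * (length r + 1)))|simpl; lia].
    apply (trip_bind TM _ _ e 1). eapply wstep_ok; eauto. cbn [fst snd].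
    rewrite (stride_hd (b :: r) f p Hf). cbn [hd_error]. intros t1 H1.
    apply trip_bind. eapply rights_ok; eauto. intros t2 H2. cbn [mvpos] in *.
    eapply wstep_ok; eauto. cbn [fst snd]. intros t3 H3.
    assert (H4 : TL t3 o (fupd f p None) (p + k)).
    { eapply TL_ext; [apply H3|]. intros i. apply fupd_same. }
    eapply IH; eauto.
    + intros i. unfold fupd. destruct (Nat.eqb_spec (p + k + k * i) p); [lia|].
      replace (p + k + k * i) with (p + k * S i) by lia. rewrite Hf. auto.
    + intros t' f' T1 T2 T3. apply (HP t' f').
      * simpl. replace (p + k * S (length r)) with (p + k + k * length r) by lia. auto.
      * intros [|i].
        -- rewrite T3; [|intros [i Hi]; lia]. rewrite Nat.mul_0_r, Nat.add_0_r.
           unfold fupd. now rewrite Nat.eqb_refl.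
        -- replace (p + k * S i) with (p + k + k * i) by lia. rewrite T2. auto.
      * intros q Hq. rewrite T3; [|now apply strided_shift].
        unfold fupd. destruct (Nat.eqb_spec q p); auto. subst. destruct Hq. exists 0; lia.
Qed.

Definition seek : frag TM unit :=
  iter (fun _ : unit => x <- wstep (fun w => (w, MS, deco w));;
          match x with
          | None => wstep (fun w => (w, MS, inr tt))
          | Some b => rights k ;;; wstep (fun w => (w, MS, inl tt))
          end) tt.

Lemma seek_ok r : forall e t o f p (P : unit -> tst -> Prop), TL t o f p ->
  (forall i, f (p + k * i) = enco (nth_error r i)) ->
  (forall t', TL t' o f (p + k * length r) -> P tt t') ->
  @trip TM _ seek e ((k + 4) * (length r + 1)) t P.
Proof.
  induction r as [|b r IH]; intros e t o f p P H Hf HP.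
  - eapply trip_le; [apply (trip_iter TM _ _ e 2 0)|simpl; lia].
    apply (trip_bind TM _ _ e 1 1). eapply wstep_ok; eauto. cbn [fst snd].
    rewrite (stride_hd [] f p Hf). simpl. intros t1 H1.
    eapply wstep_ok; eauto. cbn [fst snd]. intros t2 H2.
    eapply HP.
    simpl. rewrite Nat.mul_0_r, Nat.add_0_r. eapply TL_ext; [apply H2|]. intros i. rewrite fupd_same.
    apply fupd_same.
  - eapply trip_le; [apply (trip_iter TM _ _ e (1 + ((k + 1) + 1)) ((k + 4) * (length r + 1)))|simpl; lia].
    apply (trip_bind TM _ _ e 1). eapply wstep_ok; eauto. cbn [fst snd].
    rewrite (stride_hd (b :: r) f p Hf). cbn [hd_error]. intros t1 H1.
    apply trip_bind. eapply rights_ok; eauto. intros t2 H2. cbn [mvpos] in *.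
    eapply wstep_ok; eauto. cbn [fst snd]. intros t3 H3.
    assert (H4 : TL t3 o f (p + k)).
    { eapply TL_ext; [apply H3|]. intros i. rewrite fupd_same. apply fupd_same. }
    eapply IH; eauto.
    + intros i. replace (p + k + k * i) with (p + k * S i) by lia. rewrite Hf. auto.
    + intros t' T1. apply HP. simpl.
      replace (p + k * S (length r)) with (p + k + k * length r) by lia. auto.
Qed.

(** Popping shifts the stack back from its far end. Walking towards the marker, each cell takes the
    value of the cell visited before, starting with a blank for the vacated last place; the value
    still carried at the marker is the old top. *)
Definition back : option bool -> frag TM (option bool) :=
  iter (fun c => x <- wstep (fun w => if is_mark w then (w, MS, None) else (enco c, ML, Some (deco w)));;
          match x with
          | None => wstep (fun w => (w, MS, inr c))
          | Some b => lefts (k - 1) ;;; wstep (fun w => (w, MS, inl b))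
          end).

Lemma back_ok j i : forall c e t o f (P : option bool -> tst -> Prop), j < k ->
  marked_at_0 f -> TL t o f (1 + j + k * i) ->
  (forall i, enco (deco (f (1 + j + k * i))) = f (1 + j + k * i)) ->
  (forall t' f', TL t' o f' 0 ->
     (forall i', i' < i -> f' (1 + j + k * i') = f (1 + j + k * S i')) ->
     f' (1 + j + k * i) = enco c ->
     (forall q, (forall i', i' <= i -> q <> 1 + j + k * i') -> f' q = f q) ->
     P (deco (f (1 + j))) t') ->
  @trip TM _ (back c) e ((k + 4) * (i + 1) + 2) t P.
Proof.
  induction i as [|i IH]; intros c e t o f P Hj M H Hf HP.
  - eapply trip_le; [apply (trip_iter TM _ _ e (1 + ((k - 1 + 1) + 1)) 2)|simpl; lia].
    apply (trip_bind TM _ _ e 1). eapply wstep_ok; eauto. cbn [fst snd].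
    assert (Em : is_mark (f (1 + j + k * 0)) = false) by (apply (proj2 M)).
    rewrite !Em. cbn [fst snd]. intros t1 H1.
    assert (M' : marked_at_0 (fupd f (1 + j + k * 0) (enco c))).
    { split; intros; unfold fupd.
      - simpl. apply M.
      - destruct (Nat.eqb _ _); [apply is_mark_enco|apply M]. }
    apply trip_bind. eapply lefts_ok; eauto. intros t2 H2.
    eapply wstep_ok; eauto. cbn [fst snd]. intros t3 H3.
    assert (H4 : TL t3 o (fupd f (1 + j + k * 0) (enco c)) 0).
    { replace 0 with (mvpos MS (mvpos ML (1 + j + k * 0) - (k - 1))) at 3 by (simpl; lia).
      eapply TL_ext; [apply H3|]. intros i. apply fupd_same. }
    clear H1 H2 H3.
    apply (trip_iter TM _ _ e 2 0). apply (trip_bind TM _ _ e 1 1). eapply wstep_ok; eauto.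
    rewrite (proj1 M'). cbn [fst snd]. intros t4 H5.
    eapply wstep_ok; eauto. cbn [fst snd]. intros t5 H6.
    rewrite Nat.mul_0_r, Nat.add_0_r in *.
    apply HP with (f' := fupd f (1 + j) (enco c)).
    + eapply TL_ext; [apply H6|]. intros i. rewrite fupd_same. apply fupd_same.
    + lia.
    + unfold fupd. now rewrite Nat.eqb_refl.
    + intros q Hq. unfold fupd. destruct (Nat.eqb_spec q (1 + j)); auto.
      exfalso. apply (Hq 0); lia.
  - eapply trip_le; [apply (trip_iter TM _ _ e (1 + ((k - 1 + 1) + 1)) ((k + 4) * (i + 1) + 2))|simpl; lia].
    apply (trip_bind TM _ _ e 1). eapply wstep_ok; eauto. cbn [fst snd].
    assert (Em : is_mark (f (1 + j + k * S i)) = false) by (apply (proj2 M)).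
    rewrite !Em. cbn [fst snd]. intros t1 H1.
    assert (M' : marked_at_0 (fupd f (1 + j + k * S i) (enco c))).
    { split; intros; unfold fupd.
      - simpl. apply M.
      - destruct (Nat.eqb _ _); [apply is_mark_enco|apply M]. }
    apply trip_bind. eapply lefts_ok; eauto. intros t2 H2.
    eapply wstep_ok; eauto. cbn [fst snd]. intros t3 H3.
    assert (H4 : TL t3 o (fupd f (1 + j + k * S i) (enco c)) (1 + j + k * i)).
    { replace (1 + j + k * i) with (mvpos MS (mvpos ML (1 + j + k * S i) - (k - 1))) by (simpl; lia).
      eapply TL_ext; [apply H3|]. intros q. apply fupd_same. }
    clear H1 H2 H3.
    eapply IH; eauto.
    + intros i'. unfold fupd. destruct (Nat.eqb _ _); [now rewrite deco_enco|auto].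
    + intros t' f' T1 T2 T3 T4.
      replace (deco (fupd f (1 + j + k * S i) (enco c) (1 + j))) with (deco (f (1 + j))).
      2:{ unfold fupd. destruct (Nat.eqb_spec (1 + j) (1 + j + k * S i)); [lia|auto]. }
      apply (HP t' f'); auto.
      * intros i' Hi'. destruct (Nat.eq_dec i' i) as [->|Ne].
        -- rewrite T3. apply Hf.
        -- rewrite T2 by lia. unfold fupd.
           destruct (Nat.eqb_spec (1 + j + k * S i') (1 + j + k * S i)) as [E|]; auto.
           assert (k * S i' < k * S i) by (apply Nat.mul_lt_mono_pos_l; lia). lia.
      * rewrite T4.
        -- unfold fupd. now rewrite Nat.eqb_refl.
        -- intros i' Hi' E. assert (k * i' < k * S i) by (apply Nat.mul_lt_mono_pos_l; lia). lia.
      * intros q Hq. rewrite T4 by (intros; apply Hq; lia).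
        unfold fupd. destruct (Nat.eqb_spec q (1 + j + k * S i)); auto.
        exfalso. apply (Hq (S i)); lia.
Qed.

Definition outer_op {A} (f : option sym -> option sym -> option sym -> A)
  im am out q ask : frag TM A :=
  @prim TM A (fun i w a => One (mkAct A (f i w a) w MS im am out q ask)).

Definition exec_instr {A} {_ : Fin A} (i : instr A) : frag TM A :=
  match i with
  | Skip a => outer_op (fun _ _ _ => a) MS MS None None false
  | Push j b a => rights (1 + j) ;;; pushloop b ;;; retl ;;; wstep (fun w => (w, MS, a))
  | Pop j h => rights (1 + j) ;;; seek ;;; o <- back None ;; wstep (fun w => (w, MS, h o))
  | Clear j a => rights (1 + j) ;;; clearloop ;;; retl ;;; wstep (fun w => (w, MS, a))
  | Inp m h => outer_op (fun i _ _ => h i) m MS None None false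
  | Ans m h => outer_op (fun _ _ a => h a) MS m None None false
  | Out c a => outer_op (fun _ _ _ => a) MS MS (Some c) None false
  | Qry c a => outer_op (fun _ _ _ => a) MS MS None (Some c) false
  | Ask a => outer_op (fun _ _ _ => a) MS MS None None true
  | Choose h => @prim TM A (fun _ w _ => Two (mkAct A (h true) w MS MS MS None None false)
                                   (mkAct A (h false) w MS MS MS None None false))
  end.

Definition idx {A} (i : instr A) : nat :=
  match i with Push j _ _ | Pop j _ | Clear j _ => S j | _ => 0 end.

(** Bound for one instruction on stacks of height at most [B]: the head makes a bounded number of
    passes over a stretch of about [k * B] cells. *)
Definition icost B := (k + 4) * (3 * B + 6) + 10.

Lemma icost_mono B B' : B <= B' -> icost B <= icost B'.
Proof. intros. unfold icost. apply Nat.add_le_mono_r, Nat.mul_le_mono_l. lia. Qed.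

Lemma exec_instr_ok {A} {_ : Fin A} (i : instr A) e s t B (P : A -> tst -> Prop) :
  idx i <= k -> (forall j, length (s_stk s j) <= B) ->
  TL t (s_o s) (layout (s_stk s)) 0 ->
  (forall t', TL t' (s_o (snd (iexec e i s))) (layout (s_stk (snd (iexec e i s)))) 0 ->
    P (fst (iexec e i s)) t') ->
  trip (exec_instr i) e (icost B) t P.
Proof.
  intros Hi HB HT HP. unfold icost.
  (* The instructions that do not touch a stack take a single step on the marker and differ only in
     the outer tapes. *)
  assert (Hout : forall (i : instr A) (f : option sym -> option sym -> option sym -> A)
    im am out q (ask : bool),
    (let p := iexec e i s in
     f (nth_error (snd e) (o_ip (s_o s))) (Some splus) (nth_error (o_ans (s_o s)) (o_apos (s_o s))) = fst p /\
     s_o (snd p) =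
      mkO (mvpos im (o_ip (s_o s)))
       (if ask then [] else o_qry (s_o s) ++ opt_list q)
       (if ask then fst e (o_qry (s_o s) ++ opt_list q) else o_ans (s_o s))
       (if ask then 0 else mvpos am (o_apos (s_o s)))
       (o_out (s_o s) ++ opt_list out) (o_ch (s_o s)) /\ s_stk (snd p) = s_stk s) ->
    (forall t', TL t' (s_o (snd (iexec e i s))) (layout (s_stk (snd (iexec e i s)))) 0 ->
    P (fst (iexec e i s)) t') ->
    trip (outer_op f im am out q ask) e ((k + 4) * (3 * B + 6) + 10) t P).
  { clear i Hi HP. intros i f im am out q ask (E1 & E2 & E3) HP.
    eapply trip_le; [apply trip_prim|lia]. simpl. unfold texec, tsee. simpl.
    destruct HT as (T1 & T2 & T3). rewrite T1, T3, T2. simpl. rewrite E1. apply HP.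
    repeat split; simpl; auto.
    - rewrite E2. unfold tapply; simpl. now rewrite T1.
    - intros p. rewrite cell_upd, E3, T3. destruct (Nat.eqb_spec p 0); subst; auto. }
  destruct i; simpl idx in *; cbn [exec_instr iexec fst snd] in *.
  - eapply (Hout (Skip a)); auto. simpl. rewrite !app_nil_r. destruct (s_o s); auto.
  - set (r := s_stk s j) in *. pose proof (HB j) as HBj. fold r in HBj.
    eapply trip_le; [apply (trip_bind TM _ _ e (1 + j + 1)); eapply rights_ok; eauto; intros t1 H1;
      apply (trip_bind TM _ _ e ((k + 4) * (length r + 1)));
      eapply pushloop_ok with (r := r) (o := s_o s) (f := layout (s_stk s)) (p := 1 + j) | ].
    + exact H1.
    + intros i. now rewrite layout_at.
    + intros t2 f' T1 T2 T3.
      assert (M : marked_at_0 f').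
      { split.
        - rewrite T3; auto. intros [i Hi']. lia.
        - intros i. rewrite (layout_upd (s_stk s) j (b :: r) f'); auto.
          + apply is_mark_enco.
          + rewrite T3; auto. intros [i' Hi']. lia. }
      apply (trip_bind TM _ _ e (S (1 + j + k * length r))). eapply retl_ok; eauto.
      intros t3 H3. eapply wstep_ok; eauto. cbn [fst snd]. intros t4 H4. apply HP.
      eapply TL_ext; [apply H4|]. intros q. rewrite fupd_same.
      apply layout_upd; auto. apply M.
    + assert (k * length r <= k * B) by (apply Nat.mul_le_mono_l; lia). lia.
  - set (r := s_stk s j) in *. pose proof (HB j) as HBj. fold r in HBj.
    eapply trip_le; [apply (trip_bind TM _ _ e (1 + j + 1)); eapply rights_ok; eauto; intros t1 H1;
      apply (trip_bind TM _ _ e ((k + 4) * (length r + 1)));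
      eapply seek_ok with (r := r) (o := s_o s) (f := layout (s_stk s)) (p := 1 + j) | ].
    + exact H1.
    + intros i. now rewrite layout_at.
    + intros t2 T2. apply (trip_bind TM _ _ e ((k + 4) * (length r + 1) + 2)).
      eapply back_ok with (j := j) (f := layout (s_stk s)) (o := s_o s); auto.
      * apply layout_marked.
      * intros i. rewrite layout_at by lia. now rewrite deco_enco.
      * intros t3 f' H3 T3 T4 T5. eapply wstep_ok; eauto. cbn [fst snd]. intros t4 H4.
        assert (E : deco (layout (s_stk s) (1 + j)) = hd_error r).
        { replace (1 + j) with (1 + j + k * 0) by lia. rewrite layout_at by lia.
          rewrite deco_enco. fold r. now destruct r. }
        rewrite E. apply HP. eapply TL_ext; [apply H4|]. intros q. rewrite fupd_same.
        apply layout_upd; auto.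
        -- rewrite T5; auto. lia.
        -- intros i. destruct (lt_eq_lt_dec i (length r)) as [[L|E1]|L].
           ++ rewrite T3 by auto. rewrite layout_at by lia. fold r. destruct r; auto.
              simpl in L. lia.
           ++ rewrite E1, T4. symmetry. f_equal. apply nth_error_None. destruct r; simpl; lia.
           ++ rewrite T5.
              ** rewrite layout_at by lia. fold r. f_equal. transitivity (@None bool).
                 --- apply nth_error_None; lia.
                 --- symmetry. apply nth_error_None. destruct r; simpl in *; lia.
              ** intros i' Hi'. assert (k * i' < k * i) by (apply Nat.mul_lt_mono_pos_l; lia). lia.
        -- intros q' Hq. rewrite T5; auto. intros i' _ ->. apply Hq. exists i'; auto.
    + assert (k * length r <= k * B) by (apply Nat.mul_le_mono_l; lia). lia.
  - set (r := s_stk s j) in *. pose proof (HB j) as HBj. fold r in HBj.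
    eapply trip_le; [apply (trip_bind TM _ _ e (1 + j + 1)); eapply rights_ok; eauto; intros t1 H1;
      apply (trip_bind TM _ _ e ((k + 4) * (length r + 1)));
      eapply clearloop_ok with (r := r) (o := s_o s) (f := layout (s_stk s)) (p := 1 + j) | ].
    + exact H1.
    + intros i. now rewrite layout_at.
    + intros t2 f' T1 T2 T3.
      assert (E : forall q, f' q = layout (fun i => if Nat.eqb i j then [] else s_stk s i) q).
      { apply layout_upd; auto.
        - rewrite T3; auto. intros [i' Hi']. lia.
        - intros i. rewrite T2. destruct i; auto. }
      assert (M : marked_at_0 f').
      { split; intros; rewrite E; apply layout_marked. }
      apply (trip_bind TM _ _ e (S (1 + j + k * length r))). eapply retl_ok; eauto.
      intros t3 H3. eapply wstep_ok; eauto. cbn [fst snd]. intros t4 H4. apply HP.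
      eapply TL_ext; [apply H4|]. intros q. now rewrite fupd_same.
    + assert (k * length r <= k * B) by (apply Nat.mul_le_mono_l; lia). lia.
  - eapply (Hout (Inp m k0)); auto. simpl. rewrite !app_nil_r. destruct (s_o s); auto.
  - eapply (Hout (Ans m k0)); auto. simpl. rewrite !app_nil_r. destruct (s_o s); auto.
  - eapply (Hout (Out c a)); auto. simpl. rewrite !app_nil_r. destruct (s_o s); auto.
  - eapply (Hout (Qry c a)); auto. simpl. rewrite !app_nil_r. destruct (s_o s); auto.
  - eapply (Hout (Ask a)); auto. simpl. rewrite !app_nil_r. destruct (s_o s); auto.
  - eapply trip_le; [apply trip_prim|lia]. simpl. unfold texec, tsee. simpl.
    destruct HT as (T1 & T2 & T3). rewrite T1, T3, T2. simpl.
    replace (a_state _) with (k0 (hd false (o_ch (s_o s)))) by (destruct (o_ch (s_o s)) as [|[] ?]; auto).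
    apply HP. repeat split.
    + unfold tapply; rewrite T1. simpl. destruct (o_ch (s_o s)) as [|[] ?] eqn:Ech; unfold o_choose; rewrite Ech; simpl; now rewrite !app_nil_r.
    + intros p. destruct (o_ch (s_o s)) as [|[] ?]; cbn [tpick fst snd tapply t_work a_write]; rewrite cell_upd, T2, T3; destruct p; auto.
    + destruct (o_ch (s_o s)) as [|[] ?]; auto.
Qed.

Lemma iexec_growth {A} e (i : instr A) s B : (forall j, length (s_stk s j) <= B) ->
  forall j, length (s_stk (snd (iexec e i s)) j) <= S B.
Proof.
  intros H j. pose proof (H j) as Hj. destruct i; simpl; auto; try lia.
  - destruct (Nat.eqb j j0); simpl; auto. pose proof (H j0); lia.
  - destruct (Nat.eqb j j0); auto. pose proof (H j0). destruct (s_stk s j0); simpl in *; lia.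
  - destruct (Nat.eqb j j0); simpl; lia.
Qed.

(** The state of the stack program is the loop variable; the initial step writes the marker of the
    layout. *)
Definition compile {X} {_ : Fin X} (F : frag STK X) : frag TM X :=
  wstep (fun _ => (Some splus, MS, tt)) ;;;
  iter (fun q => exec_instr (fcode F q)) (fstart F).

(** An instruction raises a stack by at most one, so no stack exceeds [B + n] during [n]
    instructions. The total is quadratic in [n] because each instruction costs passes over the
    tape. *)
Lemma compile_ok {X} {_ : Fin X} (F : frag STK X) e (P : X -> tst -> Prop) :
  (forall q, idx (fcode F q) <= k) ->
  forall n q s t B, (forall j, length (s_stk s j) <= B) ->
  TL t (s_o s) (layout (s_stk s)) 0 ->
  @tripq STK X F e n q s (fun x s' => forall t', t_o t' = s_o s' -> P x t') ->
  trip (iter (fun q => exec_instr (fcode F q)) q) e (n * icost (B + n)) t P.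
Proof.
  intros Hk. induction n; intros q s t B HB HT (x & s' & Hr & HP); simpl in Hr; [discriminate|].
  eapply trip_le; [apply (trip_iter TM _ _ e (icost B) (n * icost (S B + n)))|].
  2:{ assert (icost B <= icost (B + S n)) by (apply icost_mono; lia).
      replace (S B + n) with (B + S n) by lia. simpl. lia. }
  eapply exec_instr_ok; eauto. intros t' HT'.
  unfold fstep in Hr. simpl in Hr.
  pose proof (iexec_growth e (fcode F q) s B HB) as HB'.
  destruct (iexec e (fcode F q) s) as [[q1|y] s1]; simpl in *.
  - apply (IHn q1 s1 t' (S B)); auto. exists x, s'. auto.
  - change (LS STK) with store in *. rewrite run_exit in Hr. inversion Hr; subst. apply HP. apply HT'.
Qed.

Lemma compile_start {X} {_ : Fin X} (F : frag STK X) e ch n (P : X -> tst -> Prop) :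
  (forall q, idx (fcode F q) <= k) ->
  @trip STK X F e n (mkS (mkO 0 [] [] 0 [] ch) (fun _ => [])) (fun x s' => forall t', t_o t' = s_o s' -> P x t') ->
  trip (compile F) e (1 + n * icost n) (tinit ch) P.
Proof.
  intros Hk H. apply trip_bind.
  eapply wstep_ok with (o := mkO 0 [] [] 0 [] ch) (f := fun _ => None) (p := 0).
  - repeat split. intros i. unfold cell. simpl. destruct i; auto.
  - cbn [fst snd]. intros t' HT. eapply (compile_ok F e P Hk n) with (B := 0); [| |apply H]; auto.
    eapply TL_ext; [apply HT|]. intros [|i]; unfold fupd; simpl; auto.
    destruct (i / k); auto.
Qed.

End Layout.

Definition sret {X} (x : X) : frag STK X := @prim STK X (Skip x).
Definition push j b : frag STK unit := @prim STK unit (Push j b tt).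
Definition pop j : frag STK (option bool) := @prim STK _ (Pop j (fun o => o)).
Definition clear j : frag STK unit := @prim STK unit (Clear j tt).
Definition inp m : frag STK (option sym) := @prim STK _ (Inp m (fun o => o)).
Definition ans m : frag STK (option sym) := @prim STK _ (Ans m (fun o => o)).
Definition out c : frag STK unit := @prim STK unit (Out c tt).
Definition qry c : frag STK unit := @prim STK unit (Qry c tt).
Definition ask : frag STK unit := @prim STK unit (Ask tt).
Definition choose : frag STK bool := @prim STK bool (Choose (fun b => b)).

Notation sp := (@trip STK _).

Lemma sp_le {X} (F : frag STK X) e n m s P : sp F e n s P -> n <= m -> sp F e m s P.
Proof. apply trip_le. Qed.
Lemma sp_post {X} (F : frag STK X) e n s (P P' : X -> store -> Prop) :
  sp F e n s P -> (forall x s', P x s' -> P' x s') -> sp F e n s P'.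
Proof. apply trip_post. Qed.
Lemma sp_bind {X Y} {_ : Fin X} (F : frag STK X) (K : X -> frag STK Y) e n m s P :
  sp F e n s (fun x s' => sp (K x) e m s' P) -> sp (bind F K) e (n + m) s P.
Proof. apply trip_bind. Qed.
Lemma sp_iter {A X} {_ : Fin A} (K : A -> frag STK (A + X)) a e n m s (P : X -> store -> Prop) :
  sp (K a) e n s (fun r s' => match r with
      | inl a' => sp (iter K a') e m s' P
      | inr x => P x s'
      end) ->
  sp (iter K a) e (n + m) s P.
Proof. apply (trip_iter STK). Qed.
Lemma sp_prim {X} (i : instr X) e s (P : X -> store -> Prop) :
  P (fst (iexec e i s)) (snd (iexec e i s)) -> sp (@prim STK X i) e 1 s P.
Proof. apply (trip_prim STK). Qed.
Lemma sp_primb {X Y} {_ : Fin X} (i : instr X) (K : X -> frag STK Y) e n s P :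
  sp (K (fst (iexec e i s))) e n (snd (iexec e i s)) P -> sp (bind (@prim STK X i) K) e (S n) s P.
Proof. intros H. apply (sp_bind _ _ e 1 n). apply sp_prim. exact H. Qed.

Ltac sstep := first
  [ eapply sp_primb | eapply sp_prim ]; cbn [iexec fst snd].

Lemma store_ext s s' : s_o s = s_o s' -> (forall i, s_stk s i = s_stk s' i) -> s = s'.
Proof.
  destruct s as [o f], s' as [o' f']; simpl. intros <- H. f_equal. now apply functional_extensionality.
Qed.

Lemma setk_self s j l : s_stk s j = l -> setk s j l = s.
Proof.
  intros H. apply store_ext; auto. intros i. simpl. destruct (Nat.eqb_spec i j); subst; auto.
Qed.

Lemma setk_setk s j l l' : setk (setk s j l) j l' = setk s j l'.
Proof. apply store_ext; auto. intros i. simpl. destruct (Nat.eqb i j); auto. Qed.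

Lemma stk_eq s j l : s_stk (setk s j l) j = l.
Proof. simpl. now rewrite Nat.eqb_refl. Qed.
Lemma stk_neq s j l i : i <> j -> s_stk (setk s j l) i = s_stk s i.
Proof. intros. simpl. destruct (Nat.eqb_spec i j); congruence. Qed.

Ltac lks := repeat first [rewrite stk_eq | rewrite stk_neq by lia].

Ltac eqbs := repeat match goal with |- context [Nat.eqb ?a ?b] =>
  destruct (Nat.eqb_spec a b); try (exfalso; lia); try subst end.

Ltac sext :=
  apply store_ext; [try reflexivity | intros ?x; cbn [setk s_stk s_o onO]; eqbs; try reflexivity; try congruence].

Definition foreach j (body : bool -> frag STK unit) : frag STK unit :=
  iter (fun _ : unit => o <- pop j;;
    match o with
    | None => sret (inr tt)
    | Some b => body b ;;; sret (inl tt)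
    end) tt.

(** [Inv] is indexed by what is left on the driving stack, which makes the number of rounds
    explicit; the body starts with the current element already popped. *)
Lemma foreach_ok e j body c (Inv : list bool -> store -> Prop) (Q : unit -> store -> Prop) :
  (forall r s, Inv r s -> s_stk s j = r) ->
  (forall b r s, Inv (b :: r) s -> sp (body b) e c (setk s j r) (fun _ s' => Inv r s')) ->
  (forall s, Inv [] s -> Q tt s) ->
  forall l s, Inv l s -> sp (foreach j body) e ((c + 2) * length l + 2) s Q.
Proof.
  intros H1 H2 H3. induction l as [|b l IH]; intros s H.
  - eapply sp_le; [eapply (sp_iter _ _ e 2 0)|lia]. sstep.
    rewrite (H1 _ _ H). simpl. sstep. apply H3.
    rewrite setk_self; auto.
  - eapply sp_le; [eapply (sp_iter _ _ e (S (c + 1)) ((c + 2) * length l + 2))|simpl; lia].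
    sstep. rewrite (H1 _ _ H). simpl. apply sp_bind.
    eapply sp_post; [apply H2, H|]. intros ? s' H'. sstep. apply IH. auto.
Qed.

(** The list arrives reversed, which is harmless for unary counters; elsewhere a second move
    restores the order. *)
Definition mov i j := foreach i (fun b => push j b).

Lemma mov_ok i j e s l (Q : unit -> store -> Prop) : i <> j -> s_stk s i = l ->
  Q tt (setk (setk s i []) j (rev l ++ s_stk s j)) ->
  sp (mov i j) e (3 * length l + 2) s Q.
Proof.
  intros N El HQ.
  apply (foreach_ok e i _ 1 (fun r s' => exists p, l = rev p ++ r /\
     s' = setk (setk s i r) j (p ++ s_stk s j))).
  - intros r s' (p & _ & ->). rewrite stk_neq, stk_eq; auto.
  - intros b r s' (p & E & ->). sstep. exists (b :: p). simpl. split.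
    + rewrite E, <- app_assoc. reflexivity.
    + sext.
  - intros s' (p & E & ->). rewrite app_nil_r in E. subst l. now rewrite E, rev_involutive in HQ.
  - exists []. simpl. split; auto. sext.
Qed.

Definition mov2 i j k := foreach i (fun b => push j b ;;; push k b).

Lemma mov2_ok i j k e s l (Q : unit -> store -> Prop) : i <> j -> i <> k -> j <> k -> s_stk s i = l ->
  Q tt (setk (setk (setk s i []) j (rev l ++ s_stk s j)) k (rev l ++ s_stk s k)) ->
  sp (mov2 i j k) e (4 * length l + 2) s Q.
Proof.
  intros N1 N2 N3 El HQ.
  apply (foreach_ok e i _ 2 (fun r s' => exists p, l = rev p ++ r /\
     s' = setk (setk (setk s i r) j (p ++ s_stk s j)) k (p ++ s_stk s k))).
  - intros r s' (p & _ & ->). rewrite 2!stk_neq, stk_eq; auto.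
  - intros b r s' (p & E & ->). sstep. sstep. exists (b :: p). simpl. split.
    + rewrite E, <- app_assoc. reflexivity.
    + sext.
  - intros s' (p & E & ->). rewrite app_nil_r in E. subst l. now rewrite E, rev_involutive in HQ.
  - exists []. simpl. split; auto. sext.
Qed.

Lemma rev_repeat {A} (x : A) n : rev (repeat x n) = repeat x n.
Proof.
  induction n; simpl; auto. rewrite IHn. clear. induction n; simpl; congruence.
Qed.

Fixpoint pushes j (l : list bool) : frag STK unit :=
  match l with [] => sret tt | b :: l => push j b ;;; pushes j l end.

Lemma pushes_ok j l : forall e s (Q : unit -> store -> Prop),
  Q tt (setk s j (rev l ++ s_stk s j)) -> sp (pushes j l) e (length l + 1) s Q.
Proof.
  induction l as [|b l IH]; intros e s Q HQ; simpl.
  - sstep. simpl in HQ. rewrite setk_self in HQ; auto.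
  - sstep. apply IH. rewrite setk_setk, stk_eq. simpl in HQ. now rewrite <- app_assoc in HQ.
Qed.

(** * Unary evaluation of second-order polynomials *)

Definition oeq (o o' : outer) : Prop :=
  o_ip o = o_ip o' /\ o_qry o = o_qry o' /\ o_out o = o_out o' /\ o_ch o = o_ch o'.

Lemma oeq_refl o : oeq o o.
Proof. now repeat split. Qed.
Lemma oeq_trans o o' o'' : oeq o o' -> oeq o' o'' -> oeq o o''.
Proof. unfold oeq. intuition congruence. Qed.

(** The value is left in unary on stack [d], with the stacks above as scratch space. In the case
    [SApp] the oracle is asked at a word of the computed length, and the symbols of its answer are
    counted. *)
Fixpoint eval (jn : nat) (P : sopoly) (d : nat) : frag STK unit :=
  match P with
  | SConst c => pushes d (repeat true (S c))
  | SVar => mov jn (S d) ;;; mov2 (S d) jn d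
  | SAdd P Q => eval jn P d ;;; eval jn Q (S d) ;;; mov (S d) d
  | SMul P Q => eval jn P d ;;; eval jn Q (S d) ;;;
      foreach d (fun _ => mov (S d) (3 + d) ;;; mov2 (3 + d) (S d) (2 + d)) ;;;
      clear (S d) ;;; mov (2 + d) d
  | SApp P => eval jn P d ;;; foreach d (fun _ => qry s0) ;;; ask ;;;
      iter (fun _ : unit => a <- ans MR ;; match a with
        | None => sret (inr tt)
        | Some _ => push d true ;;; sret (inl tt) end) tt
  end.

(** Multiplication by [c + 1], since [SConst c] stands for [c + 1]. *)
Definition kc (c : nat) (P : sopoly) : sopoly := SMul (SConst c) P.

(** The time for evaluating a second-order polynomial is again one in the same arguments; this is
    what allows a machine to compute its own time bound. *)
Fixpoint ecost (P : sopoly) : sopoly :=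
  match P with
  | SConst c => SConst (c + 1)
  | SVar => SAdd (kc 9 SVar) (SConst 9)
  | SAdd P Q => SAdd (SAdd (ecost P) (ecost Q)) (SAdd (kc 9 Q) (SConst 9))
  | SMul P Q => SAdd (SAdd (ecost P) (ecost Q))
      (SAdd (SMul P (SAdd (kc 9 Q) (SConst 9))) (SAdd (kc 9 (SMul P Q)) (SConst 9)))
  | SApp P => SAdd (ecost P) (SAdd (SAdd (kc 9 P) (kc 9 (SApp P))) (SConst 9))
  end.

(** Asking the oracle overwrites the answer tape, hence the final outer state is known only up to
    [oeq]. *)
Lemma eval_ok e jn n P : forall d s (Q : unit -> store -> Prop), jn < d ->
  s_stk s jn = repeat true n -> (forall j, d <= j -> s_stk s j = []) -> o_qry (s_o s) = [] ->
  (forall o', oeq (s_o s) o' ->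
    Q tt (setk (mkS o' (s_stk s)) d (repeat true (sop_eval P (sizef (fst e)) n)))) ->
  sp (eval jn P d) e (sop_eval (ecost P) (sizef (fst e)) n) s Q.
Proof.
  induction P as [c| |P IHP R IHR|P IHP R IHR|P IHP]; intros d s Q Hd Hn He Hq HQ; cbn [eval ecost sop_eval kc].
  - eapply sp_le; [apply pushes_ok|rewrite repeat_length; lia].
    rewrite rev_repeat, He, app_nil_r by lia. specialize (HQ (s_o s) (oeq_refl _)).
    destruct s; exact HQ.
  - eapply sp_le; [apply sp_bind; eapply mov_ok; [lia|exact Hn|]; eapply mov2_ok;
      [lia|lia|lia|rewrite stk_eq; reflexivity|]|].
    + specialize (HQ (s_o s) (oeq_refl _)). cbn [sop_eval] in HQ.
      eapply eq_ind; [exact HQ|].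
      rewrite He by lia. rewrite app_nil_r, !rev_repeat.
      apply store_ext; auto. intros x. cbn [setk s_stk].
      rewrite Nat.eqb_refl.
      destruct (Nat.eqb_spec x d); subst.
      * destruct (Nat.eqb_spec d (S d)); [lia|]. destruct (Nat.eqb_spec d jn); [lia|].
        now rewrite He, app_nil_r by lia.
      * destruct (Nat.eqb_spec jn (S d)); [lia|]. rewrite app_nil_r.
        destruct (Nat.eqb_spec x jn); subst; auto.
        destruct (Nat.eqb_spec x (S d)); subst; auto; apply He; lia.
    + rewrite He by lia. rewrite app_nil_r, length_rev, repeat_length. lia.
  - eapply sp_le; [apply sp_bind; apply IHP; auto; intros o1 H1; apply sp_bind; apply IHR; auto|].
    + rewrite stk_neq; auto. lia.
    + intros j Hj. rewrite stk_neq by lia. apply He. lia.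
    + destruct H1 as (_ & E & _). simpl. congruence.
    + intros o2 H2. cbn [s_o setk] in H2. eapply mov_ok; [lia|apply stk_eq|].
      eapply eq_ind; [apply (HQ o2); eapply oeq_trans; eauto|].
      cbn [setk s_stk s_o]. rewrite rev_repeat.
      apply store_ext; auto. intros x. cbn [setk s_stk]. rewrite Nat.eqb_refl.
      destruct (Nat.eqb_spec d (S d)); [lia|].
      destruct (Nat.eqb_spec x d); subst.
      * cbn [sop_eval]. now rewrite <- repeat_app, Nat.add_comm.
      * destruct (Nat.eqb_spec x (S d)); subst; auto; apply He; lia.
    + rewrite repeat_length. lia.
  - set (vp := sop_eval P (sizef (fst e)) n) in *. set (vr := sop_eval R (sizef (fst e)) n) in *.
    eapply sp_le; [apply sp_bind; apply IHP; auto; intros o1 H1; apply sp_bind; apply IHR; auto|].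
    + rewrite stk_neq; auto. lia.
    + intros j Hj. rewrite stk_neq by lia. apply He. lia.
    + destruct H1 as (_ & E & _). simpl. congruence.
    + fold vp vr. intros o2 H2. cbn [s_o setk] in H2. apply sp_bind.
      set (s2 := setk (mkS o2 (s_stk s)) (S d) (repeat true vr)).
      apply (foreach_ok e d _ (7 * vr + 4) (fun r s' =>
        s' = setk (setk s2 d r) (2 + d) (repeat true ((vp - length r) * vr)) /\ length r <= vp))
        with (l := repeat true vp).
      * intros r s' [-> _]. rewrite stk_neq, stk_eq by lia. auto.
      * intros b r s' [-> L]. simpl in L.
        eapply sp_le; [apply sp_bind; eapply mov_ok; [lia|unfold s2; rewrite !stk_neq, stk_eq by lia; reflexivity|];
          eapply mov2_ok; [lia|lia|lia|rewrite stk_eq; reflexivity|]|].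
        -- split; [|lia]. rewrite (stk_neq _ _ _ (3 + d)) by lia.
           rewrite (stk_neq _ _ _ (3 + d)) by lia. rewrite (stk_neq _ _ _ (3 + d)) by lia.
           replace (s_stk s2 (3 + d)) with (@nil bool).
           2:{ unfold s2. rewrite stk_neq by lia. simpl. symmetry. apply He. lia. }
           rewrite app_nil_r, !rev_repeat.
           apply store_ext; auto. intros x. subst s2. cbn [setk s_stk].
           repeat match goal with |- context [Nat.eqb ?a ?b] => destruct (Nat.eqb_spec a b); subst; try lia end;
             auto.
           ++ rewrite <- repeat_app. f_equal. simpl length.
              replace (vp - length r) with (S (vp - S (length r))) by lia. simpl. auto.
           ++ now rewrite app_nil_r.
           ++ rewrite He; auto. lia.
        -- rewrite (stk_neq _ _ _ (3 + d)) by lia. rewrite (stk_neq _ _ _ (3 + d)) by lia. rewrite (stk_neq _ _ _ (3 + d)) by lia.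
           replace (s_stk s2 (3 + d)) with (@nil bool).
           2:{ unfold s2. rewrite stk_neq by lia. simpl. symmetry. apply He. lia. }
           rewrite app_nil_r, length_rev, repeat_length. lia.
      * intros s' [-> _]. sstep. eapply mov_ok; [lia|rewrite stk_neq, stk_eq by lia; reflexivity|].
        eapply eq_ind; [apply (HQ o2); eapply oeq_trans; eauto|]. fold vp vr.
        subst s2. cbn [sop_eval]. fold vp vr. rewrite rev_repeat. simpl length. rewrite Nat.sub_0_r.
        apply store_ext; auto. intros x. cbn [setk s_stk].
        repeat match goal with |- context [Nat.eqb ?a ?b] => destruct (Nat.eqb_spec a b); subst; try lia end;
          auto; try (now rewrite app_nil_r); apply He; lia.
      * split; [|rewrite repeat_length; lia]. subst s2. rewrite repeat_length, Nat.sub_diag. simpl repeat.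
        apply store_ext; auto. intros x. cbn [setk s_stk].
        repeat match goal with |- context [Nat.eqb ?a ?b] => destruct (Nat.eqb_spec a b); subst; try lia end;
          auto; apply He; lia.
    + rewrite !repeat_length. simpl length. rewrite Nat.sub_0_r. nia.
  - set (vp := sop_eval P (sizef (fst e)) n) in *.
    eapply sp_le; [apply sp_bind; apply IHP; auto; intros o1 H1;
      apply (sp_bind _ _ e (3 * vp + 2) (S (3 * sizef (fst e) vp + 2)))|].
    + fold vp. destruct H1 as (E1 & E2 & E3 & E4).
      rewrite <- (repeat_length true vp) at 1.
      apply (foreach_ok e d _ 1 (fun r s' => exists o2,
        s' = setk (mkS o2 (s_stk s)) d r /\ length r <= vp /\ oeq (s_o s)
          (mkO (o_ip o2) [] (o_ans o2) (o_apos o2) (o_out o2) (o_ch o2)) /\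
        o_qry o2 = repeat s0 (vp - length r)))
        with (l := repeat true vp).
      * intros r s' (o2 & -> & _). apply stk_eq.
      * intros b r s' (o2 & -> & L & Ho & Eq). sstep. eexists. split; [|split; [|split]].
        -- unfold onO. rewrite setk_setk. reflexivity.
        -- simpl in L; lia.
        -- exact Ho.
        -- simpl. rewrite Eq. simpl in *. replace (vp - length r) with (vp - S (length r) + 1) by lia.
           now rewrite repeat_app.
      * intros s' (o2 & -> & _ & Ho & Eq). sstep.
        rewrite Nat.sub_0_r in Eq. unfold onO, o_ask. cbn [s_o setk s_stk]. rewrite Eq.
        set (aw := fst e (repeat s0 vp)).
        assert (Hlen : length aw = sizef (fst e) vp) by reflexivity.
        (* The counting loop, generalised to a start at position [i] of the answer with [m] symbols
           to go. *)
        assert (Hl : forall m i (Q' : unit -> store -> Prop), i + m = length aw -> (forall o', oeq (s_o s) o' ->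
                 Q' tt (setk (mkS o' (s_stk s)) d (repeat true (length aw)))) ->
          sp (iter (fun _ : unit => a <- ans MR ;; match a with
             | None => sret (inr tt)
             | Some _ => push d true ;;; sret (inl tt) end) tt) e (3 * m + 2)
             (setk (mkS (mkO (o_ip o2) [] aw i (o_out o2) (o_ch o2)) (s_stk s)) d (repeat true i)) Q').
        { induction m; intros i Q' Hi HQ'.
          - eapply sp_le; [eapply (sp_iter _ _ e 2 0)|lia]. sstep. simpl s_o. simpl o_apos. cbn [o_ans].
            rewrite (proj2 (nth_error_None aw i)) by lia. sstep.
            replace i with (length aw) by lia. apply HQ'. exact Ho.
          - eapply sp_le; [eapply (sp_iter _ _ e 3 (3 * m + 2))|lia]. sstep. simpl s_o. simpl o_apos. cbn [o_ans].
            destruct (nth_error aw i) eqn:En.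
            + sstep. sstep. unfold onO. simpl s_o. cbn [o_amove mvpos o_ip o_qry o_ans o_apos o_out o_ch].
              refine (eq_ind _ (fun st => sp _ e _ st _) (IHm (S i) Q' ltac:(lia) HQ') _ _).
              apply store_ext; auto. intros x. cbn. rewrite !Nat.eqb_refl.
              destruct (Nat.eqb x d); auto.
            + apply nth_error_None in En. lia. }
        match goal with |- sp _ _ _ ?st _ =>
          replace st with (setk (mkS (mkO (o_ip o2) [] aw 0 (o_out o2) (o_ch o2)) (s_stk s)) d (repeat true 0))
            by sext end.
        apply (Hl (length aw) 0); auto.
      * exists o1. rewrite repeat_length, Nat.sub_diag. repeat split; auto. simpl. congruence.
    + fold vp. lia.
Qed.

Notation sfall C := (@fall STK C _).
Notation tfall C := (@fall TM C _).

(** The head walks back while the count is copied, so that the program proper finds the input head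
    at position 0. *)
Definition readlen j j' : frag STK unit :=
  iter (fun _ : unit => o <- inp MS ;; match o with
    | None => sret (inr tt)
    | Some _ => inp MR ;;; push j true ;;; sret (inl tt) end) tt ;;;
  foreach j (fun _ => inp ML ;;; push j' true) ;;;
  mov j' j.

Lemma readlen_ok j j' e ch (Q : unit -> store -> Prop) : j <> j' ->
  let s := mkS (mkO 0 [] [] 0 [] ch) (fun _ => []) in
  Q tt (setk s j (repeat true (length (snd e)))) ->
  sp (readlen j j') e (11 * length (snd e) + 7) s Q.
Proof.
  intros N s HQ. destruct e as [phi u]. cbn [fst snd] in *. set (n := length u) in *.
  assert (H1 : forall m i (Q' : unit -> store -> Prop), i + m = n ->
    Q' tt (setk (mkS (mkO n [] [] 0 [] ch) (fun _ => [])) j (repeat true n)) ->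
    sp (iter (fun _ : unit => o <- inp MS ;; match o with
      | None => sret (inr tt)
      | Some _ => inp MR ;;; push j true ;;; sret (inl tt) end) tt) (phi, u) (4 * m + 2)
      (setk (mkS (mkO i [] [] 0 [] ch) (fun _ => [])) j (repeat true i)) Q').
  { induction m; intros i Q' Hi HQ'.
    - eapply sp_le; [eapply (sp_iter _ _ (phi, u) 2 0)|lia]. sstep. cbn [s_o o_ip setk].
      rewrite (proj2 (nth_error_None u i)) by (fold n; lia). sstep.
      replace i with n by lia. exact HQ'.
    - eapply sp_le; [eapply (sp_iter _ _ (phi, u) 4 (4 * m + 2))|lia]. sstep. cbn [s_o o_ip setk].
      destruct (nth_error u i) eqn:En.
      + sstep. sstep. sstep.
        match goal with |- sp _ _ _ ?st _ =>
          replace st with (setk (mkS (mkO (S i) [] [] 0 [] ch) (fun _ => [])) j (repeat true (S i))) end.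
        * apply IHm; auto. lia.
        * apply store_ext; auto. intros x. cbn. rewrite !Nat.eqb_refl. destruct (Nat.eqb x j); auto.
      + apply nth_error_None in En. fold n in En. lia. }
  eapply sp_le; [apply sp_bind|].
  - replace s with (setk s j (repeat true 0)) by (apply setk_self; auto).
    apply (H1 n 0); auto. apply sp_bind.
    apply (foreach_ok (phi, u) j _ 2 (fun r s' => length r <= n /\
      s' = setk (setk (mkS (mkO (length r) [] [] 0 [] ch) (fun _ => [])) j r) j' (repeat true (n - length r))))
      with (l := repeat true n).
    + intros r s' [_ ->]. rewrite stk_neq, stk_eq; auto.
    + intros b r s' [L ->]. simpl in L. sstep. sstep. split; [lia|].
      apply store_ext; auto. intros x. cbn.
      rewrite !Nat.eqb_refl. destruct (Nat.eqb_spec x j), (Nat.eqb_spec x j'), (Nat.eqb_spec j' j); subst; try congruence.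
      replace (n - length r) with (S (n - S (length r))) by lia. auto.
    + intros s' [_ ->]. simpl length. rewrite Nat.sub_0_r. eapply mov_ok; [auto|apply stk_eq|].
      eapply eq_ind; [exact HQ|]. rewrite rev_repeat. unfold s.
      apply store_ext; auto. intros x. cbn. rewrite !Nat.eqb_refl.
      destruct (Nat.eqb_spec x j), (Nat.eqb_spec x j'), (Nat.eqb_spec j j'); subst; try congruence.
      now rewrite app_nil_r.
    + rewrite repeat_length, Nat.sub_diag. split; auto. apply store_ext; auto. intros x. cbn.
      destruct (Nat.eqb_spec x j), (Nat.eqb_spec x j'); subst; congruence.
  - rewrite !repeat_length. lia.
Qed.

(** * Clocked execution *)

Section Clock.
Variables (F : frag STK bool) (clk : nat).
Hypothesis Hidx : forall q, idx (fcode F q) <= clk.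

(* Popping a clock before every instruction bounds the running time also on inputs that encode nothing. *)
Definition clocked : frag STK bool :=
  mkFrag STK bool (bool * fQ F) _ (false, fstart F)
    (fun p => let (b, q) := p in
      if b then imap (fun r => match r with inl q' => inl (false, q') | inr x => inr x end) (fcode F q)
      else Pop clk (fun o => match o with None => inr false | Some _ => inl (true, q) end)).

Definition noout : forall A, instr A -> Prop :=
  fun A i => match i with Out _ _ => False | _ => True end.
Definition nochoose : forall A, instr A -> Prop :=
  fun A i => match i with Choose _ => False | _ => True end.

Lemma nochoose_map A B (f : A -> B) i : nochoose A i -> nochoose B (imap f i).
Proof. destruct i; auto. Qed.

Lemma iexec_frame {A} e (i : instr A) s : idx i <= clk -> s_stk (snd (iexec e i s)) clk = s_stk s clk.
Proof.
  destruct i; simpl; auto; intros H; destruct (Nat.eqb_spec clk j); auto; lia.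
Qed.

(** Each round pops one tick and executes one instruction, and a last pop finds the clock empty:
    [2 * c + 1] steps for [c] ticks, whatever [F] does. *)
Lemma clocked_halts e : forall c q s, length (s_stk s clk) = c ->
  @tripq STK bool clocked e (2 * c + 1) (false, q) s
    (fun _ s' => sfall noout F -> o_out (s_o s') = o_out (s_o s)).
Proof.
  induction c; intros q s Hc.
  - exists false, (setk s clk []). split; auto. simpl. unfold fstep; simpl.
    destruct (s_stk s clk); auto. discriminate.
  - replace (2 * S c + 1) with (2 + (2 * c + 1)) by lia. unfold tripq.
    cbn [run]. rewrite run_add. simpl run at 2. unfold fstep at 2. simpl.
    destruct (s_stk s clk) as [|b l] eqn:El; [discriminate|]. simpl.
    unfold fstep at 1. cbn [fst snd clocked fcode]. simpl.
    set (s1 := setk s clk l).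
    pose proof (lex_map STK _ _ (fun r : fQ F + bool => match r with inl q' => inl (false, q') | inr x => inr x end) e (fcode F q) s1) as E.
    simpl in E. change (LS STK) with store in *. simpl in *. rewrite E. clear E.
    assert (El2 : s_stk (snd (iexec e (fcode F q) s1)) clk = l).
    { rewrite iexec_frame; auto. apply stk_eq. }
    assert (Eo : sfall noout F -> o_out (s_o (snd (iexec e (fcode F q) s1))) = o_out (s_o s)).
    { intros Hn. specialize (Hn q). destruct (fcode F q); simpl; auto. destruct Hn. }
    destruct (iexec e (fcode F q) s1) as [[q1|x] s2]; simpl in *.
    + destruct (IHc q1 s2) as (x & s' & H1 & H2); [congruence|].
      exists x, s'. split; auto. intros Hn. rewrite H2; auto.
    + exists x, s2. split; auto. exact (run_exit STK clocked e _ x s2).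
Qed.

Definition agree (s s' : store) : Prop :=
  s_o s = s_o s' /\ forall j, j <> clk -> s_stk s j = s_stk s' j.

Lemma iexec_agree {A} e (i : instr A) s s' : idx i <= clk -> agree s s' ->
  fst (iexec e i s) = fst (iexec e i s') /\ agree (snd (iexec e i s)) (snd (iexec e i s')).
Proof.
  intros Hi [Ho Hs]. unfold agree. destruct i; simpl in *; try rewrite Ho; auto;
    rewrite <- ?Hs by lia; repeat split; auto; intros j' Hj'; destruct (Nat.eqb_spec j' j); auto.
Qed.

(** With at least as many ticks as [F] needs the clock is invisible: [F] works below the clock
    stack, so both runs agree on everything else until the exit. *)
Lemma clocked_run e (Post : bool -> outer -> Prop) : forall n c q s s', n <= c -> length (s_stk s' clk) = c ->
  agree s s' ->
  @tripq STK bool F e n q s (fun x s2 => Post x (s_o s2)) ->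
  @tripq STK bool clocked e (2 * c + 1) (false, q) s' (fun x s2 => Post x (s_o s2)).
Proof.
  induction n; intros c q s s' L Hc Ha (x & s2 & H1 & H2); simpl in H1; [discriminate|].
  destruct c; [lia|].
  replace (2 * S c + 1) with (2 + (2 * c + 1)) by lia. unfold tripq.
  cbn [run]. rewrite run_add. simpl run at 2. unfold fstep at 2. simpl.
  destruct (s_stk s' clk) as [|b l] eqn:El; [discriminate|]. simpl.
  unfold fstep at 1. cbn [fst snd clocked fcode]. simpl.
  set (s1 := setk s' clk l).
  assert (Ha1 : agree s s1).
  { destruct Ha as [A1 A2]. split; auto. intros j Hj. unfold s1. rewrite stk_neq; auto. }
  destruct (iexec_agree e (fcode F q) s s1 (Hidx q) Ha1) as [E1 E2].
  pose proof (lex_map STK _ _ (fun r : fQ F + bool => match r with inl q' => inl (false, q') | inr x => inr x end) e (fcode F q) s1) as E.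
  simpl in E. change (LS STK) with store in *. simpl in *. rewrite E. clear E.
  assert (El2 : s_stk (snd (iexec e (fcode F q) s1)) clk = l).
  { rewrite iexec_frame; auto. apply stk_eq. }
  unfold fstep in H1 at 1. simpl in H1.
  destruct (iexec e (fcode F q) s1) as [r1 s3], (iexec e (fcode F q) s) as [r s4]; simpl in *.
  subst r1. destruct r as [q1|y].
  - eapply (IHn c q1 s4 s3); auto; try lia; try congruence. exists x, s2. auto.
  - pose proof (run_exit STK F e n y s4) as E. change (LS STK) with store in E. rewrite E in H1.
    inversion H1; subst. exists x, s3. split.
    + exact (run_exit STK clocked e _ x s3).
    + destruct E2 as [E2 _]. now rewrite <- E2.
Qed.

End Clock.

(** * From a program with a time bound to a machine *)

Fixpoint outs (l : str) : frag STK unit :=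
  match l with [] => sret tt | c :: l => out c ;;; outs l end.

Lemma outs_ok l : forall e s (Q : unit -> store -> Prop),
  Q tt (onO s (fun o => mkO (o_ip o) (o_qry o) (o_ans o) (o_apos o) (o_out o ++ l) (o_ch o))) ->
  sp (outs l) e (length l + 1) s Q.
Proof.
  induction l; intros e s Q HQ; simpl.
  - sstep. unfold onO in HQ. rewrite app_nil_r in HQ. destruct s as [[] ?]; exact HQ.
  - sstep. apply IHl. unfold onO in *. cbn in *. rewrite <- app_assoc. exact HQ.
Qed.

(** [idx] is the stack number plus one, so the stacks from number [kof F] on are free. *)
Definition kof {X} (F : frag STK X) : nat := list_max (map (fun q => idx (fcode F q)) enum).

Lemma kof_ok {X} (F : frag STK X) q : idx (fcode F q) <= kof F.
Proof.
  pose proof (proj1 (list_max_le (map (fun q => idx (fcode F q)) enum) (kof F)) (le_n _)) as H.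
  rewrite Forall_forall in H. apply H. apply in_map_iff. exists q. split; auto. apply enum_all.
Qed.

Definition initial (s : store) (ch : list bool) : Prop :=
  o_ip (s_o s) = 0 /\ o_qry (s_o s) = [] /\ o_out (s_o s) = [] /\ o_ch (s_o s) = ch /\
  forall j, s_stk s j = [].

Section Realize.
Variables (F : frag STK bool) (P : sopoly) (fin : bool -> str).
Let k := kof F.

(** Of the free stacks, [k] receives the length of the input and [S k] the clock, filled with the
    value of [P] in unary. A program stopped by the clock exits with [false]. *)
Definition full : frag STK bool :=
  readlen k (S k) ;;; eval k P (S k) ;;; clear k ;;;
  x <- clocked F (S k) ;; outs (fin x) ;;; sret x.

Definition fullcost : sopoly :=
  SAdd (SAdd (SAdd (kc 11 SVar) (SConst 7)) (ecost P))
    (SAdd (kc 1 P) (SConst (length (fin true) + length (fin false) + 5))).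

Lemma full_ok phi u ch (Post : bool -> str -> Prop) :
  (forall s, initial s ch -> forall s', agree (S k) s s' -> length (s_stk s' (S k)) = sop_eval P (sizef phi) (length u) ->
    @trip STK bool (clocked F (S k)) (phi, u) (2 * sop_eval P (sizef phi) (length u) + 1) s'
      (fun x s2 => Post x (o_out (s_o s2) ++ fin x))) ->
  sp full (phi, u) (sop_eval fullcost (sizef phi) (length u))
    (mkS (mkO 0 [] [] 0 [] ch) (fun _ => [])) (fun x s' => Post x (o_out (s_o s'))).
Proof.
  intros H. set (n := length u) in *. set (v := sop_eval P (sizef phi) n) in *.
  eapply sp_le; [apply sp_bind; apply readlen_ok; [lia|]|].
  - apply sp_bind. apply eval_ok with (n := n).
    + lia.
    + apply stk_eq.
    + intros j Hj. rewrite stk_neq by lia. auto.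
    + reflexivity.
    + intros o' (E1 & E2 & E3 & E4). cbn in E1, E2, E3, E4.
      sstep. set (s' := setk _ k _).
      apply (sp_bind _ _ (phi, u) (2 * v + 1) (length (fin true) + length (fin false) + 2)).
      eapply sp_post; [apply (H (mkS o' (fun _ => [])))|].
      * repeat split; auto.
      * split; auto. intros j Hj. unfold s'. cbn.
        destruct (Nat.eqb_spec j k); auto. destruct (Nat.eqb_spec j (S k)); auto. lia.
      * unfold s'. rewrite stk_neq, stk_eq by lia. apply repeat_length.
      * intros x s2 H2. eapply sp_le; [apply sp_bind, outs_ok; sstep|].
        -- exact H2.
        -- destruct x; lia.
  - unfold fullcost. cbn [sop_eval kc fst snd]. fold n v. lia.
Qed.

Definition result (phi : str -> str) (u : str) (ch : list bool) : bool * str :=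
  match run full (phi, u) (sop_eval fullcost (sizef phi) (length u))
          (inl (fstart full), mkS (mkO 0 [] [] 0 [] ch) (fun _ => [])) with
  | (inr x, s) => (x, o_out (s_o s))
  | _ => (false, [])
  end.

Lemma result_spec phi u ch (Post : bool -> str -> Prop) :
  sp full (phi, u) (sop_eval fullcost (sizef phi) (length u))
    (mkS (mkO 0 [] [] 0 [] ch) (fun _ => [])) (fun x s' => Post x (o_out (s_o s'))) ->
  Post (fst (result phi u ch)) (snd (result phi u ch)).
Proof.
  intros (x & s & H1 & H2). unfold result. change (LS STK) with store in *.
  now rewrite H1.
Qed.

Lemma full_halts phi u ch :
  sp full (phi, u) (sop_eval fullcost (sizef phi) (length u))
    (mkS (mkO 0 [] [] 0 [] ch) (fun _ => []))
    (fun x s' => sfall noout F -> o_out (s_o s') = fin x).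
Proof.
  apply (full_ok phi u ch (fun x w => sfall noout F -> w = fin x)).
  intros s Hs s' Ha Hl. eapply trip_post; [unfold trip; rewrite <- Hl; apply clocked_halts; auto|].
  - intros q. apply le_S, kof_ok.
  - intros x s2 H Hn. simpl in H. rewrite H; auto. destruct Ha as [<- _].
    destruct Hs as (_ & _ & -> & _). auto.
Qed.

(** Holds even when the clock runs out: a program that writes nothing itself yields one of the two
    words [fin true] and [fin false] on every input. This makes the computed name a predicate. *)
Lemma result_noout phi u ch : sfall noout F -> snd (result phi u ch) = fin (fst (result phi u ch)).
Proof. apply (result_spec phi u ch (fun x w => sfall noout F -> w = fin x)), full_halts. Qed.

(** The interface for the programs below: a triple from the empty store within time [P] determines
    the result of the machine. *)
Lemma result_run phi u ch (Post : bool -> str -> Prop) :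
  (forall s, initial s ch -> sp F (phi, u) (sop_eval P (sizef phi) (length u)) s
    (fun x s' => Post x (o_out (s_o s') ++ fin x))) ->
  Post (fst (result phi u ch)) (snd (result phi u ch)).
Proof.
  intros H. apply (result_spec phi u ch Post). apply full_ok.
  intros s Hs s' Ha Hl.
  apply (clocked_run F (S k)) with (n := sop_eval P (sizef phi) (length u)) (s := s)
    (Post := fun x o => Post x (o_out o ++ fin x)); auto.
  - intros q. apply le_S, kof_ok.
  - apply H; auto.
Qed.

End Realize.

(** * Determinism of compiled programs *)

Definition tdet : forall A, TI A -> Prop :=
  fun A f => forall x y z, match f x y z with One _ => True | Two _ _ => False end.

Lemma tdet_map A B (f : A -> B) i : tdet A i -> tdet B (@lmap TM A B f i).
Proof. intros H x y z. specialize (H x y z). simpl. destruct (i x y z); auto. Qed.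

Lemma tdet_wstep {A} (f : option sym -> option sym * mv * A) : tfall tdet (wstep f).
Proof. apply fall_prim; [exact tdet_map|]. intros x y z. destruct (f y) as [[? ?] ?]; auto. Qed.

Ltac tdet_auto :=
  repeat first [ apply (fall_bind TM); [exact tdet_map| |intros]
    | apply (fall_iter TM); [exact tdet_map|intros]
    | apply tdet_wstep
    | match goal with |- fall _ (match ?x with _ => _ end) => destruct x end ].

Lemma tdet_rights n : tfall tdet (rights n).
Proof. induction n; simpl; tdet_auto. auto. Qed.
Lemma tdet_lefts n : tfall tdet (lefts n).
Proof. induction n; simpl; tdet_auto. auto. Qed.

Lemma tdet_exec k {A} {_ : Fin A} (i : instr A) : nochoose A i -> tfall tdet (exec_instr k i).
Proof.
  intros H. destruct i; simpl; unfold pushloop, clearloop, retl, seek, back; tdet_auto;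
    auto using tdet_rights, tdet_lefts; try (apply fall_prim; [exact tdet_map|intros x y z; exact I]).
  destruct H.
Qed.

Ltac fall_auto lem :=
  repeat first [ assumption
    | apply (fall_bind STK); [exact lem| |intros]
    | apply (fall_iter STK); [exact lem|intros]
    | apply (fall_prim STK); [exact lem|exact I]
    | match goal with |- @fall STK _ _ (match ?x with _ => _ end) => destruct x end ].

Lemma outs_nochoose l : sfall nochoose (outs l).
Proof. induction l; cbn [outs]; fall_auto nochoose_map. Qed.

Lemma pushes_nochoose j l : sfall nochoose (pushes j l).
Proof. induction l; cbn [pushes]; fall_auto nochoose_map. Qed.

Lemma eval_nochoose j P : forall d, sfall nochoose (eval j P d).
Proof.
  induction P; intros d; cbn [eval]; [apply pushes_nochoose| | | |]; fall_auto nochoose_map; auto.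
Qed.

Lemma full_nochoose F P fin : sfall nochoose F -> sfall nochoose (full F P fin).
Proof.
  intros H. unfold full, readlen. fall_auto nochoose_map; auto using eval_nochoose, outs_nochoose.
  intros [[] q]; simpl; auto. apply nochoose_map, H.
Qed.

Definition mach (F : frag STK bool) P fin : machine :=
  machine_of (compile (S (kof (full F P fin))) (full F P fin)).

(** Compilation squares the time of the stack program, up to a factor given by the number of stacks;
    second-order polynomials are closed under this. *)
Definition mtime (F : frag STK bool) P fin : sopoly :=
  SAdd (SConst 0) (SMul (fullcost P fin)
   (SAdd (SMul (SConst (S (kof (full F P fin)) + 3)) (SAdd (kc 2 (fullcost P fin)) (SConst 5))) (SConst 9))).

Lemma mach_trip F P fin phi u ch :
  trip (compile (S (kof (full F P fin))) (full F P fin)) (phi, u)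
    (sop_eval (mtime F P fin) (sizef phi) (length u)) (tinit ch)
    (fun x t => x = fst (result F P fin phi u ch) /\ o_out (t_o t) = snd (result F P fin phi u ch)).
Proof.
  eapply trip_le; [apply compile_start; [lia| |]|].
  - intros q. apply le_S, kof_ok.
  - pose proof (full_halts F P fin phi u ch) as (x & s & H1 & _).
    exists x, s. split; [exact H1|]. intros t Ht. unfold result. change (LS STK) with store in *.
    rewrite H1. simpl. now rewrite Ht.
  - unfold mtime, icost. cbn [sop_eval kc].
    set (a := sop_eval (fullcost P fin) (sizef phi) (length u)).
    set (b := kof _). apply Nat.add_le_mono; [lia|]. apply Nat.mul_le_mono_l.
    lia.
Qed.

Lemma mach_runs F P fin : runs_in (mach F P fin) (mtime F P fin).
Proof.
  intros phi _ u n c H. eapply machine_of_time; [|exact H].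
  intros ch. apply mach_trip.
Qed.

Lemma mach_halts F P fin phi u ch : exists n c, reach (mach F P fin) phi u n c /\
  halted (mach F P fin) u c /\ macc (mach F P fin) (c_state c) = fst (result F P fin phi u ch) /\
  c_out c = snd (result F P fin phi u ch).
Proof. eapply machine_of_halts. intros. apply mach_trip. Qed.

Lemma mach_result F P fin phi u n c : reach (mach F P fin) phi u n c -> halted (mach F P fin) u c ->
  exists ch, macc (mach F P fin) (c_state c) = fst (result F P fin phi u ch) /\
  c_out c = snd (result F P fin phi u ch).
Proof. eapply machine_of_result. intros. apply mach_trip. Qed.

Lemma mach_det F P fin : sfall nochoose F -> deterministic (mach F P fin).
Proof.
  intros H. apply (full_nochoose F P fin) in H. unfold mach, deterministic.
  set (G := compile _ _).
  assert (HG : tfall tdet G).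
  { unfold G, compile. apply (fall_bind TM); [exact tdet_map|apply tdet_wstep|intros].
    apply (fall_iter TM); [exact tdet_map|]. intros q. apply tdet_exec, H. }
  clearbody G. intros [q|b] i w a; cbn; [|lia]. specialize (HG q i w a).
  destruct (fcode G q i w a); cbn in *; [lia|contradiction].
Qed.

(** * Binary numerals *)

Lemma repeat_snoc {A} (x : A) n : repeat x n ++ [x] = x :: repeat x n.
Proof. induction n; simpl; congruence. Qed.

Fixpoint lv (l : list bool) : nat :=
  match l with [] => 0 | b :: l => Nat.b2n b + 2 * lv l end.

Lemma lv_app a b : lv (a ++ b) = lv a + 2 ^ length a * lv b.
Proof. induction a; simpl; [lia|]. rewrite IHa. lia. Qed.

Lemma lv_lt l : lv l < 2 ^ length l.
Proof. induction l as [|[] l]; simpl; lia. Qed.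

Lemma lv_repeat_false n : lv (repeat false n) = 0.
Proof. induction n; simpl; lia. Qed.

Lemma lv_inj a b : length a = length b -> lv a = lv b -> a = b.
Proof.
  revert b. induction a as [|x a IH]; intros [|y b] L E; simpl in *; try discriminate; auto.
  assert (x = y) by (destruct x, y; simpl in E; auto; lia). subst.
  f_equal. apply IH; lia.
Qed.

Lemma lv_surj n : forall k, k < 2 ^ n -> exists l, length l = n /\ lv l = k.
Proof.
  induction n; intros k H; simpl in H.
  - exists []. split; auto. simpl. lia.
  - destruct (IHn (k / 2)) as (l & L & E). { apply Nat.Div0.div_lt_upper_bound. lia. }
    exists (Nat.odd k :: l). simpl. split; [lia|]. rewrite E.
    pose proof (Nat.div2_odd k) as H2. rewrite Nat.div2_div in H2. lia.
Qed.

Lemma lv_negb l : lv (map negb l) + lv l + 1 = 2 ^ length l.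
Proof. induction l as [|[] l]; simpl in *; lia. Qed.

Lemma bin_val_acc l : forall acc, bin_val (map encb l) acc = 2 ^ length l * acc + lv (rev l).
Proof.
  induction l as [|b l IH]; intros acc; simpl; [lia|].
  rewrite lv_app, length_rev. destruct b; simpl; rewrite IH; lia.
Qed.

Lemma bin_val_lv l : bin_val (map encb l) 0 = lv (rev l).
Proof. rewrite bin_val_acc. lia. Qed.

Lemma is_bits_map x : is_bits x -> exists l, x = map encb l.
Proof.
  induction x as [|a x IH]; intros H; [now exists []|].
  destruct IH as [l ->]; [intros b Hb; apply H; now right|].
  destruct (H a) as [-> | ->]; [now left| |]; [exists (false :: l)|exists (true :: l)]; auto.
Qed.

Lemma map_is_bits l : is_bits (map encb l).
Proof. intros a Ha. apply in_map_iff in Ha. destruct Ha as ([] & <- & _); auto. Qed.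

Open Scope R_scope.

(** * Binary fractions *)

Definition bR (b : bool) : R := if b then 1 else 0.

(** Most significant digit first, in contrast to [lv]; hence the reversals wherever the two meet. *)
Fixpoint fr (l : list bool) : R :=
  match l with [] => 0 | b :: l => (bR b + fr l) / 2 end.

Definition e2 (n : nat) : R := / 2 ^ n.

Lemma pow2_pos n : 0 < 2 ^ n.
Proof. apply pow_lt. lra. Qed.
Lemma e2_pos n : 0 < e2 n.
Proof. apply Rinv_0_lt_compat, pow2_pos. Qed.
Lemma e2_0 : e2 0 = 1.
Proof. unfold e2. simpl. lra. Qed.
Lemma e2_S n : e2 (S n) = e2 n / 2.
Proof. unfold e2. simpl. pose proof (pow2_pos n). field. lra. Qed.
Lemma e2_add n m : e2 (n + m) = e2 n * e2 m.
Proof. unfold e2. rewrite pow_add, Rinv_mult. lra. Qed.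
Lemma e2_pow n : e2 n * 2 ^ n = 1.
Proof. unfold e2. pose proof (pow2_pos n). field. lra. Qed.
Lemma e2_le n m : (n <= m)%nat -> e2 m <= e2 n.
Proof.
  intros H. replace m with (n + (m - n))%nat by lia. rewrite e2_add.
  pose proof (e2_pos n). assert (e2 (m - n) <= 1); [|nra].
  induction (m - n)%nat as [|k IH]; [rewrite e2_0; lra|rewrite e2_S; pose proof (e2_pos k); lra].
Qed.

Lemma fr_bounds l : 0 <= fr l <= 1 - e2 (length l).
Proof.
  induction l as [|b l IH]; simpl.
  - rewrite e2_0; lra.
  - rewrite e2_S. destruct b; simpl; lra.
Qed.

Lemma fr_app a b : fr (a ++ b) = fr a + e2 (length a) * fr b.
Proof.
  induction a; simpl; [rewrite e2_0; lra|]. rewrite IHa, e2_S. lra.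
Qed.

Lemma fr_repeat_false n : fr (repeat false n) = 0.
Proof. induction n; simpl; lra. Qed.

Lemma pow_INR2 n : INR (2 ^ n) = 2 ^ n.
Proof. rewrite pow_INR. simpl. f_equal; lra. Qed.

Lemma fr_lv l : INR (lv (rev l)) = fr l * 2 ^ length l.
Proof.
  induction l as [|b l IH]; simpl; [lra|].
  rewrite lv_app, plus_INR, mult_INR, pow_INR2, IH, length_rev. simpl.
  destruct b; simpl; lra.
Qed.

Lemma firstn_pad_S N (f : list bool) :
  firstn N (f ++ false :: repeat false N) = firstn N (f ++ repeat false N).
Proof.
  rewrite <- repeat_snoc, app_assoc, (firstn_app N (f ++ _)), length_app, repeat_length.
  replace (N - (length f + N))%nat with 0%nat by lia. apply app_nil_r.
Qed.

Lemma fr_firstn N : forall f, fr (firstn N (f ++ repeat false N)) <= fr f <=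
  fr (firstn N (f ++ repeat false N)) + e2 N.
Proof.
  induction N; intros f.
  - simpl. pose proof (fr_bounds f). pose proof (e2_pos (length f)). rewrite e2_0. lra.
  - rewrite e2_S. destruct f as [|b f].
    + rewrite app_nil_l, firstn_all2 by (rewrite repeat_length; lia). rewrite fr_repeat_false.
      pose proof (e2_pos N). simpl. lra.
    + simpl firstn. simpl fr. specialize (IHN f).
      rewrite firstn_pad_S. lra.
Qed.

Open Scope nat_scope.

(* Numerals have the least significant bit first. [xhat] is the offset coding [2 ^ (N + 2) + x * 2 ^ N] of
   [x = +-bits / 2 ^ m], up to an error of 1, for [|x| < 2], which is what [small] tests; see [xhat_value]. *)
Definition xhat (neg : bool) (bits : list bool) (m N : nat) : list bool :=
  let l := rev bits in
  rev (map (xorb neg) (firstn N (rev (firstn m (l ++ repeat false m)) ++ repeat false N)))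
  ++ [xorb neg (hd false (skipn m l)); neg; negb neg].

Definition small (bits : list bool) (m : nat) : bool :=
  forallb negb (tl (skipn m (rev bits))).

Lemma lv_forallb l : forallb negb l = true -> lv l = 0.
Proof. induction l as [|[] l]; simpl; auto; [discriminate|]. intros H. rewrite IHl; auto. Qed.

Lemma lv_forallb_false l : forallb negb l = false -> 1 <= lv l.
Proof. induction l as [|[] l]; simpl; intros; try discriminate; [lia|]. apply IHl in H. lia. Qed.

Lemma xhat_length neg bits m N : length (xhat neg bits m N) = N + 3.
Proof.
  unfold xhat. rewrite length_app, length_rev, length_map, length_firstn, length_app, repeat_length.
  simpl. lia.
Qed.

Lemma firstn_pad (l : list bool) m : length (firstn m (l ++ repeat false m)) = m.
Proof. rewrite length_firstn, length_app, repeat_length. lia. Qed.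

Lemma lv_split l m : lv l = lv (firstn m (l ++ repeat false m)) + 2 ^ m * lv (skipn m l).
Proof.
  revert m. induction l as [|b l IH]; intros m.
  - rewrite skipn_nil. rewrite app_nil_l, firstn_all2 by (rewrite repeat_length; lia).
    rewrite lv_repeat_false. simpl. lia.
  - destruct m; [simpl; lia|]. simpl firstn. simpl skipn. cbn [lv]. rewrite (IH m) at 1.
    rewrite firstn_pad_S. simpl. lia.
Qed.

Open Scope R_scope.
(** A negative number is coded by the complement of its digits, which gives [2 ^ N - 1] minus their
    value. The missing unit and the truncation to [N] places act in opposite directions there, so
    the error stays within 1 for both signs. *)
Lemma xhat_value (neg : bool) bits m N (x : R) :
  x = (if neg then -1 else 1) * INR (lv (rev bits)) / 2 ^ m ->
  if small bits m
  then Rabs (INR (lv (xhat neg bits m N)) - 2 ^ (N + 2) - x * 2 ^ N) <= 1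
  else 2 <= Rabs x.
Proof.
  intros Hx. set (l := rev bits) in *. set (f := rev (firstn m (l ++ repeat false m))).
  assert (Hf : length f = m) by (unfold f; rewrite length_rev; apply firstn_pad).
  assert (E : INR (lv l) / 2 ^ m = fr f + INR (lv (skipn m l))).
  { rewrite (lv_split l m), plus_INR, mult_INR, pow_INR2.
    replace (INR (lv (firstn m (l ++ repeat false m)))) with (fr f * 2 ^ m).
    - pose proof (pow2_pos m). field. lra.
    - pose proof (fr_lv f) as Ef. rewrite Hf in Ef. rewrite <- Ef. unfold f. now rewrite rev_involutive. }
  pose proof (fr_bounds f) as Bf. pose proof (e2_pos (length f)) as Be.
  assert (Hx' : x = (if neg then -1 else 1) * (fr f + INR (lv (skipn m l)))).
  { rewrite Hx. rewrite <- E. unfold Rdiv. lra. }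
  clear Hx E. unfold small. fold l.
  destruct (forallb negb (tl (skipn m l))) eqn:Es.
  - assert (Ei : lv (skipn m l) = Nat.b2n (hd false (skipn m l))).
    { destruct (skipn m l) as [|b r]; simpl in *; auto. rewrite (lv_forallb r) by auto. lia. }
    rewrite Ei in Hx'. unfold xhat. fold l. fold f. rewrite lv_app, plus_INR, mult_INR, pow_INR2.
    set (g := firstn N (f ++ repeat false N)).
    assert (Hg : length g = N) by (unfold g; rewrite length_firstn, length_app, repeat_length; lia).
    rewrite length_rev, length_map, Hg.
    pose proof (fr_firstn N f) as Bg. fold g in Bg.
    pose proof (fr_lv g) as Eg. rewrite Hg in Eg.
    pose proof (e2_pow N) as Ep. pose proof (pow2_pos N) as Pp.
    rewrite pow_add.
    assert (Bm : fr g * 2 ^ N <= fr f * 2 ^ N <= fr g * 2 ^ N + 1).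
    { split; [|rewrite <- Ep, <- Rmult_plus_distr_r]; apply Rmult_le_compat_r; lra. }
    rewrite Hx'. destruct neg; simpl xorb; cbn [negb].
    + replace (map (xorb true) g) with (map negb g) by (apply map_ext; now intros []).
      assert (En : INR (lv (rev (map negb g))) = 2 ^ N - 1 - fr g * 2 ^ N).
      { rewrite <- map_rev. pose proof (lv_negb (rev g)) as H. rewrite length_rev, Hg in H.
        apply (f_equal INR) in H. rewrite !plus_INR, pow_INR2, Eg in H. simpl in H. lra. }
      rewrite En. destruct (hd false (skipn m l)); simpl; apply Rabs_le; lra.
    + replace (map (xorb false) g) with g by (symmetry; erewrite map_ext; [apply map_id|now intros []]).
      rewrite Eg. destruct (hd false (skipn m l)); simpl; apply Rabs_le; lra.
  - assert (H2 : (2 <= lv (skipn m l))%nat).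
    { destruct (skipn m l) as [|b r]; simpl in *; [discriminate|].
      pose proof (lv_forallb_false r Es). lia. }
    apply le_INR in H2. simpl in H2. rewrite Hx'.
    destruct neg; [rewrite Rabs_left by lra|rewrite Rabs_right by lra]; lra.
Qed.
Open Scope nat_scope.

(** Adding 1 turns the run of low ones into zeros and the next zero into a one; subtracting 1 is the
    same with the digits exchanged. [c] is the digit that is run over. *)
Fixpoint flip (c : bool) (l : list bool) : list bool :=
  match l with
  | [] => []
  | b :: l => if Bool.eqb b c then negb c :: flip c l else c :: l
  end.

Lemma flip_length c l : length (flip c l) = length l.
Proof. induction l; simpl; auto. destruct (Bool.eqb a c); simpl; auto. Qed.

Lemma flip_inc l : lv l + 1 < 2 ^ length l -> lv (flip true l) = lv l + 1.
Proof. induction l as [|[] l IH]; simpl; try lia. Qed.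

Lemma flip_dec l : 1 <= lv l -> lv (flip false l) + 1 = lv l.
Proof. induction l as [|[] l IH]; simpl; try lia. Qed.

Definition bump (c : bool) j tmp : frag STK unit :=
  iter (fun _ : unit => o <- pop j ;; match o with
    | None => sret (inr tt)
    | Some b => if Bool.eqb b c then push tmp true ;;; sret (inl tt)
                else push j c ;;; sret (inr tt) end) tt ;;;
  foreach tmp (fun _ => push j (negb c)).

Lemma bump_ok c j tmp e s l (Q : unit -> store -> Prop) : j <> tmp ->
  s_stk s j = l -> s_stk s tmp = [] ->
  Q tt (setk s j (flip c l)) ->
  sp (bump c j tmp) e (6 * length l + 7) s Q.
Proof.
  intros N El Et HQ.
  assert (H1 : forall r k (Q' : unit -> store -> Prop),
    (forall r' i, i <= length r -> repeat (negb c) i ++ r' = flip c r ->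
      Q' tt (setk (setk s j r') tmp (repeat true (k + i)))) ->
    sp (iter (fun _ : unit => o <- pop j ;; match o with
      | None => sret (inr tt)
      | Some b => if Bool.eqb b c then push tmp true ;;; sret (inl tt)
                else push j c ;;; sret (inr tt) end) tt) e (3 * length r + 3)
      (setk (setk s j r) tmp (repeat true k)) Q').
  { induction r as [|b r IH]; intros k Q' HQ'.
    - eapply sp_le; [eapply (sp_iter _ _ e 2 0)|lia]. sstep. rewrite stk_neq, stk_eq by auto. cbn [hd_error tl]. sstep.
      specialize (HQ' [] 0 (le_n _) eq_refl). rewrite Nat.add_0_r in HQ'.
      eapply eq_ind; [exact HQ'|]. sext.
    - simpl flip in HQ'. destruct (Bool.eqb b c) eqn:Eb.
      + eapply sp_le; [eapply (sp_iter _ _ e 3 (3 * length r + 3))|simpl; lia]. sstep. rewrite stk_neq, stk_eq by auto. cbn [hd_error tl].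
        rewrite Eb. sstep. sstep.
        match goal with |- sp _ _ _ ?st _ =>
          replace st with (setk (setk s j r) tmp (repeat true (S k))) end.
        * apply IH. intros r' i Hi E. specialize (HQ' r' (S i)).
          replace (S k + i) with (k + S i) by lia. apply HQ'; simpl; [lia|congruence].
        * apply store_ext; auto. intros x. cbn. rewrite !Nat.eqb_refl.
          destruct (Nat.eqb_spec x tmp), (Nat.eqb_spec x j), (Nat.eqb_spec tmp j); subst; auto; congruence.
      + eapply sp_le; [eapply (sp_iter _ _ e 3 0)|simpl; lia]. sstep. rewrite stk_neq, stk_eq by auto. cbn [hd_error tl].
        rewrite Eb. sstep. sstep.
        specialize (HQ' (c :: r) 0). rewrite Nat.add_0_r in HQ'.
        eapply eq_ind; [apply HQ'; [lia|reflexivity]|].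
        apply store_ext; auto. intros x. cbn. rewrite !Nat.eqb_refl.
        destruct (Nat.eqb_spec x tmp), (Nat.eqb_spec x j), (Nat.eqb_spec tmp j); subst; auto; congruence. }
  eapply (sp_le _ _ ((3 * length l + 3) + (3 * length l + 2))); [apply sp_bind|lia].
  replace s with (setk (setk s j l) tmp (repeat true 0)) by (simpl repeat; sext).
  apply H1. intros r' i Hi E. simpl. eapply sp_le; [|instantiate (1 := (1 + 2) * length (repeat true i) + 2);
    rewrite repeat_length; lia].
  apply (foreach_ok e tmp _ 1 (fun r s' => exists k, k + length r = i /\ s' =
    setk (setk s j (repeat (negb c) k ++ r')) tmp r)).
  - intros r s' (k & _ & ->). apply stk_eq.
  - intros b r s' (k & L & ->). sstep. exists (S k). simpl in L. split; [lia|].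
    apply store_ext; auto. intros x. cbn. rewrite !Nat.eqb_refl.
    destruct (Nat.eqb_spec x tmp), (Nat.eqb_spec x j), (Nat.eqb_spec j tmp); subst; auto; congruence.
  - intros s' (k & L & ->). simpl in L. replace k with i by lia. rewrite E.
    eapply eq_ind; [exact HQ|]. sext.
  - exists 0. rewrite repeat_length. split; auto.
Qed.

Fixpoint rep (n : nat) (F : frag STK unit) : frag STK unit :=
  match n with 0 => sret tt | S n => F ;;; rep n F end.

(** * Parsing the arguments of a name *)

Definition sym_eqb (a b : sym) : bool :=
  match a, b with
  | s0, s0 | s1, s1 | splus, splus | sminus, sminus | sslash, sslash => true
  | _, _ => false
  end.

Definition dbl (w : str) : str := flat_map (fun a => [a; a]) w.

Lemma dbl_app a b : dbl (a ++ b) = dbl a ++ dbl b.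
Proof. apply flat_map_app. Qed.
Lemma dbl_length a : length (dbl a) = 2 * length a.
Proof. induction a; simpl; lia. Qed.

Definition at_ip (s : store) (i : nat) : store :=
  onO s (fun o => mkO i (o_qry o) (o_ans o) (o_apos o) (o_out o) (o_ch o)).

Lemma skipn_cut {A} i (u a r : list A) : skipn i u = a ++ r -> skipn (i + length a) u = r.
Proof.
  intros H. rewrite Nat.add_comm, <- skipn_skipn, H, skipn_app, skipn_all, Nat.sub_diag. auto.
Qed.

Lemma nth_error_skipn_hd {A} i (u : list A) : nth_error u i = hd_error (skipn i u).
Proof. revert u. induction i; intros [|a u]; simpl; auto. Qed.

(** Reads one doubled symbol of a paired word; the separator and the end of the input both give
    [None], which ends the loops built on it. *)
Definition rdsym : frag STK (option sym) :=
  a <- inp MR ;; b <- inp MR ;;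
  sret (match a, b with
        | Some x, Some y => if sym_eqb x y then Some x else None
        | _, _ => None end).

Lemma rdsym_ok phi u s i c c' r (Q : option sym -> store -> Prop) :
  skipn i u = c :: c' :: r ->
  Q (if sym_eqb c c' then Some c else None) (at_ip s (i + 2)) ->
  sp rdsym (phi, u) 3 (at_ip s i) Q.
Proof.
  intros E HQ. unfold rdsym. sstep. cbn [at_ip onO s_o o_ip].
  rewrite nth_error_skipn_hd, E. cbn [hd_error]. sstep. cbn [onO s_o o_ip o_move mvpos at_ip].
  assert (E' : skipn (S i) u = c' :: r).
  { replace (S i) with (i + length [c]) by (simpl; lia). now apply skipn_cut. }
  rewrite nth_error_skipn_hd, E'. cbn [hd_error]. sstep.
  eapply eq_ind; [exact HQ|]. unfold at_ip, onO, o_move. simpl. repeat f_equal. lia.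
Qed.

Definition rdbits j : frag STK unit :=
  iter (fun _ : unit => c <- rdsym ;; match c with
    | Some s0 => push j false ;;; sret (inl tt)
    | Some s1 => push j true ;;; sret (inl tt)
    | _ => sret (inr tt) end) tt.

Lemma rdbits_ok phi u j bits : forall s i r (Q : unit -> store -> Prop),
  skipn i u = dbl (map encb bits) ++ [sslash; sslash] ++ r ->
  Q tt (at_ip (setk s j (rev bits ++ s_stk s j)) (i + 2 * length bits + 2)) ->
  sp (rdbits j) (phi, u) (5 * length bits + 4) (at_ip s i) Q.
Proof.
  induction bits as [|b bits IH]; intros s i r Q E HQ.
  - eapply sp_le; [eapply (sp_iter _ _ (phi, u) 4 0)|lia].
    apply (sp_bind _ _ _ 3 1). eapply rdsym_ok; [exact E|]. cbn [sym_eqb]. sstep.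
    simpl in HQ. rewrite setk_self in HQ by auto. now rewrite Nat.add_0_r in HQ.
  - eapply sp_le; [eapply (sp_iter _ _ (phi, u) 5 (5 * length bits + 4))|simpl; lia].
    apply (sp_bind _ _ _ 3 2). eapply rdsym_ok; [exact E|].
    assert (Eb : sym_eqb (encb b) (encb b) = true) by (destruct b; auto). rewrite Eb.
    assert (Hn : sp (iter (fun _ : unit => c <- rdsym ;; match c with
    | Some s0 => push j false ;;; sret (inl tt)
    | Some s1 => push j true ;;; sret (inl tt)
    | _ => sret (inr tt) end) tt) (phi, u) (5 * length bits + 4)
      (at_ip (setk s j (b :: s_stk s j)) (i + 2)) Q).
    { eapply IH.
      - apply (skipn_cut i u [encb b; encb b]). exact E.
      - rewrite setk_setk, stk_eq. simpl in HQ. rewrite <- app_assoc in HQ.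
        eapply eq_ind; [exact HQ|]. f_equal. lia. }
    destruct b; cbn [encb]; sstep; sstep; exact Hn.
Qed.

Definition o2b (o : option bool) : bool := match o with Some b => b | None => false end.

(** Each zero of the denominator moves one bit across the binary point: [j] is left with the integer
    part and [j'] receives the fraction, padded with zeros if the numerator is too short. *)
Definition rdzeros j j' : frag STK unit :=
  iter (fun _ : unit => c <- rdsym ;; match c with
    | Some s0 => o <- pop j ;; push j' (o2b o) ;;; sret (inl tt)
    | _ => sret (inr tt) end) tt.

Lemma rdzeros_ok phi u j j' m : forall s i r l (Q : unit -> store -> Prop), j <> j' ->
  skipn i u = dbl (repeat s0 m) ++ [s0; s1] ++ r -> s_stk s j = l ->
  Q tt (at_ip (setk (setk s j (skipn m l)) j' (rev (firstn m (l ++ repeat false m)) ++ s_stk s j')) (i + 2 * m + 2)) ->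
  sp (rdzeros j j') (phi, u) (6 * m + 4) (at_ip s i) Q.
Proof.
  induction m; intros s i r l Q N E El HQ.
  - eapply sp_le; [eapply (sp_iter _ _ (phi, u) 4 0)|lia].
    apply (sp_bind _ _ _ 3 1). eapply rdsym_ok; [exact E|]. cbn [sym_eqb]. sstep.
    simpl in HQ. rewrite (setk_self s j), setk_self in HQ by auto. now rewrite Nat.add_0_r in HQ.
  - eapply sp_le; [eapply (sp_iter _ _ (phi, u) 6 (6 * m + 4))|simpl; lia].
    apply (sp_bind _ _ _ 3 3). eapply rdsym_ok; [exact E|]. cbn [sym_eqb]. sstep.
    cbn [at_ip onO s_stk]. rewrite El. sstep. sstep.
    cbn [setk s_stk]. destruct (Nat.eqb_spec j' j); [congruence|].
    change (sp (rdzeros j j') (phi, u) (6 * m + 4) (at_ip (setk (setk s j (tl l)) j' (o2b (hd_error l) :: s_stk s j')) (i + 2)) Q).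
    apply (IHm _ _ r (tl l)); auto.
    + apply (skipn_cut i u [s0; s0]). exact E.
    + rewrite stk_neq, stk_eq; auto.
    + eapply eq_ind; [exact HQ|].
      replace (i + 2 + 2 * m + 2) with (i + 2 * S m + 2) by lia. f_equal.
      rewrite stk_eq.
      replace (rev (firstn (S m) (l ++ repeat false (S m)))) with
        (rev (firstn m (tl l ++ repeat false m)) ++ [o2b (hd_error l)]).
      2:{ destruct l; simpl; auto. now rewrite firstn_pad_S. }
      rewrite <- app_assoc.
      replace (skipn (S m) l) with (skipn m (tl l)) by (destruct l; simpl; auto using skipn_nil).
      sext.
Qed.

Definition rdnum j j' : frag STK bool :=
  c <- rdsym ;; rdbits j ;;; rdsym ;;; rdzeros j j' ;;;
  sret (match c with Some sminus => true | _ => false end).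

Definition dystr (neg : bool) (bits : list bool) (m : nat) : str :=
  (if neg then sminus else splus) :: map encb bits ++ [sslash; s1] ++ repeat s0 m.

Lemma dystr_length neg bits m : length (dystr neg bits m) = length bits + m + 3.
Proof. unfold dystr. simpl. rewrite length_app, length_map. simpl. rewrite repeat_length. lia. Qed.

Lemma rdnum_ok phi u j j' neg bits m s i r (Q : bool -> store -> Prop) : j <> j' ->
  skipn i u = dbl (dystr neg bits m) ++ [s0; s1] ++ r -> s_stk s j = [] -> s_stk s j' = [] ->
  Q neg (at_ip (setk (setk s j (skipn m (rev bits))) j' (rev (firstn m (rev bits ++ repeat false m))))
     (i + 2 * length (dystr neg bits m) + 2)) ->
  sp (rdnum j j') (phi, u) (6 * length (dystr neg bits m) + 8) (at_ip s i) Q.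
Proof.
  intros N E E1 E2 HQ. set (sg := if neg then sminus else splus).
  assert (Esg : sym_eqb sg sg = true) by (destruct neg; auto).
  rewrite dystr_length in *.
  eapply (sp_le _ _ (3 + ((5 * length bits + 4) + (3 + ((6 * m + 4) + 1))))); [|lia].
  apply sp_bind. eapply rdsym_ok; [exact E|]. fold sg. rewrite Esg.
  assert (Ea : skipn (i + 2) u = dbl (map encb bits) ++ [sslash; sslash] ++ [s1; s1] ++ dbl (repeat s0 m) ++ [s0; s1] ++ r).
  { apply (skipn_cut i u [sg; sg]). rewrite E. unfold dystr. cbn [dbl flat_map]. fold (dbl (map encb bits ++ [sslash; s1] ++ repeat s0 m)).
    rewrite !dbl_app. simpl. rewrite <- !app_assoc. reflexivity. }
  apply sp_bind. eapply rdbits_ok; [exact Ea|].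
  assert (Eb : skipn (i + 2 + 2 * length bits + 2) u = [s1; s1] ++ dbl (repeat s0 m) ++ [s0; s1] ++ r).
  { replace (i + 2 + 2 * length bits + 2) with (i + 2 + length (dbl (map encb bits) ++ [sslash; sslash])).
    - apply skipn_cut. rewrite <- app_assoc. exact Ea.
    - rewrite length_app, dbl_length, length_map. simpl. lia. }
  apply sp_bind. eapply rdsym_ok; [exact Eb|].
  apply sp_bind. eapply rdzeros_ok; [auto| |apply stk_eq|].
  - apply (skipn_cut _ u [s1; s1]). exact Eb.
  - sstep. rewrite E1, app_nil_r, setk_setk, stk_neq, E2, app_nil_r by auto.
    replace (i + 2 + 2 * length bits + 2 + 2 + 2 * m + 2) with (i + 2 * (length bits + m + 3) + 2) by lia.
    unfold sg. destruct neg; exact HQ.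
Qed.

Definition rdunary j : frag STK unit :=
  iter (fun _ : unit => c <- inp MR ;; match c with
    | Some _ => push j true ;;; sret (inl tt)
    | None => sret (inr tt) end) tt.

Lemma rdunary_ok phi u j n : forall s i (Q : unit -> store -> Prop),
  skipn i u = repeat s0 n ->
  Q tt (at_ip (setk s j (repeat true n ++ s_stk s j)) (i + n + 1)) ->
  sp (rdunary j) (phi, u) (3 * n + 2) (at_ip s i) Q.
Proof.
  induction n; intros s i Q E HQ.
  - eapply sp_le; [eapply (sp_iter _ _ (phi, u) 2 0)|lia]. sstep.
    cbn [at_ip onO s_o o_ip]. rewrite nth_error_skipn_hd, E. cbn [hd_error repeat]. sstep.
    simpl in HQ. rewrite setk_self in HQ by auto.
    eapply eq_ind; [exact HQ|]. unfold at_ip, onO, o_move; simpl. repeat f_equal. lia.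
  - eapply sp_le; [eapply (sp_iter _ _ (phi, u) 3 (3 * n + 2))|lia]. sstep.
    cbn [at_ip onO s_o o_ip]. rewrite nth_error_skipn_hd, E. cbn [hd_error repeat]. sstep. sstep.
    match goal with |- sp _ _ _ ?st _ => replace st with (at_ip (setk s j (true :: s_stk s j)) (i + 1)) end.
    + apply IHn.
      * apply (skipn_cut i u [s0]). exact E.
      * rewrite setk_setk, stk_eq.
        eapply eq_ind; [exact HQ|]. replace (i + 1 + n + 1) with (i + S n + 1) by lia.
        do 2 f_equal. replace (true :: s_stk s j) with ([true] ++ s_stk s j) by auto.
        rewrite app_assoc, repeat_snoc. auto.
    + unfold at_ip, onO, o_move, setk; simpl. repeat f_equal. lia.
Qed.

(** Digits are pushed from the sign and the integer part downwards, so the least significant one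
    ends up on top, as [xhat] is written. Whatever remains on [a] has to vanish; this is the test
    [small]. *)
Definition normalize (neg : bool) a b n n' x : frag STK bool :=
  i <- pop a ;; push x (negb neg) ;;; push x neg ;;; push x (xorb neg (o2b i)) ;;;
  foreach n (fun _ => push n' true ;;; o <- pop b ;; push x (xorb neg (o2b o))) ;;;
  mov n' n ;;;
  ok <- iter (fun _ : unit => o <- pop a ;; match o with
    | None => sret (inr true)
    | Some b => sret (if b then inr false else inl tt) end) tt ;;
  clear a ;;; clear b ;;; sret ok.

Lemma firstn_S_pad N (f : list bool) :
  firstn (S N) (f ++ repeat false (S N)) = o2b (hd_error f) :: firstn N (tl f ++ repeat false N).
Proof. destruct f; simpl; auto. now rewrite firstn_pad_S. Qed.

Lemma normalize_ok e neg a b n n' x la lb N s (Q : bool -> store -> Prop) :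
  NoDup [a; b; n; n'; x] ->
  s_stk s a = la -> s_stk s b = lb -> s_stk s n = repeat true N -> s_stk s n' = [] -> s_stk s x = [] ->
  Q (forallb negb (tl la)) (setk (setk (setk s a []) b []) x
      (rev (map (xorb neg) (firstn N (lb ++ repeat false N))) ++ [xorb neg (o2b (hd_error la)); neg; negb neg])) ->
  sp (normalize neg a b n n' x) e (8 * N + 2 * length la + 20) s Q.
Proof.
  intros Hnd Ea Eb En En' Ex HQ.
  assert (a <> b /\ a <> n /\ a <> n' /\ a <> x /\ b <> n /\ b <> n' /\ b <> x /\ n <> n' /\ n <> x /\ n' <> x) as
    (N1 & N2 & N3 & N4 & N5 & N6 & N7 & N8 & N9 & N10).
  { repeat match goal with H : NoDup (_ :: _) |- _ => inversion_clear H end. simpl in *. intuition congruence. }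
  clear Hnd.
  set (top := [xorb neg (o2b (hd_error la)); neg; negb neg]) in *.
  eapply (sp_le _ _ (4 + ((5 * N + 2) + ((3 * N + 2) + ((2 * length la + 3) + 3))))); [|lia].
  unfold normalize. do 4 sstep. rewrite Ea.
  match goal with |- sp _ _ _ ?st _ => replace st with (setk (setk s a (tl la)) x top) end.
  2:{ apply store_ext; auto. intros y. cbn. rewrite !Nat.eqb_refl, Ex.
      destruct (Nat.eqb_spec y x); auto. destruct (Nat.eqb_spec x a); [congruence|reflexivity]. }
  apply sp_bind. replace (5 * N + 2) with ((3 + 2) * length (repeat true N) + 2) by (rewrite repeat_length; lia).
  apply (foreach_ok e n _ 3 (fun r s' => exists k m, k + length r = N /\ r = repeat true (length r) /\
    skipn k (lb ++ repeat false N) = m /\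
    s' = setk (setk (setk (setk (setk s a (tl la)) n r) n' (repeat true k)) b (skipn k lb)) x
       (rev (map (xorb neg) (firstn k (lb ++ repeat false N))) ++ top))).
  - intros r s' (k & m & _ & _ & _ & ->). rewrite 3!stk_neq, stk_eq; auto.
  - intros bb r s' (k & m & L & Er & Em & ->). simpl in L, Er.
    assert (Hr : r = repeat true (length r)) by congruence. clear Er.
    sstep. sstep. sstep. exists (S k), (tl m). split; [lia|]. split; [exact Hr|]. split.
    { rewrite <- Em. change (S k) with (1 + k). rewrite <- (skipn_skipn 1 k). destruct (skipn k _); auto. }
    assert (Eh : o2b (hd_error (skipn k lb)) = nth k (lb ++ repeat false N) false).
    { rewrite <- nth_error_skipn_hd. destruct (nth_error lb k) eqn:E1.
      - rewrite app_nth1 by (apply nth_error_Some; congruence). apply (nth_error_nth lb k false) in E1. auto.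
      - apply nth_error_None in E1. rewrite app_nth2, nth_repeat by auto. auto. }
    assert (Ef : firstn (S k) (lb ++ repeat false N) = firstn k (lb ++ repeat false N) ++ [nth k (lb ++ repeat false N) false]).
    { clear - L. set (z := lb ++ repeat false N).
      assert (Hz : k < length z) by (unfold z; rewrite length_app, repeat_length; lia).
      clearbody z. clear L. revert k Hz. induction z; intros k Hz; [simpl in Hz; lia|].
      destruct k; auto. simpl. f_equal. apply IHz. simpl in Hz; lia. }
    rewrite Ef, map_app, rev_app_distr. cbn [map rev app].
    apply store_ext; auto. intros y. cbn [setk s_stk].
    rewrite !Nat.eqb_refl.
    destruct (Nat.eqb_spec b n'); [congruence|]. destruct (Nat.eqb_spec b n); [congruence|].
    destruct (Nat.eqb_spec b x); [congruence|]. destruct (Nat.eqb_spec x b); [congruence|].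
    destruct (Nat.eqb_spec x n); [congruence|]. destruct (Nat.eqb_spec x n'); [congruence|].
    destruct (Nat.eqb_spec n' x); [congruence|]. destruct (Nat.eqb_spec n' n); [congruence|].
    destruct (Nat.eqb_spec n' b); [congruence|].
    rewrite Eh.
    destruct (Nat.eqb_spec y x); auto.
    destruct (Nat.eqb_spec y b).
    { change (S k) with (1 + k). rewrite <- (skipn_skipn 1 k). destruct (skipn k lb); auto. }
    destruct (Nat.eqb_spec y n'); auto. destruct (Nat.eqb_spec y n); auto.
  - intros s' (k & m & L & _ & _ & ->). simpl in L. rewrite Nat.add_0_r in L. subst k.
    apply sp_bind. replace (3 * N + 2) with (3 * length (repeat true N) + 2) by (rewrite repeat_length; lia).
    eapply mov_ok; [congruence|rewrite 2!stk_neq, stk_eq by auto; reflexivity|].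
    rewrite rev_repeat.
    match goal with |- sp _ _ _ ?st _ => replace st with (setk (setk (setk s a (tl la)) b (skipn N lb)) x
       (rev (map (xorb neg) (firstn N (lb ++ repeat false N))) ++ top)) end.
    2:{ apply store_ext; auto. intros y. cbn [setk s_stk].
        destruct (Nat.eqb_spec n n'); [congruence|]. destruct (Nat.eqb_spec n x); [congruence|].
        destruct (Nat.eqb_spec n b); [congruence|]. rewrite Nat.eqb_refl, app_nil_r.
        destruct (Nat.eqb_spec y n); subst.
        - destruct (Nat.eqb_spec n x); [congruence|]. destruct (Nat.eqb_spec n b); [congruence|].
          destruct (Nat.eqb_spec n a); [congruence|]. auto.
        - destruct (Nat.eqb_spec y n'); subst; auto.
          destruct (Nat.eqb_spec n' x); [congruence|]. destruct (Nat.eqb_spec n' b); [congruence|].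
          destruct (Nat.eqb_spec n' a); congruence. }
    apply sp_bind.
    assert (H1 : forall l (s : store) (Q' : bool -> store -> Prop), s_stk s a = l ->
      (forall r, Q' (forallb negb l) (setk s a r)) ->
      sp (iter (fun _ : unit => o <- pop a ;; match o with
        | None => sret (inr true)
        | Some b => sret (if b then inr false else inl tt) end) tt) e (2 * length l + 3) s Q').
    { clear. induction l as [|c l IH]; intros s Q' E HQ'.
      - eapply sp_le; [eapply (sp_iter _ _ e 2 0)|lia]. sstep. rewrite E. cbn [hd_error tl]. sstep. apply (HQ' []).
      - eapply sp_le; [eapply (sp_iter _ _ e 2 (2 * length l + 3))|simpl; lia]. sstep. rewrite E. cbn [hd_error tl].
        destruct c; sstep.
        + apply (HQ' l).
        + apply IH; [apply stk_eq|]. intros r. rewrite setk_setk. apply HQ'. }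
    eapply sp_le; [apply (H1 (tl la)); [rewrite 2!stk_neq, stk_eq by auto; reflexivity|]|destruct la; simpl; lia].
    intros r. do 3 sstep. eapply eq_ind; [exact HQ|].
    apply store_ext; auto. intros y. cbn [setk s_stk].
    destruct (Nat.eqb_spec y x); subst.
    + destruct (Nat.eqb_spec x a); [congruence|]. destruct (Nat.eqb_spec x b); [congruence|auto].
    + destruct (Nat.eqb_spec y b), (Nat.eqb_spec y a); auto.
  - exists 0, (lb ++ repeat false N). simpl. rewrite !repeat_length. repeat split; auto.
    rewrite <- (setk_self s n (repeat true N)) at 1 by auto. rewrite <- (setk_self s n' []) at 1 by auto.
    rewrite <- (setk_self s b lb) at 1 by auto.
    apply store_ext; auto. intros y. cbn [setk s_stk].
    repeat match goal with |- context [Nat.eqb ?a ?b] => destruct (Nat.eqb_spec a b); subst; try congruence end.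
Qed.

(** The six extra ticks on stack 0 turn the requested precision [n] into the working precision
    [n + 6]. *)
Definition parse : frag STK bool :=
  n1 <- rdnum 3 4 ;; n2 <- rdnum 5 6 ;; rdunary 0 ;;; pushes 0 (repeat true 6) ;;;
  k1 <- normalize n1 3 4 0 7 1 ;; k2 <- normalize n2 5 6 0 7 2 ;; sret (k1 && k2).

Definition parsed (s : store) (ch : list bool) (N : nat) (X Y : list bool) : Prop :=
  o_qry (s_o s) = [] /\ o_out (s_o s) = [] /\ o_ch (s_o s) = ch /\
  s_stk s 0 = repeat true N /\ s_stk s 1 = X /\ s_stk s 2 = Y /\ forall j, 3 <= j -> s_stk s j = [].

Lemma parse_ok phi g1 b1 m1 g2 b2 m2 n ch s (Q : bool -> store -> Prop) :
  let u := triple_str (dystr g1 b1 m1) (dystr g2 b2 m2) (repeat s0 n) in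
  initial s ch ->
  (forall s', parsed s' ch (n + 6) (xhat g1 b1 m1 (n + 6)) (xhat g2 b2 m2 (n + 6)) ->
    Q (small b1 m1 && small b2 m2) s') ->
  sp parse (phi, u) (30 * length u + 200) s Q.
Proof.
  intros u (I1 & I2 & I3 & I4 & I5) HQ.
  assert (Eu : u = dbl (dystr g1 b1 m1) ++ [s0; s1] ++ dbl (dystr g2 b2 m2) ++ [s0; s1] ++ repeat s0 n) by reflexivity.
  set (d1 := dystr g1 b1 m1) in *. set (d2 := dystr g2 b2 m2) in *.
  assert (L1 : length d1 = length b1 + m1 + 3) by apply dystr_length.
  assert (L2 : length d2 = length b2 + m2 + 3) by apply dystr_length.
  assert (Lu : length u = 2 * length d1 + 2 * length d2 + n + 4).
  { rewrite Eu, !length_app, !dbl_length, repeat_length. simpl. lia. }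
  eapply (sp_le _ _ ((6 * length d1 + 8) + ((6 * length d2 + 8) + ((3 * n + 2) + (7 +
     ((8 * (n + 6) + 2 * length b1 + 20) + ((8 * (n + 6) + 2 * length b2 + 20) + 1))))))); [|lia].
  unfold parse. apply sp_bind. replace s with (at_ip s 0).
  2:{ destruct s as [[] ?]; unfold at_ip, onO; simpl in *; congruence. }
  eapply rdnum_ok; [lia|simpl skipn; exact Eu|auto|auto|]. fold d1.
  assert (E1 : skipn (0 + 2 * length d1 + 2) u = dbl d2 ++ [s0; s1] ++ repeat s0 n).
  { replace (0 + 2 * length d1 + 2) with (0 + length (dbl d1 ++ [s0; s1])).
    - apply skipn_cut. rewrite <- app_assoc. exact Eu.
    - rewrite length_app, dbl_length. simpl. lia. }
  apply sp_bind. eapply rdnum_ok; [lia|exact E1|rewrite !stk_neq by lia; auto|rewrite !stk_neq by lia; auto|]. fold d2.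
  assert (E2 : skipn (0 + 2 * length d1 + 2 + 2 * length d2 + 2) u = repeat s0 n).
  { rewrite <- (Nat.add_assoc _ (2 * length d2)).
    replace (2 * length d2 + 2) with (length (dbl d2 ++ [s0; s1])).
    - apply skipn_cut. rewrite <- app_assoc. exact E1.
    - rewrite length_app, dbl_length. simpl. lia. }
  apply sp_bind. eapply rdunary_ok; [exact E2|].
  apply sp_bind. eapply (pushes_ok 0 (repeat true 6)).
  set (ip := _ + n + 1). clearbody ip.
  match goal with |- sp _ _ _ ?st _ => set (s1 := st) end.
  assert (S0 : s_stk s1 0 = repeat true (n + 6)).
  { unfold s1. cbn [at_ip onO s_stk setk]. simpl. rewrite I5, app_nil_r.
    rewrite Nat.add_comm, repeat_app. reflexivity. }
  assert (S3 : s_stk s1 3 = skipn m1 (rev b1)) by reflexivity.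
  assert (S4 : s_stk s1 4 = rev (firstn m1 (rev b1 ++ repeat false m1))) by reflexivity.
  assert (S5 : s_stk s1 5 = skipn m2 (rev b2)) by reflexivity.
  assert (S6 : s_stk s1 6 = rev (firstn m2 (rev b2 ++ repeat false m2))) by reflexivity.
  assert (S1 : s_stk s1 1 = []) by (simpl; apply I5). assert (S2 : s_stk s1 2 = []) by (simpl; apply I5).
  assert (S7 : forall j, 7 <= j -> s_stk s1 j = []).
  { intros j Hj. unfold s1. cbn [at_ip onO s_stk setk].
    repeat match goal with |- context [Nat.eqb ?a ?b] => destruct (Nat.eqb_spec a b); subst; try lia end. auto. }
  assert (So : o_qry (s_o s1) = [] /\ o_out (s_o s1) = [] /\ o_ch (s_o s1) = ch) by (simpl; auto).
  clearbody s1. destruct So as (O1 & O2 & O3).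
  assert (Lb1 : length (skipn m1 (rev b1)) <= length b1) by (rewrite length_skipn, length_rev; lia).
  assert (Lb2 : length (skipn m2 (rev b2)) <= length b2) by (rewrite length_skipn, length_rev; lia).
  apply sp_bind. eapply sp_le; [eapply normalize_ok; [|exact S3|exact S4|exact S0|auto|auto|]|lia].
  { repeat constructor; simpl; lia. }
  apply sp_bind. eapply sp_le; [eapply normalize_ok; [| | | | | |]|].
  { repeat constructor; simpl; lia. }
  all: try (rewrite !stk_neq by lia; eauto; fail).
  2:{ lia. }
  sstep. apply HQ. unfold parsed. cbn [setk s_stk s_o]. simpl Nat.eqb. cbv iota.
  repeat split; auto.
  - unfold xhat. now destruct (skipn m1 (rev b1)).
  - unfold xhat. now destruct (skipn m2 (rev b2)).
  - intros j Hj. repeat match goal with |- context [Nat.eqb ?a ?b] => destruct (Nat.eqb_spec a b); subst; try lia end; auto.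
    apply S7. lia.
Qed.

(** * The nondeterministic machine for the convex hull *)

Definition tk (n : nat) (ch : list bool) : list bool := firstn n (ch ++ repeat false n).

Lemma tk_S n ch : tk (S n) ch = hd false ch :: tk n (tl ch).
Proof. unfold tk. rewrite firstn_S_pad. now destruct ch. Qed.

Lemma tk_length n ch : length (tk n ch) = n.
Proof. apply firstn_pad. Qed.

Lemma tk_app l ch : tk (length l) (l ++ ch) = l.
Proof.
  unfold tk. rewrite <- app_assoc, firstn_app, firstn_all, Nat.sub_diag. apply app_nil_r.
Qed.

Lemma tl_skipn {A} k (l : list A) : tl (skipn k l) = skipn (S k) l.
Proof. change (S k) with (1 + k). rewrite <- skipn_skipn. now destruct (skipn k l). Qed.

Lemma tk_snoc k ch : tk (S k) ch = tk k ch ++ [hd false (skipn k ch)].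
Proof.
  revert ch. induction k; intros ch; [simpl; now destruct ch|].
  rewrite tk_S, IHk, (tk_S k). simpl. do 3 f_equal. destruct ch; auto. now rewrite skipn_nil.
Qed.

Definition set_ch (s : store) (ch : list bool) : store :=
  onO s (fun o => mkO (o_ip o) (o_qry o) (o_ans o) (o_apos o) (o_out o) ch).
Definition add_qry (s : store) (w : str) : store :=
  onO s (fun o => mkO (o_ip o) (o_qry o ++ w) (o_ans o) (o_apos o) (o_out o) (o_ch o)).

(** A loop controlled by the precision on stack 0, which is kept on stack 8 in the meantime and then
    put back. *)
Definition forN (body : frag STK unit) : frag STK unit :=
  foreach 0 (fun _ => push 8 true ;;; body) ;;; mov 8 0.

Lemma forN_ok e body c N (f : nat -> store) s (Q : unit -> store -> Prop) :
  (forall k l l', k < N -> sp body e c (setk (setk (f k) 0 l) 8 l')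
     (fun _ s' => s' = setk (setk (f (S k)) 0 l) 8 l')) ->
  f 0 = s -> s_stk s 0 = repeat true N -> s_stk s 8 = [] ->
  Q tt (setk (setk (f N) 0 (repeat true N)) 8 []) ->
  sp (forN body) e ((c + 6) * N + 4) s Q.
Proof.
  intros Hb H0 Hn H8 HQ.
  eapply (sp_le _ _ (((S c + 2) * length (repeat true N) + 2) + (3 * N + 2))); [apply sp_bind|rewrite repeat_length; lia].
  apply (foreach_ok e 0 _ (S c) (fun r s' => exists k, k + length r = N /\
    s' = setk (setk (f k) 0 r) 8 (repeat true k))).
  - intros r s' (k & _ & ->). reflexivity.
  - intros b r s' (k & L & ->). simpl in L. sstep.
    match goal with |- sp _ _ _ ?st _ => replace st with (setk (setk (f k) 0 r) 8 (repeat true (S k))) by sext end.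
    eapply sp_post; [apply Hb; lia|]. intros x s' ->. exists (S k). split; [lia|auto].
  - intros s' (k & L & ->). simpl in L. rewrite Nat.add_0_r in L. subst k.
    replace (3 * N + 2) with (3 * length (repeat true N) + 2) by (rewrite repeat_length; lia).
    eapply mov_ok; [lia|reflexivity|]. eapply eq_ind; [exact HQ|].
    rewrite rev_repeat. cbn [setk s_stk Nat.eqb]. rewrite app_nil_r. sext.
  - exists 0. rewrite repeat_length. split; auto. rewrite H0. simpl repeat. sext.
Qed.

Fixpoint qrys (w : str) : frag STK unit :=
  match w with [] => sret tt | c :: w => qry c ;;; qrys w end.

Lemma qrys_ok w : forall e s (Q : unit -> store -> Prop), Q tt (add_qry s w) ->
  sp (qrys w) e (length w + 1) s Q.
Proof.
  induction w as [|c w IH]; intros e s Q HQ; cbn [qrys].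
  - sstep. unfold add_qry, onO in HQ. rewrite app_nil_r in HQ. destruct s as [[] ?]; exact HQ.
  - sstep. apply IH. unfold add_qry, onO in *. cbn in *. now rewrite <- app_assoc.
Qed.

Lemma add_qry_app s w w' : add_qry (add_qry s w) w' = add_qry s (w ++ w').
Proof. unfold add_qry, onO. simpl. now rewrite <- app_assoc. Qed.

(** Every guessed digit goes to a stack and, doubled, to the query tape at the same time, so that
    the number kept is the number asked about. *)
Definition guess_num j : frag STK unit :=
  qrys (dbl [splus]) ;;; forN (b <- choose ;; push j b ;;; qrys (dbl [encb b])) ;;;
  qrys (dbl [sslash; s1]) ;;; forN (qrys (dbl [s0])) ;;; qrys [s0; s1].

Lemma guess_num_ok e j N s (Q : unit -> store -> Prop) : 9 <= j ->
  s_stk s 0 = repeat true N -> s_stk s 8 = [] -> s_stk s j = [] ->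
  (let bx := tk N (o_ch (s_o s)) in
   Q tt (add_qry (set_ch (setk s j (rev bx)) (skipn N (o_ch (s_o s)))) (dbl (dystr false bx N) ++ [s0; s1]))) ->
  sp (guess_num j) e (30 * N + 30) s Q.
Proof.
  intros Hj H0 H8 Hs HQ. set (ch := o_ch (s_o s)) in *.
  eapply (sp_le _ _ (3 + (((5 + 6) * N + 4) + (5 + (((3 + 6) * N + 4) + 3))))); [|lia].
  unfold guess_num. apply sp_bind. apply (qrys_ok (dbl [splus])). apply sp_bind.
  apply (forN_ok e _ 5 N (fun k => add_qry (set_ch (setk s j (rev (tk k ch))) (skipn k ch))
    (dbl (splus :: map encb (tk k ch))))).
  - intros k l l' Hk. sstep. sstep. eapply sp_le; [apply qrys_ok|simpl; lia].
    cbn [set_ch add_qry onO setk s_o s_stk o_ch].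
    set (b := hd false (skipn k ch)). rewrite (tk_snoc k). fold b.
    apply store_ext.
    + unfold o_choose; simpl. f_equal.
      * rewrite map_app. simpl. rewrite dbl_app. simpl. rewrite <- !app_assoc. reflexivity.
      * apply tl_skipn.
    + intros x. cbn. rewrite !Nat.eqb_refl. destruct (Nat.eqb_spec j 8), (Nat.eqb_spec j 0); try lia.
      rewrite rev_app_distr. simpl.
      destruct (Nat.eqb_spec x j), (Nat.eqb_spec x 8), (Nat.eqb_spec x 0); subst; auto; try lia.
  - simpl. unfold tk. simpl. rewrite setk_self by auto. unfold set_ch, add_qry, onO. unfold ch. simpl. reflexivity.
  - exact H0.
  - exact H8.
  - set (s1 := setk _ 8 _). set (bx := tk N ch) in *.
    assert (E1 : s1 = add_qry (set_ch (setk s j (rev bx)) (skipn N ch)) (dbl (splus :: map encb bx))).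
    { unfold s1. apply store_ext; auto. intros x. cbn [setk s_stk add_qry set_ch onO].
      destruct (Nat.eqb_spec x j), (Nat.eqb_spec x 8), (Nat.eqb_spec x 0); subst; auto; try lia. }
    clearbody s1. subst s1.
    apply sp_bind. apply (qrys_ok (dbl [sslash; s1])). rewrite add_qry_app. apply sp_bind.
    set (s2 := add_qry _ _).
    apply (forN_ok e _ 3 N (fun k => add_qry s2 (dbl (repeat s0 k)))).
    + intros k l l' Hk. eapply sp_le; [apply qrys_ok|simpl; lia].
      replace (S k) with (k + 1) by lia. rewrite repeat_app, dbl_app.
      unfold add_qry, setk, onO. simpl. now rewrite <- app_assoc.
    + unfold add_qry, onO; simpl. rewrite app_nil_r. reflexivity.
    + unfold s2. cbn [add_qry set_ch onO s_stk]. rewrite stk_neq by lia. auto.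
    + unfold s2. cbn [add_qry set_ch onO s_stk]. rewrite stk_neq by lia. auto.
    + apply (qrys_ok [s0; s1]). eapply eq_ind; [exact HQ|]. unfold s2.
      apply store_ext.
      * cbn. f_equal. rewrite <- !app_assoc. do 2 f_equal.
        unfold dystr. cbn [dbl flat_map]. change (flat_map _ ?x) with (dbl x). rewrite !dbl_app. simpl. now rewrite <- !app_assoc.
      * intros x. cbn [setk s_stk add_qry set_ch onO].
        destruct (Nat.eqb_spec x j), (Nat.eqb_spec x 8), (Nat.eqb_spec x 0); subst; auto; try lia.
Qed.

Definition is_s1 (o : option sym) : bool := match o with Some s1 => true | _ => false end.

(** The name is asked at precision [N - 1]: rounding both coordinates of a point of the set to the
    grid moves it by less than [2^-(N-1)], but possibly by more than [2^-N]. *)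
Definition guess jx jy : frag STK bool :=
  guess_num jx ;;; guess_num jy ;;; pop 0 ;;; forN (qry s0) ;;; push 0 true ;;; ask ;;;
  a <- ans MS ;; sret (is_s1 a).

Definition query (phi : str -> str) N (bx by' : list bool) : bool :=
  is_s1 (hd_error (phi (triple_str (dystr false bx N) (dystr false by' N) (repeat s0 (N - 1))))).

Lemma guess_ok phi u jx jy N s (Q : bool -> store -> Prop) : 9 <= jx -> 9 <= jy -> jx <> jy ->
  s_stk s 0 = repeat true (S N) -> s_stk s 8 = [] -> s_stk s jx = [] -> s_stk s jy = [] ->
  o_qry (s_o s) = [] ->
  (let ch := o_ch (s_o s) in
   let bx := tk (S N) ch in
   let bY := tk (S N) (skipn (S N) ch) in
   forall s', o_qry (s_o s') = [] -> o_ch (s_o s') = skipn (2 * S N) ch ->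
     s_stk s' = s_stk (setk (setk s jx (rev bx)) jy (rev bY)) ->
     Q (query phi (S N) bx bY) s') ->
  sp (guess jx jy) (phi, u) (70 * N + 150) s Q.
Proof.
  intros Hx Hy Hn H0 H8 Ex Ey Eq HQ. set (ch := o_ch (s_o s)) in *. cbv zeta in HQ.
  eapply (sp_le _ _ ((30 * S N + 30) + ((30 * S N + 30) + (1 + (((1 + 6) * N + 4) + 4))))); [|lia].
  unfold guess. apply sp_bind. apply guess_num_ok with (N := S N); auto. fold ch. cbv zeta.
  apply sp_bind. apply guess_num_ok with (N := S N); auto;
    cbn [add_qry set_ch onO s_stk s_o o_ch]; try (rewrite stk_neq by lia; auto).
  cbv zeta. set (bx := tk (S N) ch) in *. set (bY := tk (S N) (skipn (S N) ch)) in *.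
  clearbody bx bY. sstep. apply sp_bind. set (s1 := setk _ 0 _).
  apply (forN_ok (phi, u) _ 1 N (fun k => add_qry s1 (repeat s0 k))).
  - intros k l l' Hk. sstep. rewrite <- (repeat_snoc s0 k : _ = repeat s0 (S k)).
    unfold add_qry, setk, onO, o_query. simpl. now rewrite <- app_assoc.
  - unfold add_qry, onO; simpl. now rewrite app_nil_r.
  - unfold s1. rewrite stk_eq. cbn [add_qry set_ch onO s_stk setk].
    destruct (Nat.eqb_spec 0 jy), (Nat.eqb_spec 0 jx); try lia. rewrite H0. reflexivity.
  - unfold s1. cbn [add_qry set_ch onO s_stk setk].
    destruct (Nat.eqb_spec 8 jy), (Nat.eqb_spec 8 jx), (Nat.eqb_spec 8 0); try lia. auto.
  - do 4 sstep. unfold query in HQ.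
    match goal with |- Q (is_s1 ?a) _ =>
      replace a with (hd_error (phi (triple_str (dystr false bx (S N)) (dystr false bY (S N)) (repeat s0 (S N - 1)))));
      [apply HQ|] end.
    + reflexivity.
    + transitivity (skipn (S N) (skipn (S N) ch)); [reflexivity|]. rewrite skipn_skipn. f_equal. lia.
    + apply functional_extensionality. intros x. unfold s1. cbn [add_qry set_ch onO s_stk setk].
      destruct (Nat.eqb_spec x jy), (Nat.eqb_spec x jx), (Nat.eqb_spec x 8), (Nat.eqb_spec x 0); subst; auto; try lia.
    + unfold s1, onO, o_ask. cbn [s_o s_stk o_qry o_ans o_apos add_qry set_ch onO setk fst].
      rewrite Eq. unfold triple_str, pair_str. change (flat_map _ ?x) with (dbl x).
      replace (S N - 1) with N by lia. rewrite app_nil_l, <- !app_assoc. destruct (phi _); auto.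
Qed.

(** * Fixed-point averages and interpolation *)

Fixpoint add (x y : list bool) (c : bool) : list bool :=
  match x, y with
  | a :: x, b :: y => xorb (xorb a b) c :: add x y ((a && b) || (a && c) || (b && c))
  | _, _ => [c]
  end.

Lemma add_lv x : forall y c, length x = length y -> lv (add x y c) = lv x + lv y + Nat.b2n c.
Proof.
  induction x as [|a x IH]; intros [|b y] c L; simpl in *; try discriminate; [lia|].
  rewrite IH by lia. destruct a, b, c; simpl; lia.
Qed.

Lemma add_length x : forall y c, length x = length y -> length (add x y c) = S (length x).
Proof. induction x as [|a x IH]; intros [|b y] c L; simpl in *; try discriminate; auto. Qed.

Definition avg x y := tl (add x y false).

Lemma avg_length x y : length x = length y -> length (avg x y) = length x.
Proof. intros H. unfold avg. pose proof (add_length x y false H). destruct (add x y false); simpl in *; lia. Qed.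

Lemma avg_lv x y : length x = length y -> 2 * lv (avg x y) <= lv x + lv y <= 2 * lv (avg x y) + 1.
Proof.
  intros H. pose proof (add_lv x y false H) as E. unfold avg.
  destruct (add x y false) as [|[] l]; simpl in *; lia.
Qed.

Definition avgloop j i : bool * bool -> frag STK unit :=
  iter (fun st : bool * bool => let (c, first) := st in
    o <- pop j ;; match o with
    | None => push 21 c ;;; sret (inr tt)
    | Some a => o2 <- pop i ;; let b := o2b o2 in push 22 b ;;;
       (if first then sret tt else push 21 (xorb (xorb a b) c)) ;;;
       sret (inl ((a && b) || (a && c) || (b && c), false))
    end).

Definition avgp j i : frag STK unit := avgloop j i (false, true) ;;; mov 21 j ;;; mov 22 i.

Lemma avgloop_ok e j i x : j <> i -> j <> 21 -> j <> 22 -> i <> 21 -> i <> 22 ->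
  forall y c s s' l21 l22 (Q : unit -> store -> Prop), length x = length y ->
     s' = setk (setk (setk (setk s j x) i y) 21 l21) 22 l22 ->
     Q tt (setk (setk (setk (setk s j []) i []) 21 (rev (add x y c) ++ l21)) 22 (rev y ++ l22)) ->
     sp (avgloop j i (c, false)) e (5 * length x + 3) s' Q.
Proof.
  intros N1 N2 N3 N4 N5.
  induction x as [|a x IH]; intros [|b y] c s s' l21 l22 Q L Es' HQ; subst s'; try discriminate.
  - eapply sp_le; [eapply (sp_iter _ _ e 3 0)|lia]. sstep. lks. cbn [hd_error tl].
    sstep. lks. sstep. eapply eq_ind; [exact HQ|]. sext.
  - simpl in L. eapply sp_le; [eapply (sp_iter _ _ e 5 (5 * length x + 3))|simpl; lia].
    sstep. lks. cbn [hd_error tl].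
    sstep. lks. cbn [hd_error tl o2b].
    sstep. lks. sstep. lks. sstep. eapply (IH y) with (s := s) (l21 := xorb (xorb a b) c :: l21) (l22 := b :: l22); [lia| |].
    + sext.
    + cbn [add rev] in HQ. rewrite <- !app_assoc in HQ. exact HQ.
Qed.

Lemma avgp_ok e j i x y s (Q : unit -> store -> Prop) : j <> i -> j <> 21 -> j <> 22 -> i <> 21 -> i <> 22 ->
  s_stk s j = x -> s_stk s i = y -> length x = length y -> 1 <= length x ->
  s_stk s 21 = [] -> s_stk s 22 = [] ->
  Q tt (setk s j (avg x y)) ->
  sp (avgp j i) e (11 * length x + 10) s Q.
Proof.
  intros N1 N2 N3 N4 N5 Ej Ei L L1 E21 E22 HQ.
  destruct x as [|a x], y as [|b y]; try discriminate; [simpl in L1; lia|]. simpl in L.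
  eapply (sp_le _ _ ((5 + (5 * length x + 3)) + ((3 * S (length x) + 2) + (3 * S (length x) + 2)))); [|simpl; lia].
  unfold avgp, avgloop. apply sp_bind. apply sp_iter.
  sstep. rewrite Ej. cbn [hd_error tl].
  sstep. rewrite stk_neq, Ei by auto. cbn [hd_error tl o2b].
  sstep. lks. rewrite E22. sstep. sstep.
  eapply (avgloop_ok e j i x N1 N2 N3 N4 N5 y _ s _ [] [b]); [lia|sext|].
  set (r := add x y _).
  assert (Er : length r = S (length x)) by (apply add_length; lia).
  apply sp_bind. eapply sp_le; [eapply mov_ok; [auto|rewrite stk_neq, stk_eq by lia; reflexivity|]|rewrite app_nil_r, length_rev; lia].
  eapply sp_le; [eapply mov_ok; [auto|rewrite 2!stk_neq, stk_eq by lia; reflexivity|]|rewrite length_app, length_rev; simpl; lia].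
  eapply eq_ind; [exact HQ|]. unfold avg. cbn [add tl]. change (_ || _ || _) with ((a && b) || (a && false) || (b && false)). fold r.
  rewrite app_nil_r, rev_involutive, rev_app_distr, rev_involutive. simpl (rev [b]).
  apply store_ext; auto. intros z. cbn [setk s_stk]. rewrite !Nat.eqb_refl.
  eqbs;
    rewrite ?app_nil_r; auto.
Qed.

(* Interpolation between [p] and [q] by Horner's rule, the weight of [p] being the fraction with digits [rev bs]. *)
Definition seg (bs : list bool) (acc p q : list bool) : list bool :=
  fold_left (fun acc (b : bool) => avg acc (if b then p else q)) bs acc.

Lemma seg_length bs p q : length p = length q -> forall acc, length acc = length p -> length (seg bs acc p q) = length p.
Proof.
  intros L. induction bs as [|b bs IH]; intros acc H; simpl; auto.
  apply IH. rewrite avg_length; destruct b; lia.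
Qed.

Lemma seg_snoc bs b acc p q : seg (bs ++ [b]) acc p q = avg (seg bs acc p q) (if b then p else q).
Proof. unfold seg. now rewrite fold_left_app. Qed.

(** One list of choices drives both coordinates, so that they are interpolated with the same
    weight. *)
Definition segp jx jy px py qx qy : frag STK unit :=
  forN (push jx false ;;; push jy false) ;;;
  forN (b <- choose ;; if b then avgp jx px ;;; avgp jy py else avgp jx qx ;;; avgp jy qy).

Ltac lkc := repeat first [rewrite stk_eq | rewrite stk_neq by lia | progress cbn [onO set_ch add_qry s_stk s_o]].
Ltac concrete := cbn [setk s_stk s_o set_ch add_qry onO o_ch].

Lemma segp_ok e jx jy px py qx qy N s (Q : unit -> store -> Prop) :
  9 <= jx <= 20 -> 9 <= jy <= 20 -> 9 <= px <= 20 -> 9 <= py <= 20 -> 9 <= qx <= 20 -> 9 <= qy <= 20 ->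
  jx <> jy -> jx <> px -> jx <> py -> jx <> qx -> jx <> qy ->
  jy <> px -> jy <> py -> jy <> qx -> jy <> qy -> 1 <= N ->
  s_stk s 0 = repeat true N -> s_stk s 8 = [] -> s_stk s jx = [] -> s_stk s jy = [] ->
  s_stk s 21 = [] -> s_stk s 22 = [] ->
  length (s_stk s px) = N -> length (s_stk s py) = N -> length (s_stk s qx) = N -> length (s_stk s qy) = N ->
  (let bs := tk N (o_ch (s_o s)) in
   Q tt (set_ch (setk (setk s jx (seg bs (repeat false N) (s_stk s px) (s_stk s qx)))
      jy (seg bs (repeat false N) (s_stk s py) (s_stk s qy))) (skipn N (o_ch (s_o s))))) ->
  sp (segp jx jy px py qx qy) e (22 * (N * N) + 50 * N + 10) s Q.
Proof.
  intros Bjx Bjy Bpx Bpy Bqx Bqy Nj M1 M2 M3 M4 M5 M6 M7 M8 N1 H0 H8 Ejx Ejy E21 E22 Lpx Lpy Lqx Lqy HQ.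
  cbv zeta in HQ. set (ch := o_ch (s_o s)) in *.
  eapply (sp_le _ _ (((2 + 6) * N + 4) + (((1 + ((11 * N + 10) + (11 * N + 10))) + 6) * N + 4))); [|nia].
  unfold segp. apply sp_bind.
  apply (forN_ok e _ 2 N (fun k => setk (setk s jx (repeat false k)) jy (repeat false k))).
  - intros k l l' Hk. sstep. sstep. simpl repeat. sext.
  - simpl repeat. sext.
  - auto.
  - auto.
  - set (s1 := setk _ 8 _).
    assert (Es1 : s1 = setk (setk s jx (repeat false N)) jy (repeat false N)) by (unfold s1; sext).
    clearbody s1. subst s1. set (z := repeat false N).
    set (P := fun b : bool => s_stk s (if b then px else qx)). set (R := fun b : bool => s_stk s (if b then py else qy)).
    set (fx := fun k => seg (tk k ch) z (s_stk s px) (s_stk s qx)).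
    set (fy := fun k => seg (tk k ch) z (s_stk s py) (s_stk s qy)).
    assert (Lfx : forall k, length (fx k) = N).
    { intros k. unfold fx. rewrite seg_length; auto; unfold z; rewrite ?repeat_length; lia. }
    assert (Lfy : forall k, length (fy k) = N).
    { intros k. unfold fy. rewrite seg_length; auto; unfold z; rewrite ?repeat_length; lia. }
    apply (forN_ok e _ (1 + ((11 * N + 10) + (11 * N + 10))) N
      (fun k => set_ch (setk (setk s jx (fx k)) jy (fy k)) (skipn k ch))).
    + intros k l l' Hk. sstep. concrete. set (b := hd false (skipn k ch)).
      assert (Efx : fx (S k) = avg (fx k) (if b then s_stk s px else s_stk s qx)).
      { unfold fx. rewrite tk_snoc. apply seg_snoc. }
      assert (Efy : fy (S k) = avg (fy k) (if b then s_stk s py else s_stk s qy)).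
      { unfold fy. rewrite tk_snoc. apply seg_snoc. }
      rewrite Efx, Efy.
      assert (Hgen : forall ax ay, ax = (if b then px else qx) -> ay = (if b then py else qy) ->
        sp (avgp jx ax ;;; avgp jy ay) e ((11 * N + 10) + (11 * N + 10))
         (onO (setk (setk (set_ch (setk (setk s jx (fx k)) jy (fy k)) (skipn k ch)) 0 l) 8 l') o_choose)
         (fun _ s' => s' = setk (setk (set_ch (setk (setk s jx (avg (fx k) (if b then s_stk s px else s_stk s qx)))
           jy (avg (fy k) (if b then s_stk s py else s_stk s qy))) (skipn (S k) ch)) 0 l) 8 l')).
      { intros ax ay Hax Hay.
        assert (Bax : 9 <= ax <= 20) by (destruct b; lia). assert (Bay : 9 <= ay <= 20) by (destruct b; lia).
        assert (Nax : jx <> ax /\ jy <> ax) by (destruct b; subst; auto).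
        assert (Nay : jx <> ay /\ jy <> ay) by (destruct b; subst; auto).
        assert (Eax : s_stk s ax = if b then s_stk s px else s_stk s qx) by (destruct b; subst; auto).
        assert (Eay : s_stk s ay = if b then s_stk s py else s_stk s qy) by (destruct b; subst; auto).
        assert (Lax : length (s_stk s ax) = N) by (rewrite Eax; destruct b; auto).
        assert (Lay : length (s_stk s ay) = N) by (rewrite Eay; destruct b; auto).
        rewrite <- Eax, <- Eay. destruct Nax as [Na1 Na2], Nay as [Na3 Na4].
        clear Hax Hay Eax Eay M1 M2 M3 M4 M5 M6 M7 M8 Bpx Bpy Bqx Bqy.
        apply sp_bind.
        eapply (sp_le _ _ (11 * length (fx k) + 10)); [|rewrite Lfx; lia].
        eapply avgp_ok with (x := fx k) (y := s_stk s ax);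
          [lia|lia|lia|lia|lia| | |rewrite Lfx; lia|rewrite Lfx; lia| | |];
          lkc; auto.
        eapply (sp_le _ _ (11 * length (fy k) + 10)); [|rewrite Lfy; lia].
        eapply avgp_ok with (x := fy k) (y := s_stk s ay);
          [lia|lia|lia|lia|lia| | |rewrite Lfy; lia|rewrite Lfy; lia| | |];
          lkc; auto.
        apply store_ext.
        - unfold o_choose; simpl. f_equal. apply tl_skipn.
        - intros y. concrete.
          eqbs; auto. }
      destruct b eqn:Eb; apply Hgen; rewrite ?Eb; auto.
    + unfold set_ch, onO, fx, fy, tk, seg, ch. simpl. destruct s as [[] ?]; reflexivity.
    + concrete. destruct (Nat.eqb_spec 0 jx), (Nat.eqb_spec 0 jy); try lia. auto.
    + concrete. destruct (Nat.eqb_spec 8 jx), (Nat.eqb_spec 8 jy); try lia. auto.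
    + eapply eq_ind; [exact HQ|]. fold z. change (seg (tk N ch) z (s_stk s px) (s_stk s qx)) with (fx N).
      change (seg (tk N ch) z (s_stk s py) (s_stk s qy)) with (fy N).
      apply store_ext; auto. intros y. concrete.
      eqbs; auto.
Qed.

(** * Guessing a bounded correction *)

Lemma rep_ok F e c (f : nat -> store) n (Q : unit -> store -> Prop) :
  (forall k, k < n -> sp F e c (f k) (fun _ s' => s' = f (S k))) ->
  Q tt (f n) -> sp (rep n F) e ((c + 1) * n + 1) (f 0) Q.
Proof.
  revert f. induction n; intros f H HQ; cbn [rep].
  - eapply sp_le; [sstep; exact HQ|lia].
  - eapply sp_le; [apply (sp_bind _ _ e c ((c + 1) * n + 1))|simpl; lia].
    eapply sp_post; [apply H; lia|]. intros x s' ->.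
    apply (IHn (fun k => f (S k))); auto. intros k Hk. apply H. lia.
Qed.

Fixpoint iterl (n : nat) (f : list bool -> list bool) (l : list bool) : list bool :=
  match n with 0 => l | S n => f (iterl n f l) end.

Lemma iterl_flip_length n c l : length (iterl n (flip c) l) = length l.
Proof. induction n; simpl; auto. now rewrite flip_length. Qed.

Lemma decs_ok c e j tmp n s l (Q : unit -> store -> Prop) : j <> tmp ->
  s_stk s j = l -> s_stk s tmp = [] ->
  Q tt (setk s j (iterl n (flip c) l)) ->
  sp (rep n (bump c j tmp)) e ((6 * length l + 8) * n + 1) s Q.
Proof.
  intros N El Et HQ. replace s with (setk s j (iterl 0 (flip c) l)) by (apply setk_self; auto).
  eapply sp_le; [apply (rep_ok _ e (6 * length l + 7) (fun k => setk s j (iterl k (flip c) l)))|].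
  - intros k Hk. rewrite <- (iterl_flip_length k c l).
    eapply bump_ok; auto.
    + apply stk_eq.
    + rewrite stk_neq; auto.
    + rewrite setk_setk. reflexivity.
  - exact HQ.
  - apply Nat.add_le_mono_r, Nat.mul_le_mono_r. lia.
Qed.

Fixpoint incs (n : nat) (ch : list bool) (l : list bool) : list bool :=
  match n with
  | 0 => l
  | S n => let l' := incs n ch l in if hd false (skipn n ch) then flip true l' else l'
  end.

Lemma incs_length n ch l : length (incs n ch l) = length l.
Proof. induction n; simpl; auto. destruct (hd false _); auto. now rewrite flip_length. Qed.

Definition incp n j tmp : frag STK unit :=
  rep n (c <- choose ;; if c then bump true j tmp else sret tt).

Lemma incp_ok e j tmp n s l (Q : unit -> store -> Prop) : j <> tmp ->
  s_stk s j = l -> s_stk s tmp = [] ->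
  (let ch := o_ch (s_o s) in Q tt (set_ch (setk s j (incs n ch l)) (skipn n ch))) ->
  sp (incp n j tmp) e ((6 * length l + 9) * n + 1) s Q.
Proof.
  intros N El Et HQ. cbv zeta in HQ. set (ch := o_ch (s_o s)) in *.
  replace s with (set_ch (setk s j (incs 0 ch l)) (skipn 0 ch)).
  2:{ simpl. rewrite setk_self by auto. unfold ch. destruct s as [[] ?]; reflexivity. }
  eapply sp_le; [apply (rep_ok _ e (6 * length l + 8) (fun k => set_ch (setk s j (incs k ch l)) (skipn k ch)))|].
  - intros k Hk. apply (sp_le _ _ (S (6 * length l + 7))); [|lia]. sstep. cbn [set_ch onO s_o o_ch].
    match goal with |- sp _ _ _ ?st _ =>
      replace st with (setk (set_ch s (skipn (S k) ch)) j (incs k ch l))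
        by (unfold onO, set_ch, setk, o_choose; cbn; now rewrite tl_skipn) end.
    cbn [incs]. destruct (hd false (skipn k ch)).
    + rewrite <- (incs_length k ch l) at 1. eapply bump_ok; auto.
      * apply stk_eq.
      * rewrite stk_neq; auto.
      * rewrite setk_setk. reflexivity.
    + eapply sp_le; [sstep|lia]. reflexivity.
  - exact HQ.
  - apply Nat.add_le_mono_r, Nat.mul_le_mono_r. lia.
Qed.

Definition is_bit (b : bool) (o : option bool) : bool :=
  match o with Some c => Bool.eqb b c | None => false end.

Definition cmp j x : frag STK bool :=
  iter (fun _ : unit => o <- pop j ;; match o with
    | None => a <- pop x ;; b <- pop x ;; c <- pop x ;;
        sret (inr (is_bit false a && is_bit false b && is_bit true c))
    | Some a => o2 <- pop x ;; sret (if is_bit a o2 then inl tt else inr false) end) tt.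

Definition eql (a b : list bool) : bool := if list_eq_dec bool_dec a b then true else false.

Lemma eql_true a b : eql a b = true <-> a = b.
Proof. unfold eql. destruct (list_eq_dec bool_dec a b); split; congruence. Qed.

Lemma cmp_ok e j x l : forall m s (Q : bool -> store -> Prop), j <> x ->
  s_stk s j = l -> s_stk s x = m -> length m = length l + 3 ->
  (forall r r', Q (eql m (l ++ [false; false; true])) (setk (setk s j r) x r')) ->
  sp (cmp j x) e (3 * length l + 5) s Q.
Proof.
  induction l as [|a l IH]; intros m s Q N Ej Ex L HQ.
  - eapply sp_le; [eapply (sp_iter _ _ e 5 0)|simpl; lia].
    destruct m as [|a [|b [|c [|d m]]]]; try discriminate.
    sstep. rewrite Ej. cbn [hd_error tl]. sstep. lks. rewrite Ex. cbn [hd_error tl].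
    sstep. lks. cbn [hd_error tl]. sstep. lks. cbn [hd_error tl]. sstep.
    replace (is_bit false (Some a) && is_bit false (Some b) && is_bit true (Some c)) with
      (eql [a; b; c] ([] ++ [false; false; true])) by (destruct a, b, c; reflexivity).
    rewrite !setk_setk. apply HQ.
  - destruct m as [|b m]; [discriminate|]. simpl in L.
    destruct (Bool.eqb a b) eqn:Eab.
    + apply eqb_prop in Eab. subst b.
      eapply sp_le; [eapply (sp_iter _ _ e 3 (3 * length l + 5))|simpl; lia].
      sstep. rewrite Ej. cbn [hd_error tl]. sstep. lks. rewrite Ex. cbn [hd_error tl is_bit].
      rewrite eqb_reflx. sstep. apply (IH m); auto; lks; auto.
      intros r r'. replace (eql m (l ++ [false; false; true])) with (eql (a :: m) ((a :: l) ++ [false; false; true])).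
      * match goal with |- Q _ ?st => replace st with (setk (setk s j r) x r') by sext end. apply HQ.
      * apply eq_true_iff_eq. rewrite !eql_true. simpl. split; congruence.
    + eapply sp_le; [eapply (sp_iter _ _ e 3 0)|simpl; lia].
      sstep. rewrite Ej. cbn [hd_error tl]. sstep. lks. rewrite Ex. cbn [hd_error tl is_bit].
      rewrite Eab. sstep.
      replace false with (eql (b :: m) ((a :: l) ++ [false; false; true])); [apply HQ|].
      unfold eql. destruct (list_eq_dec bool_dec _ _) as [E|]; auto. simpl in E.
      inversion E. subst. rewrite eqb_reflx in Eab. discriminate.
Qed.

(* Subtracting [r] and then adding [1] at most [d] times, at will, guesses a number within distance [r] if [d = 2 * r]. *)
Definition matchF r d : frag STK bool :=
  rep r (bump false 1 20) ;;; incp d 1 20 ;;;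
  rep r (bump false 2 20) ;;; incp d 2 20 ;;;
  e1 <- cmp 17 1 ;; e2 <- cmp 18 2 ;; sret (e1 && e2).

Definition hullF r d : frag STK bool :=
  ok <- parse ;;
  if ok then
    g1 <- guess 9 10 ;; g2 <- guess 11 12 ;; g3 <- guess 13 14 ;;
    if g1 && g2 && g3 then
      segp 15 16 9 10 11 12 ;;; segp 17 18 15 16 13 14 ;;; matchF r d
    else sret false
  else sret false.

(** Blocks 0 to 5 are the coordinates of the three points and blocks 6 and 7 the two weights; the
    choices behind them drive the corrections. *)
Definition guesses (N : nat) (ch : list bool) (i : nat) : list bool := tk N (skipn (i * N) ch).

Definition accx N ch i j k :=
  let g := guesses N ch in let z := repeat false N in
  seg (g 7) z (seg (g 6) z (rev (g i)) (rev (g j))) (rev (g k)).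

Definition adjust r d (X ch : list bool) : list bool := incs d ch (iterl r (flip false) X).

Definition verify r d (phi : str -> str) N X Y ch : bool :=
  let g := guesses N ch in
  query phi N (g 0) (g 1) && query phi N (g 2) (g 3) && query phi N (g 4) (g 5) &&
  (eql (adjust r d X (skipn (8 * N) ch)) (accx N ch 0 2 4 ++ [false; false; true]) &&
   eql (adjust r d Y (skipn (8 * N + d) ch)) (accx N ch 1 3 5 ++ [false; false; true])).

Definition matchcost r d N := 2 * (((6 * (N + 3) + 8) * r + 1) + ((6 * (N + 3) + 9) * d + 1)) + 2 * (3 * N + 5) + 1.

Lemma matchF_ok e r d N X Y ax ay ch s (Q : bool -> store -> Prop) :
  length X = N + 3 -> length Y = N + 3 -> length ax = N -> length ay = N ->
  o_ch (s_o s) = ch -> s_stk s 1 = X -> s_stk s 2 = Y -> s_stk s 17 = ax -> s_stk s 18 = ay -> s_stk s 20 = [] ->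
  (forall s', Q (eql (adjust r d X ch) (ax ++ [false; false; true]) &&
     eql (adjust r d Y (skipn d ch)) (ay ++ [false; false; true])) s') ->
  sp (matchF r d) e (matchcost r d N) s Q.
Proof.
  intros LX LY Lax Lay C5 K1 K2 K17 K18 K20 HQ. unfold matchcost.
  apply (sp_le _ _
     (((6 * (N + 3) + 8) * r + 1) + (((6 * (N + 3) + 9) * d + 1) +
     (((6 * (N + 3) + 8) * r + 1) + (((6 * (N + 3) + 9) * d + 1) + ((3 * N + 5) + ((3 * N + 5) + 1))))))); [|lia].
  unfold matchF.
  apply sp_bind. rewrite <- LX at 1. eapply decs_ok; [lia|exact K1|exact K20|].
  apply sp_bind. eapply sp_le; [eapply incp_ok; [lia|lks; reflexivity|lks; exact K20|]|rewrite iterl_flip_length; lia].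
  cbv zeta. cbn [s_o setk]. rewrite C5.
  apply sp_bind. rewrite <- LY at 1. eapply decs_ok; [lia|lkc; exact K2|lkc; exact K20|].
  apply sp_bind. eapply sp_le; [eapply incp_ok; [lia|lkc; reflexivity|lkc; exact K20|]|rewrite iterl_flip_length; lia].
  cbv zeta. cbn [s_o setk set_ch onO o_ch].
  apply sp_bind. eapply sp_le; [eapply cmp_ok; [lia|lkc; exact K17|lkc; reflexivity| |]|rewrite Lax; lia].
  { rewrite incs_length, iterl_flip_length. lia. }
  intros r1 r2.
  apply sp_bind. eapply sp_le; [eapply cmp_ok; [lia|lkc; exact K18|lkc; reflexivity| |]|rewrite Lay; lia].
  { rewrite incs_length, iterl_flip_length. lia. }
  intros r3 r4. sstep. unfold adjust in HQ. apply HQ.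
Qed.

Lemma hullF_run r d phi g1 b1 m1 g2 b2 m2 n ch s (Q : bool -> store -> Prop) :
  let u := triple_str (dystr g1 b1 m1) (dystr g2 b2 m2) (repeat s0 n) in
  initial s ch ->
  (forall s', Q (small b1 m1 && small b2 m2 &&
      verify r d phi (n + 6) (xhat g1 b1 m1 (n + 6)) (xhat g2 b2 m2 (n + 6)) ch) s') ->
  sp (hullF r d) (phi, u) (30 * length u + 200 + (3 * (70 * (n + 6) + 150) +
    2 * (22 * ((n + 6) * (n + 6)) + 50 * (n + 6) + 10) + matchcost r d (n + 6))) s Q.
Proof.
  intros u Hi HQ. set (N := n + 6) in *.
  set (X := xhat g1 b1 m1 N) in *. set (Y := xhat g2 b2 m2 N) in *.
  assert (LX : length X = N + 3) by apply xhat_length. assert (LY : length Y = N + 3) by apply xhat_length.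
  unfold hullF. apply sp_bind. apply parse_ok with (ch := ch); auto.
  fold N. fold X. fold Y. intros s1 (P1 & P2 & P3 & P4 & P5 & P6 & P7). clearbody X Y.
  assert (HN : N = S (N - 1)) by (unfold N; lia).
  destruct (small b1 m1 && small b2 m2); [|eapply sp_le; [sstep; apply HQ|lia]].
  cbn [andb] in HQ. set (g := guesses N ch).
  apply (sp_le _ _ ((70 * N + 150) + ((70 * N + 150) + ((70 * N + 150) + (2 * (22 * (N * N) + 50 * N + 10) + matchcost r d N))))); [|lia].
  assert (Hg : forall i c, c = skipn (i * N) ch -> tk N c = g i) by (intros i c ->; reflexivity).
  apply sp_bind. eapply sp_le; [apply guess_ok with (N := N - 1); rewrite <- ?HN; try lia; auto; try (apply P7; lia)|lia].
  cbv zeta; rewrite <- ?HN, ?P3. intros s2 O2 C2 S2. rewrite (Hg 0), (Hg 1) by (simpl; rewrite ?Nat.add_0_r; auto).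
  apply sp_bind. eapply sp_le; [apply guess_ok with (N := N - 1); rewrite <- ?HN; try lia; auto; rewrite ?S2; lks; auto; try (apply P7; lia)|lia].
  cbv zeta; rewrite <- ?HN, ?C2. intros s3 O3 C3 S3. rewrite (Hg 2), (Hg 3) by (rewrite ?skipn_skipn; f_equal; lia).
  apply sp_bind. eapply sp_le; [apply guess_ok with (N := N - 1); rewrite <- ?HN; try lia; auto; rewrite ?S3; lks; rewrite ?S2; lks; auto; try (apply P7; lia)|lia].
  cbv zeta; rewrite <- ?HN, ?C3. intros s4 O4 C4 S4. rewrite (Hg 4), (Hg 5) by (rewrite ?skipn_skipn; f_equal; lia).
  unfold verify in HQ. fold g in HQ. cbv zeta in HQ.
  set (q1 := query phi N (g 0) (g 1)) in *. set (q2 := query phi N (g 2) (g 3)) in *. set (q3 := query phi N (g 4) (g 5)) in *.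
  destruct (q1 && q2 && q3); [|eapply sp_le; [sstep; apply HQ|lia]].
  cbn [andb] in HQ.
  rewrite (Hg 0), (Hg 1) in S2 by (simpl; rewrite ?Nat.add_0_r; auto).
  rewrite (Hg 2), (Hg 3) in S3 by (rewrite ?skipn_skipn; f_equal; lia).
  rewrite (Hg 4), (Hg 5) in S4 by (rewrite ?skipn_skipn; f_equal; lia).
  assert (C4' : o_ch (s_o s4) = skipn (6 * N) ch) by (rewrite C4, ?skipn_skipn; f_equal; lia).
  clear C4. rename C4' into C4.
  assert (K : forall j, s_stk s4 j = match j with 0 => repeat true N | 1 => X | 2 => Y
     | 9 => rev (g 0) | 10 => rev (g 1) | 11 => rev (g 2) | 12 => rev (g 3) | 13 => rev (g 4) | 14 => rev (g 5) | _ => [] end).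
  { intros j. rewrite S4. cbn [setk s_stk]. rewrite S3. cbn [setk s_stk]. rewrite S2. cbn [setk s_stk].
    do 15 (destruct j as [|j]; [cbn [Nat.eqb]; auto; apply P7; lia|]). cbn [Nat.eqb]. apply P7. lia. }
  assert (Lg : forall i, length (rev (g i)) = N) by (intros i; rewrite length_rev; apply tk_length).
  clear S2 S3 S4 P4 P5 P6 P7.
  apply (sp_le _ _ ((22 * (N * N) + 50 * N + 10) + ((22 * (N * N) + 50 * N + 10) + matchcost r d N))); [|lia].
  apply sp_bind. apply segp_ok; try lia; rewrite ?K; auto.
  rewrite (Hg 6) by (rewrite C4; f_equal; lia). cbv zeta. rewrite C4.
  apply sp_bind. apply segp_ok; try lia; lkc; rewrite ?K; auto; try (rewrite seg_length; rewrite ?repeat_length; auto; rewrite ?Lg; auto).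
  cbn [o_ch]. rewrite (Hg 7) by (rewrite skipn_skipn; f_equal; lia). cbv zeta.
  set (mx := seg (g 6) _ (rev (g 0)) _). set (my := seg (g 6) _ (rev (g 1)) _).
  change (seg (g 7) (repeat false N) mx (rev (g 4))) with (accx N ch 0 2 4).
  change (seg (g 7) (repeat false N) my (rev (g 5))) with (accx N ch 1 3 5).
  set (ax := accx N ch 0 2 4) in *. set (ay := accx N ch 1 3 5) in *.
  assert (Lax : length ax = N).
  { unfold ax, accx. fold g. rewrite !seg_length; rewrite ?seg_length; rewrite ?repeat_length; rewrite ?Lg; auto. }
  assert (Lay : length ay = N).
  { unfold ay, accx. fold g. rewrite !seg_length; rewrite ?seg_length; rewrite ?repeat_length; rewrite ?Lg; auto. }
  set (s5 := set_ch _ _).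
  assert (K5 : forall j, j = 1 \/ j = 2 \/ 17 <= j -> s_stk s5 j = match j with 1 => X | 2 => Y | 17 => ax | 18 => ay | _ => [] end).
  { intros j Hj. unfold s5. cbn [set_ch onO setk s_stk].
    destruct Hj as [->|[->|Hj]]; cbn [Nat.eqb]; rewrite ?K; auto.
    do 17 (destruct j as [|j]; [lia|]). destruct j as [|[|j]]; cbn [Nat.eqb]; auto. }
  assert (C5 : o_ch (s_o s5) = skipn (8 * N) ch) by (cbn; rewrite !skipn_skipn; f_equal; lia).
  clearbody s5 mx my ax ay. clear K.
  apply matchF_ok with (X := X) (Y := Y) (ax := ax) (ay := ay) (ch := skipn (8 * N) ch); auto; try (apply K5; lia).
  rewrite skipn_skipn. replace (d + 8 * N) with (8 * N + d) by lia. exact HQ.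
Qed.

(** Loops run over the [n + 6] digits and are nested at most twice, so a multiple of the square of
    the input length suffices. *)
Lemma hullF_ok phi g1 b1 m1 g2 b2 m2 n ch s (Q : bool -> store -> Prop) :
  let u := triple_str (dystr g1 b1 m1) (dystr g2 b2 m2) (repeat s0 n) in
  initial s ch ->
  (forall s', Q (small b1 m1 && small b2 m2 &&
      verify 70 140 phi (n + 6) (xhat g1 b1 m1 (n + 6)) (xhat g2 b2 m2 (n + 6)) ch) s') ->
  sp (hullF 70 140) (phi, u) (100 * 200 * ((length u + 1) * (length u + 1))) s Q.
Proof.
  intros u Hi HQ.
  eapply sp_le; [eapply hullF_run; eauto|]. fold u. set (N := n + 6) in *.
  assert (Lu : N <= length u).
  { unfold u, triple_str, pair_str. rewrite !length_app. change (flat_map _ ?x) with (dbl x).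
    rewrite !dbl_length, !dystr_length, repeat_length. unfold N. lia. }
  unfold matchcost. assert (N * N <= length u * length u) by (apply Nat.mul_le_mono; auto).
  generalize dependent (length u). intros L HL HNN. clear - HL HNN. generalize dependent (N * N). intros NN HNN.
  assert (HL2 : L * L <= (L + 1) * (L + 1)) by (apply Nat.mul_le_mono; lia).
  assert (HL3 : L + 1 <= (L + 1) * (L + 1)) by (rewrite <- (Nat.mul_1_r (L + 1)) at 1; apply Nat.mul_le_mono_l; lia).
  generalize dependent ((L + 1) * (L + 1)). intros. lia.
Qed.

Open Scope R_scope.

(** * Caratheodory's theorem in the plane *)

(** List entries consist of a weight, a coefficient of an affine dependence and a point; keeping the
    coefficient in the entry aligns the dependence with the weights. *)
Definition lincomb (f : R * R * point -> R) (l : list (R * R * point)) : R :=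
  fold_right (fun a s => f a + s) 0 l.

Definition wt (a : R * R * point) := fst (fst a).
Definition cf (a : R * R * point) := snd (fst a).
Definition px (a : R * R * point) := fst (snd a).
Definition py (a : R * R * point) := snd (snd a).

Lemma lincomb_app f l l' : lincomb f (l ++ l') = lincomb f l + lincomb f l'.
Proof. induction l; simpl; [lra|]. rewrite IHl. lra. Qed.

Lemma lincomb_map f g l : lincomb f (map g l) = lincomb (fun a => f (g a)) l.
Proof. induction l; simpl; auto. now rewrite IHl. Qed.

Lemma lincomb_ext f g l : (forall a, f a = g a) -> lincomb f l = lincomb g l.
Proof. intros H. induction l; simpl; auto. now rewrite IHl, H. Qed.

Lemma lincomb_lin f g t l : lincomb (fun a => f a + t * g a) l = lincomb f l + t * lincomb g l.
Proof. induction l; simpl; [lra|]. rewrite IHl. lra. Qed.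

(** The quotient [wt / cf] is minimised over the entries with positive coefficient, in
    cross-multiplied form. *)
Lemma min_ratio l : (exists a, In a l /\ 0 < cf a) -> (forall a, In a l -> 0 <= wt a) ->
  exists l1 x l2, l = l1 ++ x :: l2 /\ 0 < cf x /\
    forall y, In y l -> 0 < cf y -> wt x * cf y <= wt y * cf x.
Proof.
  induction l as [|a l IH]; intros (b & Hb & Pb) Hw; [destruct Hb|].
  destruct (classic (exists a, In a l /\ 0 < cf a)) as [He|He].
  - destruct IH as (l1 & x & l2 & E & Px & Hx); auto. { intros; apply Hw; now right. }
    destruct (Rle_or_lt (cf a) 0) as [La|La].
    + exists (a :: l1), x, l2. split; [simpl; congruence|]. split; auto.
      intros y [->|Hy] Py; [lra|auto].
    + destruct (Rle_or_lt (wt x * cf a) (wt a * cf x)) as [Lx|Lx].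
      * exists (a :: l1), x, l2. split; [simpl; congruence|]. split; auto.
        intros y [->|Hy] Py; auto.
      * exists [], a, l. split; auto. split; auto.
        intros y [->|Hy] Py; [lra|]. specialize (Hx y Hy Py).
        apply (Rmult_le_reg_r (cf x)); auto.
        assert (0 < cf a * cf y) by nra. nra.
  - destruct Hb as [->|Hb]; [|exfalso; apply He; eauto].
    exists [], b, l. split; auto. split; auto. intros y [->|Hy] Py; [lra|].
    exfalso. apply He; eauto.
Qed.

Definition rep3 (S : point -> Prop) (l : list (R * R * point)) (w x y : R) : Prop :=
  (forall a, In a l -> 0 <= wt a /\ S (snd a)) /\
  lincomb wt l = w /\ lincomb (fun a => wt a * px a) l = x /\ lincomb (fun a => wt a * py a) l = y.

Lemma eliminate S l w x y :
  rep3 S l w x y -> (exists a, In a l /\ 0 < cf a) ->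
  lincomb cf l = 0 -> lincomb (fun a => cf a * px a) l = 0 -> lincomb (fun a => cf a * py a) l = 0 ->
  exists l', rep3 S l' w x y /\ length l = Datatypes.S (length l').
Proof.
  intros (H1 & H2 & H3 & H4) He C1 C2 C3.
  destruct (min_ratio l He) as (l1 & x0 & l2 & E & Px & Hx). { intros; now apply H1. }
  set (t := wt x0 / cf x0). set (g := fun a : R * R * point => ((wt a - t * cf a, cf a), snd a)).
  assert (Ht : 0 <= t).
  { unfold t. apply Rmult_le_pos; [apply H1; rewrite E; apply in_elt|].
    left. now apply Rinv_0_lt_compat. }
  assert (Hz : wt x0 - t * cf x0 = 0) by (unfold t; field; lra).
  exists (map g (l1 ++ l2)). split.
  - split.
    + intros a Ha. apply in_map_iff in Ha. destruct Ha as (b & <- & Hb).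
      assert (Hb' : In b l) by (rewrite E; apply in_app_or in Hb; apply in_or_app; simpl; tauto).
      destruct (H1 b Hb') as [Wb Sb]. split; auto. change (0 <= wt b - t * cf b).
      destruct (Rle_or_lt (cf b) 0) as [Lb|Lb]; [nra|].
      specialize (Hx b Hb' Lb). assert (t * cf b * cf x0 <= wt b * cf x0).
      { replace (t * cf b * cf x0) with (wt x0 * cf b) by (unfold t; field; lra). auto. }
      apply Rmult_le_reg_r in H; lra.
    + assert (G : forall h : point -> R,
        lincomb (fun a => wt a * h (snd a)) (map g (l1 ++ l2)) =
        lincomb (fun a => wt a * h (snd a)) l - t * lincomb (fun a => cf a * h (snd a)) l).
      { intros h. rewrite lincomb_map.
        transitivity (lincomb (fun a => wt a * h (snd a) + (- t) * (cf a * h (snd a))) l).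
        - rewrite E, !lincomb_app. simpl.
          rewrite !(lincomb_ext (fun a => wt (g a) * h (snd (g a))) (fun a => wt a * h (snd a) + - t * (cf a * h (snd a))))
            by (intros a; unfold g, wt, cf; simpl; lra).
          replace (wt x0 * h (snd x0) + - t * (cf x0 * h (snd x0))) with ((wt x0 - t * cf x0) * h (snd x0)) by lra.
          rewrite Hz. lra.
        - rewrite lincomb_lin. lra. }
      pose proof (G (fun _ => 1)) as G1. pose proof (G fst) as G2. pose proof (G snd) as G3.
      unfold px, py in *. rewrite C2 in G2. rewrite C3 in G3.
      rewrite (lincomb_ext (fun a => wt a * 1) wt) in G1 by (intros; lra).
      rewrite (lincomb_ext (fun a => wt a * 1) wt) in G1 by (intros; lra).
      rewrite (lincomb_ext (fun a => cf a * 1) cf) in G1 by (intros; lra). rewrite C1 in G1.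
      repeat split; lra.
  - rewrite E, length_map, !length_app. simpl. lia.
Qed.

(** Three difference vectors in the plane are dependent: if the first two are, they give the
    relation, and otherwise Cramer's rule expresses the third. The four coefficients sum to zero
    without all being zero, so one of them is positive. *)
Lemma affine_dependence (p q r s : point) : exists a b c d,
  a + b + c + d = 0 /\
  a * fst p + b * fst q + c * fst r + d * fst s = 0 /\
  a * snd p + b * snd q + c * snd r + d * snd s = 0 /\
  (0 < a \/ 0 < b \/ 0 < c \/ 0 < d).
Proof.
  destruct p as [p1 p2], q as [q1 q2], r as [r1 r2], s as [t1 t2]. simpl.
  set (u1 := q1 - p1). set (u2 := q2 - p2). set (v1 := r1 - p1). set (v2 := r2 - p2).
  set (w1 := t1 - p1). set (w2 := t2 - p2).
  assert (H : exists b c d, b * u1 + c * v1 + d * w1 = 0 /\ b * u2 + c * v2 + d * w2 = 0 /\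
     (b <> 0 \/ c <> 0 \/ d <> 0)).
  { destruct (Req_dec (u1 * v2 - u2 * v1) 0) as [E|E].
    - destruct (Req_dec (u1 * u1 + u2 * u2) 0) as [Z|Z].
      + assert (u1 = 0 /\ u2 = 0) as [-> ->] by (split; nra).
        exists 1, 0, 0. repeat split; lra.
      + exists (u1 * v1 + u2 * v2), (- (u1 * u1 + u2 * u2)), 0. repeat split; try (right; left; lra).
        * replace (_ + _) with (u2 * (u1 * v2 - u2 * v1)) by ring. rewrite E. ring.
        * replace (_ + _) with (- u1 * (u1 * v2 - u2 * v1)) by ring. rewrite E. ring.
    - exists (v1 * w2 - v2 * w1), (w1 * u2 - w2 * u1), (u1 * v2 - u2 * v1).
      repeat split; try ring; auto. }
  destruct H as (b & c & d & H1 & H2 & H3).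
  exists (- (b + c + d)), b, c, d. unfold u1, u2, v1, v2, w1, w2 in *.
  repeat split; try lra.
Qed.

Lemma rep3_reduce S l w x y : rep3 S l w x y -> (4 <= length l)%nat ->
  exists l', rep3 S l' w x y /\ length l = Datatypes.S (length l').
Proof.
  intros H L. destruct l as [|a [|b [|c [|d l]]]]; simpl in L; try lia.
  destruct (affine_dependence (snd a) (snd b) (snd c) (snd d)) as (ka & kb & kc & kd & E1 & E2 & E3 & E4).
  set (f := fun (k : R) (a : R * R * point) => ((wt a, k), snd a)).
  set (l0 := f ka a :: f kb b :: f kc c :: f kd d :: map (f 0) l).
  assert (G : forall h : R -> point -> R, lincomb (fun a => h (wt a) (snd a)) l0 =
    lincomb (fun a => h (wt a) (snd a)) (a :: b :: c :: d :: l)).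
  { intros h. unfold l0. simpl. rewrite lincomb_map. reflexivity. }
  assert (Z : forall h : point -> R, lincomb (fun a => cf a * h (snd a)) (map (f 0) l) = 0).
  { intros h. clear. induction l; simpl; auto. rewrite IHl. unfold cf; simpl; lra. }
  assert (Z1 : lincomb cf (map (f 0) l) = 0).
  { refine (eq_trans _ (Z (fun _ => 1))). apply lincomb_ext. intros; lra. }
  destruct H as (H1 & H2 & H3 & H4).
  destruct (eliminate S l0 w x y) as (l' & R1 & R2).
  - split.
    + intros z Hz. unfold l0 in Hz. simpl in Hz.
      assert (Hz' : exists z', In z' (a :: b :: c :: d :: l) /\ wt z = wt z' /\ snd z = snd z').
      { destruct Hz as [<-|[<-|[<-|[<-|Hz]]]];
          [exists a|exists b|exists c|exists d|apply in_map_iff in Hz; destruct Hz as (z' & <- & Hz); exists z'];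
          simpl; tauto. }
      destruct Hz' as (z' & I' & -> & ->). now apply H1.
    + pose proof (G (fun w _ => w)) as G1. pose proof (G (fun w p => w * fst p)) as G2.
      pose proof (G (fun w p => w * snd p)) as G3. unfold px, py in *.
      change (fun a => wt a) with wt in G1. cbv beta in G1. repeat split.
      * etransitivity; [exact G1|exact H2].
      * etransitivity; [exact G2|exact H3].
      * etransitivity; [exact G3|exact H4].
  - destruct E4 as [P|[P|[P|P]]]; [exists (f ka a)|exists (f kb b)|exists (f kc c)|exists (f kd d)];
      (split; [unfold l0; simpl; tauto|exact P]).
  - unfold l0. simpl. rewrite Z1. unfold cf; simpl. lra.
  - unfold l0. simpl. pose proof (Z fst) as Zf. unfold px. rewrite Zf. unfold cf; simpl. lra.
  - unfold l0. simpl. pose proof (Z snd) as Zf. unfold py. rewrite Zf. unfold cf; simpl. lra.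
  - exists l'. split; auto. unfold l0 in R2. simpl in R2 |- *. rewrite length_map in R2. exact R2.
Qed.

Lemma rep3_small S w x y : forall n l, (length l <= n)%nat -> rep3 S l w x y ->
  exists l', rep3 S l' w x y /\ (length l' <= 3)%nat.
Proof.
  induction n; intros l L H; [exists l; split; auto; lia|].
  destruct (le_lt_dec (length l) 3); [eauto|].
  destruct (rep3_reduce S l w x y H) as (l' & H' & E); [lia|]. apply (IHn l'); auto. lia.
Qed.

Definition mix (t a b : R) := t * a + (1 - t) * b.
(** Two nested interpolations instead of three weights, in the form in which the machine computes
    the combination. *)
Definition hull3 (S : point -> Prop) (h : point) : Prop :=
  exists q1 q2 q3 l m, S q1 /\ S q2 /\ S q3 /\ 0 <= l <= 1 /\ 0 <= m <= 1 /\
    fst h = mix l (mix m (fst q1) (fst q2)) (fst q3) /\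
    snd h = mix l (mix m (snd q1) (snd q2)) (snd q3).

(** Combinations of arbitrary length make convexity a matter of concatenating lists; the reduction
    to three entries brings them back to triangles. *)
Lemma hull3_rep S h : hull3 S h <-> exists l, rep3 S l 1 (fst h) (snd h).
Proof.
  split.
  - intros (q1 & q2 & q3 & l & m & S1 & S2 & S3 & Hl & Hm & E1 & E2).
    exists [((l * m, 0), q1); ((l * (1 - m), 0), q2); ((1 - l, 0), q3)].
    unfold mix in *. split.
    + intros a [<-|[<-|[<-|[]]]]; unfold wt; simpl; split; auto; try nra.
    + unfold wt, px, py; simpl. repeat split; rewrite ?E1, ?E2; ring.
  - intros [l H]. destruct (rep3_small S 1 (fst h) (snd h) (length l) l (le_n _) H) as (l' & (H1 & H2 & H3 & H4) & L).
    clear H l.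
    assert (Hgen : forall w1 q1 w2 q2 w3 q3, 0 <= w1 -> 0 <= w2 -> 0 <= w3 -> S q1 -> S q2 -> S q3 ->
      w1 + w2 + w3 = 1 -> fst h = w1 * fst q1 + w2 * fst q2 + w3 * fst q3 ->
      snd h = w1 * snd q1 + w2 * snd q2 + w3 * snd q3 -> hull3 S h).
    { intros w1 q1 w2 q2 w3 q3 W1 W2 W3 S1 S2 S3 E EX EY.
      (* If the first two weights vanish, their quotient is undefined and the inner weight is set to
         0. *)
      destruct (Req_dec (w1 + w2) 0) as [Z|Z].
      - exists q1, q2, q3, 0, 0. unfold mix. repeat split; auto; try lra;
        assert (w1 = 0) by lra; assert (w2 = 0) by lra; assert (w3 = 1) by lra; subst; lra.
      - exists q1, q2, q3, (w1 + w2), (w1 / (w1 + w2)). unfold mix.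
        assert (P : 0 < w1 + w2) by lra. repeat split; auto; try lra.
        + apply Rmult_le_pos; auto. left. now apply Rinv_0_lt_compat.
        + apply (Rmult_le_reg_r (w1 + w2)); auto. unfold Rdiv. rewrite Rmult_assoc, Rinv_l; lra.
        + rewrite EX. replace w3 with (1 - (w1 + w2)) by lra. field. lra.
        + rewrite EY. replace w3 with (1 - (w1 + w2)) by lra. field. lra. }
    unfold px, py, wt in *.
    destruct l' as [|[[w1 c1] q1] [|[[w2 c2] q2] [|[[w3 c3] q3] [|? ?]]]]; simpl in *; try lia; try lra.
    + destruct (H1 _ (or_introl eq_refl)). apply (Hgen w1 q1 0 q1 0 q1); simpl in *; auto; lra.
    + destruct (H1 _ (or_introl eq_refl)). destruct (H1 _ (or_intror (or_introl eq_refl))).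
      apply (Hgen w1 q1 w2 q2 0 q1); simpl in *; auto; lra.
    + destruct (H1 _ (or_introl eq_refl)). destruct (H1 _ (or_intror (or_introl eq_refl))).
      destruct (H1 _ (or_intror (or_intror (or_introl eq_refl)))).
      apply (Hgen w1 q1 w2 q2 w3 q3); simpl in *; auto; lra.
Qed.

Lemma hull3_convex S : convex (hull3 S).
Proof.
  intros p q t Ht Hp Hq. apply hull3_rep in Hp, Hq. apply hull3_rep.
  destruct Hp as [l (A1 & A2 & A3 & A4)], Hq as [m (B1 & B2 & B3 & B4)].
  set (g := fun (t : R) (a : R * R * point) => ((t * wt a, 0), snd a)).
  assert (G : forall k (h : point -> R) z, lincomb (fun a => wt a * h (snd a)) (map (g k) z) =
     k * lincomb (fun a => wt a * h (snd a)) z).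
  { intros k h z. induction z; simpl; [lra|]. rewrite IHz. unfold wt at 1, g; simpl. lra. }
  exists (map (g t) l ++ map (g (1 - t)) m). split.
  - intros a Ha. apply in_app_or in Ha. destruct Ha as [Ha|Ha]; apply in_map_iff in Ha; destruct Ha as (b & <- & Hb);
    [destruct (A1 b Hb)|destruct (B1 b Hb)]; split; auto; unfold wt at 1; simpl; apply Rmult_le_pos; lra.
  - pose proof (fun k => G k (fun _ => 1)) as G1. pose proof (fun k => G k fst) as G2.
    pose proof (fun k => G k snd) as G3.
    assert (U : forall z, lincomb wt z = lincomb (fun a => wt a * 1) z) by (intros; apply lincomb_ext; intros; lra).
    unfold px, py in *. rewrite !lincomb_app, !G2, !G3, !U, !G1, <- !U.
    rewrite A2, A3, A4, B2, B3, B4. simpl. repeat split; lra.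
Qed.

Lemma conv_hull_hull3 S h : conv_hull S h -> hull3 S h.
Proof.
  intros H. apply H; [apply hull3_convex|]. intros q Hq.
  exists q, q, q, 1, 1. unfold mix. repeat split; auto; lra.
Qed.

Lemma conv_hull_convex S : convex (conv_hull S).
Proof. intros p q t Ht Hp Hq C HC HS. apply HC; auto; [apply Hp|apply Hq]; auto. Qed.

Lemma conv_hull_incl S p : S p -> conv_hull S p.
Proof. intros H C HC HS. auto. Qed.

(** * Euclidean distance and coordinate differences *)

Lemma eucl_ge_fst p q : Rabs (fst p - fst q) <= eucl p q.
Proof.
  unfold eucl. rewrite <- sqrt_Rsqr_abs. apply sqrt_le_1_alt. unfold Rsqr.
  pose proof (pow2_ge_0 (snd p - snd q)). simpl in *. lra.
Qed.
Lemma eucl_ge_snd p q : Rabs (snd p - snd q) <= eucl p q.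
Proof.
  unfold eucl. rewrite <- sqrt_Rsqr_abs. apply sqrt_le_1_alt. unfold Rsqr.
  pose proof (pow2_ge_0 (fst p - fst q)). simpl in *. lra.
Qed.
Lemma Rabs_le_elim x a : Rabs x <= a -> - a <= x <= a.
Proof. unfold Rabs. destruct (Rcase_abs x); lra. Qed.

Lemma eucl_lt p q a b : 0 <= a -> 0 < b -> Rabs (fst p - fst q) <= a -> Rabs (snd p - snd q) <= a ->
  2 * (a * a) < b * b -> eucl p q < b.
Proof.
  intros Ha Hb H1 H2 H. unfold eucl. rewrite <- (sqrt_square b) by lra. apply sqrt_lt_1_alt.
  apply Rabs_le_elim in H1, H2.
  assert (G : forall d, - a <= d <= a -> d * d <= a * a).
  { intros d Hd. assert (0 <= (a - d) * (a + d)) by (apply Rmult_le_pos; lra). lra. }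
  apply G in H1, H2. clear G. simpl. split; [|lra].
  pose proof (Rle_0_sqr (fst p - fst q)). pose proof (Rle_0_sqr (snd p - snd q)). unfold Rsqr in *. lra.
Qed.

(** * The convex hull operator is in NP2 *)

Lemma dyadic_dystr neg bits m :
  dyadic (dystr neg bits m) ((if neg then -1 else 1) * INR (lv (rev bits)) / 2 ^ m).
Proof.
  exists neg, (map encb bits), m. rewrite bin_val_lv. repeat split; auto. apply map_is_bits.
Qed.

Lemma dyadic_inv w x : dyadic w x -> exists neg bits m,
  w = dystr neg bits m /\ x = (if neg then -1 else 1) * INR (lv (rev bits)) / 2 ^ m.
Proof.
  intros (neg & y & m & Hy & -> & ->). destruct (is_bits_map y Hy) as [bits ->].
  exists neg, bits, m. now rewrite bin_val_lv.
Qed.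

Lemma lvR_bounds l N : length l = N -> 0 <= INR (lv l) <= 2 ^ N - 1.
Proof.
  intros <-. pose proof (lv_lt l) as H. split; [apply pos_INR|].
  apply le_INR in H. rewrite pow_INR2, S_INR in H. lra.
Qed.

(** Each average rounds down by at most 1/2 and halves the error made before, so the error never
    exceeds 1, however many digits the weight has. The start value keeps the share [e2 (length bs)],
    which the weights of [p] and [q] leave over. *)
Lemma seg_lv p q N : length p = N -> length q = N -> forall bs acc, length acc = N ->
  let w := fr (rev bs) in
  let v := w * INR (lv p) + (1 - e2 (length bs) - w) * INR (lv q) + e2 (length bs) * INR (lv acc) in
  v - 1 <= INR (lv (seg bs acc p q)) <= v.
Proof.
  intros Lp Lq. induction bs as [|b bs IH] using rev_ind; intros acc La; cbv zeta.
  - simpl. rewrite e2_0. lra.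
  - specialize (IH acc La). cbv zeta in IH. rewrite seg_snoc, rev_app_distr, length_app. simpl rev. cbn [app fr].
    replace (length bs + length [b])%nat with (S (length bs)) by (simpl; lia). rewrite e2_S.
    assert (Ls : length (seg bs acc p q) = N) by (rewrite seg_length; lia).
    assert (Ha := avg_lv (seg bs acc p q) (if b then p else q)).
    destruct Ha as [A1 A2]; [destruct b; lia|].
    apply le_INR in A1, A2. rewrite !plus_INR, !mult_INR in *. simpl (INR 2) in *. simpl (INR 1) in *.
    set (a := INR (lv (avg _ _))) in *. set (z := INR (lv (seg bs acc p q))) in *.
    destruct b; cbn [bR]; lra.
Qed.

Lemma xhat_range neg bits m N : 2 * 2 ^ N <= INR (lv (xhat neg bits m N)) <= 6 * 2 ^ N - 1.
Proof.
  unfold xhat. rewrite lv_app. set (l := rev _).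
  assert (Ll : length l = N).
  { unfold l. rewrite length_rev, length_map, length_firstn, length_app, repeat_length. lia. }
  rewrite Ll. pose proof (lvR_bounds l N Ll) as B. pose proof (pow2_pos N).
  rewrite plus_INR, mult_INR, pow_INR2.
  destruct neg, (hd false (skipn m (rev bits))); simpl; lra.
Qed.

Lemma iterl_dec n l : (n <= lv l)%nat -> (lv (iterl n (flip false) l) + n = lv l)%nat.
Proof.
  induction n; intros H; simpl; [lia|].
  pose proof (flip_dec (iterl n (flip false) l)). lia.
Qed.

Lemma incs_range n ch l : (lv l + n < 2 ^ length l)%nat ->
  (lv l <= lv (incs n ch l) <= lv l + n)%nat.
Proof.
  induction n; intros H; simpl; [lia|]. specialize (IHn ltac:(lia)).
  destruct (hd false _); [|lia]. rewrite flip_inc; rewrite ?incs_length; lia.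
Qed.

Lemma hd_skipn {A} (d : A) n : forall l, hd d (skipn n l) = nth n l d.
Proof. induction n; intros [|c l]; simpl; auto. Qed.

Lemma incs_exact d l rest m : (lv l + d < 2 ^ length l)%nat -> forall n, (n <= d + m)%nat ->
  lv (incs n (repeat true d ++ repeat false m ++ rest) l) = (lv l + Nat.min n d)%nat.
Proof.
  intros H. induction n; intros Hn; cbn [incs]; [lia|].
  specialize (IHn ltac:(lia)). set (ch := repeat true d ++ _) in *.
  assert (E : hd false (skipn n ch) = if (n <? d)%nat then true else false).
  { replace (hd false (skipn n ch)) with (nth n ch false).
    - unfold ch. destruct (Nat.ltb_spec n d).
      + rewrite app_nth1 by (rewrite repeat_length; lia). apply nth_repeat_lt. lia.
      + rewrite app_nth2, repeat_length by (rewrite repeat_length; lia).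
        rewrite app_nth1 by (rewrite repeat_length; lia). apply nth_repeat.
    - symmetry. apply hd_skipn. }
  rewrite E. destruct (Nat.ltb_spec n d).
  - rewrite flip_inc; rewrite ?incs_length; lia.
  - lia.
Qed.

Lemma nat_grid r N : 0 <= r <= 1 -> exists k, (k < 2 ^ N)%nat /\ r * 2 ^ N - 1 <= INR k <= r * 2 ^ N.
Proof.
  intros Hr. pose proof (pow2_pos N) as P.
  assert (P1 : 1 <= 2 ^ N) by (apply pow_R1_Rle; lra).
  destruct (Rlt_or_le r 1) as [L|L].
  - assert (B : 0 <= r * 2 ^ N) by nra.
    destruct (archimed (r * 2 ^ N)) as [U1 U2]. set (z := up (r * 2 ^ N)) in *.
    assert (Hz : (0 < z)%Z) by (apply lt_IZR; lra).
    exists (Z.to_nat (z - 1)).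
    assert (E : INR (Z.to_nat (z - 1)) = IZR z - 1).
    { rewrite INR_IZR_INZ, Z2Nat.id by lia. rewrite minus_IZR. lra. }
    split; [|lra]. apply INR_lt. rewrite E, pow_INR2. nra.
  - exists (2 ^ N - 1)%nat. assert (0 < 2 ^ N)%nat by (apply Nat.neq_0_lt_0, Nat.pow_nonzero; lia).
    rewrite minus_INR, pow_INR2 by lia. simpl (INR 1). split; [lia|nra].
Qed.

Lemma grid r N : 0 <= r <= 1 ->
  exists l, length l = N /\ r * 2 ^ N - 1 <= INR (lv l) <= r * 2 ^ N.
Proof.
  intros Hr. destruct (nat_grid r N Hr) as (k & Hk & H). destruct (lv_surj N k Hk) as (l & L & <-). eauto.
Qed.

Section Hull.
Variables (S : point -> Prop) (phi : str -> str).
Hypotheses (HA : in_A S) (Hphi : circ_name phi S).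

(** The answer 1 excludes that the distance exceeds 4 grid units. This provides points of the set at
    distances arbitrarily close to 4 units or below, and 5 leaves room for picking one. *)
Lemma query_sound N bx bY : (1 <= N)%nat -> length bx = N -> length bY = N -> query phi N bx bY = true ->
  exists q, S q /\ Rabs (INR (lv (rev bx)) - fst q * 2 ^ N) <= 5 /\ Rabs (INR (lv (rev bY)) - snd q * 2 ^ N) <= 5.
Proof.
  intros HN Lx Ly H. unfold query in H. destruct Hphi as [[_ Hp] Hn].
  destruct (Hn (N - 1)%nat _ _ _ _ (dyadic_dystr false bx N) (dyadic_dystr false bY N)) as [_ H2].
  set (x := 1 * INR (lv (rev bx)) / 2 ^ N) in *. set (y := 1 * INR (lv (rev bY)) / 2 ^ N) in *.
  pose proof (pow2_pos N) as P.
  assert (E : / 2 ^ (N - 1) = 2 * e2 N).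
  { replace N with (Datatypes.S (N - 1)) at 2 by lia. rewrite e2_S. unfold e2. lra. }
  destruct (classic (exists q, S q /\ eucl (x, y) q < 5 * e2 N)) as [(q & Sq & Hq)|No].
  - exists q. split; auto. pose proof (eucl_ge_fst (x, y) q) as G1. pose proof (eucl_ge_snd (x, y) q) as G2. simpl in *.
    assert (G : forall a b, Rabs (1 * a / 2 ^ N - b) < 5 * e2 N -> Rabs (a - b * 2 ^ N) <= 5).
    { intros a b Hab. replace (a - b * 2 ^ N) with ((1 * a / 2 ^ N - b) * 2 ^ N) by (field; lra).
      rewrite Rabs_mult, (Rabs_right (2 ^ N)) by lra.
      replace 5 with (5 * e2 N * 2 ^ N) by (rewrite Rmult_assoc, e2_pow; lra).
      apply Rmult_le_compat_r; lra. }
    split; apply G; fold x; fold y; lra.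
  - exfalso. rewrite H2 in H; [discriminate|]. exists (5 * e2 N). rewrite E. pose proof (e2_pos N).
    split; [lra|]. intros q Sq. apply Rnot_lt_le. intros L. apply No. eauto.
Qed.

Lemma query_complete N bx bY q : (1 <= N)%nat -> S q ->
  fst q * 2 ^ N - 1 <= INR (lv (rev bx)) <= fst q * 2 ^ N ->
  snd q * 2 ^ N - 1 <= INR (lv (rev bY)) <= snd q * 2 ^ N ->
  query phi N bx bY = true.
Proof.
  intros HN Sq Hx Hy. unfold query. destruct Hphi as [_ Hn].
  destruct (Hn (N - 1)%nat _ _ _ _ (dyadic_dystr false bx N) (dyadic_dystr false bY N)) as [H1 _].
  rewrite H1; auto. exists q. split; auto.
  assert (E : / 2 ^ (N - 1) = 2 * e2 N).
  { replace N with (Datatypes.S (N - 1)) at 2 by lia. rewrite e2_S. unfold e2. lra. }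
  rewrite E. pose proof (e2_pos N) as P. pose proof (e2_pow N) as EP.
  assert (G : forall a b, b * 2 ^ N - 1 <= a <= b * 2 ^ N -> Rabs (1 * a / 2 ^ N - b) <= e2 N).
  { intros a b Hab. replace (1 * a / 2 ^ N - b) with ((a - b * 2 ^ N) * e2 N).
    - rewrite Rabs_mult, (Rabs_right (e2 N)) by lra. rewrite <- (Rmult_1_l (e2 N)) at 2.
      apply Rmult_le_compat_r; [lra|]. apply Rabs_le. lra.
    - unfold e2. pose proof (pow2_pos N). field. lra. }
  apply (eucl_lt _ _ (e2 N)); try lra.
  - simpl. now apply G.
  - simpl. now apply G.
  - nra.
Qed.

Lemma mix_bounds t a b c d lo hi : 0 <= t <= 1 -> lo <= a - c <= hi -> lo <= b - d <= hi ->
  lo <= mix t a b - mix t c d <= hi.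
Proof. unfold mix. intros. split; nra. Qed.

Lemma guesses_length N ch i : length (guesses N ch i) = N.
Proof. apply tk_length. Qed.

(** The 5 units of the guessed points grow to 7 and then to 9: each interpolation may lose one unit
    by rounding and one by the share [e2 N] of the zero start value. *)
Lemma accx_sound N ch i j k Q1 Q2 Q3 : (1 <= N)%nat ->
  Rabs (INR (lv (rev (guesses N ch i))) - Q1) <= 5 ->
  Rabs (INR (lv (rev (guesses N ch j))) - Q2) <= 5 ->
  Rabs (INR (lv (rev (guesses N ch k))) - Q3) <= 5 ->
  Rabs (INR (lv (accx N ch i j k)) -
    mix (fr (rev (guesses N ch 7))) (mix (fr (rev (guesses N ch 6))) Q1 Q2) Q3) <= 9.
Proof.
  intros HN H1 H2 H3. apply Rabs_le_elim in H1, H2, H3. unfold accx. cbv zeta.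
  set (g := guesses N ch) in *.
  assert (Lg : forall i, length (g i) = N) by (intros; apply guesses_length).
  assert (Lr : forall i, length (rev (g i)) = N) by (intros; rewrite length_rev; auto).
  assert (Lz : length (repeat false N) = N) by apply repeat_length.
  pose proof (seg_lv (rev (g i)) (rev (g j)) N (Lr i) (Lr j) (g 6%nat) (repeat false N) Lz) as A. cbv zeta in A.
  set (m1 := seg (g 6%nat) _ _ _) in *.
  assert (Lm : length m1 = N) by (unfold m1; rewrite seg_length; rewrite ?Lr; auto).
  pose proof (seg_lv m1 (rev (g k)) N Lm (Lr k) (g 7%nat) (repeat false N) Lz) as B. cbv zeta in B.
  rewrite lv_repeat_false in A, B. simpl (INR 0) in *. rewrite !Lg, Rmult_0_r, Rplus_0_r in A, B.
  pose proof (fr_bounds (rev (g 6%nat))) as F6. pose proof (fr_bounds (rev (g 7%nat))) as F7. rewrite Lr in F6, F7.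
  pose proof (lvR_bounds _ N (Lr j)) as Bj. pose proof (lvR_bounds _ N (Lr k)) as Bk.
  set (w := fr (rev (g 6%nat))) in *. set (w' := fr (rev (g 7%nat))) in *.
  pose proof (e2_pos N) as Pe. pose proof (e2_pow N) as Ee. pose proof (pow2_pos N) as Pp.
  set (P1 := INR (lv (rev (g i)))) in *. set (P2 := INR (lv (rev (g j)))) in *. set (P3 := INR (lv (rev (g k)))) in *.
  assert (C2 : 0 <= e2 N * P2 <= 1).
  { split; [apply Rmult_le_pos; lra|]. rewrite <- Ee. apply Rmult_le_compat_l; lra. }
  assert (C3 : 0 <= e2 N * P3 <= 1).
  { split; [apply Rmult_le_pos; lra|]. rewrite <- Ee. apply Rmult_le_compat_l; lra. }
  assert (D1 : -7 <= INR (lv m1) - mix w Q1 Q2 <= 5).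
  { assert (T : -5 <= mix w P1 P2 - mix w Q1 Q2 <= 5) by (apply mix_bounds; lra).
    unfold mix in *. lra. }
  assert (T : -7 <= mix w' (INR (lv m1)) P3 - mix w' (mix w Q1 Q2) Q3 <= 5) by (apply mix_bounds; lra).
  apply Rabs_le. unfold mix in *. lra.
Qed.

(** All errors are downwards: 1 for rounding the corners to the grid, and 2 for each interpolation,
    one from the truncated weights and one from the averages. *)
Lemma accx_complete N ch i j k Q1 Q2 Q3 l m : (1 <= N)%nat -> 0 <= l <= 1 -> 0 <= m <= 1 ->
  0 <= Q1 <= 2 ^ N -> 0 <= Q2 <= 2 ^ N -> 0 <= Q3 <= 2 ^ N ->
  Q1 - 1 <= INR (lv (rev (guesses N ch i))) <= Q1 ->
  Q2 - 1 <= INR (lv (rev (guesses N ch j))) <= Q2 ->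
  Q3 - 1 <= INR (lv (rev (guesses N ch k))) <= Q3 ->
  m * 2 ^ N - 1 <= INR (lv (guesses N ch 6)) <= m * 2 ^ N ->
  l * 2 ^ N - 1 <= INR (lv (guesses N ch 7)) <= l * 2 ^ N ->
  -5 <= INR (lv (accx N ch i j k)) - mix l (mix m Q1 Q2) Q3 <= 0.
Proof.
  intros HN Hl Hm R1 R2 R3 H1 H2 H3 H6 H7. unfold accx. cbv zeta.
  set (g := guesses N ch) in *.
  assert (Lg : forall i, length (g i) = N) by (intros; apply guesses_length).
  assert (Lr : forall i, length (rev (g i)) = N) by (intros; rewrite length_rev; auto).
  assert (Lz : length (repeat false N) = N) by apply repeat_length.
  pose proof (seg_lv (rev (g i)) (rev (g j)) N (Lr i) (Lr j) (g 6%nat) (repeat false N) Lz) as A. cbv zeta in A.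
  set (m1 := seg (g 6%nat) _ _ _) in *.
  assert (Lm : length m1 = N) by (unfold m1; rewrite seg_length; rewrite ?Lr; auto).
  pose proof (seg_lv m1 (rev (g k)) N Lm (Lr k) (g 7%nat) (repeat false N) Lz) as B. cbv zeta in B.
  rewrite lv_repeat_false in A, B. simpl (INR 0) in *. rewrite !Lg, Rmult_0_r, Rplus_0_r in A, B.
  pose proof (fr_bounds (rev (g 6%nat))) as F6. pose proof (fr_bounds (rev (g 7%nat))) as F7. rewrite Lr in F6, F7.
  pose proof (fr_lv (rev (g 6%nat))) as V6. pose proof (fr_lv (rev (g 7%nat))) as V7.
  rewrite rev_involutive, Lr in V6, V7. rewrite V6 in H6. rewrite V7 in H7.
  set (w := fr (rev (g 6%nat))) in *. set (w' := fr (rev (g 7%nat))) in *.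
  pose proof (e2_pos N) as Pe. pose proof (e2_pow N) as Ee. pose proof (pow2_pos N) as Pp.
  set (P1 := INR (lv (rev (g i)))) in *. set (P2 := INR (lv (rev (g j)))) in *. set (P3 := INR (lv (rev (g k)))) in *.
  assert (W : m - e2 N <= w <= m).
  { split; apply (Rmult_le_reg_r (2 ^ N)); auto; [rewrite Rmult_minus_distr_r, Ee|]; lra. }
  assert (W' : l - e2 N <= w' <= l).
  { split; apply (Rmult_le_reg_r (2 ^ N)); auto; [rewrite Rmult_minus_distr_r, Ee|]; lra. }
  (* One interpolation for corners known up to [c]. The weight missing on the first corner and on
     the second one add up to [e2 N], which is worth at most one unit. *)
  assert (Step : forall t w a b A' B' c, 0 <= t <= 1 -> t - e2 N <= w <= t -> 0 <= w <= 1 - e2 N ->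
    0 <= A' <= 2 ^ N -> 0 <= B' <= 2 ^ N -> A' - c <= a <= A' -> B' - c <= b <= B' -> 0 <= c ->
    - 1 - c <= w * a + (1 - e2 N - w) * b - mix t A' B' <= 0).
  { intros t w0 a b A' B' c Ht Hw Hw' HA' HB' Ha Hb Hc. unfold mix.
    assert (X1 : 0 <= (t - w0) * A' + (e2 N - (t - w0)) * B' <= 1).
    { split; [apply Rplus_le_le_0_compat; apply Rmult_le_pos; lra|].
      rewrite <- Ee. replace (e2 N * 2 ^ N) with ((t - w0) * 2 ^ N + (e2 N - (t - w0)) * 2 ^ N) by ring.
      apply Rplus_le_compat; apply Rmult_le_compat_l; lra. }
    assert (X2 : - c <= w0 * (a - A') + (1 - e2 N - w0) * (b - B') <= 0).
    { split; [|nra].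
      assert (- c * w0 <= w0 * (a - A')) by nra.
      assert (- c * (1 - e2 N - w0) <= (1 - e2 N - w0) * (b - B')) by nra.
      assert (0 <= c * e2 N) by (apply Rmult_le_pos; lra). lra. }
    lra. }
  assert (M : mix m Q1 Q2 - 3 <= INR (lv m1) <= mix m Q1 Q2).
  { pose proof (Step m w P1 P2 Q1 Q2 1) as T. destruct T as [T1 T2]; try lra. }
  assert (RM : 0 <= mix m Q1 Q2 <= 2 ^ N) by (unfold mix; split; nra).
  pose proof (Step l w' (INR (lv m1)) P3 (mix m Q1 Q2) Q3 3) as T. destruct T as [T1 T2]; try lra.
Qed.

End Hull.

Lemma adjust_length r d X ch : length (adjust r d X ch) = length X.
Proof. unfold adjust. now rewrite incs_length, iterl_flip_length. Qed.

Lemma adjust_range r d X ch : (r <= lv X)%nat -> (lv X + d < 2 ^ length X + r)%nat ->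
  INR (lv X) - INR r <= INR (lv (adjust r d X ch)) <= INR (lv X) - INR r + INR d.
Proof.
  intros H1 H2. unfold adjust. pose proof (iterl_dec r X H1) as E.
  assert (L : length (iterl r (flip false) X) = length X) by apply iterl_flip_length.
  destruct (incs_range d ch (iterl r (flip false) X)) as [I1 I2]; [rewrite L; lia|].
  apply le_INR in I1, I2. rewrite plus_INR in I2. apply (f_equal INR) in E. rewrite plus_INR in E. lra.
Qed.

Lemma adjust_hits r d X t : (r <= lv X)%nat -> (lv X + d < 2 ^ length X + r)%nat ->
  (lv X <= t + r)%nat -> (t + r <= lv X + d)%nat ->
  exists c, length c = d /\ forall rest, lv (adjust r d X (c ++ rest)) = t.
Proof.
  intros H1 H2 H3 H4. pose proof (iterl_dec r X H1) as E.
  assert (L : length (iterl r (flip false) X) = length X) by apply iterl_flip_length.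
  set (k := (t + r - lv X)%nat).
  exists (repeat true k ++ repeat false (d - k)). split.
  - rewrite length_app, !repeat_length. unfold k. lia.
  - intros rest. unfold adjust. rewrite <- app_assoc, incs_exact; rewrite ?L; unfold k in *; lia.
Qed.

Lemma INR_70 : INR 70 = 70.
Proof. rewrite INR_IZR_INZ. reflexivity. Qed.
Lemma INR_140 : INR 140 = 140.
Proof. rewrite INR_IZR_INZ. reflexivity. Qed.

Lemma pow2_ge64 N : (6 <= N)%nat -> 64 <= 2 ^ N.
Proof.
  intros H. replace N with (6 + (N - 6))%nat by lia. rewrite pow_add.
  assert (1 <= 2 ^ (N - 6)) by (apply pow_R1_Rle; lra). simpl. lra.
Qed.

Lemma xhat_nat neg bits m N : (6 <= N)%nat -> let X := xhat neg bits m N in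
  (70 <= lv X)%nat /\ (lv X + 140 < 2 ^ length X + 70)%nat.
Proof.
  intros HN X. pose proof (xhat_range neg bits m N) as R. fold X in R.
  assert (L : length X = (N + 3)%nat) by apply xhat_length. pose proof (pow2_ge64 N HN).
  clearbody X. split; [apply INR_le|apply INR_lt].
  - rewrite INR_70. lra.
  - rewrite !plus_INR, INR_70, INR_140, pow_INR2, L, pow_add. simpl (2 ^ 3). lra.
Qed.

Lemma lv_marker acc N : length acc = N -> lv (acc ++ [false; false; true]) = (lv acc + 4 * 2 ^ N)%nat.
Proof. intros <-. rewrite lv_app. simpl. lia. Qed.

Lemma e2_6 n : 2 ^ (n + 6) * e2 n = 64.
Proof. rewrite pow_add. pose proof (e2_pow n). simpl (2 ^ 6). nra. Qed.

Lemma pow_4 N : 2 ^ (N + 2) = 4 * 2 ^ N.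
Proof. rewrite pow_add. simpl (2 ^ 2). lra. Qed.

(** 80 units: 70 for the correction, 1 for the coding of the query coordinate and 9 for the computed
    combination. *)
Lemma match_sound neg bits m N ch acc x h : (6 <= N)%nat -> length acc = N ->
  Rabs (INR (lv (xhat neg bits m N)) - 2 ^ (N + 2) - x * 2 ^ N) <= 1 ->
  eql (adjust 70 140 (xhat neg bits m N) ch) (acc ++ [false; false; true]) = true ->
  Rabs (INR (lv acc) - h) <= 9 ->
  Rabs (x * 2 ^ N - h) <= 80.
Proof.
  intros HN La Hx E Hh. apply eql_true in E.
  destruct (xhat_nat neg bits m N HN) as [X1 X2].
  pose proof (adjust_range 70 140 _ ch X1 X2) as R. rewrite E in R. clear E X1 X2.
  rewrite (lv_marker acc N La), plus_INR, mult_INR, pow_INR2, INR_70, INR_140 in R.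
  rewrite pow_4 in Hx. simpl (INR 4) in R.
  apply Rabs_le_elim in Hx, Hh. apply Rabs_le. lra.
Qed.

Lemma mix_01 t a b : 0 <= t <= 1 -> 0 <= a <= 1 -> 0 <= b <= 1 -> 0 <= mix t a b <= 1.
Proof. unfold mix. intros. split; nra. Qed.

Section Verify.
Variables (S : point -> Prop) (phi : str -> str).
Hypotheses (HA : in_A S) (Hphi : circ_name phi S).

(** 80 grid units are [1.25 * 2^-n], and the diagonal of a square with this side is shorter than
    [2 * 2^-n]. *)
Lemma verify_sound (g1 : bool) b1 m1 (g2 : bool) b2 m2 n ch x y :
  x = (if g1 then -1 else 1) * INR (lv (rev b1)) / 2 ^ m1 ->
  y = (if g2 then -1 else 1) * INR (lv (rev b2)) / 2 ^ m2 ->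
  small b1 m1 && small b2 m2 &&
    verify 70 140 phi (n + 6) (xhat g1 b1 m1 (n + 6)) (xhat g2 b2 m2 (n + 6)) ch = true ->
  ~ dist_gt (x, y) (conv_hull S) (2 * / 2 ^ n).
Proof.
  intros Ex Ey H. apply andb_true_iff in H. destruct H as [H Hv].
  apply andb_true_iff in H. destruct H as [Hs1 Hs2].
  pose proof (xhat_value g1 b1 m1 (n + 6) x Ex) as Vx. rewrite Hs1 in Vx.
  pose proof (xhat_value g2 b2 m2 (n + 6) y Ey) as Vy. rewrite Hs2 in Vy.
  set (N := (n + 6)%nat) in *. unfold verify in Hv. cbv zeta in Hv. repeat rewrite andb_true_iff in Hv.
  destruct Hv as (((Q1 & Q2) & Q3) & M1 & M2). set (g := guesses N ch) in *.
  assert (HN : (1 <= N)%nat) by (unfold N; lia). assert (HN6 : (6 <= N)%nat) by (unfold N; lia).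
  assert (Lg : forall i, length (g i) = N) by (intros; apply guesses_length).
  destruct (query_sound S phi Hphi N _ _ HN (Lg _) (Lg _) Q1) as (q1 & S1 & X1 & Y1).
  destruct (query_sound S phi Hphi N _ _ HN (Lg _) (Lg _) Q2) as (q2 & S2 & X2 & Y2).
  destruct (query_sound S phi Hphi N _ _ HN (Lg _) (Lg _) Q3) as (q3 & S3 & X3 & Y3).
  pose proof (accx_sound N ch 0 2 4 _ _ _ HN X1 X2 X3) as AX.
  pose proof (accx_sound N ch 1 3 5 _ _ _ HN Y1 Y2 Y3) as AY.
  fold g in AX, AY. set (w' := fr (rev (g 7%nat))) in *. set (w := fr (rev (g 6%nat))) in *.
  assert (La : forall i j k, length (accx N ch i j k) = N).
  { intros i j k. unfold accx. cbv zeta. fold g. rewrite !seg_length; rewrite ?length_rev, ?repeat_length, ?Lg; auto;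
    rewrite seg_length; rewrite ?length_rev, ?repeat_length, ?Lg; auto. }
  pose proof (match_sound g1 b1 m1 N _ _ x _ HN6 (La _ _ _) Vx M1 AX) as DX.
  pose proof (match_sound g2 b2 m2 N _ _ y _ HN6 (La _ _ _) Vy M2 AY) as DY.
  set (h := (mix w' (mix w (fst q1) (fst q2)) (fst q3), mix w' (mix w (snd q1) (snd q2)) (snd q3)) : point).
  assert (Bw : 0 <= w <= 1 /\ 0 <= w' <= 1).
  { pose proof (fr_bounds (rev (g 6%nat))) as F6. pose proof (fr_bounds (rev (g 7%nat))) as F7.
    pose proof (e2_pos (length (rev (g 6%nat)))). pose proof (e2_pos (length (rev (g 7%nat)))). fold w in F6. fold w' in F7. lra. }
  destruct Bw as [Bw Bw'].
  assert (Hh : conv_hull S h).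
  { unfold h, mix. apply (conv_hull_convex S (w * fst q1 + (1 - w) * fst q2, w * snd q1 + (1 - w) * snd q2) q3); auto.
    - apply (conv_hull_convex S q1 q2); auto; now apply conv_hull_incl.
    - now apply conv_hull_incl. }
  intros (r & Hr & Hall). specialize (Hall h Hh).
  assert (D : eucl (x, y) h < 2 * / 2 ^ n); [|lra]. fold (e2 n).
  pose proof (e2_pos n) as Pn. pose proof (e2_6 n) as E6. fold N in E6. pose proof (pow2_pos N) as PN.
  assert (G : forall a b, Rabs (a * 2 ^ N - b * 2 ^ N) <= 80 -> Rabs (a - b) <= 1.25 * e2 n).
  { intros a b Hab. apply (Rmult_le_reg_r (2 ^ N)); auto.
    replace (Rabs (a - b) * 2 ^ N) with (Rabs (a * 2 ^ N - b * 2 ^ N)); [lra|].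
    rewrite <- Rmult_minus_distr_r, Rabs_mult, (Rabs_right (2 ^ N)); lra. }
  apply (eucl_lt _ _ (1.25 * e2 n)); try lra.
  - simpl. apply G. unfold mix in *.
    replace (x * 2 ^ N - _) with (x * 2 ^ N - (w' * (w * (fst q1 * 2 ^ N) + (1 - w) * (fst q2 * 2 ^ N)) + (1 - w') * (fst q3 * 2 ^ N))) by ring. exact DX.
  - simpl. apply G. unfold mix in *.
    replace (y * 2 ^ N - _) with (y * 2 ^ N - (w' * (w * (snd q1 * 2 ^ N) + (1 - w) * (snd q2 * 2 ^ N)) + (1 - w') * (snd q3 * 2 ^ N))) by ring. exact DY.
  - nra.
Qed.

(** 64 units of distance, 1 of coding and 5 of rounding make 70, which fixes the radius of the
    correction. *)
Lemma match_complete neg bits m N acc x h : (6 <= N)%nat -> length acc = N ->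
  Rabs (INR (lv (xhat neg bits m N)) - 2 ^ (N + 2) - x * 2 ^ N) <= 1 ->
  -5 <= INR (lv acc) - h <= 0 -> Rabs (x * 2 ^ N - h) <= 64 ->
  exists c, length c = 140%nat /\ forall rest,
    eql (adjust 70 140 (xhat neg bits m N) (c ++ rest)) (acc ++ [false; false; true]) = true.
Proof.
  intros HN La Hx Ha Hh. destruct (xhat_nat neg bits m N HN) as [X1 X2].
  assert (LX : length (xhat neg bits m N) = (N + 3)%nat) by apply xhat_length.
  set (X := xhat neg bits m N) in *. clearbody X.
  rewrite pow_4 in Hx. apply Rabs_le_elim in Hx, Hh.
  destruct (adjust_hits 70 140 X (lv acc + 4 * 2 ^ N)%nat) as (c & Lc & Hc); auto.
  - apply INR_le. rewrite !plus_INR, mult_INR, pow_INR2, INR_70. simpl (INR 4). lra.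
  - apply INR_le. rewrite !plus_INR, mult_INR, pow_INR2, INR_70, INR_140. simpl (INR 4). lra.
  - exists c. split; auto. intros rest. apply eql_true. apply lv_inj.
    + rewrite adjust_length, LX, length_app, La. reflexivity.
    + now rewrite (lv_marker acc N La).
Qed.

Lemma guesses_concat N gs rest i : (forall g, In g gs -> length g = N) -> (i < length gs)%nat ->
  guesses N (concat gs ++ rest) i = nth i gs [].
Proof.
  revert gs. unfold guesses. induction i; intros [|g gs] H L; simpl in L; try lia.
  - simpl. rewrite <- app_assoc. rewrite <- (H g) by (now left). apply tk_app.
  - simpl. rewrite <- (IHi gs) by (intros; try apply H; simpl; auto; lia).
    rewrite <- app_assoc. f_equal. rewrite Nat.add_comm, <- skipn_skipn. f_equal.
    rewrite <- (H g) by (now left). rewrite skipn_app, skipn_all, Nat.sub_diag. auto.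
Qed.

Lemma concat_length_const {A} N (gs : list (list A)) : (forall g, In g gs -> length g = N) ->
  length (concat gs) = (length gs * N)%nat.
Proof.
  induction gs; intros H; simpl; auto. rewrite length_app, IHgs by (intros; apply H; now right).
  rewrite (H a) by (now left). auto.
Qed.

Lemma verify_complete (g1 : bool) b1 m1 (g2 : bool) b2 m2 n x y :
  x = (if g1 then -1 else 1) * INR (lv (rev b1)) / 2 ^ m1 ->
  y = (if g2 then -1 else 1) * INR (lv (rev b2)) / 2 ^ m2 ->
  dist_lt (x, y) (conv_hull S) (/ 2 ^ n) ->
  exists ch, small b1 m1 && small b2 m2 &&
    verify 70 140 phi (n + 6) (xhat g1 b1 m1 (n + 6)) (xhat g2 b2 m2 (n + 6)) ch = true.
Proof.
  intros Ex Ey (h & Hh & Dh). fold (e2 n) in Dh. apply conv_hull_hull3 in Hh.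
  destruct Hh as (q1 & q2 & q3 & l & m & S1 & S2 & S3 & Hl & Hm & E1 & E2).
  destruct HA as [HB _].
  destruct (HB q1 S1) as [B1x B1y]. destruct (HB q2 S2) as [B2x B2y]. destruct (HB q3 S3) as [B3x B3y].
  pose proof (eucl_ge_fst (x, y) h) as Gx. pose proof (eucl_ge_snd (x, y) h) as Gy. simpl in Gx, Gy.
  pose proof (e2_pos n) as Pn. assert (En1 : e2 n <= 1) by (rewrite <- e2_0; apply e2_le; lia).
  assert (Hhx : 0 <= fst h <= 1) by (rewrite E1; auto using mix_01).
  assert (Hhy : 0 <= snd h <= 1) by (rewrite E2; auto using mix_01).
  pose proof (xhat_value g1 b1 m1 (n + 6) x Ex) as Vx. pose proof (xhat_value g2 b2 m2 (n + 6) y Ey) as Vy.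
  assert (Dx : Rabs (x - fst h) < e2 n) by lra. assert (Dy : Rabs (y - snd h) < e2 n) by lra.
  (* The query point is at distance less than 1 from a point of the unit square, so its coordinates
     have modulus below 2 and pass the size test. *)
  assert (Hsx : small b1 m1 = true).
  { destruct (small b1 m1); auto. exfalso. revert Vx Dx. unfold Rabs. destruct (Rcase_abs x), (Rcase_abs (x - fst h)); lra. }
  assert (Hsy : small b2 m2 = true).
  { destruct (small b2 m2); auto. exfalso. revert Vy Dy. unfold Rabs. destruct (Rcase_abs y), (Rcase_abs (y - snd h)); lra. }
  rewrite Hsx in Vx |- *. rewrite Hsy in Vy |- *. cbn [andb].
  set (N := (n + 6)%nat) in *.
  assert (HN : (1 <= N)%nat) by (unfold N; lia). assert (HN6 : (6 <= N)%nat) by (unfold N; lia).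
  pose proof (e2_6 n) as E6. fold N in E6. pose proof (pow2_pos N) as PN.
  destruct (grid (fst q1) N B1x) as (p0 & L0 & G0). destruct (grid (snd q1) N B1y) as (p1 & L1 & G1).
  destruct (grid (fst q2) N B2x) as (p2 & L2 & G2). destruct (grid (snd q2) N B2y) as (p3 & L3 & G3).
  destruct (grid (fst q3) N B3x) as (p4 & L4 & G4). destruct (grid (snd q3) N B3y) as (p5 & L5 & G5).
  destruct (grid m N Hm) as (p6 & L6 & G6). destruct (grid l N Hl) as (p7 & L7 & G7).
  (* Coordinates are guessed from the most significant digit on, since pushing them on a stack
     reverses them; the weights are consumed as they are guessed, least significant digit first. *)
  set (gs := [rev p0; rev p1; rev p2; rev p3; rev p4; rev p5; p6; p7]).
  assert (Lgs : forall g, In g gs -> length g = N).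
  { intros g Hg. unfold gs in Hg. simpl in Hg. repeat (destruct Hg as [<-|Hg]; [rewrite ?length_rev; auto|]). destruct Hg. }
  assert (Eg : forall rest i, (i < 8)%nat -> guesses N (concat gs ++ rest) i = nth i gs []).
  { intros. apply guesses_concat; auto. }
  assert (Lc : length (concat gs) = (8 * N)%nat) by (apply (concat_length_const N); auto).
  assert (Acc : forall i j k a b c, (i < 8)%nat -> (j < 8)%nat -> (k < 8)%nat ->
    forall Z1 Z2 Z3, nth i gs [] = rev a -> nth j gs [] = rev b -> nth k gs [] = rev c ->
    0 <= Z1 <= 1 -> 0 <= Z2 <= 1 -> 0 <= Z3 <= 1 ->
    Z1 * 2 ^ N - 1 <= INR (lv a) <= Z1 * 2 ^ N -> Z2 * 2 ^ N - 1 <= INR (lv b) <= Z2 * 2 ^ N ->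
    Z3 * 2 ^ N - 1 <= INR (lv c) <= Z3 * 2 ^ N ->
    exists acc, length acc = N /\ (forall rest, accx N (concat gs ++ rest) i j k = acc) /\
      -5 <= INR (lv acc) - mix l (mix m Z1 Z2) Z3 * 2 ^ N <= 0).
  { intros i j k a b c Hi Hj Hk Z1 Z2 Z3 Ei Ej Ek R1 R2 R3 H1 H2 H3.
    assert (Same : forall rest, accx N (concat gs ++ rest) i j k = accx N (concat gs ++ []) i j k).
    { intros rest. unfold accx. cbv zeta. rewrite !Eg by lia. reflexivity. }
    exists (accx N (concat gs ++ []) i j k). split; [|split; auto].
    - unfold accx. cbv zeta. rewrite !seg_length; rewrite ?length_rev, ?repeat_length, ?guesses_length; auto;
      rewrite seg_length; rewrite ?length_rev, ?repeat_length, ?guesses_length; auto.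
    - pose proof (accx_complete N (concat gs ++ []) i j k (Z1 * 2 ^ N) (Z2 * 2 ^ N) (Z3 * 2 ^ N) l m) as T.
      rewrite !Eg, Ei, Ej, Ek in T by lia. rewrite !rev_involutive in T. cbn [nth gs] in T.
      unfold mix in *.
      replace ((l * (m * Z1 + (1 - m) * Z2) + (1 - l) * Z3) * 2 ^ N) with
        (l * (m * (Z1 * 2 ^ N) + (1 - m) * (Z2 * 2 ^ N)) + (1 - l) * (Z3 * 2 ^ N)) by ring.
      apply T; auto; (split; [apply Rmult_le_pos; lra|]);
        rewrite <- (Rmult_1_l (2 ^ N)) at 2; apply Rmult_le_compat_r; lra. }
  destruct (Acc 0%nat 2%nat 4%nat p0 p2 p4 ltac:(lia) ltac:(lia) ltac:(lia) _ _ _ eq_refl eq_refl eq_refl B1x B2x B3x G0 G2 G4)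
    as (ax & Lax & Eax & Bax).
  destruct (Acc 1%nat 3%nat 5%nat p1 p3 p5 ltac:(lia) ltac:(lia) ltac:(lia) _ _ _ eq_refl eq_refl eq_refl B1y B2y B3y G1 G3 G5)
    as (ay & Lay & Eay & Bay).
  rewrite <- E1 in Bax. rewrite <- E2 in Bay.
  assert (G : forall a b, Rabs (a - b) < e2 n -> Rabs (a * 2 ^ N - b * 2 ^ N) <= 64).
  { intros a b Hab. rewrite <- Rmult_minus_distr_r, Rabs_mult, (Rabs_right (2 ^ N)) by lra.
    rewrite <- E6, Rmult_comm. apply Rmult_le_compat_l; lra. }
  destruct (match_complete g1 b1 m1 N ax x (fst h * 2 ^ N) HN6 Lax Vx Bax (G _ _ Dx)) as (c1 & Lc1 & M1).
  destruct (match_complete g2 b2 m2 N ay y (snd h * 2 ^ N) HN6 Lay Vy Bay (G _ _ Dy)) as (c2 & Lc2 & M2).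
  exists (concat gs ++ c1 ++ c2). unfold verify. cbv zeta. rewrite !Eg by lia. cbn [nth gs].
  assert (K1 : skipn (8 * N) (concat gs ++ c1 ++ c2) = c1 ++ c2).
  { rewrite <- Lc, skipn_app, skipn_all, Nat.sub_diag. auto. }
  assert (K2 : skipn (8 * N + 140) (concat gs ++ c1 ++ c2) = c2).
  { rewrite Nat.add_comm, <- skipn_skipn, K1, <- Lc1, skipn_app, skipn_all, Nat.sub_diag. auto. }
  rewrite K1, K2, Eax, Eay, M1. rewrite <- (app_nil_r c2), M2.
  rewrite (query_complete S phi Hphi N _ _ q1), (query_complete S phi Hphi N _ _ q2), (query_complete S phi Hphi N _ _ q3);
    rewrite ?rev_involutive; auto.
Qed.

End Verify.

Definition hullP : sopoly :=
  SMul (SMul (SConst 99) (SConst 199)) (SMul (SAdd SVar (SConst 0)) (SAdd SVar (SConst 0))).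

Definition hullM : machine := mach (hullF 70 140) hullP (fun _ => []).

(** The name is read off from acceptance on all words, including those that are not triples of the
    required form. *)
Definition hull_name (phi : str -> str) (w : str) : str :=
  if excluded_middle_informative (accepts hullM phi w) then [s1] else [s0].

Lemma hull_name_ok S phi : in_A S -> circ_name phi S -> circ_name (hull_name phi) (conv_hull S).
Proof.
  intros HA Hphi. split.
  { unfold hull_name. split; [intros u v _|intros u]; repeat destruct (excluded_middle_informative _); auto. }
  intros n u v x y Du Dv.
  destruct (dyadic_inv u x Du) as (g1 & b1 & m1 & -> & Ex).
  destruct (dyadic_inv v y Dv) as (g2 & b2 & m2 & -> & Ey).
  set (w := triple_str _ _ _).
  assert (Hres : forall ch, fst (result (hullF 70 140) hullP (fun _ => []) phi w ch) =
     small b1 m1 && small b2 m2 && verify 70 140 phi (n + 6) (xhat g1 b1 m1 (n + 6)) (xhat g2 b2 m2 (n + 6)) ch).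
  { intros ch. apply (result_run (hullF 70 140) hullP (fun _ => []) phi w ch (fun b _ => b = _)).
    intros s Hs. apply hullF_ok with (ch := ch); auto. }
  unfold hull_name. split; intros H.
  - destruct (excluded_middle_informative _) as [_|No]; auto. exfalso. apply No.
    destruct (verify_complete S phi HA Hphi g1 b1 m1 g2 b2 m2 n x y Ex Ey H) as [ch Hch].
    destruct (mach_halts (hullF 70 140) hullP (fun _ => []) phi w ch) as (k & c & H1 & H2 & H3 & _).
    exists k, c. repeat split; auto. etransitivity; [exact H3|]. now rewrite Hres.
  - destruct (excluded_middle_informative _) as [(k & c & H1 & H2 & H3)|_]; auto. exfalso.
    destruct (mach_result _ _ _ _ _ _ _ H1 H2) as (ch & H4 & _).
    unfold hullM in H3. rewrite H4, Hres in H3.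
    exact (verify_sound S phi Hphi g1 b1 m1 g2 b2 m2 n ch x y Ex Ey H3 H).
Qed.

Lemma CH_NP2 : NP2 CH_mf.
Proof.
  split.
  - intros phi psi (S & HA & [[Hr _] _] & [Hp _]). auto.
  - exists hullM, (mtime (hullF 70 140) hullP (fun _ => [])). split; [apply mach_runs|].
    intros phi (psi & S & HA & Hn & _). exists (hull_name phi). split.
    + exists S. split; [auto|]. split; [auto|]. now apply hull_name_ok.
    + intros u. unfold hull_name. destruct (excluded_middle_informative _); split; auto; try discriminate.
      contradiction.
Qed.

(** * Closed sets given by trees of dyadic cells *)

Lemma e2_small eps : 0 < eps -> exists N, e2 N < eps.
Proof.
  intros H. destruct (pow_lt_1_zero (/ 2)) with (y := eps) as [N HN]; auto.
  - rewrite Rabs_right; lra.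
  - exists N. specialize (HN N (le_n _)). rewrite Rabs_right in HN; [|apply Rle_ge, pow_le; lra].
    unfold e2. now rewrite <- pow_inv.
Qed.

Definition bits2 : Type := list (bool * bool).
Definition cx (zs : bits2) : R := fr (map fst zs).
Definition cy (zs : bits2) : R := fr (map snd zs).

Lemma cx_app a b : cx (a ++ b) = cx a + e2 (length a) * cx b.
Proof. unfold cx. now rewrite map_app, fr_app, length_map. Qed.
Lemma cy_app a b : cy (a ++ b) = cy a + e2 (length a) * cy b.
Proof. unfold cy. now rewrite map_app, fr_app, length_map. Qed.
Lemma cx_bounds a : 0 <= cx a <= 1 - e2 (length a).
Proof. unfold cx. pose proof (fr_bounds (map fst a)) as H. now rewrite length_map in H. Qed.
Lemma cy_bounds a : 0 <= cy a <= 1 - e2 (length a).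
Proof. unfold cy. pose proof (fr_bounds (map snd a)) as H. now rewrite length_map in H. Qed.

Section Marks.
Variable mark : bits2 -> Prop.
Hypothesis mark_prefix : forall a b, mark (a ++ b) -> mark a.
Hypothesis mark_extend : forall a, mark a -> exists z, mark (a ++ [z]).

Definition cell_near (zs : bits2) (p : point) (d : R) : Prop :=
  Rabs (fst p - cx zs) <= d /\ Rabs (snd p - cy zs) <= d.

(* The slack 2 (rather than 1) makes the complement of this set open without
   a compactness argument. *)
Definition tree_set (p : point) : Prop :=
  forall N, exists zs, length zs = N /\ mark zs /\ cell_near zs p (2 * e2 N).

Lemma le_by_e2 a b c : (forall N, a <= b + c * e2 N) -> a <= b.
Proof.
  intros H. destruct (Rle_or_lt a b) as [|L]; auto. exfalso.
  destruct (Rle_or_lt c 0) as [Lc|Lc].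
  - specialize (H 0%nat). rewrite e2_0 in H. lra.
  - destruct (e2_small ((a - b) / c)) as [N HN].
    { apply Rdiv_lt_0_compat; lra. }
    specialize (H N). apply (Rmult_lt_compat_l c) in HN; auto.
    replace (c * ((a - b) / c)) with (a - b) in HN by (field; lra). lra.
Qed.

(** For closedness: if [p] fails at level [N], so does every [q] within half a cell. A cell two
    levels deeper that is near [q] would have an ancestor near [p], because its slack, the distance
    and its offset in the ancestor add up to 1/2 + 1/2 + 3/4 < 2 cell widths. *)
Lemma tree_set_in_A : in_A tree_set.
Proof.
  split.
  - intros p Hp.
    assert (H : forall N, -2 * e2 N <= fst p <= 1 + 2 * e2 N /\ -2 * e2 N <= snd p <= 1 + 2 * e2 N).
    { intros N. destruct (Hp N) as (zs & L & _ & H1 & H2). apply Rabs_le_elim in H1, H2.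
      pose proof (cx_bounds zs). pose proof (cy_bounds zs). pose proof (e2_pos (length zs)). lra. }
    repeat split.
    + apply (le_by_e2 0 (fst p) 2). intros N. specialize (H N). lra.
    + apply (le_by_e2 (fst p) 1 2). intros N. specialize (H N). lra.
    + apply (le_by_e2 0 (snd p) 2). intros N. specialize (H N). lra.
    + apply (le_by_e2 (snd p) 1 2). intros N. specialize (H N). lra.
  - intros p Hp. apply not_all_ex_not in Hp. destruct Hp as [N HN].
    exists (e2 N / 2). pose proof (e2_pos N) as P. split; [lra|]. intros q Hpq Hq. apply HN.
    destruct (Hq (N + 2)%nat) as (zs & L & Hm & H1 & H2). rewrite e2_add in H1, H2.
    assert (E4 : e2 2 = / 4) by (unfold e2; simpl; lra). rewrite E4 in H1, H2.
    rewrite <- (firstn_skipn N zs) in Hm, H1, H2.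
    assert (Lf : length (firstn N zs) = N) by (rewrite length_firstn; lia).
    assert (Ls : length (skipn N zs) = 2%nat) by (rewrite length_skipn; lia).
    exists (firstn N zs). split; auto. split; [eapply mark_prefix; eauto|].
    rewrite cx_app, Lf in H1. rewrite cy_app, Lf in H2.
    pose proof (cx_bounds (skipn N zs)) as B1. pose proof (cy_bounds (skipn N zs)) as B2. rewrite Ls, E4 in B1, B2.
    pose proof (eucl_ge_fst p q) as G1. pose proof (eucl_ge_snd p q) as G2.
    assert (G1' : Rabs (fst p - fst q) <= e2 N / 2) by lra. assert (G2' : Rabs (snd p - snd q) <= e2 N / 2) by lra.
    apply Rabs_le_elim in G1', G2', H1, H2.
    assert (0 <= e2 N * cx (skipn N zs) <= e2 N * (3 / 4)).
    { split; [apply Rmult_le_pos; lra|apply Rmult_le_compat_l; lra]. }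
    assert (0 <= e2 N * cy (skipn N zs) <= e2 N * (3 / 4)).
    { split; [apply Rmult_le_pos; lra|apply Rmult_le_compat_l; lra]. }
    split; apply Rabs_le; lra.
Qed.

Lemma nested_limit (f : nat -> R) N : (forall k j, (k <= j)%nat -> f k <= f j <= f k + e2 (N + k)) ->
  exists x, forall k, f k <= x <= f k + e2 (N + k).
Proof.
  intros H. destruct (completeness (fun y => exists k, y = f k)) as [x [U L]].
  - exists (f 0%nat + e2 (N + 0)). intros y [k ->]. apply H. lia.
  - exists (f 0%nat). eauto.
  - exists x. intros k. split; [apply U; eauto|]. apply L. intros y [j ->].
    destruct (Nat.le_ge_cases k j) as [Lk|Lk]; [now apply H|].
    pose proof (H j k Lk). pose proof (e2_pos (N + k)). lra.
Qed.

(** A marked cell can be refined for ever through marked cells, and the lower left corners converge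
    to a point of the set inside the first one. *)
Lemma tree_set_cell zs : mark zs -> exists p, tree_set p /\ cell_near zs p (e2 (length zs)).
Proof.
  intros Hm. set (N := length zs).
  assert (Hc : exists f : nat -> bits2, f 0%nat = zs /\ forall k, mark (f k) /\ exists z, f (S k) = f k ++ [z]).
  (* Making the refinement total, with a vacuous requirement on unmarked cells, lets one description
     operator supply the whole sequence. *)
  { set (g := fun a => a ++ [proj1_sig (constructive_indefinite_description (fun z => mark a -> mark (a ++ [z]))
        (match classic (mark a) with
         | or_introl h => match mark_extend a h with ex_intro _ z hz => ex_intro _ z (fun _ => hz) end
         | or_intror h => ex_intro _ (true, true) (fun h' => match h h' with end) end))]).
    assert (Hg : forall a, mark a -> mark (g a)) by (intros a; unfold g; destruct (constructive_indefinite_description _ _); auto).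
    exists (fun k => Nat.iter k g zs). split; auto. intros k. split.
    - induction k; simpl; auto.
    - simpl. unfold g at 1. eauto. }
  destruct Hc as (f & F0 & FS).
  assert (Lf : forall k, length (f k) = (N + k)%nat).
  { induction k; [rewrite F0; unfold N; lia|]. destruct (FS k) as (_ & z & ->). rewrite length_app, IHk. simpl. lia. }
  assert (Fp : forall k j, (k <= j)%nat -> exists r, f j = f k ++ r).
  { intros k j Hj. induction Hj as [|j Hj [r IH]]; [exists []; now rewrite app_nil_r|].
    destruct (FS j) as (_ & z & ->). rewrite IH, <- app_assoc. eauto. }
  destruct (nested_limit (fun k => cx (f k)) N) as [x Hx].
  { intros k j Hj. destruct (Fp k j Hj) as [r ->]. rewrite cx_app, Lf. pose proof (cx_bounds r). pose proof (e2_pos (N + k)).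
    pose proof (e2_pos (length r)). split; nra. }
  destruct (nested_limit (fun k => cy (f k)) N) as [y Hy].
  { intros k j Hj. destruct (Fp k j Hj) as [r ->]. rewrite cy_app, Lf. pose proof (cy_bounds r). pose proof (e2_pos (N + k)).
    pose proof (e2_pos (length r)). split; nra. }
  exists (x, y). split.
  - intros M. destruct (Nat.le_ge_cases N M) as [L|L].
    + exists (f (M - N)%nat). rewrite Lf. split; [lia|]. split; [apply FS|].
      specialize (Hx (M - N)%nat). specialize (Hy (M - N)%nat). replace (N + (M - N))%nat with M in * by lia.
      pose proof (e2_pos M). split; apply Rabs_le; simpl; lra.
    + assert (LM : length (firstn M zs) = M) by (rewrite length_firstn; fold N; lia).
      exists (firstn M zs). split; auto. split.
      * apply (mark_prefix _ (skipn M zs)). now rewrite firstn_skipn.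
      * specialize (Hx 0%nat). specialize (Hy 0%nat). rewrite F0, Nat.add_0_r in Hx, Hy.
        rewrite <- (firstn_skipn M zs) in Hx, Hy. rewrite cx_app, LM in Hx. rewrite cy_app, LM in Hy.
        pose proof (cx_bounds (skipn M zs)). pose proof (cy_bounds (skipn M zs)). pose proof (e2_pos (length (skipn M zs))).
        pose proof (e2_pos M). pose proof (e2_le M N L).
        split; apply Rabs_le; simpl; nra.
  - specialize (Hx 0%nat). specialize (Hy 0%nat). rewrite F0, Nat.add_0_r in Hx, Hy.
    split; apply Rabs_le; simpl; lra.
Qed.

(** The radius 70 covers the 64 + 1 + 2 units of [near_complete], and in [near_sound] it leads to 70
    + 1 + 1 units, fewer than the 80 that make up [1.25 * 2^-n]. *)
Definition near (N : nat) (X Y : list bool) : Prop :=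
  exists zs, length zs = N /\ mark zs /\
    Rabs (INR (lv X) - 2 ^ (N + 2) - cx zs * 2 ^ N) <= 70 /\
    Rabs (INR (lv Y) - 2 ^ (N + 2) - cy zs * 2 ^ N) <= 70.

Lemma near_sound n X Y x y :
  Rabs (INR (lv X) - 2 ^ (n + 6 + 2) - x * 2 ^ (n + 6)) <= 1 ->
  Rabs (INR (lv Y) - 2 ^ (n + 6 + 2) - y * 2 ^ (n + 6)) <= 1 ->
  near (n + 6) X Y -> ~ dist_gt (x, y) tree_set (2 * / 2 ^ n).
Proof.
  set (N := (n + 6)%nat). intros HX HY (zs & L & Hm & NX & NY) (r & Hr & Hall).
  destruct (tree_set_cell zs Hm) as (q & Hq & CX & CY). rewrite L in CX, CY.
  specialize (Hall q Hq). fold (e2 n) in Hr.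
  pose proof (e2_pos n) as Pn. pose proof (e2_6 n) as E6. fold N in E6. pose proof (pow2_pos N) as PN.
  pose proof (e2_pow N) as EN.
  assert (G : forall l c a b, Rabs (l - 2 ^ (N + 2) - c * 2 ^ N) <= 70 -> Rabs (l - 2 ^ (N + 2) - a * 2 ^ N) <= 1 ->
     Rabs (b - c) <= e2 N -> Rabs (a - b) <= 1.25 * e2 n).
  { intros l c a b H1 H2 H3. apply Rabs_le_elim in H1, H2, H3.
    assert (H4 : - 1 <= (b - c) * 2 ^ N <= 1).
    { split; [replace (-1) with (- e2 N * 2 ^ N) by lra|replace 1 with (e2 N * 2 ^ N) by lra]; apply Rmult_le_compat_r; lra. }
    apply Rabs_le. split; apply (Rmult_le_reg_r (2 ^ N)); auto; lra. }
  assert (D : eucl (x, y) q < 2 * e2 n); [|lra].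
  apply (eucl_lt _ _ (1.25 * e2 n)); try lra; simpl.
  - apply (G _ _ _ _ NX HX CX).
  - apply (G _ _ _ _ NY HY CY).
  - nra.
Qed.

Lemma near_complete n X Y x y :
  Rabs (INR (lv X) - 2 ^ (n + 6 + 2) - x * 2 ^ (n + 6)) <= 1 ->
  Rabs (INR (lv Y) - 2 ^ (n + 6 + 2) - y * 2 ^ (n + 6)) <= 1 ->
  dist_lt (x, y) tree_set (/ 2 ^ n) -> near (n + 6) X Y.
Proof.
  set (N := (n + 6)%nat). intros HX HY (q & Hq & Dq). fold (e2 n) in Dq.
  pose proof (eucl_ge_fst (x, y) q) as Gx. pose proof (eucl_ge_snd (x, y) q) as Gy. simpl in Gx, Gy.
  pose proof (e2_pos n) as Pn. pose proof (e2_6 n) as E6. fold N in E6. pose proof (pow2_pos N) as PN.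
  pose proof (e2_pow N) as EN.
  destruct (Hq N) as (zs & L & Hm & C1 & C2). exists zs. split; auto. split; auto.
  assert (G : forall l c a b, Rabs (l - 2 ^ (N + 2) - a * 2 ^ N) <= 1 -> Rabs (a - b) < e2 n ->
     Rabs (b - c) <= 2 * e2 N -> Rabs (l - 2 ^ (N + 2) - c * 2 ^ N) <= 70).
  { intros l c a b H1 H2 H3. apply Rabs_def2 in H2. apply Rabs_le_elim in H1, H3.
    assert (H4 : - 2 <= (b - c) * 2 ^ N <= 2).
    { assert (- (2 * e2 N) * 2 ^ N <= (b - c) * 2 ^ N <= 2 * e2 N * 2 ^ N) by (split; apply Rmult_le_compat_r; lra). lra. }
    assert (H5 : - 64 <= (a - b) * 2 ^ N <= 64).
    { assert (- e2 n * 2 ^ N <= (a - b) * 2 ^ N <= e2 n * 2 ^ N) by (split; apply Rmult_le_compat_r; lra). lra. }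
    apply Rabs_le. lra. }
  split; [apply (G _ _ x (fst q))|apply (G _ _ y (snd q))]; auto; lra.
Qed.

End Marks.

(** * Uniqueness of the named set *)

Lemma dyadic_approx r N : 0 <= r <= 1 -> exists u x, dyadic u x /\ Rabs (x - r) <= e2 N.
Proof.
  intros Hr. destruct (grid r N Hr) as (l & L & H).
  exists (dystr false (rev l) N). eexists. split; [apply dyadic_dystr|].
  rewrite rev_involutive. pose proof (pow2_pos N). pose proof (e2_pow N).
  replace (1 * INR (lv l) / 2 ^ N - r) with ((INR (lv l) - r * 2 ^ N) * e2 N) by (unfold e2; field; lra).
  pose proof (e2_pos N). rewrite Rabs_mult, (Rabs_right (e2 N)) by lra.
  rewrite <- (Rmult_1_l (e2 N)) at 2. apply Rmult_le_compat_r; [lra|]. apply Rabs_le. lra.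
Qed.

Lemma eucl_triangle p q r : eucl p r <= eucl p q + eucl q r.
Proof.
  destruct p as [p1 p2], q as [q1 q2], r as [r1 r2]. unfold eucl; simpl.
  pose proof (triangle p1 p2 r1 r2 q1 q2) as T. unfold dist_euc, Rsqr in T.
  rewrite !Rmult_1_r. exact T.
Qed.

(** [CH_mf] relates a name to the hull of some set it names, so the reduction needs that a name
    determines its closed set. A point of [S] off [S'] has a neighbourhood free of [S'], and a
    dyadic point close enough to it would have to receive both answers. *)
Lemma name_subset phi S S' : in_A S -> in_A S' -> circ_name phi S -> circ_name phi S' -> forall p, S p -> S' p.
Proof.
  intros [B _] [_ C'] [_ N] [_ N'] p Hp. apply NNPP. intros Hn.
  destruct (C' p Hn) as (eps & Pe & He). destruct (e2_small (eps / 4)) as [n Hn']; [lra|].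
  destruct (B p Hp) as [Bx By]. pose proof (e2_pos n) as Pn.
  destruct (dyadic_approx (fst p) (n + 1) Bx) as (u & x & Du & Hx).
  destruct (dyadic_approx (snd p) (n + 1) By) as (v & y & Dv & Hy).
  rewrite e2_add in Hx, Hy. replace (e2 1) with (/ 2) in Hx, Hy by (unfold e2; simpl; lra).
  assert (D : eucl (x, y) p < e2 n).
  { apply (eucl_lt _ _ (e2 n / 2)); simpl; try lra. nra. }
  destruct (N n u v x y Du Dv) as [N1 _]. destruct (N' n u v x y Du Dv) as [_ N2].
  assert (E : [s1] = [s0]); [|discriminate].
  rewrite <- N1, <- N2; auto.
  - exists (eps - e2 n). fold (e2 n). split; [lra|]. intros q Hq.
    destruct (Rlt_or_le (eucl p q) eps) as [L|L]; [exfalso; eapply He; eauto|].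
    pose proof (eucl_triangle p (x, y) q) as T.
    assert (Es : eucl p (x, y) = eucl (x, y) p).
    { unfold eucl. f_equal. simpl. ring. }
    lra.
  - exists p. split; auto.
Qed.

Lemma conv_hull_mono (S S' : point -> Prop) : (forall p, S p -> S' p) -> forall p, conv_hull S p -> conv_hull S' p.
Proof. intros H p Hp C HC HS. apply Hp; auto. Qed.

Open Scope nat_scope.

(** * The curve encoding all computations of a nondeterministic machine *)

(* One block: it adds [b / 2] to [x], adds [b / 2] times the fraction with digits [pre ++ 001] to [y], and ends with
   the [y]-digit [e]. The zeros make the scale of the next block small
   compared with the differences between slopes. *)
Definition blk (pre : list bool) (e b : bool) : bits2 :=
  (b, false) :: map (fun d => (false, b && d)) (pre ++ [false; false; true]) ++
  repeat (false, false) 4 ++ [(false, e)].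

Definition enc3 (o : option sym) : list bool :=
  match o with
  | None => [false; false; false]
  | Some s0 => [false; false; true]
  | Some s1 => [false; true; false]
  | Some splus => [false; true; true]
  | Some sminus => [true; false; false]
  | Some sslash => [true; false; true]
  end.

Definition dec3 (a b c : bool) : option sym :=
  match a, b, c with
  | false, false, true => Some s0
  | false, true, false => Some s1
  | false, true, true => Some splus
  | true, false, false => Some sminus
  | true, false, true => Some sslash
  | _, _, _ => None
  end.

Definition osym (o : option sym) : sym := match o with Some a => a | None => s0 end.

Definition code (u : str) : list bool := flat_map (fun a => true :: enc3 (Some a)) u ++ [false].

Lemma code_length u : length (code u) = 4 * length u + 1.
Proof.
  unfold code. rewrite length_app. simpl. f_equal. induction u as [|a u IH]; auto.
  simpl flat_map. simpl length. rewrite length_app, IH. destruct a; simpl; lia.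
Qed.

Fixpoint cdigs (pre v : list bool) : bits2 :=
  match v with [] => [] | b :: v => blk pre true b ++ cdigs (pre ++ [false; b]) v end.

Definition bdigs (pre bs : list bool) : bits2 := flat_map (blk pre true) bs.

(** Two slope digits per code bit, a zero and the bit: this leaves room for the slope [sl pre] of
    the current block strictly between the slopes of the two continuations. *)
Definition prel (v : list bool) : list bool := flat_map (fun b => [false; b]) v.

Lemma blk_length pre e b : length (blk pre e b) = length pre + 9.
Proof. unfold blk. simpl. rewrite length_app, length_map, length_app. simpl. lia. Qed.

Lemma bdigs_length pre bs : length (bdigs pre bs) = length bs * (length pre + 9).
Proof.
  induction bs; auto. change (bdigs pre (a :: bs)) with (blk pre true a ++ bdigs pre bs).
  rewrite length_app, blk_length, IHbs. simpl. lia.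
Qed.

(** An index beyond the last option selects the last one, so that every bit stream describes a
    computation. *)
Fixpoint pick {A} (o : A) (l : list A) (i : nat) : A :=
  match i, l with
  | S i, o' :: l => pick o' l i
  | _, _ => o
  end.

Lemma pick_in {A} (l : list A) : forall o i, In (pick o l i) (o :: l).
Proof.
  induction l as [|o' l IH]; intros o [|i]; simpl; auto. right. apply IH.
Qed.

Lemma in_pick {A} (l : list A) a : forall o, In a (o :: l) -> exists i, i <= length l /\ pick o l i = a.
Proof.
  induction l as [|o' l IH]; intros o [->|H].
  - exists 0. auto.
  - destruct H.
  - exists 0. split; auto. lia.
  - destruct (IH o' H) as (i & Hi & E). exists (S i). simpl. split; [lia|auto].
Qed.

Section Curve.
Variables (M : machine) (phi : str -> str).

(* Phases [PA]: reading the input, each symbol as [1] and three bits, [0] at the end. Phases [PB0], [PB1]: two bits,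
   which must be [01] to make acceptance visible. Phase [PB2]: simulation; a bit [1] passes on to the next option,
   a bit [0] takes the current one. *)
Inductive phase :=
| PA0 | PA1 | PA2 (b1 : bool) | PA3 (b1 b2 : bool)
| PB0 | PB1 (d : bool) | PB2 (act : bool) (c : config M) (i : nat).

Record gstate := mkG { g_pre : list bool; g_u : str; g_ph : phase }.

Definition mstep (u : str) (c : config M) (i : nat) (b : bool) : config M * nat :=
  match options M u c with
  | [] => (c, i)
  | o :: l => if b then (c, S i) else (apply_act M phi (pick o l i) c, 0)
  end.

Definition gstep (g : gstate) (b : bool) : gstate :=
  let p' := g_pre g ++ [false; b] in
  match g_ph g with
  | PA0 => mkG p' (g_u g) (if b then PA1 else PB0)
  | PA1 => mkG p' (g_u g) (PA2 b)
  | PA2 b1 => mkG p' (g_u g) (PA3 b1 b)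
  | PA3 b1 b2 => mkG p' (g_u g ++ [osym (dec3 b1 b2 b)]) PA0
  | PB0 => mkG (g_pre g) (g_u g) (PB1 b)
  | PB1 d => mkG (g_pre g) (g_u g) (PB2 (negb d && b) (init_config M) 0)
  | PB2 act c i => let (c', i') := mstep (g_u g) c i b in mkG (g_pre g) (g_u g) (PB2 act c' i')
  end.

Definition unaccepted (u : str) (c : config M) : bool :=
  match options M u c with [] => negb (macc M (c_state c)) | _ => true end.

Definition ge (g : gstate) : bool :=
  match g_ph g with PB2 true c _ => unaccepted (g_u g) c | _ => true end.

Definition block (g : gstate) (b : bool) : bits2 := blk (g_pre g) (ge g) b.

Fixpoint digs (g : gstate) (z : list bool) : bits2 :=
  match z with [] => [] | b :: z => block g b ++ digs (gstep g b) z end.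

Definition gsteps (g : gstate) (z : list bool) : gstate := fold_left gstep z g.

Definition g0 : gstate := mkG [] [] PA0.

Definition mark (zs : bits2) : Prop := exists z r, digs g0 z = zs ++ r.

Lemma digs_app z z' : forall g, digs g (z ++ z') = digs g z ++ digs (gsteps g z) z'.
Proof. induction z; intros g; simpl; auto. now rewrite IHz, app_assoc. Qed.

Lemma mark_prefix a b : mark (a ++ b) -> mark a.
Proof. intros (z & r & E). exists z, (b ++ r). now rewrite E, app_assoc. Qed.

Lemma mark_extend a : mark a -> exists z, mark (a ++ [z]).
Proof.
  intros (z & [|d r] & E).
  - exists (true, false), (z ++ [true]). eexists. rewrite digs_app, E, app_nil_r, <- app_assoc.
    simpl. unfold block, blk. reflexivity.
  - exists d, z, r. now rewrite <- app_assoc.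
Qed.

Definition inA (g : gstate) : Prop :=
  match g_ph g with PA0 | PA1 | PA2 _ | PA3 _ _ => True | _ => False end.

Fixpoint Aok (g : gstate) (v : list bool) : Prop :=
  match v with
  | [] => g_ph g = PB0
  | b :: v => inA g /\ Aok (gstep g b) v
  end.

Lemma inA_ge g : inA g -> ge g = true.
Proof. unfold inA, ge. destruct (g_ph g); tauto || auto. Qed.

Lemma inA_pre g b : inA g -> g_pre (gstep g b) = g_pre g ++ [false; b].
Proof. unfold inA, gstep. destruct (g_ph g); simpl; tauto || auto. Qed.

Lemma code_ok u : forall g, g_ph g = PA0 ->
  Aok g (code u) /\ g_u (gsteps g (code u)) = g_u g ++ u.
Proof.
  unfold code. induction u as [|a u IH]; intros g E.
  - simpl. unfold inA, gstep. rewrite E. simpl. rewrite app_nil_r. auto.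
  - cbn [flat_map]. rewrite <- app_assoc.
    assert (T : forall b1 b2 b3 v, osym (dec3 b1 b2 b3) = a ->
      (forall g', g_ph g' = PA0 -> g_u g' = g_u g ++ [a] -> Aok g' v /\ g_u (gsteps g' v) = g_u g ++ a :: u) ->
      Aok g (true :: b1 :: b2 :: b3 :: v) /\ g_u (gsteps g (true :: b1 :: b2 :: b3 :: v)) = g_u g ++ a :: u).
    { intros b1 b2 b3 v Ea Hv.
      assert (S1 : g_ph (gstep g true) = PA1) by (unfold gstep; rewrite E; auto).
      assert (S2 : g_ph (gstep (gstep g true) b1) = PA2 b1) by (unfold gstep at 1; rewrite S1; auto).
      assert (S3 : g_ph (gstep (gstep (gstep g true) b1) b2) = PA3 b1 b2) by (unfold gstep at 1; rewrite S2; auto).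
      set (g4 := gstep (gstep (gstep (gstep g true) b1) b2) b3).
      assert (S4 : g_ph g4 = PA0) by (unfold g4, gstep at 1; rewrite S3; auto).
      assert (U4 : g_u g4 = g_u g ++ [a]).
      { unfold g4, gstep at 1. rewrite S3. cbn [g_u]. rewrite Ea. f_equal.
        unfold gstep at 1. rewrite S2. cbn [g_u]. unfold gstep at 1. rewrite S1. cbn [g_u].
        unfold gstep. rewrite E. auto. }
      destruct (Hv g4 S4 U4) as [V1 V2]. split; [|exact V2].
      cbn [Aok]. fold g4. unfold inA. rewrite E, S1, S2, S3. auto. }
    assert (Hu : forall g', g_ph g' = PA0 -> g_u g' = g_u g ++ [a] ->
       Aok g' (flat_map (fun a => true :: enc3 (Some a)) u ++ [false]) /\
       g_u (gsteps g' (flat_map (fun a => true :: enc3 (Some a)) u ++ [false])) = g_u g ++ a :: u).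
    { intros g' P U. destruct (IH g' P) as [I1 I2]. split; auto. rewrite I2, U, <- app_assoc. auto. }
    destruct a; cbn [enc3 app]; apply T; auto.
Qed.

Lemma Aok_digs v : forall g, Aok g v -> digs g v = cdigs (g_pre g) v.
Proof.
  induction v as [|b v IH]; intros g H; simpl; auto. destruct H as [H1 H2].
  unfold block. rewrite (inA_ge g H1), IH, inA_pre by auto. reflexivity.
Qed.

Lemma Aok_pre v : forall g, Aok g v -> g_pre (gsteps g v) = g_pre g ++ prel v.
Proof.
  induction v as [|b v IH]; intros g H; simpl; [now rewrite app_nil_r|]. destruct H as [H1 H2].
  rewrite IH, inA_pre by auto. now rewrite <- app_assoc.
Qed.

Lemma Aok_end v : forall g, Aok g v -> g_ph (gsteps g v) = PB0.
Proof. induction v as [|b v IH]; intros g H; simpl; auto. apply IH, H. Qed.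

(** * The supporting line of a rejected input *)

Open Scope R_scope.

Definition sl (pre : list bool) : R := fr pre + e2 (length pre) / 8.
Definition eW (pre : list bool) : R := e2 (length pre + 9).
(** The geometric series of the powers of [eW pre] from the first on: the height contributed by the
    last digits of infinitely many blocks that all end in 1. *)
Definition beta (pre : list bool) : R := eW pre / (1 - eW pre).
(** Height above the line of slope [m] through the origin. It respects concatenation of digits up to
    the scale of the first part. *)
Definition Lin (m : R) (zs : bits2) : R := cy zs - m * cx zs.

Lemma eW_bounds pre : 0 < eW pre <= / 512.
Proof.
  split; [apply e2_pos|]. unfold eW. replace (/ 512) with (e2 9) by (unfold e2; f_equal; simpl; lra).
  apply e2_le. lia.
Qed.

Lemma eW_pre pre : eW pre = e2 (length pre) / 512.
Proof. unfold eW. rewrite e2_add. unfold e2 at 2. simpl. lra. Qed.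

Lemma beta_eq pre : beta pre = eW pre * (1 + beta pre).
Proof. unfold beta. pose proof (eW_bounds pre). field. lra. Qed.

Lemma beta_bounds pre : eW pre <= beta pre <= 1 / 100.
Proof.
  pose proof (eW_bounds pre) as B. pose proof (beta_eq pre) as E.
  assert (0 <= beta pre).
  { unfold beta. apply Rmult_le_pos; [lra|]. left. apply Rinv_0_lt_compat. lra. }
  split; nra.
Qed.

Lemma sl_fr pre : fr (pre ++ [false; false; true]) = sl pre.
Proof. rewrite fr_app. unfold sl. simpl. lra. Qed.

Lemma fr_map_false {A} (l : list A) : fr (map (fun _ => false) l) = 0.
Proof. induction l; simpl; lra. Qed.

Lemma cx_blk pre e b : cx (blk pre e b) = bR b / 2.
Proof.
  unfold cx, blk. rewrite map_cons, map_app, map_map. cbn [fst fr]. rewrite fr_app, fr_map_false.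
  simpl. lra.
Qed.

Lemma cy_blk pre e b : cy (blk pre e b) = bR b / 2 * sl pre + eW pre * bR e.
Proof.
  unfold cy, blk. rewrite map_cons, map_app, map_map. cbn [snd fr]. rewrite fr_app.
  replace (fr (map (fun d => b && d) (pre ++ [false; false; true]))) with (bR b * sl pre).
  - rewrite length_map, length_app. simpl. rewrite eW_pre.
    rewrite e2_add. replace (e2 3) with (/ 8) by (unfold e2; simpl; lra). lra.
  - destruct b; simpl.
    + rewrite map_id, sl_fr. lra.
    + rewrite fr_map_false. lra.
Qed.

Lemma Lin_app m a b : Lin m (a ++ b) = Lin m a + e2 (length a) * Lin m b.
Proof. unfold Lin. rewrite cx_app, cy_app. lra. Qed.

(** For [m = sl pre] the first summand vanishes: the bit of the block then moves the point along the
    line, and only the last digit changes the height. *)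
Lemma Lin_blk m pre e b r :
  Lin m (blk pre e b ++ r) = bR b / 2 * (sl pre - m) + eW pre * (bR e + Lin m r).
Proof.
  rewrite Lin_app, blk_length. fold (eW pre). unfold Lin at 1. rewrite cx_blk, cy_blk. lra.
Qed.

Lemma Lin_bounds m zs : 0 <= m <= 1 -> -1 <= Lin m zs <= 1.
Proof.
  intros Hm. unfold Lin. pose proof (cx_bounds zs). pose proof (cy_bounds zs).
  pose proof (e2_pos (length zs)). split; nra.
Qed.

Fixpoint slope (pre v : list bool) : R :=
  match v with [] => sl pre | b :: v => slope (pre ++ [false; b]) v end.

Lemma slope_prel v : forall pre, slope pre v = sl (pre ++ prel v).
Proof.
  induction v as [|b v IH]; intros pre; simpl; [now rewrite app_nil_r|].
  rewrite IH. now rewrite <- app_assoc.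
Qed.

Lemma fr_snoc2 pre b : fr (pre ++ [false; b]) = fr pre + e2 (length pre) * (bR b / 4).
Proof. rewrite fr_app. simpl. lra. Qed.

Lemma e2_snoc2 (pre : list bool) b : e2 (length (pre ++ [false; b])) = e2 (length pre) / 4.
Proof. rewrite length_app, e2_add. unfold e2 at 2. simpl. lra. Qed.

(** Each further code bit adds at most a quarter of the current scale and divides the scale by 4;
    1/4 + 1/16 + ... is 1/3. *)
Lemma slope_range v : forall pre, fr pre <= slope pre v <= fr pre + e2 (length pre) / 3.
Proof.
  induction v as [|b v IH]; intros pre; simpl.
  - unfold sl. pose proof (e2_pos (length pre)). lra.
  - specialize (IH (pre ++ [false; b])). rewrite fr_snoc2, e2_snoc2 in IH.
    pose proof (e2_pos (length pre)). destruct b; simpl in IH; lra.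
Qed.

Lemma slope_01 v pre : 0 <= slope pre v <= 1.
Proof.
  pose proof (slope_range v pre). pose proof (fr_bounds pre). pose proof (e2_pos (length pre)). lra.
Qed.

(** For the code of [u] this is the intercept of its line: the value of [Lin m] on an infinite
    stream that spells [v] and has every block end in 1, with [m] the slope reached. *)
Fixpoint base (m : R) (pre v : list bool) : R :=
  match v with
  | [] => beta pre
  | b :: v => bR b / 2 * (sl pre - m) + eW pre * (1 + base m (pre ++ [false; b]) v)
  end.

Lemma sl_01 pre : 0 <= sl pre <= 1.
Proof. apply (slope_01 []). Qed.

Lemma base_bounds m v : 0 <= m <= 1 -> forall pre, -1 <= base m pre v <= 1.
Proof.
  intros Hm. induction v as [|b v IH]; intros pre; simpl.
  - pose proof (beta_bounds pre). pose proof (eW_bounds pre). lra.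
  - specialize (IH (pre ++ [false; b])). pose proof (eW_bounds pre). pose proof (sl_01 pre).
    destruct b; simpl; split; nra.
Qed.

Lemma Lin_cdigs m v r : forall pre, Lin m (cdigs pre v ++ r) =
  base m pre v + e2 (length (cdigs pre v)) * (Lin m r - beta (pre ++ prel v)).
Proof.
  induction v as [|b v IH]; intros pre; cbn [cdigs base prel flat_map].
  - simpl. rewrite e2_0, app_nil_r. lra.
  - rewrite <- app_assoc, Lin_blk, IH, length_app, e2_add, blk_length. fold (eW pre).
    change (flat_map (fun b => [false; b]) v) with (prel v).
    replace ((pre ++ [false; b]) ++ prel v) with (pre ++ [false; b] ++ prel v) by (now rewrite app_assoc).
    simpl (bR true). ring.
Qed.

Lemma Lin_bdigs pre bs r :
  Lin (sl pre) (bdigs pre bs ++ r) = beta pre + e2 (length (bdigs pre bs)) * (Lin (sl pre) r - beta pre).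
Proof.
  induction bs as [|b bs IH]; cbn [bdigs flat_map].
  - simpl. rewrite e2_0. lra.
  - change (flat_map (blk pre true) bs) with (bdigs pre bs).
    rewrite <- app_assoc, Lin_blk, IH, length_app, e2_add, blk_length. fold (eW pre). simpl (bR true).
    pose proof (beta_eq pre). nra.
Qed.

Section Rejecting.
Variable u : str.
Hypothesis Hrej : ~ accepts M phi u.

Definition PBok (g : gstate) : Prop :=
  g_u g = u /\
  match g_ph g with
  | PB0 | PB1 _ => True
  | PB2 _ c _ => exists n, reach M phi u n c
  | _ => False
  end.

Lemma PBok_step g b : PBok g -> PBok (gstep g b) /\ g_pre (gstep g b) = g_pre g.
Proof.
  intros [Eu H]. unfold PBok, gstep. destruct (g_ph g) as [ | | | | |d|act c i]; try contradiction; simpl.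
  - auto.
  - split; auto. split; auto. exists 0%nat. constructor.
  - destruct (mstep (g_u g) c i b) as [c' i'] eqn:Es. simpl. split; auto. split; auto.
    destruct H as [n Hn]. unfold mstep in Es. rewrite Eu in Es.
    destruct (options M u c) as [|o l] eqn:Eo; [inversion Es; subst; eauto|].
    destruct b; inversion Es; subst; eauto.
    exists (S n). constructor; auto. rewrite Eo. apply pick_in.
Qed.

(** The simulated configurations are reachable, so for a rejected [u] none of them is halted and
    accepting. *)
Lemma PBok_ge g : PBok g -> ge g = true.
Proof.
  intros [Eu H]. unfold ge. destruct (g_ph g) as [ | | | | |d|[] c i]; auto.
  destruct H as [n Hn]. rewrite Eu. unfold unaccepted. destruct (options M u c) eqn:Eo; auto.
  destruct (macc M (c_state c)) eqn:Ea; auto. exfalso. apply Hrej. exists n, c. auto.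
Qed.

(** With all last digits equal to 1 the height is a partial sum of the series [beta]; the allowance
    of three times the scale pays for the part cut off. *)
Lemma PB_lower z : forall g, PBok g ->
  beta (g_pre g) - 3 * e2 (length (digs g z)) <= Lin (sl (g_pre g)) (digs g z).
Proof.
  induction z as [|b z IH]; intros g H; cbn [digs].
  - simpl length. rewrite e2_0. unfold Lin, cx, cy. simpl. pose proof (beta_bounds (g_pre g)). lra.
  - destruct (PBok_step g b H) as [H1 H2]. specialize (IH _ H1). rewrite H2 in IH.
    unfold block. rewrite (PBok_ge g H), Lin_blk, length_app, e2_add, blk_length. fold (eW (g_pre g)).
    simpl (bR true). pose proof (beta_eq (g_pre g)). pose proof (eW_bounds (g_pre g)).
    apply (Rmult_le_compat_l (eW (g_pre g))) in IH; lra.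
Qed.

(** Consider the first bit where the stream leaves the code of [u], at scale
    [E = e2 (length (g_pre g))]. By [slope_range] the slope [m] is at most [fr + E / 12] or at least
    [fr + E / 4], while the block has slope [fr + E / 8]; in both cases the wrong bit raises the
    height by at least [E / 48]. All later digits change it by at most [2 * eW = E / 256], which is
    why a block ends in extra zeros. *)
Lemma A_lower v : forall g z, Aok g v -> g_u (gsteps g v) = u ->
  let m := slope (g_pre g) v in
  base m (g_pre g) v - 3 * e2 (length (digs g z)) <= Lin m (digs g z).
Proof.
  induction v as [|b' v IH]; intros g z HA Hu; cbv zeta.
  - simpl. apply PB_lower. simpl in HA, Hu. split; auto. now rewrite HA.
  - destruct HA as [H1 H2]. set (m := slope (g_pre g) (b' :: v)).
    assert (Hm : 0 <= m <= 1) by apply slope_01.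
    pose proof (base_bounds m (b' :: v) Hm (g_pre g)) as Bb.
    destruct z as [|b z].
    + simpl length. rewrite e2_0. unfold Lin, cx, cy. simpl map. simpl fr. lra.
    + cbn [digs]. unfold block. rewrite (inA_ge g H1), Lin_blk, length_app, e2_add, blk_length. fold (eW (g_pre g)).
      cbn [base]. simpl (bR true).
      pose proof (eW_bounds (g_pre g)) as We. pose proof (eW_pre (g_pre g)) as Wp.
      pose proof (Lin_bounds m (digs (gstep g b) z) Hm) as Lb.
      pose proof (base_bounds m v Hm (g_pre g ++ [false; b'])) as Bb'.
      pose proof (e2_pos (length (digs (gstep g b) z))) as Pe.
      destruct (bool_dec b b') as [->|Nb].
      * specialize (IH (gstep g b') z H2 Hu). cbv zeta in IH. rewrite inA_pre in IH by auto.
        change (slope (g_pre g ++ [false; b']) v) with m in IH.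
        apply (Rmult_le_compat_l (eW (g_pre g))) in IH; lra.
      * pose proof (slope_range v (g_pre g ++ [false; b'])) as Sr. rewrite fr_snoc2, e2_snoc2 in Sr.
        change (slope (g_pre g ++ [false; b']) v) with m in Sr. unfold sl.
        pose proof (e2_pos (length (g_pre g))) as Pg. set (E := e2 (length (g_pre g))) in *.
        assert (X : - (2 * eW (g_pre g)) <= eW (g_pre g) * (1 + Lin m (digs (gstep g b) z)) -
           eW (g_pre g) * (1 + base m (g_pre g ++ [false; b']) v)).
        { rewrite <- Rmult_minus_distr_l. replace (- (2 * eW (g_pre g))) with (eW (g_pre g) * (-2)) by lra.
          apply Rmult_le_compat_l; lra. }
        assert (0 <= eW (g_pre g) * e2 (length (digs (gstep g b) z))) by (apply Rmult_le_pos; lra).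
        destruct b, b'; try congruence; simpl in *; lra.
Qed.
End Rejecting.

(** Passes from cells to points: the position in the cell and the cut-off stream cost less than
    [9 * e2 N] at level [N], for every [N]. *)
Lemma tree_below u m c : ~ accepts M phi u -> m = slope [] (code u) -> c = base m [] (code u) ->
  forall p, tree_set mark p -> c <= snd p - m * fst p.
Proof.
  intros Hr -> -> p Hp. set (m := slope [] (code u)).
  apply (le_by_e2 _ _ 9). intros N. destruct (Hp N) as (zs & L & (z & r & E) & H1 & H2).
  destruct (code_ok u g0 eq_refl) as [A1 A2].
  pose proof (A_lower u Hr (code u) g0 z A1 A2) as Lw. cbv zeta in Lw. simpl g_pre in Lw. fold m in Lw.
  assert (Hm : 0 <= m <= 1) by apply slope_01.
  rewrite E, Lin_app, length_app, e2_add, L in Lw. pose proof (Lin_bounds m r Hm) as Lb.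
  pose proof (e2_pos N) as PN. assert (El : 0 < e2 (length r) <= 1).
  { split; [apply e2_pos|]. rewrite <- e2_0. apply e2_le. lia. }
  apply Rabs_le_elim in H1, H2. unfold Lin in Lw at 1.
  assert (e2 N * Lin m r <= e2 N * 1) by (apply Rmult_le_compat_l; lra).
  assert (e2 N * e2 (length r) <= e2 N * 1) by (apply Rmult_le_compat_l; lra).
  assert (m * (fst p - cx zs) <= 2 * e2 N) by nra. lra.
Qed.

(** Membership is reduced to finite streams that approach the point from below, so that no infinite
    stream has to be formed. *)
Lemma tree_set_stream p : (forall N, exists z, (N <= length (digs g0 z))%nat /\
   0 <= fst p - cx (digs g0 z) <= e2 N /\ 0 <= snd p - cy (digs g0 z) <= e2 N) -> tree_set mark p.
Proof.
  intros H N. destruct (H N) as (z & L & H1 & H2). set (d := digs g0 z) in *.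
  assert (Lf : length (firstn N d) = N) by (rewrite length_firstn; lia).
  exists (firstn N d). split; auto. split.
  - exists z, (skipn N d). fold d. now rewrite firstn_skipn.
  - rewrite <- (firstn_skipn N d) in H1, H2. rewrite cx_app, Lf in H1. rewrite cy_app, Lf in H2.
    pose proof (cx_bounds (skipn N d)) as B1. pose proof (cy_bounds (skipn N d)) as B2.
    pose proof (e2_pos (length (skipn N d))). pose proof (e2_pos N).
    assert (0 <= e2 N * cx (skipn N d) <= e2 N) by (split; nra).
    assert (0 <= e2 N * cy (skipn N d) <= e2 N) by (split; nra).
    split; apply Rabs_le; lra.
Qed.

End Curve.

(** * An accepted input breaks through its line *)

Open Scope R_scope.

(** Two vertices lie on the line and the third one, at [c], is [h] below it. As [t] is at least
    halfway from [a] to [c], the edge from [a] to the low vertex is at least [h / 2] below the line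
    at [t], hence reaches the depth [d]. *)
Lemma triangle_in (C : point -> Prop) m l a b c t h d : convex C ->
  C (a, m * a + l) -> C (b, m * b + l) -> C (c, m * c + l - h) ->
  a < t -> t <= c -> t <= b -> c - a <= 2 * (t - a) -> 0 < h -> 0 <= d -> 2 * d <= h ->
  C (t, m * t + l - d).
Proof.
  intros HC Ha Hb Hc L1 L2 L3 L4 Hh Hd Hdh.
  set (r := (t - a) / (c - a)). set (r' := (t - a) / (b - a)).
  assert (E : r * (c - a) = t - a) by (unfold r; field; lra).
  assert (E' : r' * (b - a) = t - a) by (unfold r'; field; lra).
  assert (Br : / 2 <= r <= 1) by (split; nra). assert (Br' : 0 <= r' <= 1) by (split; nra).
  assert (G : C (t, m * t + l - r * h)).
  { replace (t, m * t + l - r * h) with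
      (r * fst (c, m * c + l - h) + (1 - r) * fst (a, m * a + l),
       r * snd (c, m * c + l - h) + (1 - r) * snd (a, m * a + l)).
    - apply HC; auto. lra.
    - simpl. assert (Et : t = r * (c - a) + a) by lra. f_equal; rewrite Et; ring. }
  assert (G' : C (t, m * t + l)).
  { replace (t, m * t + l) with
      (r' * fst (b, m * b + l) + (1 - r') * fst (a, m * a + l),
       r' * snd (b, m * b + l) + (1 - r') * snd (a, m * a + l)).
    - apply HC; auto.
    - simpl. assert (Et : t = r' * (b - a) + a) by lra. f_equal; rewrite Et; ring. }
  set (w := d / (r * h)). assert (P : 0 < r * h) by nra.
  assert (Ew : w * (r * h) = d) by (unfold w; field; split; lra).
  assert (Bw : 0 <= w <= 1).
  { split; [unfold w; apply Rmult_le_pos; auto; left; now apply Rinv_0_lt_compat|].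
    apply (Rmult_le_reg_r (r * h)); auto. rewrite Ew. nra. }
  replace (t, m * t + l - d) with
    (w * fst (t, m * t + l - r * h) + (1 - w) * fst (t, m * t + l),
     w * snd (t, m * t + l - r * h) + (1 - w) * snd (t, m * t + l)).
  - now apply HC.
  - simpl. f_equal; [ring|]. rewrite <- Ew. ring.
Qed.

Lemma cx_bdigs_cons pre b bs : cx (bdigs pre (b :: bs)) = bR b / 2 + eW pre * cx (bdigs pre bs).
Proof.
  change (bdigs pre (b :: bs)) with (blk pre true b ++ bdigs pre bs).
  now rewrite cx_app, cx_blk, blk_length.
Qed.

Lemma cx_bdigs_zeros pre k : cx (bdigs pre (repeat false k)) = 0.
Proof.
  induction k; [reflexivity|]. change (repeat false (S k)) with (false :: repeat false k).
  rewrite cx_bdigs_cons, IHk. simpl. lra.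
Qed.

Lemma bdigs_app pre a b : bdigs pre (a ++ b) = bdigs pre a ++ bdigs pre b.
Proof. apply flat_map_app. Qed.

Definition tdigs (u : str) (bs : list bool) : bits2 := cdigs [] (code u) ++ bdigs (prel (code u)) bs.

Section Accepting.
Variables (M : machine) (phi : str -> str) (u : str) (D : nat).
Hypothesis HD : forall q i w a, (length (mdelta M q i w a) <= D)%nat.

Let pre := prel (code u).
Let m := slope [] (code u).
Let c0 := base m [] (code u).
Let dc := cdigs [] (code u).
Let E := e2 (length dc).
Let eta := eW pre.

Notation dg := (digs M phi).
Notation gsteps := (gsteps M phi).
Notation g0 := (g0 M).
Notation mark := (mark M phi).

Lemma m_sl : m = sl pre.
Proof. unfold m, pre. now rewrite slope_prel. Qed.

(** Cutting the stream off removes the tail of the geometric series, so the truncated point is below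
    the line by exactly this tail. *)
Lemma Lin_tdigs bs : Lin m (tdigs u bs) = c0 - e2 (length (tdigs u bs)) * beta pre.
Proof.
  unfold tdigs. rewrite Lin_cdigs. fold m c0. change ([] ++ prel (code u)) with pre.
  pose proof (Lin_bdigs pre bs []) as L. rewrite app_nil_r in L. fold pre. rewrite m_sl, L.
  rewrite length_app, e2_add. unfold Lin, cx, cy. simpl. ring.
Qed.

Lemma cy_tdigs bs : cy (tdigs u bs) = m * cx (tdigs u bs) + c0 - e2 (length (tdigs u bs)) * beta pre.
Proof. pose proof (Lin_tdigs bs) as L. unfold Lin in L. lra. Qed.

Lemma cx_tdigs bs : cx (tdigs u bs) = cx dc + E * cx (bdigs pre bs).
Proof. unfold tdigs. now rewrite cx_app. Qed.

Lemma digs_code bs : dg g0 (code u ++ bs) = dc ++ dg (gsteps g0 (code u)) bs /\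
  g_pre M (gsteps g0 (code u)) = pre /\ g_u M (gsteps g0 (code u)) = u /\ g_ph M (gsteps g0 (code u)) = PB0 M.
Proof.
  destruct (code_ok M phi u g0 eq_refl) as [A1 A2].
  rewrite digs_app, (Aok_digs M phi _ _ A1). split; [reflexivity|].
  split; [rewrite Aok_pre by auto; reflexivity|]. split; [exact A2|]. now apply Aok_end.
Qed.

Lemma digs_inactive bs : forall g c i, g_ph M g = PB2 M false c i -> dg g bs = bdigs (g_pre M g) bs.
Proof.
  induction bs as [|b bs IH]; intros g c i Hg; auto.
  change (bdigs (g_pre M g) (b :: bs)) with (blk (g_pre M g) true b ++ bdigs (g_pre M g) bs).
  cbn [digs]. unfold block, ge. rewrite Hg. f_equal.
  unfold gstep. rewrite Hg. destruct (mstep M phi (g_u M g) c i b) as [c' i'].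
  erewrite IH; simpl; reflexivity.
Qed.

Lemma digs_start d1 d2 bs : dg g0 (code u ++ d1 :: d2 :: bs) =
  dc ++ blk pre true d1 ++ blk pre true d2 ++
  dg (mkG M pre u (PB2 M (negb d1 && d2) (init_config M) 0)) bs.
Proof.
  destruct (digs_code (d1 :: d2 :: bs)) as (-> & E1 & E2 & E3).
  set (g := gsteps g0 (code u)) in *. f_equal. cbn [digs]. unfold block at 1, ge. rewrite E1, E3. f_equal.
  assert (G1 : gstep M phi g d1 = mkG M pre u (PB1 M d1)) by (unfold gstep; rewrite E1, E2, E3; reflexivity).
  rewrite G1. reflexivity.
Qed.

(** Streams that continue with [00] or [11] never show acceptance, so all last digits are 1 and the
    limit is exactly on the line, whether [u] is accepted or not. The two values of [d] give points
    on either side of the test point. *)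
Lemma inactive_point d : tree_set mark (cx (tdigs u [d; d]), m * cx (tdigs u [d; d]) + c0).
Proof.
  apply tree_set_stream. intros N. exists (code u ++ d :: d :: repeat false N).
  set (bs := d :: d :: repeat false N).
  assert (Ed : dg g0 (code u ++ bs) = tdigs u bs).
  { unfold bs at 1. rewrite digs_start. replace (negb d && d) with false by (destruct d; auto).
    erewrite digs_inactive; simpl; reflexivity. }
  rewrite Ed.
  assert (L : (N <= length (tdigs u bs))%nat).
  { unfold tdigs. rewrite length_app, bdigs_length. unfold bs. simpl length. rewrite repeat_length. nia. }
  split; auto.
  assert (Ex : cx (tdigs u bs) = cx (tdigs u [d; d])).
  { rewrite !cx_tdigs. unfold bs. rewrite !cx_bdigs_cons, cx_bdigs_zeros.
    replace (cx (bdigs pre [])) with 0 by reflexivity. reflexivity. }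
  pose proof (e2_pos N). simpl fst. simpl snd. rewrite cy_tdigs, Ex.
  pose proof (beta_bounds pre). pose proof (eW_bounds pre). pose proof (e2_le _ _ L). pose proof (e2_pos (length (tdigs u bs))).
  split; [lra|]. split; nra.
Qed.

Lemma digs_step act c i b o l : options M u c = o :: l ->
  let g := mkG M pre u (PB2 M act c i) in
  ge M g = true /\ gstep M phi g b = mkG M pre u (if b then PB2 M act c (S i)
     else PB2 M act (apply_act M phi (pick o l i) c) 0).
Proof.
  intros Eo g. split.
  - unfold ge, g; simpl. destruct act; auto. unfold unaccepted. now rewrite Eo.
  - unfold gstep, g; simpl. unfold mstep. rewrite Eo. now destruct b.
Qed.

Lemma reach_bits n c : reach M phi u n c -> exists w, (length w <= D * n)%nat /\
  forall bs, dg (mkG M pre u (PB2 M true (init_config M) 0)) (w ++ bs) =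
    bdigs pre w ++ dg (mkG M pre u (PB2 M true c 0)) bs.
Proof.
  induction 1 as [|n c a H (w & Lw & Hw) Ha].
  - exists []. split; [simpl; lia|auto].
  - destruct (options M u c) as [|o l] eqn:Eo; [destruct Ha|].
    destruct (in_pick l a o Ha) as (i & Hi & Ei).
    exists (w ++ repeat true i ++ [false]). split.
    + rewrite !length_app, repeat_length. simpl.
      assert (S (length l) <= D)%nat by (change (S (length l)) with (length (o :: l)); rewrite <- Eo; apply HD). lia.
    + intros bs. rewrite <- app_assoc, Hw, !bdigs_app, <- !app_assoc. f_equal.
      assert (T : forall i k bs, dg (mkG M pre u (PB2 M true c k)) (repeat true i ++ false :: bs) =
        bdigs pre (repeat true i) ++ blk pre true false ++
        dg (mkG M pre u (PB2 M true (apply_act M phi (pick o l (k + i)) c) 0)) bs).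
      { clear i Hi Ei bs. induction i; intros k bs.
        - simpl app. cbn [digs bdigs flat_map]. destruct (digs_step true c k false o l Eo) as [G1 G2].
          unfold block. rewrite G1, G2, Nat.add_0_r. reflexivity.
        - simpl app. cbn [digs]. destruct (digs_step true c k true o l Eo) as [G1 G2].
          unfold block. rewrite G1, G2, IHi.
          change (bdigs pre (true :: repeat true i)) with (blk pre true true ++ bdigs pre (repeat true i)).
          rewrite <- app_assoc. replace (S k + i)%nat with (k + S i)%nat by lia. reflexivity. }
      change ([false] ++ bs) with (false :: bs). rewrite T, Nat.add_0_l, Ei.
      change (bdigs pre [false]) with (blk pre true false ++ []). now rewrite app_nil_r.
Qed.

(** After acceptance a block with bit 0 consists of zeros only, so the finite expansion is itself
    the limit point, and by [cy_tdigs] it is strictly below the line. *)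
Lemma accept_point n c : reach M phi u n c -> halted M u c -> macc M (c_state c) = true ->
  exists w, (length w <= D * n)%nat /\
   tree_set mark (cx (tdigs u (false :: true :: w)), cy (tdigs u (false :: true :: w))).
Proof.
  intros Hr Hh Ha. destruct (reach_bits n c Hr) as (w & Lw & Hw). exists w. split; auto.
  apply tree_set_stream. intros N. exists (code u ++ false :: true :: w ++ repeat false N).
  rewrite digs_start. cbn [negb andb]. rewrite Hw.
  set (g := mkG M pre u (PB2 M true c 0)).
  assert (Z : forall k, cx (dg g (repeat false k)) = 0 /\ cy (dg g (repeat false k)) = 0 /\
     (k <= length (dg g (repeat false k)))%nat).
  { assert (Eg : ge M g = false).
    { unfold ge, g; simpl. unfold unaccepted. rewrite Hh. now rewrite Ha. }
    assert (Es : gstep M phi g false = g).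
    { unfold gstep, g; simpl. unfold mstep. now rewrite Hh. }
    induction k; [repeat split; unfold cx, cy; simpl; auto|]. cbn [repeat digs].
    destruct IHk as (I1 & I2 & I3). unfold block. rewrite Eg, Es, cx_app, cy_app, cx_blk, cy_blk, I1, I2.
    simpl bR. repeat split; try lra. rewrite length_app, blk_length. lia. }
  destruct (Z N) as (Z1 & Z2 & Z3).
  replace (dc ++ blk pre true false ++ blk pre true true ++ bdigs pre w ++ dg g (repeat false N)) with
    (tdigs u (false :: true :: w) ++ dg g (repeat false N)).
  2:{ unfold tdigs. fold dc pre.
      change (bdigs pre (false :: true :: w)) with (blk pre true false ++ blk pre true true ++ bdigs pre w).
      now rewrite <- !app_assoc. }
  rewrite cx_app, cy_app, Z1, Z2, length_app. simpl fst. simpl snd. pose proof (e2_pos N). split; [lia|]. lra.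
Qed.

(* The test point: a truncated expansion of a point on the line of [u], hence slightly below that line by [cy_tdigs]. *)
Definition tau (T : nat) : bits2 := tdigs u (false :: true :: repeat false T).

(** As [T] exceeds the [D * n] choice bits, the test point has more digits than the accepting point
    and is at most half as far below the line. The bits [01] with which both begin keep their
    abscissas as close as [triangle_in] demands. *)
Lemma tau_accept n T : (exists c, reach M phi u n c /\ halted M u c /\ macc M (c_state c) = true) ->
  (D * n < T)%nat -> conv_hull (tree_set mark) (cx (tau T), cy (tau T)).
Proof.
  intros (c & H1 & H2 & H3) HT. destruct (accept_point n c H1 H2 H3) as (w & Lw & Hw).
  pose proof (inactive_point false) as PA. pose proof (inactive_point true) as PB.
  assert (Ee : 0 < E) by apply e2_pos. pose proof (eW_bounds pre) as Be. fold eta in Be.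
  pose proof (beta_bounds pre) as Bb. fold eta in Bb.
  assert (cxe : cx (bdigs pre []) = 0) by reflexivity.
  assert (XA : cx (tdigs u [false; false]) = cx dc).
  { rewrite cx_tdigs, !cx_bdigs_cons, cxe. simpl. lra. }
  assert (XB : cx (tdigs u [true; true]) = cx dc + E * (/ 2 + eta * / 2)).
  { rewrite cx_tdigs, !cx_bdigs_cons, cxe. fold eta. simpl. lra. }
  assert (XT : cx (tau T) = cx dc + E * (eta * / 2)).
  { unfold tau. rewrite cx_tdigs, !cx_bdigs_cons, cx_bdigs_zeros. fold eta. simpl. lra. }
  set (xi := cx (bdigs pre w)).
  assert (Bxi : 0 <= xi <= 1).
  { pose proof (cx_bounds (bdigs pre w)). pose proof (e2_pos (length (bdigs pre w))). fold xi in H. lra. }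
  assert (XW : cx (tdigs u (false :: true :: w)) = cx dc + E * (eta * (/ 2 + eta * xi))).
  { rewrite cx_tdigs, !cx_bdigs_cons. fold eta xi. simpl. lra. }
  rewrite cy_tdigs in Hw. unfold tau. rewrite cy_tdigs. fold (tau T).
  rewrite XA in PA. rewrite XB in PB. rewrite XT. rewrite XW in Hw.
  assert (Len : e2 (length (tau T)) <= / 2 * e2 (length (tdigs u (false :: true :: w)))).
  { replace (/ 2) with (e2 1) by (unfold e2; simpl; lra). rewrite <- e2_add. apply e2_le.
    unfold tau, tdigs. rewrite !length_app, !bdigs_length. simpl length. rewrite repeat_length. fold pre. nia. }
  pose proof (e2_pos (length (tau T))) as PT.
  assert (0 < E * eta) by (apply Rmult_lt_0_compat; lra).
  assert (0 <= eta * xi <= / 4) by (split; nra).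
  assert (0 <= E * (eta * (eta * xi)) <= E * eta * / 4).
  { rewrite <- Rmult_assoc. split; [apply Rmult_le_pos; lra|apply Rmult_le_compat_l; lra]. }
  apply triangle_in with (a := cx dc) (b := cx dc + E * (/ 2 + eta * / 2)) (c := cx dc + E * (eta * (/ 2 + eta * xi)))
    (h := e2 (length (tdigs u (false :: true :: w))) * beta pre).
  - apply conv_hull_convex.
  - now apply conv_hull_incl.
  - now apply conv_hull_incl.
  - now apply conv_hull_incl.
  - lra.
  - lra.
  - lra.
  - lra.
  - apply Rmult_lt_0_compat; [apply e2_pos|lra].
  - apply Rmult_le_pos; lra.
  - rewrite <- Rmult_assoc. apply Rmult_le_compat_r; lra.
Qed.

(** The test point is [e2 len * beta pre] below a line whose slope is in [0,1], hence at least half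
    of that away from the half-plane above. As [beta pre] is at least [eW pre], and this at least
    [e2 len], precision [2 * len + 3] detects the gap. *)
Lemma tau_reject T : ~ accepts M phi u ->
  dist_gt (cx (tau T), cy (tau T)) (conv_hull (tree_set mark)) (2 * e2 (2 * length (tau T) + 3)).
Proof.
  intros Hr. set (len := length (tau T)).
  assert (HL : forall q, conv_hull (tree_set mark) q -> c0 <= snd q - m * fst q).
  { intros q Hq. apply (Hq (fun q => c0 <= snd q - m * fst q)).
    - intros p q' t Ht Hp Hq'. simpl. nra.
    - apply (tree_below M phi u m c0); auto. }
  pose proof (eW_bounds pre) as Be. pose proof (beta_bounds pre) as Bb.
  assert (Wl : e2 len <= eW pre).
  { apply e2_le. unfold len, tau, tdigs. rewrite length_app, bdigs_length. simpl length. fold pre. nia. }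
  pose proof (e2_pos len) as Pl.
  assert (Dd : e2 (2 * len) <= e2 len * beta pre).
  { replace (2 * len)%nat with (len + len)%nat by lia. rewrite e2_add. apply Rmult_le_compat_l; lra. }
  pose proof (e2_pos (2 * len)) as P2. assert (Hm : 0 <= m <= 1) by apply slope_01.
  exists (e2 len * beta pre / 2). split.
  - rewrite e2_add. replace (e2 3) with (/ 8) by (unfold e2; simpl; lra). lra.
  - intros q Hq. specialize (HL q Hq). unfold tau. rewrite cy_tdigs. fold (tau T). fold len.
    set (t := (cx (tau T), m * cx (tau T) + c0 - e2 len * beta pre) : point).
    pose proof (eucl_ge_fst t q) as G1. pose proof (eucl_ge_snd t q) as G2.
    set (d := eucl t q) in *. apply Rabs_le_elim in G1, G2. unfold t in G1, G2. simpl in G1, G2.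
    assert (m * (cx (tau T) - fst q) <= d) by nra. lra.
Qed.

End Accepting.

Open Scope nat_scope.

(** * The query transformer of the reduction *)

Fixpoint ems (l : bits2) : frag STK unit :=
  match l with [] => sret tt | (a, b) :: l => push 7 a ;;; push 8 b ;;; ems l end.

Definition emitted (s : store) (l : bits2) : store :=
  setk (setk s 7 (rev (map fst l) ++ s_stk s 7)) 8 (rev (map snd l) ++ s_stk s 8).

Lemma emitted_app s l l' : emitted (emitted s l) l' = emitted s (l ++ l').
Proof.
  unfold emitted. rewrite !map_app, !rev_app_distr, <- !app_assoc. sext.
Qed.

Lemma ems_ok l : forall e s (Q : unit -> store -> Prop), Q tt (emitted s l) ->
  sp (ems l) e (2 * length l + 1) s Q.
Proof.
  induction l as [|[a b] l IH]; intros e s Q HQ; cbn [ems].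
  - apply (sp_le _ _ 1); [sstep|simpl; lia]. unfold emitted in HQ. simpl in HQ. rewrite (setk_self s 7), setk_self in HQ; auto.
  - apply (sp_le _ _ (S (S (2 * length l + 1)))); [sstep; sstep; apply IH|simpl; lia].
    eapply eq_ind; [exact HQ|]. change ((a, b) :: l) with ([(a, b)] ++ l). rewrite <- emitted_app. reflexivity.
Qed.

(** Stack 5 keeps [pre] in reverse, so that extending it after a code bit takes two pushes; stack 6
    serves to traverse it in the right order while it is restored. *)
Definition emitblk (b : bool) : frag STK unit :=
  ems [(b, false)] ;;; mov 5 6 ;;; foreach 6 (fun d => push 5 d ;;; ems [(false, b && d)]) ;;;
  ems ((false, false) :: (false, false) :: (false, b) :: repeat (false, false) 4 ++ [(false, true)]).

Lemma emitblk_ok e b pre s (Q : unit -> store -> Prop) :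
  s_stk s 5 = rev pre -> s_stk s 6 = [] ->
  Q tt (emitted s (blk pre true b)) ->
  sp (emitblk b) e (9 * length pre + 30) s Q.
Proof.
  intros E5 E6 HQ.
  apply (sp_le _ _ (3 + ((3 * length pre + 2) + (((4 + 2) * length pre + 2) + 17)))); [|lia].
  unfold emitblk. apply sp_bind. apply (ems_ok [(b, false)]). set (s1 := emitted _ _).
  assert (H5 : s_stk s1 5 = rev pre) by exact E5. assert (H6 : s_stk s1 6 = []) by exact E6.
  apply sp_bind. rewrite <- (length_rev pre) at 1. eapply mov_ok; [lia|exact H5|].
  rewrite rev_involutive, H6, app_nil_r. apply sp_bind.
  apply (foreach_ok e 6 _ 4 (fun r s' => exists p, pre = p ++ r /\
    s' = setk (setk (emitted s1 (map (fun d => (false, b && d)) p)) 5 (rev p)) 6 r)) with (l := pre).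
  - intros r s' (p & _ & ->). apply stk_eq.
  - intros d r s' (p & Ep & ->). sstep. eapply sp_le; [apply (ems_ok [(false, b && d)])|simpl; lia].
    exists (p ++ [d]). split; [now rewrite <- app_assoc|].
    rewrite map_app, <- emitted_app. simpl map. unfold emitted. simpl rev. rewrite rev_app_distr. simpl.
    sext.
  - intros s' (p & Ep & ->). rewrite app_nil_r in Ep. subst p.
    eapply sp_le; [apply ems_ok|simpl; lia]. eapply eq_ind; [exact HQ|].
    unfold blk. rewrite map_app.
    change ((b, false) :: ?x) with ([(b, false)] ++ x). rewrite <- emitted_app. fold s1. rewrite <- app_assoc, <- emitted_app.
    replace (map (fun d => (false, b && d)) [false; false; true] ++ repeat (false, false) 4 ++ [(false, true)]) with
      ((false, false) :: (false, false) :: (false, b) :: repeat (false, false) 4 ++ [(false, true)]).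
    + set (l0 := (false, false) :: _). set (s2 := emitted s1 _).
      assert (K5 : s_stk s2 5 = rev pre) by exact H5. assert (K6 : s_stk s2 6 = []) by exact H6.
      f_equal. sext.
    + destruct b; reflexivity.
  - exists []. split; auto. simpl map. simpl rev. unfold emitted. simpl rev. simpl app. sext.
Qed.

Definition rdcode : frag STK unit :=
  iter (fun _ : unit => c <- inp MR ;; match c with
    | None => sret (inr tt)
    | Some a => pushes 1 (true :: enc3 (Some a)) ;;; push 0 true ;;; sret (inl tt) end) tt.

Lemma rdcode_ok phi u : forall w s i (Q : unit -> store -> Prop), skipn i u = w ->
  (forall i', Q tt (at_ip (setk (setk s 1 (rev (flat_map (fun a => true :: enc3 (Some a)) w) ++ s_stk s 1))
        0 (repeat true (length w) ++ s_stk s 0)) i')) ->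
  sp rdcode (phi, u) (8 * length w + 2) (at_ip s i) Q.
Proof.
  induction w as [|a w IH]; intros s i Q E HQ.
  - eapply sp_le; [eapply (sp_iter _ _ (phi, u) 2 0)|lia]. sstep.
    cbn [at_ip onO s_o o_ip]. rewrite nth_error_skipn_hd, E. cbn [hd_error]. sstep.
    specialize (HQ (S i)). simpl in HQ. rewrite (setk_self s 1), setk_self in HQ by auto. exact HQ.
  - eapply sp_le; [eapply (sp_iter _ _ (phi, u) (1 + (5 + 2)) (8 * length w + 2))|simpl; lia]. sstep.
    cbn [at_ip onO s_o o_ip]. rewrite nth_error_skipn_hd, E. cbn [hd_error].
    apply sp_bind. eapply sp_le; [apply pushes_ok|destruct a; simpl; lia]. sstep. sstep.
    match goal with |- sp _ _ _ ?st _ => replace st with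
      (at_ip (setk (setk s 1 (rev (true :: enc3 (Some a)) ++ s_stk s 1)) 0 (true :: s_stk s 0)) (i + 1)) end.
    + apply IH.
      * apply (skipn_cut i u [a]). exact E.
      * intros i'. eapply eq_ind; [apply (HQ i')|]. f_equal.
        change (flat_map ?f (a :: w)) with ((true :: enc3 (Some a)) ++ flat_map f w).
        rewrite rev_app_distr, <- app_assoc. lks.
        change (repeat true (length (a :: w))) with (true :: repeat true (length w)).
        rewrite <- repeat_snoc, <- app_assoc. simpl ([true] ++ _). sext.
    + apply store_ext.
      * unfold o_move; simpl. f_equal. lia.
      * intros x. cbn [setk s_stk at_ip onO]. eqbs; auto.
Qed.

Definition said (s : store) (w : str) : store :=
  onO s (fun o => mkO (o_ip o) (o_qry o) (o_ans o) (o_apos o) (o_out o ++ w) (o_ch o)).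

Lemma said_app s w w' : said (said s w) w' = said s (w ++ w').
Proof. unfold said, onO. simpl. now rewrite <- app_assoc. Qed.
Lemma said_nil s : said s [] = s.
Proof. unfold said, onO. rewrite app_nil_r. destruct s as [[] ?]; reflexivity. Qed.
Lemma said_setk s w j l : setk (said s w) j l = said (setk s j l) w.
Proof. reflexivity. Qed.
Lemma said_stk s w j : s_stk (said s w) j = s_stk s j.
Proof. reflexivity. Qed.

(** The unary copy left on [k] remembers the number of digits, from which the zeros of the
    denominators and the precision are written later. *)
Definition sayeach j (f : bool -> str) k : frag STK unit :=
  foreach j (fun b => outs (f b) ;;; push k true).

Lemma sayeach_ok e j f k c l s (Q : unit -> store -> Prop) : j <> k -> (forall b, length (f b) <= c) ->
  s_stk s j = l -> s_stk s k = [] ->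
  Q tt (said (setk (setk s j []) k (repeat true (length l))) (flat_map f l)) ->
  sp (sayeach j f k) e ((c + 4) * length l + 2) s Q.
Proof.
  intros N Hf El Ek HQ. replace (c + 4) with (c + 2 + 2) by lia.
  apply (foreach_ok e j _ (c + 2) (fun r s' => exists p, l = p ++ r /\
    s' = said (setk (setk s j r) k (repeat true (length p))) (flat_map f p))).
  - intros r s' (p & _ & ->). rewrite said_stk. lks. auto.
  - intros b r s' (p & Ep & ->). eapply (sp_le _ _ ((length (f b) + 1) + 1)); [apply sp_bind, outs_ok; sstep|specialize (Hf b); lia].
    exists (p ++ [b]). split; [now rewrite <- app_assoc|].
    rewrite flat_map_app, length_app, Nat.add_comm, <- said_app. simpl flat_map. rewrite app_nil_r.
    apply store_ext; [reflexivity|]. intros x. cbn [setk s_stk said onO]. eqbs; auto; congruence.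
  - intros s' (p & Ep & ->). rewrite app_nil_r in Ep. subst p. exact HQ.
  - exists []. split; auto. simpl. rewrite said_nil. simpl repeat. sext.
Qed.

(** Two symbols per tick are the doubled zero of a paired word; for the last component, which is not
    doubled, they give the factor 2 in the precision [2 * length ds + 3]. *)
Definition sayzeros j k : frag STK unit := sayeach j (fun _ => [s0; s0]) k.

Definition drawF (P : sopoly) : frag STK unit :=
  rdcode ;;; push 1 false ;;; eval 0 P 10 ;;; mov 1 3 ;;;
  foreach 3 (fun b => emitblk b ;;; push 5 false ;;; push 5 b) ;;;
  emitblk false ;;; emitblk true ;;; foreach 10 (fun _ => emitblk false).

Definition sayF : frag STK unit :=
  outs (dbl [splus]) ;;; sayeach 11 (fun b => dbl [encb b]) 12 ;;; outs (dbl [sslash; s1]) ;;;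
  sayzeros 12 13 ;;; outs [s0; s1] ;;;
  outs (dbl [splus]) ;;; sayeach 14 (fun b => dbl [encb b]) 15 ;;; outs (dbl [sslash; s1]) ;;;
  sayzeros 13 16 ;;; outs [s0; s1] ;;;
  sayzeros 16 17 ;;; outs [s0; s0; s0].

Definition tF (P : sopoly) : frag STK bool :=
  drawF P ;;; mov 7 11 ;;; mov 8 14 ;;; sayF ;;; sret true.

Definition tquery (ds : bits2) : str :=
  triple_str (dystr false (map fst ds) (length ds)) (dystr false (map snd ds) (length ds))
    (repeat s0 (2 * length ds + 3)).

Lemma flat_map_dbl_encb l : flat_map (fun b => dbl [encb b]) l = dbl (map encb l).
Proof. unfold dbl. rewrite flat_map_concat_map, flat_map_concat_map, map_map. reflexivity. Qed.

Lemma flat_map_zeros {A} (l : list A) : flat_map (fun _ => [s0; s0]) l = dbl (repeat s0 (length l)).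
Proof. unfold dbl. induction l; simpl; congruence. Qed.

Lemma dbl_repeat_s0 n : dbl (repeat s0 n) = repeat s0 (2 * n).
Proof.
  induction n; auto. replace (2 * S n) with (S (S (2 * n))) by lia. unfold dbl in *. simpl. now rewrite IHn.
Qed.

Lemma cdigs_length_bound v : forall pre, length (cdigs pre v) <= length v * (length pre + 2 * length v + 9).
Proof.
  induction v as [|b v IH]; intros pre; [simpl; lia|].
  change (cdigs pre (b :: v)) with (blk pre true b ++ cdigs (pre ++ [false; b]) v).
  specialize (IH (pre ++ [false; b])). rewrite length_app in IH. simpl (length [false; b]) in IH.
  rewrite length_app, blk_length. simpl length. nia.
Qed.

Lemma prel_length v : length (prel v) = 2 * length v.
Proof. induction v; simpl; lia. Qed.

Lemma cdigs_snoc b p : forall pre, cdigs pre (p ++ [b]) = cdigs pre p ++ blk (pre ++ prel p) true b.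
Proof.
  induction p as [|a p IH]; intros pre; [simpl; now rewrite !app_nil_r|].
  change (cdigs pre ((a :: p) ++ [b])) with (blk pre true a ++ cdigs (pre ++ [false; a]) (p ++ [b])).
  change (cdigs pre (a :: p)) with (blk pre true a ++ cdigs (pre ++ [false; a]) p).
  change (prel (a :: p)) with ([false; a] ++ prel p). now rewrite IH, !app_assoc.
Qed.

Lemma rev_prel_snoc p b : rev (prel (p ++ [b])) = b :: false :: rev (prel p).
Proof. unfold prel. rewrite flat_map_app, rev_app_distr. reflexivity. Qed.

Lemma sayF_ok e ds s (Q : unit -> store -> Prop) :
  s_stk s 11 = map fst ds -> s_stk s 14 = map snd ds ->
  (forall j, j = 12 \/ j = 13 \/ 15 <= j -> s_stk s j = []) -> o_out (s_o s) = [] ->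
  (forall s', o_out (s_o s') = tquery ds -> Q tt s') ->
  sp sayF e (30 * length ds + 40) s Q.
Proof.
  intros U11 U14 Ue O8 HQ.
  assert (LF : forall A (f : bool * bool -> A), length (map f ds) = length ds) by (intros; apply length_map).
  set (L := length ds) in *.
  apply (sp_le _ _ (3 + (((2 + 4) * L + 2) + (5 + (((2 + 4) * L + 2) + (3 +
    (3 + (((2 + 4) * L + 2) + (5 + (((2 + 4) * L + 2) + (3 +
    (((2 + 4) * L + 2) + 4)))))))))))); [|lia].
  unfold sayF.
  apply sp_bind. apply (outs_ok (dbl [splus])). change (onO s _) with (said s (dbl [splus])).
  apply sp_bind. rewrite <- (LF _ fst) at 1. eapply sayeach_ok; [lia|intros b; simpl; lia|exact U11|apply Ue; lia|].
  rewrite flat_map_dbl_encb, said_setk, said_setk, said_app, LF.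
  apply sp_bind. apply (outs_ok (dbl [sslash; s1])). match goal with |- sp _ _ _ (onO ?s _) _ => change (onO s _) with (said s (dbl [sslash; s1])) end.
  rewrite said_app.
  apply sp_bind. rewrite <- (repeat_length true L) at 1. eapply sayeach_ok; [lia|intros b; simpl; lia|rewrite said_stk; lks; reflexivity|rewrite said_stk; lks; apply Ue; lia|].
  rewrite repeat_length, flat_map_zeros, repeat_length, !said_setk, said_app.
  apply sp_bind. apply (outs_ok [s0; s1]). match goal with |- sp _ _ _ (onO ?s _) _ => change (onO s _) with (said s [s0; s1]) end.
  rewrite said_app.
  apply sp_bind. apply (outs_ok (dbl [splus])). match goal with |- sp _ _ _ (onO ?s _) _ => change (onO s _) with (said s (dbl [splus])) end.
  rewrite said_app.
  apply sp_bind. rewrite <- (LF _ snd) at 1. eapply sayeach_ok; [lia|intros b; simpl; lia|rewrite said_stk; lks; exact U14|rewrite said_stk; lks; apply Ue; lia|].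
  rewrite flat_map_dbl_encb, !said_setk, said_app, LF.
  apply sp_bind. apply (outs_ok (dbl [sslash; s1])). match goal with |- sp _ _ _ (onO ?s _) _ => change (onO s _) with (said s (dbl [sslash; s1])) end.
  rewrite said_app.
  apply sp_bind. rewrite <- (repeat_length true L) at 1. eapply sayeach_ok; [lia|intros b; simpl; lia|rewrite said_stk; lks; reflexivity|rewrite said_stk; lks; apply Ue; lia|].
  rewrite repeat_length, flat_map_zeros, repeat_length, !said_setk, said_app.
  apply sp_bind. apply (outs_ok [s0; s1]). match goal with |- sp _ _ _ (onO ?s _) _ => change (onO s _) with (said s [s0; s1]) end.
  rewrite said_app.
  apply sp_bind. rewrite <- (repeat_length true L) at 1. eapply sayeach_ok; [lia|intros b; simpl; lia|rewrite said_stk; lks; reflexivity|rewrite said_stk; lks; apply Ue; lia|].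
  rewrite repeat_length, flat_map_zeros, repeat_length, !said_setk, said_app.
  apply (outs_ok [s0; s0; s0]). match goal with |- Q tt (onO ?s _) => change (onO s _) with (said s [s0; s0; s0]) end.
  rewrite said_app. apply HQ. cbn [said onO s_o o_out setk]. rewrite O8, app_nil_l.
  unfold tquery, triple_str, pair_str. change (flat_map (fun a => [a; a]) ?x) with (dbl x). fold L.
  unfold dystr. change (splus :: ?x) with ([splus] ++ x). rewrite !dbl_app.
  rewrite (repeat_app s0 (2 * L) 3), <- dbl_repeat_s0. rewrite <- !app_assoc. reflexivity.
Qed.

Definition dcost (v K c : nat) : nat := 15 * K + c + (18 * K + 36) * (K + 2 + v) + 20.

Lemma drawF_ok phi u P s (Q : unit -> store -> Prop) :
  initial s [] ->
  let v := sop_eval P (sizef phi) (length u) in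
  let ds := tau u v in
  (forall s', s_stk s' 7 = rev (map fst ds) -> s_stk s' 8 = rev (map snd ds) ->
    (forall j, 11 <= j -> s_stk s' j = []) -> o_out (s_o s') = [] -> Q tt s') ->
  sp (drawF P) (phi, u) (dcost v (length (code u)) (sop_eval (ecost P) (sizef phi) (length u))) s Q.
Proof.
  intros (I1 & I2 & I3 & I4 & I5) v ds HQ. set (K := length (code u)).
  set (c := sop_eval (ecost P) (sizef phi) (length u)).
  assert (HK : K = 4 * length u + 1) by apply code_length.
  apply (sp_le _ _ ((8 * length u + 2) + (1 + (c + ((3 * K + 2) + (((18 * K + 32 + 2) * K + 2) +
    ((18 * K + 30) + ((18 * K + 30) + ((18 * K + 30 + 2) * v + 2))))))))).
  2:{ unfold dcost. assert (X : (18 * K + 32 + 2) * K + (18 * K + 30 + 2) * v <= (18 * K + 36) * (K + v)) by nia.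
      replace ((18 * K + 36) * (K + 2 + v)) with ((18 * K + 36) * (K + v) + 2 * (18 * K + 36)) by ring.
      generalize dependent ((18 * K + 36) * (K + v)). generalize dependent ((18 * K + 32 + 2) * K).
      generalize dependent ((18 * K + 30 + 2) * v). intros. lia. }
  unfold drawF. apply sp_bind. replace s with (at_ip s 0).
  2:{ destruct s as [[] ?]; unfold at_ip, onO; simpl in *; congruence. }
  apply (rdcode_ok phi u u); [reflexivity|]. intros i'. sstep.
  rewrite !I5, !app_nil_r.
  match goal with |- sp _ _ _ ?st _ => set (s1 := st) end.
  assert (S1 : s_stk s1 1 = rev (code u)).
  { unfold s1. cbn [setk s_stk Nat.eqb at_ip onO]. unfold code. now rewrite rev_app_distr. }
  assert (S0 : s_stk s1 0 = repeat true (length u)) by reflexivity.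
  assert (Se : forall j, 2 <= j -> s_stk s1 j = []).
  { intros j Hj. unfold s1. cbn [setk s_stk at_ip onO]. eqbs. apply I5. }
  assert (So : o_qry (s_o s1) = [] /\ o_out (s_o s1) = []) by (simpl; auto). clearbody s1.
  apply sp_bind. apply eval_ok with (n := length u); auto; [lia|intros; apply Se; lia|tauto|].
  cbn [fst]. fold v. intros o' (_ & _ & Eo & _). destruct So as [_ So]. rewrite So in Eo.
  set (s2 := setk (mkS o' (s_stk s1)) 10 (repeat true v)).
  apply sp_bind. unfold K. rewrite <- (length_rev (code u)) at 1. eapply mov_ok; [lia|exact S1|].
  rewrite rev_involutive. unfold s2 at 2. rewrite stk_neq by lia. cbn [s_stk]. rewrite Se, app_nil_r by lia.
  match goal with |- sp _ _ _ ?st _ => set (s3 := st) end. set (Kc := code u) in *. fold K.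
  assert (T3 : forall j, s_stk s3 j = match j with 0 => repeat true (length u) | 3 => Kc | 10 => repeat true v | _ => [] end).
  { intros j. unfold s3, s2. cbn [setk s_stk]. do 11 (destruct j as [|j]; [cbn [Nat.eqb]; auto; apply Se; lia|]).
    cbn [Nat.eqb]. apply Se. lia. }
  assert (O3 : o_out (s_o s3) = []) by (symmetry; exact Eo).
  clearbody s3. clear s2 Se S1 S0.
  apply sp_bind.
  apply (foreach_ok (phi, u) 3 _ (18 * K + 32) (fun r s' => exists p, Kc = p ++ r /\
    s' = setk (setk (emitted s3 (cdigs [] p)) 5 (rev (prel p))) 3 r)) with (l := Kc).
  { intros r s' (p & _ & ->). apply stk_eq. }
  { intros b r s' (p & Ep & ->).
    assert (Lp : length (prel p) <= 2 * K).
    { rewrite prel_length. unfold K. rewrite Ep, length_app. lia. }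
    apply (sp_le _ _ ((9 * length (prel p) + 30) + 2)); [|lia].
    apply sp_bind. apply (emitblk_ok _ b (prel p)).
    - reflexivity.
    - cbn. apply T3.
    - sstep. sstep. exists (p ++ [b]). split; [now rewrite <- app_assoc|].
      rewrite cdigs_snoc, <- emitted_app. simpl ([] ++ prel p).
      rewrite rev_prel_snoc.
      set (s4 := emitted s3 (cdigs [] p)). set (bl := blk (prel p) true b).
      unfold emitted. fold (prel p). sext. }
  2:{ exists []. split; auto. unfold emitted.
      pose proof (T3 5) as T5. pose proof (T3 3) as T33. pose proof (T3 7) as T7. pose proof (T3 8) as T8. cbn in T5, T33, T7, T8. simpl. sext. }
  intros s' (p & Ep & ->). rewrite app_nil_r in Ep. subst p.
  set (pre := prel Kc) in *.
  assert (Lp : length pre = 2 * K) by apply prel_length.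
  apply sp_bind. eapply sp_le; [apply (emitblk_ok _ false pre); [reflexivity|cbn; apply T3|]|lia].
  apply sp_bind. eapply sp_le; [apply (emitblk_ok _ true pre); [reflexivity|cbn; apply T3|]|lia].
  set (s5 := setk (setk s3 5 (rev pre)) 3 []).
  match goal with |- sp _ _ _ ?st _ => replace st with (emitted s5 (cdigs [] Kc ++ blk pre true false ++ blk pre true true)) end.
  2:{ rewrite <- !emitted_app. set (b1 := blk pre true false). set (b2 := blk pre true true). set (cd := cdigs [] Kc).
      unfold s5, emitted. sext. }
  set (d2 := cdigs [] Kc ++ blk pre true false ++ blk pre true true).
  assert (Eds : ds = d2 ++ bdigs pre (repeat false v)).
  { unfold ds, tau, tdigs, d2. fold Kc pre.
    change (bdigs pre (false :: true :: repeat false v)) with (blk pre true false ++ blk pre true true ++ bdigs pre (repeat false v)).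
    now rewrite <- !app_assoc. }
  replace ((18 * K + 30 + 2) * v) with ((18 * K + 30 + 2) * length (repeat true v)) by (now rewrite repeat_length).
  apply (foreach_ok (phi, u) 10 _ (18 * K + 30) (fun r s' => exists k, k + length r = v /\
     s' = setk (emitted s5 (d2 ++ bdigs pre (repeat false k))) 10 r)).
  { intros r s' (k & _ & ->). apply stk_eq. }
  { intros b r s' (k & Ek & ->). simpl in Ek. eapply sp_le; [apply (emitblk_ok _ false pre)|lia].
    - reflexivity.
    - cbn. apply T3.
    - exists (S k). split; [lia|]. simpl repeat. rewrite <- repeat_snoc, bdigs_app, app_assoc, <- (emitted_app s5 (d2 ++ _)).
      change (bdigs pre [false]) with (blk pre true false ++ []). rewrite app_nil_r.
      set (s6 := emitted s5 _). set (bl := blk pre true false). unfold emitted. sext. }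
  2:{ exists 0. rewrite repeat_length. split; auto. simpl. rewrite app_nil_r. symmetry. apply setk_self. cbn. apply T3. }
  intros s' (k & Ek & ->). simpl in Ek. rewrite Nat.add_0_r in Ek. subst k. rewrite <- Eds.
  set (s7 := setk (emitted s5 ds) 10 []).
  assert (T7 : s_stk s7 7 = rev (map fst ds)).
  { unfold s7, s5. cbn. rewrite T3. apply app_nil_r. }
  assert (T8 : s_stk s7 8 = rev (map snd ds)).
  { unfold s7, s5. cbn. rewrite T3. apply app_nil_r. }
  assert (T11 : forall j, 11 <= j -> s_stk s7 j = []).
  { intros j Hj. unfold s7, s5, emitted. cbn [setk s_stk]. eqbs. rewrite T3. do 11 (destruct j as [|j]; [lia|]). auto. }
  apply HQ; auto.
Qed.

Definition tcost (v K c L : nat) : nat := dcost v K c + 40 * L + 60.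

Lemma tF_ok phi u P s (Q : bool -> store -> Prop) :
  initial s [] ->
  let v := sop_eval P (sizef phi) (length u) in
  let ds := tau u v in
  (forall s', o_out (s_o s') = tquery ds -> Q true s') ->
  sp (tF P) (phi, u) (tcost v (length (code u)) (sop_eval (ecost P) (sizef phi) (length u)) (length ds)) s Q.
Proof.
  intros Hi v ds HQ. set (K := length (code u)). set (c := sop_eval (ecost P) (sizef phi) (length u)).
  apply (sp_le _ _ (dcost v K c + ((3 * length ds + 2) + ((3 * length ds + 2) + ((30 * length ds + 40) + 1))))); [|unfold tcost; lia].
  unfold tF. apply sp_bind, drawF_ok; auto. fold v. fold ds. intros s7 T7 T8 T11 O7.
  clear - T7 T8 T11 O7 HQ. clearbody ds.
  assert (LF : forall A (f : bool * bool -> A), length (map f ds) = length ds) by (intros; apply length_map).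
  apply sp_bind. rewrite <- (LF _ fst) at 1. rewrite <- length_rev at 1. eapply mov_ok; [lia|exact T7|].
  rewrite rev_involutive, (T11 11), app_nil_r by lia.
  apply sp_bind. rewrite <- (LF _ snd) at 1. rewrite <- length_rev at 1. eapply mov_ok; [lia|lks; exact T8|].
  rewrite rev_involutive. lks. rewrite (T11 14), app_nil_r by lia.
  match goal with |- sp _ _ _ ?st _ => set (s8 := st) end.
  assert (U11 : s_stk s8 11 = map fst ds) by reflexivity. assert (U14 : s_stk s8 14 = map snd ds) by reflexivity.
  assert (Ue : forall j, j = 12 \/ j = 13 \/ 15 <= j -> s_stk s8 j = []).
  { intros j Hj. unfold s8. cbn [setk s_stk]. eqbs. apply T11. lia. }
  assert (O8 : o_out (s_o s8) = []) by exact O7. clearbody s8. clear s7 T7 T8 T11 O7.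
  apply sp_bind, sayF_ok; auto. intros s' Hs. sstep. auto.
Qed.

Lemma ems_nochoose l : sfall nochoose (ems l).
Proof. induction l as [|[a b] l IH]; cbn [ems]; fall_auto nochoose_map. Qed.

Lemma tF_nochoose P : sfall nochoose (tF P).
Proof.
  unfold tF, drawF, sayF, rdcode, emitblk, sayzeros, sayeach, mov, foreach. fall_auto nochoose_map;
    auto using eval_nochoose, outs_nochoose, ems_nochoose, pushes_nochoose.
Qed.

Lemma sop_eval_mono P L n m : (forall a b, a <= b -> L a <= L b) -> n <= m -> sop_eval P L n <= sop_eval P L m.
Proof. intros HL H. induction P; simpl; auto; nia. Qed.

Lemma sizef_mono phi : regular phi -> forall a b, a <= b -> sizef phi a <= sizef phi b.
Proof. intros H a b L. apply H. now rewrite !repeat_length. Qed.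

Lemma cdigs_length_mono v : forall pre v' pre', length pre <= length pre' -> length v <= length v' ->
  length (cdigs pre v) <= length (cdigs pre' v').
Proof.
  induction v as [|b v IH]; intros pre [|b' v'] pre' H1 H2; simpl length in H2; try (simpl; lia).
  change (cdigs pre (b :: v)) with (blk pre true b ++ cdigs (pre ++ [false; b]) v).
  change (cdigs pre' (b' :: v')) with (blk pre' true b' ++ cdigs (pre' ++ [false; b']) v').
  rewrite !length_app, !blk_length. specialize (IH (pre ++ [false; b]) v' (pre' ++ [false; b'])).
  rewrite !length_app in IH. simpl in IH. lia.
Qed.

Lemma tau_length u T :
  length (tau u T) = length (cdigs [] (code u)) + (T + 2) * (2 * length (code u) + 9).
Proof.
  unfold tau, tdigs. rewrite length_app, bdigs_length, prel_length. simpl length. rewrite repeat_length. lia.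
Qed.

Lemma tquery_length ds : length (tquery ds) = 10 * length ds + 19.
Proof.
  unfold tquery, triple_str, pair_str. change (flat_map (fun a => [a; a]) ?x) with (dbl x).
  rewrite !length_app, !dbl_length, !dystr_length, !length_map, repeat_length. simpl (length [s0; s1]). lia.
Qed.

(** The polynomial bounds the number of choice bits in advance, so the depth of the test point is
    found without simulating anything. *)
Definition qmap (P : sopoly) (phi : str -> str) (u : str) : str :=
  tquery (tau u (sop_eval P (sizef phi) (length u))).

(** The query length is a monotone function of the length of [u]: all symbols have codes of equal
    length, and the length of a block ignores its contents. *)
Lemma qmap_regular P phi : regular phi -> regular (qmap P phi).
Proof.
  intros Hphi u v L. unfold qmap. rewrite !tquery_length, !tau_length.
  assert (Lc : length (code u) <= length (code v)) by (rewrite !code_length; lia).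
  pose proof (cdigs_length_mono (code u) [] (code v) [] (le_n _) Lc).
  pose proof (sop_eval_mono P (sizef phi) _ _ (sizef_mono phi Hphi) L).
  set (a := sop_eval P _ _) in *. set (b := sop_eval P _ (length v)) in *.
  assert ((a + 2) * (2 * length (code u) + 9) <= (b + 2) * (2 * length (code v) + 9)) by (apply Nat.mul_le_mono; lia).
  lia.
Qed.

Definition tpoly (P : sopoly) : sopoly :=
  let K := SAdd (kc 3 SVar) (SConst 0) in
  let W := SAdd (kc 1 K) (SConst 8) in
  SAdd (SAdd (kc 14 K) (ecost P))
    (SAdd (SMul (SAdd (kc 17 K) (SConst 35)) (SAdd (SAdd K (SConst 1)) P))
      (SAdd (kc 39 (SAdd (SMul K W) (SMul (SAdd P (SConst 1)) W))) (SConst 79))).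

Lemma tpoly_ok P phi u :
  let v := sop_eval P (sizef phi) (length u) in
  tcost v (length (code u)) (sop_eval (ecost P) (sizef phi) (length u)) (length (tau u v)) <=
  sop_eval (tpoly P) (sizef phi) (length u).
Proof.
  intros v. unfold tpoly, kc. cbn [sop_eval]. fold v. rewrite tau_length.
  pose proof (cdigs_length_bound (code u) []) as B. rewrite code_length in *. simpl length in B.
  set (c := sop_eval (ecost P) _ _). set (n := length u) in *. unfold tcost, dcost.
  set (K := 4 * n + 1) in *.
  set (X := (18 * K + 36) * (K + 2 + v)).
  set (W := 2 * K + 9) in *.
  replace (0 + 2 * K + 9) with W in B by (unfold W; lia).
  set (L := length (cdigs [] (code u))) in *.
  set (Y := (v + 2) * W).
  lia.
Qed.

(** Without [Choose] there is only one run, which is represented by the empty list of choices. *)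
Lemma FP2_of_program F P fin s : sfall nochoose F -> (forall phi, regular phi -> regular (s phi)) ->
  (forall phi u, regular phi -> s phi u = snd (result F P fin phi u [])) -> FP2_total s.
Proof.
  intros H1 H2 H3. split; auto. exists (mach F P fin), (mtime F P fin).
  split; [now apply mach_det|]. split; [apply mach_runs|].
  intros phi Hphi u. destruct (mach_halts F P fin phi u []) as (n & c & R1 & R2 & _ & R3).
  exists n, c. rewrite H3; auto.
Qed.

Lemma qmap_FP2 P : FP2_total (qmap P).
Proof.
  apply (FP2_of_program (tF P) (tpoly P) (fun _ => [])); [apply tF_nochoose|apply qmap_regular|].
  intros phi u _. symmetry.
  apply (result_run (tF P) (tpoly P) (fun _ => []) phi u [] (fun _ w => w = qmap P phi u)).
  intros s Hs. eapply sp_le; [apply tF_ok; [exact Hs|]|apply tpoly_ok].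
  intros s' Hs'. rewrite app_nil_r. exact Hs'.
Qed.

(** * Recognising the cells of the curve *)

Definition cells (l : list (option sym)) : list bool := flat_map enc3 l.

(** An exhausted half tape and a blank cell both read as blank. *)
Definition oget {A} (o : option (option A)) : option A := match o with Some x => x | None => None end.

Lemma enc3_dec3 x : exists a b c, enc3 x = [a; b; c] /\ dec3 a b c = x.
Proof. destruct x as [[]|]; do 3 eexists; split; reflexivity. Qed.

Definition popcell j : frag STK (option (option sym)) :=
  a <- pop j ;; match a with
  | None => sret None
  | Some a => b <- pop j ;; c <- pop j ;; sret (Some (dec3 a (o2b b) (o2b c)))
  end.

Lemma popcell_ok e j l s (Q : option (option sym) -> store -> Prop) :
  s_stk s j = cells l -> Q (hd_error l) (setk s j (cells (tl l))) -> sp (popcell j) e 4 s Q.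
Proof.
  intros El HQ. destruct l as [|x l]; simpl in El, HQ.
  - apply (sp_le _ _ 2); [|lia]. unfold popcell. sstep. rewrite El. cbn [hd_error tl]. sstep. exact HQ.
  - destruct (enc3_dec3 x) as (a & b & c & E & Ed). rewrite E in El. simpl in El.
    unfold popcell. sstep. rewrite El. cbn [hd_error tl]. sstep. lks. cbn [hd_error tl o2b].
    sstep. lks. cbn [hd_error tl o2b]. sstep. rewrite Ed, !setk_setk. exact HQ.
Qed.

Definition pushcell j x : frag STK unit := pushes j (rev (enc3 x)).

Lemma pushcell_ok e j x l s (Q : unit -> store -> Prop) :
  s_stk s j = cells l -> Q tt (setk s j (cells (x :: l))) -> sp (pushcell j x) e 4 s Q.
Proof.
  intros El HQ. eapply sp_le; [apply pushes_ok|destruct x as [[]|]; simpl; lia].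
  rewrite rev_involutive, El. exact HQ.
Qed.

(** The tape is a pair of lists around the head; a left move at the left end stays, in agreement
    with [mvpos] at 0. *)
Definition zmv (m : mv) (l r : list (option sym)) : list (option sym) * list (option sym) :=
  match m with
  | MS => (l, r)
  | MR => (hd None r :: l, tl r)
  | ML => match l with [] => ([], r) | y :: l => (l, y :: r) end
  end.

Definition wrmv L R x m : frag STK unit :=
  match m with
  | MS => pushcell R x
  | MR => pushcell L x
  | ML => pushcell R x ;;; o <- popcell L ;;
      match o with None => sret tt | Some y => pushcell R y end
  end.

Lemma wrmv_ok e L R x m l r s (Q : unit -> store -> Prop) : L <> R ->
  s_stk s L = cells l -> s_stk s R = cells r ->
  (let z := zmv m l (x :: r) in Q tt (setk (setk s L (cells (fst z))) R (cells (snd z)))) ->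
  sp (wrmv L R x m) e 12 s Q.
Proof.
  intros N El Er HQ. destruct m; cbn [zmv fst snd wrmv] in *.
  - apply (sp_le _ _ (4 + (4 + 4))); [|lia]. apply sp_bind. eapply pushcell_ok; [exact Er|].
    apply sp_bind. eapply popcell_ok; [lks; exact El|]. destruct l as [|y l]; cbn [hd_error tl fst snd] in *.
    + eapply sp_le; [sstep|lia]. eapply eq_ind; [exact HQ|]. sext.
    + eapply pushcell_ok; [lks; reflexivity|]. eapply eq_ind; [exact HQ|]. sext.
  - eapply sp_le; [eapply pushcell_ok; [exact Er|]|lia]. rewrite (setk_self s L) in HQ; auto.
  - eapply sp_le; [eapply pushcell_ok; [exact El|]|lia]. eapply eq_ind; [exact HQ|]. cbn [hd tl]. sext.
Qed.

(* A tape with contents [f] and head at [p], cut into the reversed part left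
   of the head and the part from the head on. *)
Definition zrep (l r : list (option sym)) (f : nat -> option sym) (p : nat) : Prop :=
  length l = p /\ forall i, nth i (rev l ++ r) None = f i.

Lemma zrep_read l r f p : zrep l r f p -> oget (hd_error r) = f p.
Proof.
  intros [<- H]. rewrite <- H, app_nth2; rewrite length_rev; [|lia]. rewrite Nat.sub_diag. now destruct r.
Qed.

Lemma zrep_write l r f p x : zrep l r f p -> zrep l (x :: tl r) (fun i => if Nat.eqb i p then x else f i) p.
Proof.
  intros [<- H]. split; auto. intros i. rewrite <- H.
  destruct (Nat.eqb_spec i (length l)) as [->|Ni].
  - rewrite app_nth2; rewrite length_rev; [|lia]. now rewrite Nat.sub_diag.
  - destruct (Nat.lt_ge_cases i (length l)).
    + rewrite !app_nth1; rewrite ?length_rev; auto.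
    + rewrite !app_nth2; rewrite ?length_rev; auto.
      destruct (i - length l) eqn:E; [lia|]. destruct r; simpl; auto. now destruct n.
Qed.

Lemma zrep_ext l r f g p : zrep l r f p -> (forall i, f i = g i) -> zrep l r g p.
Proof. intros [H1 H2] E. split; auto. intros i. now rewrite H2. Qed.

Lemma zrep_same l r f p : zrep l r f p -> zrep l (oget (hd_error r) :: tl r) f p.
Proof.
  intros H. eapply zrep_ext; [apply zrep_write; exact H|]. intros i. simpl.
  destruct (Nat.eqb_spec i p); subst; auto. exact (zrep_read _ _ _ _ H).
Qed.

Lemma zrep_mv m l r f p : zrep l r f p -> zrep (fst (zmv m l r)) (snd (zmv m l r)) f (mvpos m p).
Proof.
  intros [<- H]. destruct m; simpl.
  - destruct l as [|y l]; simpl; split; auto. intros i. rewrite <- H. simpl. now rewrite <- app_assoc.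
  - split; auto.
  - split; auto. intros i. rewrite <- H. simpl. rewrite <- app_assoc. destruct r; simpl; auto.
    destruct (Nat.lt_ge_cases i (length l)).
    + rewrite !app_nth1; rewrite ?length_rev; auto.
    + rewrite !app_nth2; rewrite ?length_rev; auto. destruct (i - length l) as [|[|]]; auto.
Qed.

Lemma zrep_input u : zrep [] (map Some u) (nth_error u) 0.
Proof.
  split; auto. simpl. induction u as [|a u IH]; intros [|i]; simpl; auto.
Qed.

(** * Comparing a cell with the digits of a stream *)

Fixpoint agree2 (zs l : bits2) : bool :=
  match zs, l with
  | z :: zs, d :: l => (Bool.eqb (fst z) (fst d) && Bool.eqb (snd z) (snd d)) && agree2 zs l
  | _, _ => true
  end.

Lemma agree2_nil zs : agree2 zs [] = true.
Proof. now destruct zs. Qed.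

Lemma agree2_app l l' : forall zs, agree2 zs (l ++ l') = agree2 zs l && agree2 (skipn (length l) zs) l'.
Proof.
  induction l as [|d l IH]; intros [|z zs]; simpl; try (destruct l'; reflexivity).
  rewrite IH. now rewrite andb_assoc.
Qed.

Lemma agree2_cases l : forall zs, agree2 zs l = true ->
  zs = l ++ skipn (length l) zs \/ (skipn (length l) zs = [] /\ exists r, l = zs ++ r).
Proof.
  induction l as [|d l IH]; intros [|z zs] H; simpl in *; auto.
  - right. split; auto. exists (d :: l). auto.
  - apply andb_prop in H. destruct H as [H1 H2]. apply andb_prop in H1. destruct H1 as [H0 H1].
    apply eqb_prop in H0, H1. assert (z = d) by (destruct z, d; simpl in *; congruence). subst z.
    destruct (IH zs H2) as [E|[E [r Er]]]; [left|right; split]; auto; try congruence. exists r. congruence.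
Qed.

Lemma agree2_common l x r : forall zs, l ++ x = zs ++ r -> agree2 zs l = true /\
  (skipn (length l) zs = [] \/ x = skipn (length l) zs ++ r).
Proof.
  induction l as [|d l IH]; intros [|z zs] E; simpl in *; auto. inversion E; subst.
  destruct (IH zs H1) as [I1 I2]. now rewrite I1, !eqb_reflx.
Qed.

(* Stacks 10 and 11 hold the digits still to be matched, and stack 12 is empty until a mismatch occurs. *)
Definition cks (s : store) (zs : bits2) (ok : bool) : store :=
  setk (setk (setk s 10 (map fst zs)) 11 (map snd zs)) 12 (if ok then [] else [true]).

(** Digits beyond the end of the cell are accepted without comparison, since a cell is only a prefix
    of a stream. After a mismatch the digits are still consumed, which keeps the control flow
    independent of the outcome. *)
Definition chk1 (d : bool * bool) : frag STK unit :=
  a <- pop 10 ;; b <- pop 11 ;;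
  match a, b with
  | Some a, Some b => if Bool.eqb a (fst d) && Bool.eqb b (snd d) then sret tt else clear 12 ;;; push 12 true
  | _, _ => sret tt
  end.

Lemma chk1_ok d e zs ok s (Q : unit -> store -> Prop) : Q tt (cks s (tl zs) (ok && agree2 zs [d])) ->
  sp (chk1 d) e 4 (cks s zs ok) Q.
Proof.
  intros HQ. unfold chk1. sstep. sstep. unfold cks at 1 3. lks. unfold cks. lks.
  destruct zs as [|[a b] zs]; cbn [map hd_error tl fst snd].
  - eapply sp_le; [sstep|lia]. eapply eq_ind; [exact HQ|]. simpl. rewrite andb_true_r. unfold cks. sext.
  - cbn [agree2 fst snd tl] in HQ. rewrite agree2_nil, andb_true_r in HQ.
    destruct (Bool.eqb a (fst d) && Bool.eqb b (snd d)).
    + eapply sp_le; [sstep|lia]. eapply eq_ind; [exact HQ|]. rewrite andb_true_r. unfold cks. sext.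
    + sstep. sstep. lks. eapply eq_ind; [exact HQ|]. rewrite andb_false_r. unfold cks. sext.
Qed.

Fixpoint chks (l : bits2) : frag STK unit :=
  match l with [] => sret tt | d :: l => chk1 d ;;; chks l end.

Lemma tl_skipn1 {A} (l : list A) : tl l = skipn 1 l.
Proof. now destruct l. Qed.

Lemma chks_ok l e : forall zs ok s (Q : unit -> store -> Prop),
  Q tt (cks s (skipn (length l) zs) (ok && agree2 zs l)) -> sp (chks l) e (4 * length l + 1) (cks s zs ok) Q.
Proof.
  induction l as [|d l IH]; intros zs ok s Q HQ; cbn [chks].
  - apply (sp_le _ _ 1); [|lia]. sstep. eapply eq_ind; [exact HQ|]. simpl. now rewrite agree2_nil, andb_true_r.
  - apply (sp_le _ _ (4 + (4 * length l + 1))); [|simpl; lia]. apply sp_bind, chk1_ok, IH.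
    eapply eq_ind; [exact HQ|]. rewrite tl_skipn1, skipn_skipn, <- andb_assoc.
    change (d :: l) with ([d] ++ l). rewrite agree2_app, length_app. simpl length. now rewrite Nat.add_comm.
Qed.

Definition chkblk (ee b : bool) : frag STK unit :=
  chks [(b, false)] ;;; mov 13 14 ;;; foreach 14 (fun d => push 13 d ;;; chks [(false, b && d)]) ;;;
  chks ((false, false) :: (false, false) :: (false, b) :: repeat (false, false) 4 ++ [(false, ee)]).

Lemma cks_setk s zs ok j l : 13 <= j -> setk (cks s zs ok) j l = cks (setk s j l) zs ok.
Proof. intros H. unfold cks. sext. Qed.

Lemma chkblk_ok e ee b pre zs ok s (Q : unit -> store -> Prop) :
  s_stk s 13 = rev pre -> s_stk s 14 = [] ->
  Q tt (cks s (skipn (length (blk pre ee b)) zs) (ok && agree2 zs (blk pre ee b))) ->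
  sp (chkblk ee b) e (11 * length pre + 50) (cks s zs ok) Q.
Proof.
  intros E5 E6 HQ.
  apply (sp_le _ _ (5 + ((3 * length pre + 2) + (((6 + 2) * length pre + 2) + 33)))); [|lia].
  unfold chkblk. apply sp_bind. apply (chks_ok [(b, false)]). simpl length.
  set (z1 := skipn 1 zs). set (k1 := ok && agree2 zs [(b, false)]).
  apply sp_bind. rewrite <- (length_rev pre) at 1. eapply mov_ok; [lia|exact E5|].
  rewrite rev_involutive. unfold cks at 2. lks. rewrite E6, app_nil_r. apply sp_bind.
  rewrite cks_setk, cks_setk by lia.
  apply (foreach_ok e 14 _ 6 (fun r s' => exists p, pre = p ++ r /\
    s' = cks (setk (setk s 13 (rev p)) 14 r) (skipn (length p) z1)
      (k1 && agree2 z1 (map (fun d => (false, b && d)) p)))) with (l := pre).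
  - intros r s' (p & _ & ->). unfold cks. lks. auto.
  - intros d r s' (p & Ep & ->). sstep.
    match goal with |- context [setk (setk (cks ?a ?b ?c) 14 r) 13 ?l] =>
      replace (setk (setk (cks a b c) 14 r) 13 l) with (cks (setk (setk s 13 (d :: rev p)) 14 r) b c) end.
    2:{ unfold cks. sext. }
    eapply sp_le; [apply (chks_ok [(false, b && d)])|simpl; lia].
    exists (p ++ [d]). split; [now rewrite <- app_assoc|].
    rewrite map_app, agree2_app, length_map, length_app, rev_app_distr, skipn_skipn, andb_assoc. simpl.
    now rewrite Nat.add_comm.
  - intros s' (p & Ep & ->). rewrite app_nil_r in Ep. subst p.
    eapply sp_le; [apply chks_ok|simpl; lia].
    replace (setk (setk s 13 (rev pre)) 14 []) with s.
    2:{ rewrite (setk_self s 13); auto. now rewrite setk_self. }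
    eapply eq_ind; [exact HQ|].
    set (m := map (fun d => (false, b && d)) pre).
    set (l0 := (false, false) :: (false, false) :: _ :: _).
    assert (Eb : blk pre ee b = [(b, false)] ++ m ++ l0).
    { unfold blk. rewrite map_app. unfold l0, m. rewrite <- app_assoc. simpl app. now rewrite !andb_false_r, andb_true_r. }
    rewrite Eb, !agree2_app, !length_app, skipn_skipn. unfold k1, z1. rewrite !skipn_skipn.
    assert (Lm : length m = length pre) by apply length_map. rewrite Lm, !andb_assoc. simpl (length [(b, false)]).
    do 2 f_equal. lia.
  - exists []. split; auto. simpl map. simpl length. simpl skipn. rewrite agree2_nil, andb_true_r. reflexivity.
Qed.

(** * Replaying the simulated computation *)

Section Simulate.
Variables (M : machine) (phi : str -> str) (w0 : str) (D : nat).
Hypothesis HD : forall q i w a, length (mdelta M q i w a) <= D.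
Let e : env := (phi, w0).

Instance Fin_mQ : Fin (mQ M) := {| enum := mQenum M; enum_all := mQfin M |}.

(* [asked] tells whether the simulated machine has queried the oracle: before that its answer tape is empty, whereas
   the real one holds the answer to an earlier query. *)
Inductive ctl :=
| CA0 | CA1 | CA2 (b1 : bool) | CA3 (b1 b2 : bool)
| CB0 | CB1 (d : bool) | CB2 (act : bool) (q : mQ M) (asked : bool).

Instance Fin_ctl : Fin ctl.
Proof.
  exists ([CA0; CA1; CB0] ++ map CA2 enum ++ map CB1 enum ++ map (fun p => CA3 (fst p) (snd p)) enum ++
    map (fun p => CB2 (fst p) (fst (snd p)) (snd (snd p))) enum).
  intros k. repeat rewrite in_app_iff. destruct k as [| |b|b c| |b|b q c]; try (simpl; tauto).
  - right; left. apply in_map, enum_all.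
  - do 3 right; left. apply (in_map (fun p => CA3 (fst p) (snd p)) enum (b, c)), enum_all.
  - do 2 right; left. apply in_map, enum_all.
  - do 4 right. apply (in_map (fun p => CB2 (fst p) (fst (snd p)) (snd (snd p))) enum (b, (q, c))), enum_all.
Defined.

Definition rdans (asked : bool) : frag STK (option sym) := if asked then ans MS else sret None.

(** The unary option number on stack 19 is consumed along the list of options; a number that is too
    large ends at the last option, as in [pick]. *)
Fixpoint pickF {X} (o : act (mQ M)) (l : list (act (mQ M))) (K : act (mQ M) -> frag STK X) : frag STK X :=
  match l with
  | [] => clear 19 ;;; K o
  | o' :: l => x <- pop 19 ;; match x with None => K o | Some _ => pickF o' l K end
  end.

Lemma pickF_ok {X} (K : act (mQ M) -> frag STK X) n (Q : X -> store -> Prop) l : forall o i s,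
  s_stk s 19 = repeat true i -> sp (K (pick o l i)) e n (setk s 19 []) Q ->
  sp (pickF o l K) e (length l + 1 + n) s Q.
Proof.
  induction l as [|o' l IH]; intros o i s Ei H; cbn [pickF].
  - sstep. destruct i; exact H.
  - apply (sp_le _ _ (S (length l + 1 + n))); [|simpl; lia]. sstep. rewrite Ei.
    destruct i as [|i]; cbn [repeat hd_error tl].
    + eapply sp_le; [exact H|lia].
    + apply (IH o' i); lks; auto. now rewrite setk_setk.
Qed.

(** The input of the simulated machine is gathered on the left half tape while it is spelt; moving
    its head back to the start makes it readable. *)
Definition rewind : frag STK unit :=
  iter (fun _ : unit => o <- popcell 15 ;; match o with
    | None => sret (inr tt)
    | Some x => pushcell 16 x ;;; sret (inl tt) end) tt.

Lemma rewind_ok (Q : unit -> store -> Prop) l : forall r s,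
  s_stk s 15 = cells l -> s_stk s 16 = cells r ->
  Q tt (setk (setk s 15 []) 16 (cells (rev l ++ r))) -> sp rewind e (9 * length l + 5) s Q.
Proof.
  induction l as [|x l IH]; intros r s E1 E2 HQ.
  - apply (sp_le _ _ ((4 + 1) + 0)); [|lia]. apply sp_iter. apply sp_bind. eapply popcell_ok; [exact E1|].
    sstep. eapply eq_ind; [exact HQ|]. simpl. sext.
  - apply (sp_le _ _ ((4 + (4 + 1)) + (9 * length l + 5))); [|simpl; lia]. apply sp_iter. apply sp_bind. eapply popcell_ok; [exact E1|].
    cbn [hd_error tl]. apply sp_bind. eapply pushcell_ok; [lks; exact E2|]. sstep.
    apply (IH (x :: r)); lks; auto. eapply eq_ind; [exact HQ|]. simpl rev. rewrite <- app_assoc. simpl app. sext.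
Qed.

Definition ext2 b : frag STK unit := push 13 false ;;; push 13 b.

(** Before the first simulated query the real answer head may move too; this is harmless, as the
    query resets it to 0. *)
Definition actF (act : bool) (i : option sym) (asked : bool) (a : Defs.act (mQ M)) : frag STK ctl :=
  wrmv 15 16 i (a_imove a) ;;; wrmv 17 18 (a_write a) (a_wmove a) ;;;
  (match a_qry a with Some c => qry c | None => sret tt end) ;;;
  (if a_ask a then ask else ans (a_amove a) ;;; sret tt) ;;;
  sret (CB2 act (a_state a) (asked || a_ask a)).

Definition stepF (k : ctl) (b : bool) : frag STK ctl :=
  match k with
  | CA0 => ext2 b ;;; sret (if b then CA1 else CB0)
  | CA1 => ext2 b ;;; sret (CA2 b)
  | CA2 b1 => ext2 b ;;; sret (CA3 b1 b)
  | CA3 b1 b2 => ext2 b ;;; pushcell 15 (Some (osym (dec3 b1 b2 b))) ;;; sret CA0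
  | CB0 => sret (CB1 b)
  | CB1 d => rewind ;;; sret (CB2 (negb d && b) (mstart M) false)
  | CB2 act q asked =>
    i <- popcell 16 ;; w <- popcell 18 ;; a <- rdans asked ;;
    match mdelta M q (oget i) (oget w) a with
    | [] => pushcell 16 (oget i) ;;; pushcell 18 (oget w) ;;; sret k
    | o :: l =>
      if b then pushcell 16 (oget i) ;;; pushcell 18 (oget w) ;;; push 19 true ;;; sret k
      else pickF o l (actF act (oget i) asked)
    end
  end.

(** The last digit of a block depends on whether a transition applies, so the three symbols are
    inspected and put back before the block is compared. *)
Definition geF (k : ctl) : frag STK bool :=
  match k with
  | CB2 true q asked =>
    i <- popcell 16 ;; w <- popcell 18 ;; a <- rdans asked ;;
    pushcell 16 (oget i) ;;; pushcell 18 (oget w) ;;;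
    sret (match mdelta M q (oget i) (oget w) a with [] => negb (macc M q) | _ => true end)
  | _ => sret true
  end.

(* Stacks 15, 16 hold the input tape of the simulated machine, 17, 18 its work tape, and 19 the number of the current
   option. The oracle tapes of the simulated machine are the real ones. *)
Definition collects (s : store) (u : str) : Prop :=
  s_stk s 15 = cells (rev (map Some u)) /\ (forall j, 16 <= j <= 19 -> s_stk s j = []) /\ o_qry (s_o s) = [].

Definition answers (s : store) (c : config M) (asked : bool) : Prop :=
  if asked then o_ans (s_o s) = c_ans c /\ o_apos (s_o s) = c_apos c else c_ans c = [].

Definition holds (s : store) (u : str) (c : config M) (i : nat) (asked : bool) : Prop :=
  (exists l r, s_stk s 15 = cells l /\ s_stk s 16 = cells r /\ zrep l r (nth_error u) (c_ipos c)) /\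
  (exists l r, s_stk s 17 = cells l /\ s_stk s 18 = cells r /\ zrep l r (cell (c_work c)) (c_wpos c)) /\
  s_stk s 19 = repeat true i /\ o_qry (s_o s) = c_qry c /\ answers s c asked.

Definition represents (s : store) (u : str) (ph : phase M) (k : ctl) : Prop :=
  match ph, k with
  | PA0 _, CA0 | PA1 _, CA1 | PB0 _, CB0 => collects s u
  | PA2 _ b, CA2 b' | PB1 _ b, CB1 b' => b = b' /\ collects s u
  | PA3 _ b c, CA3 b' c' => b = b' /\ c = c' /\ collects s u
  | PB2 _ act c i, CB2 act' q asked => act = act' /\ q = c_state c /\ holds s u c i asked
  | _, _ => False
  end.

Lemma represents_frame s s' u ph k : s_o s' = s_o s -> (forall j, 15 <= j <= 19 -> s_stk s' j = s_stk s j) ->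
  represents s u ph k -> represents s' u ph k.
Proof.
  intros Eo Es. unfold represents, collects, holds, answers. rewrite Eo, !Es by lia.
  assert (X : (forall j, 16 <= j <= 19 -> s_stk s j = []) -> forall j, 16 <= j <= 19 -> s_stk s' j = []).
  { intros H j Hj. rewrite Es by lia. auto. }
  destruct ph, k; tauto.
Qed.

Lemma rdans_ok asked c s (Q : option sym -> store -> Prop) : answers s c asked ->
  Q (nth_error (c_ans c) (c_apos c)) s -> sp (rdans asked) e 1 s Q.
Proof.
  intros H HQ. unfold answers in H. unfold rdans. destruct asked; sstep.
  - destruct H as [-> ->]. destruct s as [[] ?]; exact HQ.
  - rewrite H in HQ. destruct (c_apos c); exact HQ.
Qed.

Lemma readF_ok {X} (K : option sym -> option sym -> option sym -> frag STK X) u c i asked n s (Q : X -> store -> Prop) :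
  holds s u c i asked ->
  (forall l r l' r',
    zrep l r (nth_error u) (c_ipos c) -> zrep l' r' (cell (c_work c)) (c_wpos c) ->
    s_stk s 15 = cells l -> s_stk s 17 = cells l' ->
    sp (K (nth_error u (c_ipos c)) (cell (c_work c) (c_wpos c)) (nth_error (c_ans c) (c_apos c))) e n
      (setk (setk s 16 (cells (tl r))) 18 (cells (tl r'))) Q) ->
  sp (i <- popcell 16 ;; w <- popcell 18 ;; a <- rdans asked ;; K (oget i) (oget w) a) e (9 + n) s Q.
Proof.
  intros ((l & r & E1 & E2 & Z) & (l' & r' & E3 & E4 & Z') & H1 & H2 & H3) HK.
  apply (sp_le _ _ (4 + (4 + (1 + n)))); [|lia].
  apply sp_bind. eapply popcell_ok; [exact E2|]. apply sp_bind. eapply popcell_ok; [lks; exact E4|].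
  apply sp_bind. apply (rdans_ok asked c); [exact H3|].
  rewrite (zrep_read _ _ _ _ Z), (zrep_read _ _ _ _ Z'). now apply (HK l r l' r').
Qed.

Lemma unreadF_ok {X} (K : frag STK X) u c i asked n s r r' l l' (Q : X -> store -> Prop) :
  holds s u c i asked ->
  zrep l r (nth_error u) (c_ipos c) -> zrep l' r' (cell (c_work c)) (c_wpos c) ->
  s_stk s 15 = cells l -> s_stk s 17 = cells l' ->
  (forall s', holds s' u c i asked -> (forall j, j < 15 -> s_stk s' j = s_stk s j) -> sp K e n s' Q) ->
  sp (pushcell 16 (nth_error u (c_ipos c)) ;;; pushcell 18 (cell (c_work c) (c_wpos c)) ;;; K) e (8 + n)
    (setk (setk s 16 (cells (tl r))) 18 (cells (tl r'))) Q.
Proof.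
  intros (_ & _ & H1 & H2 & H3) Z Z' E1 E3 HK.
  apply (sp_le _ _ (4 + (4 + n))); [|lia].
  apply sp_bind. eapply pushcell_ok; [lks; reflexivity|].
  apply sp_bind. eapply pushcell_ok; [lks; reflexivity|]. apply HK.
  - split; [|split; [|split; [|split]]]; auto.
    + exists l, (nth_error u (c_ipos c) :: tl r). lks. split; [auto|split; [auto|]].
      rewrite <- (zrep_read _ _ _ _ Z). now apply zrep_same.
    + exists l', (cell (c_work c) (c_wpos c) :: tl r'). lks. split; [auto|split; [auto|]].
      rewrite <- (zrep_read _ _ _ _ Z'). now apply zrep_same.
  - intros j Hj. lks. auto.
Qed.

Lemma geF_ok u ph k pre s (Q : bool -> store -> Prop) : represents s u ph k ->
  (forall s', represents s' u ph k -> (forall j, j < 15 -> s_stk s' j = s_stk s j) -> Q (ge M (mkG M pre u ph)) s') ->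
  sp (geF k) e 18 s Q.
Proof.
  intros H HQ. unfold ge in HQ. cbn [g_ph g_u] in HQ.
  assert (Triv : (represents s u ph k -> Q true s) -> sp (sret true) e 18 s Q).
  { intros HT. apply (sp_le _ _ 1); [|lia]. sstep. apply HT; auto. }
  destruct ph as [| |b1|b1 b2| |d|act c i], k as [| |b1'|b1' b2'| |d'|act' q asked]; cbn [represents] in H; try contradiction;
    cbn [geF]; try (apply Triv; intros H1; apply HQ; auto).
  destruct H as (<- & -> & H). destruct act; cbn [geF]; [|apply Triv; intros H1; apply HQ; auto].
  clear Triv. apply (sp_le _ _ (9 + (8 + 1))); [|lia].
  apply (readF_ok (fun i w a => pushcell 16 i ;;; pushcell 18 w ;;;
    sret (match mdelta M (c_state c) i w a with [] => negb (macc M (c_state c)) | _ => true end)) u c i asked); auto.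
  intros l r l' r' Z Z' E1 E3.
  eapply unreadF_ok; eauto. intros s' Hs Hl. sstep. apply HQ; auto. cbn [represents]. auto.
Qed.

Lemma actF_ok u c act asked a s (l r l' r' : list (option sym)) (Q : ctl -> store -> Prop) :
  zrep l r (nth_error u) (c_ipos c) -> zrep l' r' (cell (c_work c)) (c_wpos c) ->
  s_stk s 15 = cells l -> s_stk s 17 = cells l' -> s_stk s 16 = cells (tl r) -> s_stk s 18 = cells (tl r') ->
  s_stk s 19 = [] -> o_qry (s_o s) = c_qry c -> answers s c asked ->
  (forall s' k', represents s' u (PB2 M act (apply_act M phi a c) 0) k' -> (forall j, j < 15 -> s_stk s' j = s_stk s j) ->
     Q k' s') ->
  sp (actF act (nth_error u (c_ipos c)) asked a) e 28 s Q.
Proof.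
  intros Z Z' E1 E3 E2 E4 E5 Hq Ha HQ.
  apply (sp_le _ _ (12 + (12 + (1 + (2 + 1))))); [|lia]. unfold actF.
  apply sp_bind. eapply wrmv_ok; [lia|exact E1|exact E2|]. cbv zeta.
  apply sp_bind. eapply wrmv_ok; [lia|lks; exact E3|lks; exact E4|]. cbv zeta.
  set (z := zmv _ _ _). set (z' := zmv _ _ _).
  assert (Zn : zrep (fst z) (snd z) (nth_error u) (mvpos (a_imove a) (c_ipos c))).
  { apply zrep_mv. rewrite <- (zrep_read _ _ _ _ Z). apply zrep_same, Z. }
  assert (Zn' : zrep (fst z') (snd z') (cell (upd (c_work c) (c_wpos c) (a_write a))) (mvpos (a_wmove a) (c_wpos c))).
  { apply zrep_mv. eapply zrep_ext; [apply zrep_write, Z'|]. intros j. now rewrite cell_upd. }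
  clearbody z z'.
  set (s2 := setk (setk (setk (setk s 15 _) 16 _) 17 _) 18 _).
  assert (L2 : forall j, j < 15 -> s_stk s2 j = s_stk s j) by (intros j Hj; unfold s2; lks; auto).
  assert (S15 : s_stk s2 15 = cells (fst z)) by (unfold s2; lks; auto).
  assert (S16 : s_stk s2 16 = cells (snd z)) by (unfold s2; lks; auto).
  assert (S17 : s_stk s2 17 = cells (fst z')) by (unfold s2; lks; auto).
  assert (S18 : s_stk s2 18 = cells (snd z')) by (unfold s2; lks; auto).
  assert (S19 : s_stk s2 19 = []) by (unfold s2; lks; auto).
  assert (So : s_o s2 = s_o s) by reflexivity. clearbody s2.
  apply sp_bind. apply (sp_post _ _ _ _ (fun _ s3 => s_stk s3 = s_stk s2 /\
    o_qry (s_o s3) = c_qry c ++ opt_list (a_qry a) /\ answers s3 c asked)).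
  { unfold answers in *. destruct (a_qry a); sstep; simpl; rewrite ?So, ?Hq, ?app_nil_r; auto. }
  intros _ s3 (T & Tq & Ta).
  apply sp_bind. apply (sp_post _ _ _ _ (fun _ s4 => s_stk s4 = s_stk s2 /\
    o_qry (s_o s4) = c_qry (apply_act M phi a c) /\ answers s4 (apply_act M phi a c) (asked || a_ask a))).
  { unfold apply_act. cbn [c_qry]. destruct (a_ask a) eqn:Ek; cbn [answers].
    - apply (sp_le _ _ 1); [|lia]. sstep. rewrite orb_true_r. unfold answers. simpl. rewrite T, Tq. auto.
    - sstep. sstep. simpl. rewrite T, Tq, orb_false_r. unfold answers in *. simpl. destruct asked; auto.
      destruct Ta as [-> ->]. auto. }
  intros _ s4 (V & Vq & Va). sstep. apply HQ.
  - cbn [represents]. split; auto. split; auto. split; [|split; [|split; [|split]]]; auto.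
    + exists (fst z), (snd z). rewrite V. auto.
    + exists (fst z'), (snd z'). rewrite V. auto.
    + rewrite V. auto.
  - intros j Hj. rewrite V. auto.
Qed.

(** The term in the length of [g_u] pays for the rewinding of the input, and [D] for the search
    among the options. *)
Lemma stepF_ok g k b s (Q : ctl -> store -> Prop) :
  represents s (g_u M g) (g_ph M g) k -> s_stk s 13 = rev (g_pre M g) ->
  let g' := gstep M phi g b in
  (forall s' k', represents s' (g_u M g') (g_ph M g') k' -> s_stk s' 13 = rev (g_pre M g') ->
     (forall j, j < 13 \/ j = 14 -> s_stk s' j = s_stk s j) -> Q k' s') ->
  sp (stepF k b) e (9 * length (g_u M g) + D + 40) s Q.
Proof.
  destruct g as [pre u ph]. cbn [g_u g_ph g_pre]. intros H Hp HQ. unfold gstep in HQ. cbn [g_ph g_u g_pre] in HQ.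
  assert (Er : rev (pre ++ [false; b]) = b :: false :: rev pre) by (now rewrite rev_app_distr).
  assert (Hext : forall (K : frag STK ctl) n, n <= 6 ->
    (collects s u -> sp K e n (setk s 13 (rev (pre ++ [false; b]))) Q) -> collects s u ->
    sp (ext2 b ;;; K) e (9 * length u + D + 40) s Q).
  { intros K n Hn HK Hc. apply (sp_le _ _ ((1 + 1) + n)); [|lia]. apply sp_bind. unfold ext2. sstep. sstep. lks.
    rewrite setk_setk, Hp. rewrite Er in HK. auto. }
  assert (Hc13 : forall l, collects s u -> collects (setk s 13 l) u).
  { intros l (C1 & C2 & C3). split; [lks; auto|]. split; [intros j Hj; lks; auto|auto]. }
  destruct ph as [| |b1|b1 b2| |d|act c i], k as [| |b1'|b1' b2'| |d'|act' q asked]; cbn [represents] in H; try contradiction;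
    cbn [stepF].
  - apply (Hext _ 1); [lia| |exact H]. intros Hc. sstep. apply HQ; cbn [g_u g_ph g_pre]; lks; auto.
    + destruct b; cbn [represents]; auto.
    + intros j Hj. lks. auto.
  - apply (Hext _ 1); [lia| |exact H]. intros Hc. sstep. apply HQ; cbn [g_u g_ph g_pre]; lks; auto.
    + cbn [represents]; auto.
    + intros j Hj. lks. auto.
  - destruct H as [<- H]. apply (Hext _ 1); [lia| |exact H]. intros Hc. sstep. apply HQ; cbn [g_u g_ph g_pre]; lks; auto.
    + cbn [represents]; auto.
    + intros j Hj. lks. auto.
  - destruct H as (<- & <- & H). apply (Hext _ (4 + 1)); [lia| |exact H]. intros (C1 & C2 & C3).
    apply sp_bind. eapply pushcell_ok; [lks; exact C1|]. sstep. apply HQ; cbn [g_u g_ph g_pre]; lks; auto.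
    + cbn [represents]. split; [|split; auto].
      * lks. rewrite map_app, rev_app_distr. reflexivity.
      * intros j Hj. lks. auto.
    + intros j Hj. lks. auto.
  - apply (sp_le _ _ 1); [|lia]. sstep. apply HQ; cbn [g_u g_ph g_pre]; auto. cbn [represents]. auto.
  - destruct H as [<- (C1 & C2 & C3)]. apply (sp_le _ _ ((9 * length u + 5) + 1)); [|lia].
    apply sp_bind. rewrite <- (length_map Some u), <- length_rev. eapply rewind_ok with (r := []); [exact C1|apply C2; lia|].
    rewrite rev_involutive, app_nil_r. sstep. apply HQ; cbn [g_u g_ph g_pre].
    + cbn [represents]. split; auto. split; auto. split; [|split; [|split; [|split]]].
      * exists [], (map Some u). lks. split; auto. split; auto. apply zrep_input.
      * exists [], []. lks. rewrite !C2 by lia. split; auto. split; auto. split; auto. intros []; reflexivity.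
      * lks. rewrite C2 by lia. auto.
      * auto.
      * reflexivity.
    + lks. auto.
    + intros j Hj. lks. auto.
  - destruct H as (<- & -> & H). apply (sp_le _ _ (9 + (D + 29))); [|lia].
    set (k := CB2 act (c_state c) asked).
    apply (readF_ok (fun x w a => match mdelta M (c_state c) x w a with
    | [] => pushcell 16 x ;;; pushcell 18 w ;;; sret k
    | o :: l =>
      if b then pushcell 16 x ;;; pushcell 18 w ;;; push 19 true ;;; sret k
      else pickF o l (actF act x asked)
    end) u c i asked); auto.
    intros l r l' r' Z Z' E1 E3.
    unfold mstep in HQ. unfold options in HQ. fold (cell (c_work c) (c_wpos c)) in HQ.
    pose proof (HD (c_state c) (nth_error u (c_ipos c)) (cell (c_work c) (c_wpos c)) (nth_error (c_ans c) (c_apos c))) as HDc.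
    destruct (mdelta M (c_state c) _ _ _) as [|o ol].
    + apply (sp_le _ _ (8 + 1)); [|lia]. eapply unreadF_ok; eauto. intros s' Hs Hl. sstep. apply HQ; cbn [g_u g_ph g_pre].
      * unfold k. cbn [represents]. auto.
      * rewrite Hl by lia. auto.
      * intros j Hj. apply Hl. lia.
    + destruct b.
      * apply (sp_le _ _ (8 + 2)); [|lia]. eapply unreadF_ok; eauto. intros s' Hs Hl. sstep. sstep. apply HQ; cbn [g_u g_ph g_pre].
        -- unfold k. cbn [represents]. split; auto. split; auto. destruct Hs as (I1 & I2 & I3 & I4 & I5).
           split; [|split; [|split; [|split]]].
           ++ destruct I1 as (x & y & X1 & X2 & X3). exists x, y. lks. auto.
           ++ destruct I2 as (x & y & X1 & X2 & X3). exists x, y. lks. auto.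
           ++ lks. rewrite I3. auto.
           ++ exact I4.
           ++ exact I5.
        -- lks. rewrite Hl by lia. auto.
        -- intros j Hj. lks. apply Hl. lia.
      * destruct H as (_ & _ & I3 & I4 & I5).
        apply (sp_le _ _ (length ol + 1 + 28)); [|simpl in HDc; lia].
        eapply pickF_ok with (i := i); [lks; exact I3|].
        eapply actF_ok; eauto; lks; auto.
        intros s' k' Hr Hl. apply HQ; cbn [g_u g_ph g_pre]; auto.
        -- rewrite Hl by lia. lks. auto.
        -- intros j Hj. rewrite Hl by lia. lks. auto.
Qed.

Definition scanbody (k : ctl) : frag STK (ctl + bool) :=
  a <- pop 10 ;; match a with
  | None => f <- pop 12 ;; sret (inr (match f with None => true | Some _ => false end))
  | Some b => push 10 b ;;; ee <- geF k ;; chkblk ee b ;;; k' <- stepF k b ;; sret (inl k')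
  end.

(** A block opens with its own bit as [x]-digit, so a nonempty cell dictates the bits of the stream
    and there is nothing to search for. If the cell ends inside the block, no digits remain to be
    matched. *)
Lemma digs_prefix g b y zs :
  (exists z r, digs M phi g z = ((b, y) :: zs) ++ r) <->
  agree2 ((b, y) :: zs) (block M g b) = true /\
  exists z r, digs M phi (gstep M phi g b) z = skipn (length (block M g b)) ((b, y) :: zs) ++ r.
Proof.
  split.
  - intros ([|b' z] & r & E); [discriminate|]. cbn [digs] in E.
    assert (b' = b) by (unfold block, blk in E; simpl in E; congruence). subst b'.
    destruct (agree2_common _ _ _ _ E) as [A [S|S]]; split; auto.
    + exists [], []. now rewrite S.
    + exists z, r. exact S.
  - intros (A & z & r & E). destruct (agree2_cases _ _ A) as [S|[S [r' Er]]].
    + exists (b :: z), r. cbn [digs]. rewrite E, app_assoc. now rewrite <- S.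
    + exists [b], r'. cbn [digs]. now rewrite app_nil_r, Er.
Qed.

Lemma gstep_growth g b : length (g_pre M (gstep M phi g b)) <= length (g_pre M g) + 2 /\
  length (g_u M (gstep M phi g b)) <= length (g_u M g) + 1.
Proof.
  unfold gstep. destruct (g_ph M g); simpl; rewrite ?length_app; simpl; try lia.
  destruct (mstep M phi (g_u M g) c i b); simpl. lia.
Qed.

(** Every block consumes at least one digit, so [n] digits take at most [n] rounds. [B] bounds the
    prefix and the input, which grow by at most two and one symbols per round. *)
Lemma scan_ok B n : forall g k (zs : bits2) (ok : bool) s, length zs <= n ->
  s_stk s 10 = map fst zs -> s_stk s 11 = map snd zs -> s_stk s 12 = (if ok then [] else [true]) ->
  s_stk s 13 = rev (g_pre M g) -> s_stk s 14 = [] -> represents s (g_u M g) (g_ph M g) k ->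
  length (g_pre M g) + 2 * n <= B -> length (g_u M g) + n <= B ->
  sp (iter scanbody k) e ((20 * B + D + 111) * n + 3) s (fun x s' =>
    (x = true <-> ok = true /\ exists z r, digs M phi g z = zs ++ r) /\
    forall j, j < 10 -> s_stk s' j = s_stk s j).
Proof.
  induction n as [|n IH]; intros g k zs ok s Ln E0 E1 E2 E3 E4 Hr B1 B2.
  - assert (zs = []) by (destruct zs; auto; simpl in Ln; lia). subst zs. simpl in E0.
    apply (sp_le _ _ (3 + 0)); [|lia]. apply sp_iter. unfold scanbody. sstep. rewrite E0. cbn [hd_error tl].
    sstep. lks. rewrite E2. sstep. split.
    + split; [|destruct ok; tauto || (intros [H _]; discriminate)]. destruct ok; [|discriminate]. intros _. split; auto. exists [], []. auto.
    + intros j Hj. lks. auto.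
  - destruct zs as [|[b y] zs].
    + simpl in E0. apply (sp_le _ _ (3 + 0)); [|lia]. apply sp_iter. unfold scanbody. sstep. rewrite E0. cbn [hd_error tl].
      sstep. lks. rewrite E2. sstep. split.
      * split; [|destruct ok; tauto || (intros [H _]; discriminate)]. destruct ok; [|discriminate]. intros _. split; auto. exists [], []. auto.
      * intros j Hj. lks. auto.
    + cbn [length] in Ln. destruct (gstep_growth g b) as [G1 G2].
      set (C := 20 * B + D + 111) in *.
      apply (sp_le _ _ (S (S (18 + ((11 * length (g_pre M g) + 50) + ((9 * length (g_u M g) + D + 40) + 1)))) + (C * n + 3))).
      2:{ unfold C. lia. }
      apply sp_iter. unfold scanbody. sstep. rewrite E0. cbn [map fst hd_error tl]. sstep. lks.
      rewrite setk_setk, setk_self by exact E0.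
      apply sp_bind. apply (geF_ok (g_u M g) (g_ph M g) k (g_pre M g)); auto.
      intros s1 R1 L1. replace (ge M _) with (ge M g) by (destruct g; reflexivity).
      set (z := (b, y) :: zs) in *.
      assert (F1 : cks s1 z ok = s1).
      { unfold cks. rewrite !setk_self; lks; rewrite ?L1 by lia; auto. }
      rewrite <- F1. apply sp_bind.
      apply chkblk_ok with (pre := g_pre M g); [rewrite L1 by lia; auto|rewrite L1 by lia; auto|].
      fold (block M g b). set (z2 := skipn _ z). set (ok2 := ok && _).
      assert (R2 : represents (cks s1 z2 ok2) (g_u M g) (g_ph M g) k).
      { eapply represents_frame; [| |exact R1]; auto. intros j Hj. unfold cks. lks. auto. }
      apply sp_bind. apply stepF_ok; auto.
      { unfold cks. lks. rewrite L1 by lia. auto. }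
      intros s3 k3 R3 P3 L3. sstep.
      eapply sp_post; [apply (IH (gstep M phi g b) k3 z2 ok2); try exact R3; try exact P3; try lia;
        try (rewrite L3 by lia; unfold cks; lks; rewrite ?L1 by lia; auto)|].
      * unfold z2, block. rewrite length_skipn, blk_length. unfold z. cbn [length]. lia.
      * intros x s4 [X1 X2]. split.
        -- rewrite X1. unfold ok2. rewrite andb_true_iff. unfold z, z2. rewrite digs_prefix. tauto.
        -- intros j Hj. rewrite X2, L3 by lia. unfold cks. lks. rewrite L1 by lia. auto.
Qed.

Fixpoint clears j n : frag STK unit :=
  match n with 0 => sret tt | S n => clear j ;;; clears (S j) n end.

Lemma clears_ok n : forall j s (Q : unit -> store -> Prop),
  (forall s', s_o s' = s_o s -> (forall i, i < j \/ j + n <= i -> s_stk s' i = s_stk s i) ->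
    (forall i, j <= i < j + n -> s_stk s' i = []) -> Q tt s') -> sp (clears j n) e (n + 1) s Q.
Proof.
  induction n as [|n IH]; intros j s Q HQ; cbn [clears].
  - sstep. apply HQ; auto. intros; lia.
  - apply (sp_le _ _ (S (n + 1))); [|lia]. sstep. apply IH. intros s' So S1 S2. apply HQ.
    + exact So.
    + intros i Hi. rewrite S1 by lia. lks. auto.
    + intros i Hi. destruct (Nat.eq_dec i j) as [->|]; [rewrite S1 by lia; lks; auto|apply S2; lia].
Qed.

Definition hd3 j : frag STK bool :=
  a <- pop j ;; b <- pop j ;; c <- pop j ;; sret (is_bit true a && is_bit false b && is_bit false c).

Lemma hd3_ok j a b c l s (Q : bool -> store -> Prop) : s_stk s j = a :: b :: c :: l ->
  Q (eql [a; b; c] [true; false; false]) (setk s j l) -> sp (hd3 j) e 4 s Q.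
Proof.
  intros El HQ. unfold hd3. sstep. rewrite El. cbn [hd_error tl]. sstep. lks. cbn [hd_error tl].
  sstep. lks. cbn [hd_error tl]. sstep. rewrite !setk_setk.
  replace (is_bit _ _ && _ && _) with (eql [a; b; c] [true; false; false]) by (destruct a, b, c; reflexivity). exact HQ.
Qed.

(** The test is run repeatedly on the same store, so its stacks are cleared, and one query is issued
    merely to empty the query tape. *)
Definition markF : frag STK bool :=
  clears 10 10 ;;; ask ;;; mov2 1 3 10 ;;; mov 3 1 ;;; mov2 2 3 11 ;;; mov 3 2 ;;;
  p1 <- hd3 10 ;; p2 <- hd3 11 ;; if p1 && p2 then iter scanbody CA0 else sret false.

(** The leading digits [100] are the offset 4 of the coding, that is, integer part 0; the remaining
    digits must be those of a marked cell. *)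
Definition marks N (X Y : list bool) : Prop := exists zs, length zs = N /\ mark M phi zs /\
  rev X = [true; false; false] ++ map fst zs /\ rev Y = [true; false; false] ++ map snd zs.

Lemma fst_combine {A B} (l : list A) : forall l' : list B, length l = length l' -> map fst (combine l l') = l /\ map snd (combine l l') = l'.
Proof.
  induction l as [|a l IH]; intros [|b l'] H; try discriminate; auto. simpl.
  destruct (IH l') as [-> ->]; auto.
Qed.

Definition markcost N := (40 * N + D + 111) * N + 14 * (N + 3) + 40.

Lemma markF_ok N X Y s (Q : bool -> store -> Prop) :
  length X = N + 3 -> length Y = N + 3 -> s_stk s 1 = X -> s_stk s 2 = Y -> s_stk s 3 = [] ->
  (forall x s', (x = true <-> marks N X Y) -> (forall j, j < 10 -> s_stk s' j = s_stk s j) -> Q x s') ->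
  sp markF e (markcost N) s Q.
Proof.
  intros LX LY E1 E2 E3 HQ.
  assert (GX : exists a b c l, rev X = a :: b :: c :: l /\ length l = N).
  { rewrite <- length_rev in LX. destruct (rev X) as [|a [|b [|c l]]]; simpl in LX; try lia. do 4 eexists. split; eauto. lia. }
  assert (GY : exists a b c l, rev Y = a :: b :: c :: l /\ length l = N).
  { rewrite <- length_rev in LY. destruct (rev Y) as [|a [|b [|c l]]]; simpl in LY; try lia. do 4 eexists. split; eauto. lia. }
  destruct GX as (a & b & c & xs & EX & Lx). destruct GY as (a' & b' & c' & ys & EY & Ly).
  apply (sp_le _ _ (11 + (S ((4 * (N + 3) + 2) + ((3 * (N + 3) + 2) + ((4 * (N + 3) + 2) + ((3 * (N + 3) + 2) +
    (4 + (4 + ((20 * (2 * N) + D + 111) * N + 3)))))))))).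
  2:{ unfold markcost. replace (20 * (2 * N)) with (40 * N) by lia. lia. }
  unfold markF. apply sp_bind. apply (clears_ok 10 10). intros s1 So1 S1 S2. sstep.
  set (s2 := onO s1 _).
  assert (T1 : forall j, j < 10 -> s_stk s2 j = s_stk s j) by (intros j Hj; apply S1; lia).
  assert (T2 : forall j, 10 <= j < 20 -> s_stk s2 j = []) by (intros j Hj; apply S2; lia).
  assert (To : o_qry (s_o s2) = []) by reflexivity. clearbody s2. clear s1 So1 S1 S2.
  apply sp_bind. rewrite <- LX. eapply mov2_ok; [lia|lia|lia|rewrite T1 by lia; exact E1|].
  rewrite (T1 3), (T2 10), E3, app_nil_r by lia.
  apply sp_bind. rewrite <- (length_rev X). eapply mov_ok; [lia|lks; reflexivity|]. lks. rewrite rev_involutive, app_nil_r.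
  apply sp_bind. rewrite length_rev, LX, <- LY. eapply mov2_ok; [lia|lia|lia|lks; rewrite T1 by lia; exact E2|]. lks.
  rewrite (T2 11) by lia. rewrite app_nil_r.
  apply sp_bind. rewrite <- (length_rev Y). eapply mov_ok; [lia|lks; reflexivity|]. lks. rewrite rev_involutive, app_nil_r.
  match goal with |- sp _ _ _ ?st _ => set (s3 := st) end.
  assert (U1 : forall j, j < 10 -> s_stk s3 j = s_stk s j).
  { intros j Hj. unfold s3. cbn [setk s_stk]. eqbs; auto; now apply T1. }
  assert (U10 : s_stk s3 10 = a :: b :: c :: xs) by (unfold s3; lks; auto).
  assert (U11 : s_stk s3 11 = a' :: b' :: c' :: ys) by (unfold s3; lks; auto).
  assert (U2 : forall j, 12 <= j < 20 -> s_stk s3 j = []).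
  { intros j Hj. unfold s3. lks. apply T2. lia. }
  assert (Uo : o_qry (s_o s3) = []) by exact To. clearbody s3. clear s2 T1 T2 To.
  apply sp_bind. eapply hd3_ok; [exact U10|]. apply sp_bind. eapply hd3_ok; [lks; exact U11|].
  destruct (eql [a; b; c] _ && eql [a'; b'; c'] _) eqn:Ee.
  - apply andb_prop in Ee. destruct Ee as [F1 F2]. apply eql_true in F1, F2.
    inversion F1; inversion F2; subst.
    destruct (fst_combine xs ys) as [C1 C2]; [lia|]. set (zs := combine xs ys) in *.
    assert (Lz : length zs = length xs) by (rewrite <- C1; symmetry; apply length_map).
    eapply sp_post; [apply (scan_ok (2 * length xs) (length xs) (g0 M) CA0 zs true); lks; auto; try (simpl; lia)|].
    + rewrite U2 by lia. auto.
    + rewrite U2 by lia. auto.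
    + rewrite U2 by lia. auto.
    + cbn [g0 represents g_ph g_u]. split; [lks; rewrite U2 by lia; auto|]. split; auto. intros j Hj. lks. apply U2. lia.
    + intros x s' [H1 H2]. apply HQ.
      * rewrite H1. unfold marks. split.
        -- intros [_ H]. exists zs. split; auto. split; [exact H|]. rewrite C1, C2. auto.
        -- intros (zs' & L & H & X1 & X2). split; auto. replace zs with zs'; [exact H|].
           rewrite EX in X1. rewrite EY in X2. simpl in X1, X2. assert (Q1 : xs = map fst zs') by congruence. assert (Q2 : ys = map snd zs') by congruence.
           unfold zs. rewrite Q1, Q2. clear. induction zs' as [|[p q] l IH]; simpl; congruence.
      * intros j Hj. rewrite H2 by lia. lks. auto.
  - apply (sp_le _ _ 1); [|lia]. sstep. apply HQ.
    + split; [discriminate|]. intros (zs' & L & H & X1 & X2). rewrite EX in X1. rewrite EY in X2.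
      inversion X1. inversion X2. subst. discriminate.
    + intros j Hj. lks. auto.
Qed.
End Simulate.

(** * Searching the neighbouring cells *)

Lemma iterl_shift n f l : iterl n f (f l) = f (iterl n f l).
Proof. induction n; simpl; congruence. Qed.

Section Grid.
Variable mF : frag STK bool.

Fixpoint rowF k : frag STK bool :=
  match k with
  | 0 => sret false
  | S k => b <- mF ;; if b then sret true else bump true 2 3 ;;; rowF k
  end.

Fixpoint colF d k : frag STK bool :=
  match k with
  | 0 => sret false
  | S k => mov2 2 5 4 ;;; mov 5 2 ;;; b <- rowF d ;;
      if b then sret true else clear 2 ;;; mov 4 2 ;;; bump true 1 3 ;;; colF d k
  end.

(** Deterministic counterpart of the guessed correction: up to [d * d] cells, a number independent
    of the input, are tried one after the other, starting [r] units below in both coordinates. *)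
Definition gridF r d : frag STK bool :=
  ok <- parse ;;
  if ok then rep r (bump false 1 3) ;;; rep r (bump false 2 3) ;;; colF d d else sret false.

Variables (e : env) (L c : nat) (P : list bool -> list bool -> Prop).
Hypothesis mF_ok : forall X Y s (Q : bool -> store -> Prop),
  length X = L -> length Y = L -> s_stk s 1 = X -> s_stk s 2 = Y -> s_stk s 3 = [] ->
  (forall x s', (x = true <-> P X Y) -> (forall j, j < 10 -> s_stk s' j = s_stk s j) -> Q x s') ->
  sp mF e c s Q.

Definition rowcost k := (c + (6 * L + 7)) * k + 1.
Definition colcost d k := (4 * L + 2 + (3 * L + 2 + (rowcost d + S (3 * L + 2 + (6 * L + 7))))) * k + 1.

Lemma rowF_ok X k : forall Y s (Q : bool -> store -> Prop),
  length X = L -> length Y = L -> s_stk s 1 = X -> s_stk s 2 = Y -> s_stk s 3 = [] ->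
  (forall x s', (x = true <-> exists i, i < k /\ P X (iterl i (flip true) Y)) ->
    (forall j, j < 10 -> j <> 2 -> s_stk s' j = s_stk s j) -> Q x s') ->
  sp (rowF k) e (rowcost k) s Q.
Proof.
  induction k as [|k IH]; intros Y s Q LX LY E1 E2 E3 HQ; cbn [rowF].
  - apply (sp_le _ _ 1); [|unfold rowcost; lia]. sstep. apply HQ; auto. split; [discriminate|]. intros (i & Hi & _). lia.
  - apply (sp_le _ _ (c + (6 * L + 7 + rowcost k))); [|unfold rowcost; lia].
    apply sp_bind. apply (mF_ok X Y); auto. intros x s1 Hx H1. destruct x.
    + apply (sp_le _ _ 1); [|unfold rowcost; lia]. sstep. apply HQ; auto. split; auto. intros _. exists 0. split; [lia|]. apply Hx. auto.
    + apply sp_bind. rewrite <- LY at 1. eapply bump_ok; [lia|rewrite H1 by lia; exact E2|rewrite H1 by lia; exact E3|].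
      apply (IH (flip true Y)); lks; auto; try (rewrite H1 by lia; auto).
      * now rewrite flip_length.
      * intros x s2 Hx2 H2. apply HQ.
        -- rewrite Hx2. split.
           ++ intros (i & Hi & Hp). exists (S i). split; [lia|]. simpl. rewrite <- iterl_shift. auto.
           ++ intros ([|i] & Hi & Hp); [apply Hx in Hp; discriminate|]. exists i. split; [lia|]. rewrite iterl_shift. auto.
        -- intros j Hj Nj. rewrite H2 by lia. lks. rewrite H1 by lia. auto.
Qed.

Lemma colF_ok d Y k : forall X s (Q : bool -> store -> Prop),
  length X = L -> length Y = L -> s_stk s 1 = X -> s_stk s 2 = Y -> s_stk s 3 = [] -> s_stk s 4 = [] -> s_stk s 5 = [] ->
  (forall x s', (x = true <-> exists i j, i < k /\ j < d /\ P (iterl i (flip true) X) (iterl j (flip true) Y)) -> Q x s') ->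
  sp (colF d k) e (colcost d k) s Q.
Proof.
  induction k as [|k IH]; intros X s Q LX LY E1 E2 E3 E4 E5 HQ; cbn [colF].
  - apply (sp_le _ _ 1); [|unfold colcost; lia]. sstep. apply HQ; auto. split; [discriminate|]. intros (i & j & Hi & _). lia.
  - apply (sp_le _ _ (4 * L + 2 + (3 * L + 2 + (rowcost d + S (3 * L + 2 + (6 * L + 7 + colcost d k)))))); [|unfold colcost; lia].
    apply sp_bind. rewrite <- LY at 1. eapply mov2_ok; [lia|lia|lia|exact E2|]. rewrite E4, E5, !app_nil_r.
    apply sp_bind. rewrite <- LY at 1. rewrite <- (length_rev Y). eapply mov_ok; [lia|lks; reflexivity|]. lks.
    rewrite rev_involutive, app_nil_r. apply sp_bind. apply (rowF_ok X d Y); lks; auto.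
    intros x s1 Hx H1. destruct x.
    + apply (sp_le _ _ 1); [|lia]. sstep. apply HQ. split; auto. intros _.
      destruct (proj1 Hx eq_refl) as (j & Hj & Hp). exists 0, j. split; [lia|]. auto.
    + sstep. apply sp_bind. rewrite <- LY at 1. rewrite <- (length_rev Y).
      eapply mov_ok; [lia|lks; rewrite H1 by lia; lks; reflexivity|]. lks. rewrite rev_involutive, app_nil_r.
      apply sp_bind. rewrite <- LX at 1. eapply bump_ok; [lia|lks; rewrite H1 by lia; lks; exact E1|lks; rewrite H1 by lia; lks; exact E3|].
      apply (IH (flip true X)); lks; auto; try (rewrite H1 by lia; lks; auto).
      * now rewrite flip_length.
      * intros x s2 Hx2. apply HQ. rewrite Hx2. split.
        -- intros (i & j & Hi & Hj & Hp). exists (S i), j. split; [lia|]. simpl. rewrite <- iterl_shift. auto.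
        -- intros ([|i] & j & Hi & Hj & Hp).
           ++ assert (false = true); [|discriminate]. apply Hx. exists j. auto.
           ++ exists i, j. split; [lia|]. rewrite iterl_shift. auto.
Qed.
End Grid.

(** * Programs without output and choices *)

Definition plain : forall A, instr A -> Prop :=
  fun A i => match i with Out _ _ | Choose _ => False | _ => True end.

Lemma plain_map A B (f : A -> B) i : plain A i -> plain B (imap f i).
Proof. destruct i; auto. Qed.

Lemma plain_noout {X} (F : frag STK X) : sfall plain F -> sfall noout F.
Proof. intros H q. specialize (H q). destruct (fcode F q); simpl in *; tauto. Qed.
Lemma plain_nochoose {X} (F : frag STK X) : sfall plain F -> sfall nochoose F.
Proof. intros H q. specialize (H q). destruct (fcode F q); simpl in *; tauto. Qed.

Lemma pushes_plain j l : sfall plain (pushes j l).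
Proof. induction l; cbn [pushes]; fall_auto plain_map. Qed.
Lemma rep_plain n F : sfall plain F -> sfall plain (rep n F).
Proof. intros H. induction n; cbn [rep]; fall_auto plain_map. Qed.
Lemma bump_plain c j tmp : sfall plain (bump c j tmp).
Proof. unfold bump, foreach. fall_auto plain_map. Qed.
Lemma popcell_plain j : sfall plain (popcell j).
Proof. unfold popcell. fall_auto plain_map. Qed.
Lemma wrmv_plain l r x m : sfall plain (wrmv l r x m).
Proof. unfold wrmv, pushcell. destruct m; fall_auto plain_map; auto using pushes_plain, popcell_plain. Qed.
Lemma chks_plain l : sfall plain (chks l).
Proof. induction l; cbn [chks]; unfold chk1; fall_auto plain_map. Qed.
Lemma clears_plain n : forall j, sfall plain (clears j n).
Proof. induction n; intros j; cbn [clears]; fall_auto plain_map. apply IHn. Qed.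

Lemma actF_plain M act i asked a : sfall plain (actF M act i asked a).
Proof. unfold actF. fall_auto plain_map; auto using wrmv_plain. Qed.

Lemma pickF_plain M {X} (K : Defs.act (mQ M) -> frag STK X) : (forall a, sfall plain (K a)) ->
  forall l o, sfall plain (pickF M o l K).
Proof. intros H. induction l; intros o; cbn [pickF]; fall_auto plain_map; auto. Qed.

Lemma markF_plain M : sfall plain (markF M).
Proof.
  unfold markF, mov2, mov, foreach, hd3, scanbody, geF, chkblk, stepF, ext2, rewind, rdans, mov, foreach, pushcell.
  fall_auto plain_map; auto using clears_plain, pushes_plain, popcell_plain, chks_plain, pickF_plain, actF_plain.
Qed.

Lemma parse_plain : sfall plain parse.
Proof.
  unfold parse, rdnum, rdunary, normalize, rdbits, rdzeros, rdsym, mov, foreach. fall_auto plain_map.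
Qed.

Lemma gridF_plain mF r d : sfall plain mF -> sfall plain (gridF mF r d).
Proof.
  intros H. unfold gridF, mov2, mov, foreach.
  assert (Hr : forall k, sfall plain (rowF mF k)).
  { induction k; cbn [rowF]; fall_auto plain_map; auto using bump_plain. }
  assert (Hc : forall k, sfall plain (colF mF d k)).
  { induction k; cbn [colF]; unfold mov2, mov, foreach; fall_auto plain_map; auto using bump_plain. }
  fall_auto plain_map; auto using parse_plain, rep_plain, bump_plain.
Qed.

Definition markP (D : nat) : sopoly :=
  let V := SAdd SVar (SConst 8) in
  SAdd (SMul (SAdd (kc 39 V) (SConst (D + 110))) V) (SAdd (kc 13 V) (SConst 39)).

Definition gridP (r d D : nat) : sopoly :=
  let V := SAdd SVar (SConst 8) in
  let A := SAdd (kc 5 V) (SConst 7) in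
  let row := SAdd (kc d (SAdd (markP D) A)) (SConst 0) in
  let col := SAdd (kc d (SAdd (kc 15 V) (SAdd row (SConst 20)))) (SConst 0) in
  SAdd (SAdd (kc 29 SVar) (SConst 200)) (SAdd (kc 1 (SAdd (kc r A) (SConst 0))) col).

Lemma gridP_ok r d D phi n u : n + 6 <= u + 6 ->
  (30 * u + 200) + (((6 * (n + 9) + 8) * r + 1) + (((6 * (n + 9) + 8) * r + 1) +
    colcost (n + 9) (markcost D (n + 6)) d d)) <= sop_eval (gridP r d D) (sizef phi) u.
Proof.
  intros H. unfold gridP, markP, kc. cbn [sop_eval].
  set (v := u + 9). assert (Hv : n + 9 <= v) by (unfold v; lia).
  set (mc := (40 * v + S (D + 110)) * v + (14 * v + 40)).
  assert (Hm : markcost D (n + 6) <= mc).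
  { unfold markcost, mc. assert ((40 * (n + 6) + D + 111) * (n + 6) <= (40 * v + S (D + 110)) * v) by (apply Nat.mul_le_mono; lia). lia. }
  set (A := 6 * v + 8).
  assert (Hr : rowcost (n + 9) (markcost D (n + 6)) d <= S d * (mc + A) + 1).
  { unfold rowcost. rewrite Nat.mul_comm. assert (d * (markcost D (n + 6) + (6 * (n + 9) + 7)) <= S d * (mc + A)) by (apply Nat.mul_le_mono; unfold A; lia). lia. }
  set (row := rowcost _ _ _) in *. set (row' := S d * (mc + A) + 1) in *.
  assert (Hc : colcost (n + 9) (markcost D (n + 6)) d d <= S d * (16 * v + (row' + 21)) + 1).
  { unfold colcost. fold row. rewrite Nat.mul_comm.
    match goal with |- d * ?x + 1 <= _ => assert (d * x <= S d * (16 * v + (row' + 21))) by (apply Nat.mul_le_mono; lia) end. lia. }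
  assert (HA : (6 * (n + 9) + 8) * r <= S r * A) by (rewrite Nat.mul_comm; apply Nat.mul_le_mono; unfold A; lia).
  fold v A. fold mc. fold row'. lia.
Qed.

Lemma gridF_ok M phi r d D g1 b1 m1 g2 b2 m2 n ch s (Q : bool -> store -> Prop) :
  (forall q i w a, length (mdelta M q i w a) <= D) ->
  let u := triple_str (dystr g1 b1 m1) (dystr g2 b2 m2) (repeat s0 n) in
  let X := iterl r (flip false) (xhat g1 b1 m1 (n + 6)) in
  let Y := iterl r (flip false) (xhat g2 b2 m2 (n + 6)) in
  initial s ch ->
  (forall x s', (x = true <-> small b1 m1 && small b2 m2 = true /\ exists i j, i < d /\ j < d /\
     marks M phi (n + 6) (iterl i (flip true) X) (iterl j (flip true) Y)) -> Q x s') ->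
  sp (gridF (markF M) r d) (phi, u) (sop_eval (gridP r d D) (sizef phi) (length u)) s Q.
Proof.
  intros HD u X Y Hs HQ.
  assert (Hn : n + 6 <= length u + 6).
  { unfold u, triple_str, pair_str. rewrite !length_app, repeat_length. lia. }
  eapply sp_le; [|apply (gridP_ok r d D phi n (length u) Hn)].
  unfold gridF. apply sp_bind. apply (parse_ok phi g1 b1 m1 g2 b2 m2 n ch); auto.
  intros s1 (P1 & P2 & P3 & P4 & P5 & P6 & P7). fold u.
  destruct (small b1 m1 && small b2 m2).
  - set (X0 := xhat g1 b1 m1 (n + 6)) in *. set (Y0 := xhat g2 b2 m2 (n + 6)) in *.
    assert (LX : length X0 = n + 9) by (unfold X0; rewrite xhat_length; lia).
    assert (LY : length Y0 = n + 9) by (unfold Y0; rewrite xhat_length; lia).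
    apply sp_bind. rewrite <- LX at 1. eapply decs_ok; [lia|exact P5|apply P7; lia|].
    apply sp_bind. rewrite <- LY at 1. eapply decs_ok; [lia|lks; exact P6|lks; apply P7; lia|].
    eapply (colF_ok (markF M) (phi, u) (n + 9) (markcost D (n + 6)) (marks M phi (n + 6))) with (X := X) (Y := Y).
    + intros X1 Y1 s' Q1 L1 L2 E1 E2 E3 H1. eapply markF_ok with (X := X1) (Y := Y1); eauto; lia.
    + unfold X. now rewrite iterl_flip_length.
    + unfold Y. now rewrite iterl_flip_length.
    + lks. reflexivity.
    + lks. reflexivity.
    + lks. apply P7. lia.
    + lks. apply P7. lia.
    + lks. apply P7. lia.
    + intros x s' Hx. apply HQ. rewrite Hx. tauto.
  - apply (sp_le _ _ 1); [|lia]. sstep. apply HQ. split; [discriminate|]. intros [H _]. discriminate.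
Qed.

Open Scope R_scope.

(** * The reduction *)

Lemma iterl_inc i l : (lv l + i < 2 ^ length l)%nat -> lv (iterl i (flip true) l) = (lv l + i)%nat.
Proof.
  induction i; intros H; simpl; [lia|]. rewrite flip_inc; rewrite ?iterl_flip_length; lia.
Qed.

(** Subtracting [r] and adding 0 to [2 * r] runs through all numbers at distance at most [r]; the
    two bounds on [lv X] exclude underflow and overflow. *)
Lemma shifted_cell r N X xs : length X = (N + 3)%nat -> length xs = N ->
  (r <= lv X)%nat -> (lv X + r < 2 ^ length X)%nat ->
  (exists i, (i < S (2 * r))%nat /\
     rev (iterl i (flip true) (iterl r (flip false) X)) = [true; false; false] ++ xs) <->
  Rabs (INR (lv X) - 2 ^ (N + 2) - fr xs * 2 ^ N) <= INR r.
Proof.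
  intros LX Lx H1 H2. set (t := (lv (rev xs) + 4 * 2 ^ N)%nat).
  assert (Et : INR t = 2 ^ (N + 2) + fr xs * 2 ^ N).
  { unfold t. rewrite plus_INR, mult_INR, pow_INR2, fr_lv, Lx, pow_4. simpl INR. lra. }
  assert (Lt : t = lv (rev xs ++ [false; false; true])).
  { unfold t. rewrite (lv_marker _ N); auto. now rewrite length_rev. }
  set (X0 := iterl r (flip false) X).
  pose proof (iterl_dec r X H1) as E0. fold X0 in E0.
  assert (L0 : length X0 = length X) by apply iterl_flip_length.
  split.
  - intros (i & Hi & E). apply (f_equal (@rev bool)) in E. rewrite rev_involutive, rev_app_distr in E.
    apply (f_equal lv) in E. change (rev [true; false; false]) with [false; false; true] in E.
    rewrite <- Lt, iterl_inc in E by (rewrite L0; lia).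
    replace (INR (lv X) - 2 ^ (N + 2) - fr xs * 2 ^ N) with (INR (lv X) - INR t) by lra.
    assert (Ha : (lv X <= t + r)%nat) by lia. assert (Hb : (t <= lv X + r)%nat) by lia.
    apply le_INR in Ha, Hb. rewrite plus_INR in Ha, Hb. apply Rabs_le. lra.
  - intros H. replace (INR (lv X) - 2 ^ (N + 2) - fr xs * 2 ^ N) with (INR (lv X) - INR t) in H by lra.
    apply Rabs_le_elim in H.
    assert (Ha : (lv X <= t + r)%nat) by (apply INR_le; rewrite plus_INR; lra).
    assert (Hb : (t <= lv X + r)%nat) by (apply INR_le; rewrite plus_INR; lra).
    exists (t + r - lv X)%nat. split; [lia|].
    assert (E : iterl (t + r - lv X) (flip true) X0 = rev xs ++ [false; false; true]).
    { apply lv_inj.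
      - rewrite iterl_flip_length, L0, LX, length_app, length_rev, Lx. simpl. lia.
      - rewrite <- Lt, iterl_inc; rewrite ?L0; lia. }
    rewrite E, rev_app_distr, rev_involutive. reflexivity.
Qed.

Lemma marks_near M phi r N X Y : INR r = 70 -> length X = (N + 3)%nat -> length Y = (N + 3)%nat ->
  (r <= lv X)%nat -> (lv X + r < 2 ^ length X)%nat -> (r <= lv Y)%nat -> (lv Y + r < 2 ^ length Y)%nat ->
  (exists i j, (i < S (2 * r))%nat /\ (j < S (2 * r))%nat /\
    marks M phi N (iterl i (flip true) (iterl r (flip false) X)) (iterl j (flip true) (iterl r (flip false) Y))) <->
  near (mark M phi) N X Y.
Proof.
  intros Er LX LY A1 A2 B1 B2. unfold near, marks. rewrite <- Er. split.
  - intros (i & j & Hi & Hj & zs & L & Hm & Ex & Ey). exists zs. split; auto. split; auto. split.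
    + apply (shifted_cell r N X (map fst zs)); auto; [now rewrite length_map|eauto].
    + apply (shifted_cell r N Y (map snd zs)); auto; [now rewrite length_map|eauto].
  - intros (zs & L & Hm & Hx & Hy).
    apply (shifted_cell r N X (map fst zs)) in Hx; auto; [|now rewrite length_map].
    apply (shifted_cell r N Y (map snd zs)) in Hy; auto; [|now rewrite length_map].
    destruct Hx as (i & Hi & Ex). destruct Hy as (j & Hj & Ey). exists i, j. eauto 10.
Qed.

Definition bitstr (b : bool) : str := [if b then s1 else s0].

(** The exit bit is written by [bitstr] after the clocked part, so the value is a single bit even on
    words that encode no triple. *)
Definition smap (M : machine) (r D : nat) (phi : str -> str) (w : str) : str :=
  snd (result (gridF (markF M) r (S (2 * r))) (gridP r (S (2 * r)) D) bitstr phi w []).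

Section Map.
Variables (M : machine) (r D : nat).
Hypothesis HD : forall q i w a, (length (mdelta M q i w a) <= D)%nat.

Lemma smap_bit phi w : smap M r D phi w = bitstr (fst (result (gridF (markF M) r (S (2 * r))) (gridP r (S (2 * r)) D) bitstr phi w [])).
Proof. apply result_noout, plain_noout, gridF_plain, markF_plain. Qed.

Lemma smap_pred phi : is_pred (smap M r D phi).
Proof.
  split; [intros u v _|intros u]; rewrite !smap_bit; [auto|].
  destruct (fst (result _ _ _ _ _ _)); auto.
Qed.

Lemma smap_FP2 : FP2_total (smap M r D).
Proof.
  apply (FP2_of_program (gridF (markF M) r (S (2 * r))) (gridP r (S (2 * r)) D) bitstr).
  - apply plain_nochoose, gridF_plain, markF_plain.
  - intros phi _. apply smap_pred.
  - reflexivity.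
Qed.

Lemma smap_spec phi g1 b1 m1 g2 b2 m2 n :
  INR r = 70 ->
  let X := xhat g1 b1 m1 (n + 6) in let Y := xhat g2 b2 m2 (n + 6) in
  exists b, smap M r D phi (triple_str (dystr g1 b1 m1) (dystr g2 b2 m2) (repeat s0 n)) = bitstr b /\
    (b = true <-> small b1 m1 && small b2 m2 = true /\ near (mark M phi) (n + 6) X Y).
Proof.
  intros Er X Y. eexists. split; [apply smap_bit|].
  set (w := triple_str _ _ _).
  assert (R70 : r = 70%nat) by (apply INR_eq; rewrite Er; symmetry; apply INR_70).
  destruct (xhat_nat g1 b1 m1 (n + 6) ltac:(lia)) as [X1 X2].
  destruct (xhat_nat g2 b2 m2 (n + 6) ltac:(lia)) as [Y1 Y2]. fold X in X1, X2. fold Y in Y1, Y2.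
  rewrite <- (marks_near M phi r (n + 6) X Y Er); try (unfold X, Y; rewrite ?xhat_length; fold X Y; lia).
  1: apply (result_run (gridF (markF M) r (S (2 * r))) (gridP r (S (2 * r)) D) bitstr phi w [] (fun b _ => b = true <-> _)).
  - intros s Hs. eapply gridF_ok; eauto.
  - lia.
  - lia.
Qed.

Lemma smap_name phi : INR r = 70 -> circ_name (smap M r D phi) (tree_set (mark M phi)).
Proof.
  intros Er. split; [apply smap_pred|]. intros n u v x y Du Dv.
  destruct (dyadic_inv u x Du) as (g1 & b1 & m1 & -> & Ex).
  destruct (dyadic_inv v y Dv) as (g2 & b2 & m2 & -> & Ey).
  destruct (smap_spec phi g1 b1 m1 g2 b2 m2 n Er) as (b & -> & Hb).
  pose proof (xhat_value g1 b1 m1 (n + 6) x Ex) as Vx. pose proof (xhat_value g2 b2 m2 (n + 6) y Ey) as Vy.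
  split; intros H.
  - destruct H as (q & Hq & Dq).
    destruct (tree_set_in_A (mark M phi) (mark_prefix M phi)) as [Bd _]. destruct (Bd q Hq) as [Qx Qy].
    pose proof (eucl_ge_fst (x, y) q) as Gx. pose proof (eucl_ge_snd (x, y) q) as Gy. simpl in Gx, Gy.
    assert (En : / 2 ^ n <= 1).
    { change (e2 n <= 1). rewrite <- e2_0. apply e2_le. lia. }
    (* A coordinate of modulus at least 2 is at distance at least 1 from the unit square, so such a
       point cannot be within [2^-n] of the set. *)
    assert (Far : forall a c, 2 <= Rabs a -> 0 <= c <= 1 -> Rabs (a - c) <= eucl (x, y) q -> False).
    { intros a c Ha Hc Hd. apply Rabs_le_elim in Hd. unfold Rabs in Ha. destruct (Rcase_abs a); lra. }
    destruct (small b1 m1); [|destruct (Far x (fst q) Vx Qx Gx)].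
    destruct (small b2 m2); [|destruct (Far y (snd q) Vy Qy Gy)].
    replace b with true; [reflexivity|]. symmetry. apply Hb. split; auto.
    apply (near_complete (mark M phi) n _ _ x y); auto. exists q. auto.
  - destruct b; [|reflexivity]. exfalso. destruct (proj1 Hb eq_refl) as [Hs Hn]. apply andb_prop in Hs. destruct Hs as [S1 S2].
    rewrite S1 in Vx. rewrite S2 in Vy.
    exact (near_sound (mark M phi) (mark_prefix M phi) (mark_extend M phi) n _ _ x y Vx Vy Hn H).
Qed.
End Map.

(** There are finitely many states and triples of symbols. The bound limits the number of bits by
    which one step of [M] is spelt. *)
Lemma branching_bound (M : machine) : exists D, forall q i w a, (length (mdelta M q i w a) <= D)%nat.
Proof.
  set (f := fun p : mQ M * (option sym * (option sym * option sym)) =>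
    let '(q, (i, (w, a))) := p in length (mdelta M q i w a)).
  pose (HF := Fin_mQ M).
  exists (list_max (map f enum)). intros q i w a.
  pose proof (proj1 (list_max_le (map f enum) _) (le_n _)) as H. rewrite Forall_forall in H.
  apply H, in_map_iff. exists (q, (i, (w, a))). split; auto. apply enum_all.
Qed.

Lemma dyadic_fr bits : dyadic (dystr false bits (length bits)) (fr bits).
Proof.
  replace (fr bits) with (1 * INR (lv (rev bits)) / 2 ^ length bits); [apply dyadic_dystr|].
  rewrite fr_lv. field. pose proof (pow2_pos (length bits)). lra.
Qed.

Lemma eucl_refl p : eucl p p = 0.
Proof. unfold eucl. rewrite <- sqrt_0. f_equal. ring. Qed.

Lemma CH_hard A : NP2 A -> mreduces A CH_mf.
Proof.
  intros [HA (M & P & HR & Hc)]. destruct (branching_bound M) as [D HD].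
  (* Hiding the numeral behind an existential keeps the many copies of the cell test in the program
     from being unfolded. *)
  destruct (ex_intro (fun r => INR r = 70) 70%nat INR_70) as [r Er].
  (* As [SConst] is shifted by one, this is [(D + 1) * P + 1], strictly more than the [D] bits per
     step of any computation within time [P]. *)
  set (PT := SAdd (SMul (SConst D) P) (SConst 0)).
  exists (smap M r D), (qmap PT). split; [apply smap_FP2|]. split; [apply qmap_FP2|].
  intros phi Hdom.
  assert (Hphi : regular phi) by (destruct Hdom as [psi0 H0]; apply (HA phi psi0 H0)).
  pose proof (tree_set_in_A (mark M phi) (mark_prefix M phi)) as SA.
  pose proof (smap_name M r D HD phi Er) as SN. set (S := tree_set (mark M phi)) in *.
  split.
  { exists (hull_name (smap M r D phi)), S. split; auto. split; auto. now apply hull_name_ok. }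
  intros theta (S' & SA' & SN' & TN).
  destruct (Hc phi Hdom) as (psi & Hpsi & Hacc).
  (* [A] relates functions, so the composite has to equal [psi] as a function; both are compared at
     each [u] by cases on acceptance. *)
  replace (fun u => theta (qmap PT phi u)) with psi; auto.
  apply functional_extensionality. intros u. destruct (HA phi psi Hpsi) as [_ [_ Hbit]].
  unfold qmap. set (T := sop_eval PT (sizef phi) (length u)). set (ds := tau u T).
  destruct TN as [_ TN].
  pose proof (dyadic_fr (map fst ds)) as Dx. pose proof (dyadic_fr (map snd ds)) as Dy.
  rewrite length_map in Dx, Dy. fold (cx ds) in Dx. fold (cy ds) in Dy.
  destruct (TN (2 * length ds + 3)%nat _ _ _ _ Dx Dy) as [T1 T2]. fold (tquery ds) in T1, T2.
  destruct (classic (accepts M phi u)) as [Ac|Rj].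
  - rewrite (proj2 (Hacc u) Ac). symmetry. apply T1. exists (cx ds, cy ds). split.
    + destruct Ac as (n & c & R1 & R2 & R3). apply (conv_hull_mono S S'); [now apply (name_subset (smap M r D phi))|].
      apply (tau_accept M phi u D HD n); [eauto|].
      pose proof (HR phi Hphi u n c R1) as Ht. unfold T, PT. cbn [sop_eval].
      set (v := sop_eval P (sizef phi) (length u)) in *. nia.
    + rewrite eucl_refl. apply (e2_pos (2 * length ds + 3)).
  - destruct (Hbit u) as [E|E]; [|exfalso; apply Rj, Hacc, E]. rewrite E. symmetry. apply T2.
    destruct (tau_reject M phi u T Rj) as (r' & Hr' & Hall). exists r'. split; [exact Hr'|].
    intros q Hq. apply Hall. apply (conv_hull_mono S' S); auto. now apply (name_subset (smap M r D phi)).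
Qed.

Theorem mainTheorem9 :
  NP2 CH_mf /\ (forall A : mfun, NP2 A -> mreduces A CH_mf).
Proof. split; [exact CH_NP2|exact CH_hard]. Qed.
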